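(* Let $\nu>\iota+b+a(r-1)$. Then $f_{-2\nu}\in L^1(\mathfrak a,d\mu)$ and for all $\lambda\in i\mathfrak a^\ast$ its spherical transform is $$\widetilde{f_{-2\nu}}(\lambda)=N_\nu\prod_{j=1}^r\prod_{\epsilon=\pm1}\frac{\Gamma\big(\nu-\frac12\rho(\xi_1)+\frac{\epsilon}{2}\lambda(\xi_j)\big)}{\Gamma\big(\nu-\frac12\rho(\xi_1)+\frac{\epsilon}{2}(\iota+b+a(j-1))\big)},$$ where $\rho(\xi_1)=\iota+b+a(r-1)$ and $N_\nu=\int_{\mathfrak a}f_{-2\nu}\,d\mu$, explicitly $$N_\nu=2^{r(2\iota+2b+a(r-1))}\,r!\;\Gamma_a\!\Big(\frac{\iota+1+2b+a(r-1)}{2}\Big)\frac{\Gamma_a(\nu-\iota-b-\frac a2(r-1))}{\Gamma_a(\nu+\frac{1-\iota}2)}\prod_{1\le i<j\le r}\frac{\Gamma(\frac a2(j-i+1))}{\Gamma(\frac a2(j-i))}.$$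
   Context: Let $r\ge 1$ and $a,b,\iota>0$ be real. Let $\mathfrak a=\mathbb R^r$ with orthonormal basis $\xi_1,\dots,\xi_r$, dual basis $\varepsilon_1,\dots,\varepsilon_r$, and $t=\sum t_j\xi_j$. $R$ is the $BC_r$ root system with positive roots $2\varepsilon_j$ (multiplicity $b$), $4\varepsilon_j$ (multiplicity $\iota/2$), $2(\varepsilon_j\pm\varepsilon_k)$, $j<k$ (multiplicity $a/2$); $\rho_j=\rho(\xi_j)=\iota+b+a(r-j)$; $W$ is the group of signed permutations of coordinates. The measure is $d\mu(t)=\prod_{j}|2\sinh t_j|^{2b}|2\sinh 2t_j|^{\iota}\prod_{j<k}|2\sinh(t_j-t_k)|^a|2\sinh(t_j+t_k)|^a\,dt$. The Cherednik operators are $$D_j=\partial_{t_j}-a\sum_{i<j}\frac{1-s_{ij}}{1-e^{-2(t_i-t_j)}}+a\sum_{k>j}\frac{1-s_{jk}}{1-e^{-2(t_j-t_k)}}+a\sum_{k\ne j}\frac{1-\sigma_{jk}}{1-e^{-2(t_j+t_k)}}+2\iota\frac{1-\sigma_j}{1-e^{-4t_j}}+2b\frac{1-\sigma_j}{1-e^{-2t_j}}-\rho_j,$$ where $s_{ij}$ swaps $t_i,t_j$, $\sigma_{ij}$ sends $(t_i,t_j)\mapsto(-t_j,-t_i)$, $\sigma_i$ sends $t_i\mapsto-t_i$. For $\lambda\in(\mathfrak a^\ast)_{\mathbb C}$, $\phi_\lambda$ denotes the Heckman–Opdam spherical (hypergeometric) function: the $W$-invariant analytic function on $\mathfrak a$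 with $\phi_\lambda(0)=1$ and $p(D_1,\dots,D_r)\phi_\lambda=p(\lambda(\xi_1),\dots,\lambda(\xi_r))\phi_\lambda$ for every $W$-invariant polynomial $p$; for $\lambda\in i\mathfrak a^\ast$ it is bounded and continuous. The spherical transform of a $W$-invariant $f\in L^1(\mathfrak a,d\mu)$ is $\widetilde f(\lambda)=\int_{\mathfrak a}f(t)\phi_\lambda(t)\,d\mu(t)$. For $\delta\in\mathbb R$, $f_\delta(t)=\prod_j\cosh^\delta t_j$. $\Gamma_a(\sigma)=\prod_{j=1}^r\Gamma(\sigma-\frac a2(j-1))$. *)

(* Defs.v *)
From HB Require Import structures.
From mathcomp Require Import all_boot all_order all_algebra all_fingroup.
From mathcomp Require Import all_classical all_reals all_analysis.
From mathcomp.real_closed Require Import complex.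

Set Implicit Arguments.
Unset Strict Implicit.
Unset Printing Implicit Defensive.

Import Order.TTheory GRing.Theory Num.Theory.
Local Open Scope ring_scope.

Definition toC {R : realType} (x : R) : R[i] := Complex x 0.
Definition cre {R : realType} (z : R[i]) : R := let: Complex x _ := z in x.
Definition cim {R : realType} (z : R[i]) : R := let: Complex _ y := z in y.
Definition cabs {R : realType} (z : R[i]) : R := Num.sqrt (cre z ^+ 2 + cim z ^+ 2).
Definition coshR {R : realType} (x : R) : R := (expR x + expR (- x)) / 2.
Definition sinhR {R : realType} (x : R) : R := (expR x - expR (- x)) / 2.

(* Euler's integral Gamma(z) = int_0^oo t^(z-1) e^(-t) dt  (cre z > 0);
   t^(z-1) = t^(cre z - 1) (cos (cim z ln t) + i sin (cim z ln t)).
   Only used with cre z > 0. *)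
Definition GammaC {R : realType} (z : R[i]) : R[i] :=
  Complex
    (Rintegral (@lebesgue_measure R) `]0, +oo[%classic
       (fun t => powR t (cre z - 1) * cos (cim z * ln t) * expR (- t)))
    (Rintegral (@lebesgue_measure R) `]0, +oo[%classic
       (fun t => powR t (cre z - 1) * sin (cim z * ln t) * expR (- t))).

Definition GammaR {R : realType} (x : R) : R := cre (GammaC (toC x)).

Definition Gamma_a {R : realType} (r : nat) (a s : R) : R :=
  \prod_(j < r) GammaR (s - a / 2 * j%:R).

Definition f_delta {R : realType} {r : nat} (delta : R) (t : r.-tuple R) : R :=
  \prod_(j < r) powR (coshR (tnth t j)) delta.

Definition mu_density {R : realType} {r : nat} (a b iota : R) (t : r.-tuple R) : R :=
  (\prod_(j < r) (powR `|2 * sinhR (tnth t j)| (2 * b)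
                  * powR `|2 * sinhR (2 * tnth t j)| iota))
  * \prod_(j < r) \prod_(k < r | (j < k)%N)
      (powR `|2 * sinhR (tnth t j - tnth t k)| a
       * powR `|2 * sinhR (tnth t j + tnth t k)| a).

(* Lebesgue integral over R^r, realised as the iterated one-dimensional
   Lebesgue integral (the library has no r-dimensional Lebesgue measure;
   for the nonnegative measurable integrands used below it coincides with
   the product-measure integral by Tonelli). *)
Fixpoint iint {R : realType} (n : nat) : (n.-tuple R -> \bar R) -> \bar R :=
  match n return (n.-tuple R -> \bar R) -> \bar R with
  | 0 => fun f => f [tuple]
  | n'.+1 => fun f =>
      (\int[@lebesgue_measure R]_x iint (fun t : n'.-tuple R => f [tuple of x :: t]))%E
  end.

Definition L1_mu {R : realType} {r : nat} (a b iota : R) (g : r.-tuple R -> R) : Prop :=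
  measurable_fun setT g /\
  (iint (fun t : r.-tuple R => (`|g t| * mu_density a b iota t)%:E) < +oo)%E.

Definition Rint_mu {R : realType} {r : nat} (a b iota : R) (g : r.-tuple R -> R) : R :=
  fine (iint (fun t : r.-tuple R => (Num.max (g t) 0 * mu_density a b iota t)%:E))
  - fine (iint (fun t : r.-tuple R => (Num.max (- g t) 0 * mu_density a b iota t)%:E)).

Definition Cint_mu {R : realType} {r : nat} (a b iota : R) (h : r.-tuple R -> R[i]) : R[i] :=
  Complex (Rint_mu a b iota (fun t => cre (h t))) (Rint_mu a b iota (fun t => cim (h t))).

Definition sph_transform {R : realType} {r : nat} (a b iota : R)
    (phi : r.-tuple R -> R[i]) (f : r.-tuple R -> R) : R[i] :=
  Cint_mu a b iota (fun t => toC (f t) * phi t).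

Definition Wact {T : pzRingType} {r : nat} (s : 'S_r) (e : r.-tuple bool)
    (z : r.-tuple T) : r.-tuple T :=
  [tuple (if tnth e k then - tnth z (s k) else tnth z (s k)) | k < r].

Definition upd {R : realType} {r : nat} (t : r.-tuple R) (j : 'I_r) (x : R) : r.-tuple R :=
  [tuple (if k == j then x else tnth t k) | k < r].

Definition s_ij {R : realType} {r : nat} (i j : 'I_r) (t : r.-tuple R) : r.-tuple R :=
  [tuple (if k == i then tnth t j else if k == j then tnth t i else tnth t k) | k < r].
Definition sigma_ij {R : realType} {r : nat} (i j : 'I_r) (t : r.-tuple R) : r.-tuple R :=
  [tuple (if k == i then - tnth t j else if k == j then - tnth t i else tnth t k) | k < r].
Definition sigma_i {R : realType} {r : nat} (i : 'I_r) (t : r.-tuple R) : r.-tuple R :=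
  [tuple (if k == i then - tnth t i else tnth t k) | k < r].

Definition pderiv {R : realType} {r : nat} (j : 'I_r) (f : r.-tuple R -> R[i])
    (t : r.-tuple R) : R[i] :=
  Complex (derive1 (fun x => cre (f (upd t j x))) (tnth t j))
          (derive1 (fun x => cim (f (upd t j x))) (tnth t j)).

(* rho_j = iota + b + a (r - j) for 1-based j; here j is 0-based *)
Definition rho_j {R : realType} {r : nat} (a b iota : R) (j : 'I_r) : R :=
  iota + b + a * (r - 1 - j)%:R.

Definition Cherednik {R : realType} {r : nat} (a b iota : R) (j : 'I_r)
    (f : r.-tuple R -> R[i]) (t : r.-tuple R) : R[i] :=
  pderiv j f t
  - toC a * \sum_(i < r | (i < j)%N)
      (f t - f (s_ij i j t)) / toC (1 - expR (- 2 * (tnth t i - tnth t j)))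
  + toC a * \sum_(k < r | (j < k)%N)
      (f t - f (s_ij j k t)) / toC (1 - expR (- 2 * (tnth t j - tnth t k)))
  + toC a * \sum_(k < r | k != j)
      (f t - f (sigma_ij j k t)) / toC (1 - expR (- 2 * (tnth t j + tnth t k)))
  + toC (2 * iota) * (f t - f (sigma_i j t)) / toC (1 - expR (- 4 * tnth t j))
  + toC (2 * b) * (f t - f (sigma_i j t)) / toC (1 - expR (- 2 * tnth t j))
  - toC (rho_j a b iota j) * f t.

Definition cpoly (R : realType) (r : nat) := seq (R[i] * r.-tuple nat).

Definition peval {R : realType} {r : nat} (p : cpoly R r) (z : r.-tuple R[i]) : R[i] :=
  \sum_(m <- p) m.1 * \prod_(j < r) tnth z j ^+ tnth m.2 j.

Definition W_invariant_poly {R : realType} {r : nat} (p : cpoly R r) : Prop :=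
  forall (s : 'S_r) (e : r.-tuple bool) (z : r.-tuple R[i]),
    peval p (Wact s e z) = peval p z.

Definition Dmono {R : realType} {r : nat} (a b iota : R) (al : r.-tuple nat)
    (f : r.-tuple R -> R[i]) : r.-tuple R -> R[i] :=
  foldr (fun j g => iter (tnth al j) (Cherednik a b iota j) g) f (enum 'I_r).

Definition polyD {R : realType} {r : nat} (a b iota : R) (p : cpoly R r)
    (f : r.-tuple R -> R[i]) (t : r.-tuple R) : R[i] :=
  \sum_(m <- p) m.1 * Dmono a b iota m.2 f t.

Definition analytic_at {R : realType} {r : nat} (f : r.-tuple R -> R[i])
    (x : r.-tuple R) : Prop :=
  exists (d : R) (c : r.-tuple nat -> R[i]), 0 < d /\
  forall y : r.-tuple R, (forall k, `|tnth y k - tnth x k| < d) ->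
    (exists M : R, forall N : nat,
        \sum_(al : r.-tuple 'I_N)
          cabs (c (map_tuple (@nat_of_ord N) al))
          * \prod_(k < r) `|tnth y k - tnth x k| ^+ tnth al k <= M) /\
    (forall eps : R, 0 < eps -> exists N0 : nat, forall N : nat, (N0 <= N)%N ->
        cabs (\sum_(al : r.-tuple 'I_N)
                 c (map_tuple (@nat_of_ord N) al)
                 * \prod_(k < r) toC (tnth y k - tnth x k) ^+ tnth al k
              - f y) < eps).

Definition regular {R : realType} {r : nat} (t : r.-tuple R) : Prop :=
  (forall j, tnth t j != 0) /\
  (forall i j : 'I_r, i != j -> tnth t i != tnth t j /\ tnth t i != - tnth t j).

(* phi is the Heckman-Opdam spherical function phi_lambda:
   W-invariant, analytic, phi(0) = 1, p(D) phi = p(lambda) phi for all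
   W-invariant polynomials p.  (The eigen-equations are imposed on the
   regular set, where the operators D_j are literally given by the
   formula; by analyticity this is equivalent.) *)
Definition is_HO_spherical {R : realType} {r : nat} (a b iota : R)
    (lam : r.-tuple R[i]) (phi : r.-tuple R -> R[i]) : Prop :=
  [/\ (forall (s : 'S_r) (e : r.-tuple bool) (t : r.-tuple R), phi (Wact s e t) = phi t),
      (forall x, analytic_at phi x),
      phi [tuple (0 : R) | _ < r] = 1 &
      (forall p : cpoly R r, W_invariant_poly p ->
         forall t, regular t -> polyD a b iota p phi t = peval p lam * phi t)].

Definition N_nu {R : realType} (r : nat) (a b iota nu : R) : R :=
  powR 2 (r%:R * (2 * iota + 2 * b + a * r.-1%:R)) * (r`!)%:R
  * Gamma_a r a ((iota + 1 + 2 * b + a * r.-1%:R) / 2)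
  * (Gamma_a r a (nu - iota - b - a / 2 * r.-1%:R) / Gamma_a r a (nu + (1 - iota) / 2))
  * \prod_(i < r) \prod_(j < r | (i < j)%N)
      (GammaR (a / 2 * (j - i + 1)%:R) / GammaR (a / 2 * (j - i)%:R)).

(* Main.v *)
(* The Cherednik operators commute, and the eigen-equations turn [phi] into a solution of a
   first-order system on the orbit of a regular point; an energy estimate shows that for
   imaginary [lam] it grows slower than any exponential. As [D_j] is adjoint to [- D_j] up to
   a reflection, applying [\prod_j (c^2 - D_j^2)] to [f_{-2 nu}] gives a recursion in [nu] for
   the norm [N_nu] and for the transform, which the Gamma products also satisfy. Uniqueness
   follows as [nu -> oo]: [f_{-2 nu} mu / N_nu] concentrates at [0], where [phi = 1], and Gamma
   quotients vary slowly. The remaining constant [c] in [N_nu = c * (Gamma product)] is found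
   by induction on [r]: as [nu] decreases to [rho_1], [(nu - rho_1) N_nu] tends to an explicit
   multiple of the rank [r - 1] norm. *)
Require Import Defs.
From HB Require Import structures.
From mathcomp Require Import all_boot all_order all_algebra all_fingroup.
From mathcomp Require Import all_classical all_reals all_analysis.
From mathcomp Require Import measurable_realfun.
From mathcomp.real_closed Require Import complex.
From mathcomp Require Import ring lra zify.

Set Implicit Arguments.
Unset Strict Implicit.
Unset Printing Implicit Defensive.

Import Order.TTheory GRing.Theory Num.Theory.
Import numFieldNormedType.Exports numFieldTopology.Exports.
Local Open Scope classical_set_scope.
Local Open Scope ring_scope.

(** * Polynomials as weighted words: norms and twisted derivations *)

Section WordSeries.
Context {R : realType} {r : nat}.
Implicit Types (h : 'I_r -> R) (w : seq 'I_r) (q : seq (R * seq 'I_r)).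

(** The eigen-equations concern only [W]-invariant polynomials in the [D_j] and only points off the
    walls: [phi] is not an eigenfunction of a single [D_j], and nothing is known about its growth.
    Yet the integrations by parts use the [D_j] one at a time, so all iterates of [D_j] on [phi]
    must be bounded. The bound starts from [\prod_k (D_j ^ 2 + y_k ^ 2)] killing [phi] when
    [lam_k = i y_k]: by commutativity this is Vieta's formula, so the iterates span a
    finite-dimensional space. The coefficients of [D_j] have poles on the walls. At the origin,
    where the energy estimate starts, the poles cancel, which is shown with absolutely convergent
    series that can be divided by a root. In the integrals the two halves of a difference quotient
    are separated, and the pole [1 / alpha] is absorbed by the factor [|sinh alpha| ^ m] of the
    density, [m > 0]. The recursion in [nu] works because [\prod_j (1 - tanh t_j ^ 2)], which turns
    [f_{-2 nu}] into [f_{-2 (nu + 1)}], is linked to [1] through [\prod_j (1 - tanh t_j)], one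
    coordinate at a time, each step being carried by a first-order operator [c - D_j] or [c + D_j]
    with [c = 2 nu - rho_1]. *)

Definition wev h w : R := \prod_(k <- w) h k.
(** Words are not collected into multi-indices, and a monomial may occur in several orders: sums,
    products and twisted derivations are then plain list operations. [pn] is the weighted l1 norm of
    the coefficients, a majorant of [pe] on the box of radius [rho]. *)
Definition pe q h : R := \sum_(m <- q) m.1 * wev h m.2.
Definition pn (rho : R) q : R := \sum_(m <- q) `|m.1| * rho ^+ size m.2.

Definition inbox (rho : R) h := forall k, `|h k| <= rho.

Lemma wev_cons h k w : wev h (k :: w) = h k * wev h w.
Proof. by rewrite /wev big_cons. Qed.

Lemma wev_cat h w1 w2 : wev h (w1 ++ w2) = wev h w1 * wev h w2.
Proof. by rewrite /wev big_cat. Qed.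

Lemma wev_le (rho : R) h w : inbox rho h -> `|wev h w| <= rho ^+ size w.
Proof.
move=> hb; elim: w => [|k w IH]; first by rewrite /wev big_nil normr1 expr0.
by rewrite wev_cons normrM exprS ler_pM.
Qed.

Lemma pe_nil h : pe [::] h = 0. Proof. by rewrite /pe big_nil. Qed.
Lemma pe_cons m q h : pe (m :: q) h = m.1 * wev h m.2 + pe q h.
Proof. by rewrite /pe big_cons. Qed.
Lemma pe_cat q1 q2 h : pe (q1 ++ q2) h = pe q1 h + pe q2 h.
Proof. by rewrite /pe big_cat. Qed.
Lemma pn_nil rho : pn rho [::] = 0. Proof. by rewrite /pn big_nil. Qed.
Lemma pn_cons rho m q : pn rho (m :: q) = `|m.1| * rho ^+ size m.2 + pn rho q.
Proof. by rewrite /pn big_cons. Qed.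
Lemma pn_cat rho q1 q2 : pn rho (q1 ++ q2) = pn rho q1 + pn rho q2.
Proof. by rewrite /pn big_cat. Qed.

Lemma pn_ge0 rho q : 0 <= rho -> 0 <= pn rho q.
Proof. by move=> r0; apply: sumr_ge0 => m _; rewrite mulr_ge0 // exprn_ge0. Qed.

Lemma pe_le rho q h : inbox rho h -> `|pe q h| <= pn rho q.
Proof.
move=> hb; apply: le_trans (ler_norm_sum _ _ _) _; apply: ler_sum => m _.
by rewrite normrM ler_wpM2l // wev_le.
Qed.

Lemma pn_le rho' rho q : 0 <= rho' -> rho' <= rho -> pn rho' q <= pn rho q.
Proof.
by move=> r0 rr; apply: ler_sum => m _; rewrite ler_wpM2l // lerXn2r // nnegrE // (le_trans r0).
Qed.

Definition pmul q q' : seq (R * seq 'I_r) :=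
  [seq (m.1 * m'.1, m.2 ++ m'.2) | m <- q, m' <- q'].

Lemma pe_mul q q' h : pe (pmul q q') h = pe q h * pe q' h.
Proof.
rewrite /pe /pmul big_allpairs_dep /= mulr_suml; apply: eq_bigr => m _.
rewrite mulr_sumr; apply: eq_bigr => m' _ /=; rewrite wev_cat; ring.
Qed.

Lemma pn_mul rho q q' : pn rho (pmul q q') = pn rho q * pn rho q'.
Proof.
rewrite /pn /pmul big_allpairs_dep /= mulr_suml; apply: eq_bigr => m _.
rewrite mulr_sumr; apply: eq_bigr => m' _ /=; rewrite size_cat exprD normrM; ring.
Qed.

(* A twisted derivation T(k :: w) = c k * w + tau(k) * T(w): it specialises both to
   the partial derivatives and to the divided differences (1 - s) / alpha. *)
Variables (c : 'I_r -> R) (tau : 'I_r -> R * 'I_r).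

Fixpoint tword w : seq (R * seq 'I_r) :=
  if w is k :: w' then
    (c k, w') :: [seq ((tau k).1 * m.1, (tau k).2 :: m.2) | m <- tword w']
  else [::].

Definition tpoly q : seq (R * seq 'I_r) :=
  flatten [seq [seq (m.1 * m'.1, m'.2) | m' <- tword m.2] | m <- q].

Definition tact h : 'I_r -> R := fun k => (tau k).1 * h (tau k).2.

Lemma pe_tword_cons h k w :
  pe (tword (k :: w)) h = c k * wev h w + tact h k * pe (tword w) h.
Proof.
rewrite /= pe_cons /=; congr (_ + _); rewrite /pe big_map mulr_sumr.
by apply: eq_bigr => m _ /=; rewrite wev_cons /tact; ring.
Qed.

Lemma pe_tpoly q h : pe (tpoly q) h = \sum_(m <- q) m.1 * pe (tword m.2) h.
Proof.
rewrite /pe /tpoly big_flatten big_map; apply: eq_bigr => m _.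
by rewrite big_map mulr_sumr; apply: eq_bigr => m' _ /=; rewrite mulrA.
Qed.

Lemma pn_tpoly rho q : pn rho (tpoly q) = \sum_(m <- q) `|m.1| * pn rho (tword m.2).
Proof.
rewrite /pn /tpoly big_flatten big_map; apply: eq_bigr => m _.
by rewrite big_map mulr_sumr; apply: eq_bigr => m' _ /=; rewrite normrM mulrA.
Qed.

Hypothesis c_le : forall k, `|c k| <= 2.
Hypothesis tau_le : forall k, `|(tau k).1| <= 1.

(** Each letter is deleted once, at a cost of at most 2, and the other letters keep at most their
    weight because [tau] contracts. The cost 2 is attained by the sign change [t_i -> - t_i] divided
    by [t_i]. *)
Lemma pn_tword rho w : 0 <= rho ->
  rho * pn rho (tword w) <= 2 * (size w)%:R * rho ^+ size w.
Proof.
move=> r0; elim: w => [|k w IH]; first by rewrite pn_nil !mulr0 mul0r.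
rewrite /= pn_cons /= -natr1 exprS.
have -> : pn rho [seq ((tau k).1 * m.1, (tau k).2 :: m.2) | m <- tword w]
   = `|(tau k).1| * rho * pn rho (tword w).
  rewrite /pn big_map mulr_sumr; apply: eq_bigr => m _ /=.
  by rewrite normrM exprS; ring.
have h1 : `|c k| * (rho * rho ^+ size w) <= 2 * (rho * rho ^+ size w).
  by rewrite ler_wpM2r // mulr_ge0 // exprn_ge0.
have h2 : `|(tau k).1| * (rho * (rho * pn rho (tword w))) <=
          rho * (2 * (size w)%:R * rho ^+ size w).
  apply: le_trans (_ : 1 * (rho * (rho * pn rho (tword w))) <= _).
    by rewrite ler_wpM2r // !mulr_ge0 // pn_ge0.
  by rewrite mul1r ler_wpM2l.
lra.
Qed.

Lemma natr_le_exp2 n : n%:R <= 2 ^+ n :> R.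
Proof. by rewrite -natrX ler_nat ltnW // ltn_expl. Qed.

(** The factor [size w] is absorbed by doubling the radius, as [n <= 2 ^ n]; this plays the part of
    a Cauchy estimate. *)
Lemma pn_tpoly_le rho q : 0 < rho -> pn rho (tpoly q) <= 2 / rho * pn (2 * rho) q.
Proof.
move=> r0; rewrite pn_tpoly /pn mulr_sumr; apply: ler_sum => m _.
rewrite mulrCA; apply: ler_wpM2l => //.
rewrite -(ler_pM2l r0); apply: le_trans (pn_tword _ (ltW r0)) _.
rewrite exprMn [leRHS](_ : _ = 2 * 2 ^+ size m.2 * rho ^+ size m.2); last first.
  by field; rewrite gt_eqF.
by rewrite ler_wpM2r ?exprn_ge0 ?(ltW r0) // ler_wpM2l // natr_le_exp2.
Qed.

(** Telescoping: the letters pass from [h] to [tact h] one at a time, and each passage contributes a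
    multiple of [al h]. *)
Lemma dvd_tword (al : ('I_r -> R) -> R) h w :
  (forall k, h k - tact h k = c k * al h) ->
  al h * pe (tword w) h = wev h w - wev (tact h) w.
Proof.
move=> E; elim: w => [|k w IH]; first by rewrite pe_nil mulr0 /wev !big_nil subrr.
rewrite pe_tword_cons !wev_cons mulrDr mulrA [al h * _]mulrC -E.
by rewrite mulrCA IH; ring.
Qed.

Lemma dvd_tpoly (al : ('I_r -> R) -> R) h q :
  (forall k, h k - tact h k = c k * al h) ->
  al h * pe (tpoly q) h = pe q h - pe q (tact h).
Proof.
move=> E; rewrite pe_tpoly /pe -sumrB mulr_sumr; apply: eq_bigr => m _.
by rewrite mulrCA (dvd_tword _ E) mulrBr.
Qed.

End WordSeries.

(** * Formal partial derivatives and Taylor remainders *)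

Section WordDerivation.
Context {R : realType} {r : nat}.
Implicit Types (h : 'I_r -> R) (w : seq 'I_r) (q : seq (R * seq 'I_r)).

Definition dword (j : 'I_r) := tword (fun k => (k == j)%:R : R) (fun k => (1, k)).
Definition dpoly (j : 'I_r) := tpoly (fun k => (k == j)%:R : R) (fun k => (1, k)).

Lemma tact_id h : tact (fun k => (1, k)) h = h.
Proof. by apply/funext => k; rewrite /tact mul1r. Qed.

Lemma pe_dword_cons j h k w :
  pe (dword j (k :: w)) h = (k == j)%:R * wev h w + h k * pe (dword j w) h.
Proof. by rewrite /dword pe_tword_cons tact_id. Qed.

Lemma pe_dpoly_cons (j : 'I_r) (a : R) w q h :
  pe (dpoly j ((a, w) :: q)) h = a * pe (dword j w) h + pe (dpoly j q) h.
Proof. by rewrite /dpoly !pe_tpoly big_cons. Qed.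

Lemma pe_dpoly_map (j : 'I_r) (a : R) (k : 'I_r) q h :
  pe (dpoly j [seq (a * m.1, k :: m.2) | m <- q]) h =
  a * ((k == j)%:R * pe q h + h k * pe (dpoly j q) h).
Proof.
rewrite /dpoly !pe_tpoly big_map [pe q h]/pe !mulr_sumr -big_split /= mulr_sumr.
apply: eq_bigr => m _; have := pe_dword_cons j h k m.2; rewrite /dword /= => ->; ring.
Qed.

Lemma pe_dword_comm i j w h : pe (dpoly i (dword j w)) h = pe (dpoly j (dword i w)) h.
Proof.
elim: w => [|k w IH]; first by rewrite /dpoly !pe_tpoly /= !big_nil.
rewrite /dword /= -!/(dword _ _) !pe_dpoly_cons !pe_dpoly_map IH; ring.
Qed.

Lemma pe_dpoly_comm i j q h : pe (dpoly i (dpoly j q)) h = pe (dpoly j (dpoly i q)) h.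
Proof.
have E k l : pe (dpoly k (dpoly l q)) h = \sum_(m <- q) m.1 * pe (dpoly k (dword l m.2)) h.
  rewrite [in LHS]/dpoly pe_tpoly {1}/dpoly /tpoly big_flatten big_map.
  apply: eq_bigr => m _; rewrite big_map /dpoly pe_tpoly mulr_sumr.
  by apply: eq_bigr => m' _ /=; rewrite mulrA.
by rewrite !E; apply: eq_bigr => m _; rewrite pe_dword_comm.
Qed.

Lemma wev_diff_le rho (e : R) h d w : 0 <= rho -> inbox rho h ->
  inbox rho (fun k => h k + d k) -> inbox e d ->
  rho * `|wev (fun k => h k + d k) w - wev h w| <= (size w)%:R * rho ^+ size w * e.
Proof.
move=> r0 bh bhd bd; elim: w => [|k w IH].
  by rewrite /wev !big_nil subrr normr0 mulr0 !mul0r.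
rewrite !wev_cons /= -natr1 exprS.
set W' := wev _ w in IH *; set W := wev _ w in IH *.
have -> : (h k + d k) * W' - h k * W = (h k + d k) * (W' - W) + d k * W by ring.
apply: le_trans (ler_wpM2l r0 (ler_normD _ _)) _; rewrite mulrDr !normrM.
have h1 : rho * (`|h k + d k| * `|W' - W|) <= rho * ((size w)%:R * rho ^+ size w * e).
  by rewrite mulrCA; apply: ler_pM => //; rewrite mulr_ge0.
have h2 : rho * (`|d k| * `|W|) <= rho * (e * rho ^+ size w).
  by rewrite ler_wpM2l //; apply: ler_pM => //; exact: wev_le.
lra.
Qed.

(** Adding a letter multiplies the old remainder by [h k] and adds [d k] times a first difference,
    bounded by [wev_diff_le]. The powers of [rho] stand on the left to keep divisions out of the
    induction. *)
Lemma wev_taylor_le rho (e : R) h d w : 0 <= rho -> inbox rho h ->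
  inbox rho (fun k => h k + d k) -> inbox e d ->
  rho ^+ 2 * `|wev (fun k => h k + d k) w - wev h w - \sum_j d j * pe (dword j w) h|
  <= (size w)%:R ^+ 2 * rho ^+ size w * e ^+ 2.
Proof.
move=> r0 bh bhd bd; elim: w => [|k w IH].
  rewrite /wev !big_nil subrr big1 ?subrr ?normr0 ?mulr0 ?expr0n ?mul0r //= => j _.
  by rewrite pe_nil mulr0.
rewrite !wev_cons /= -natr1 exprS.
have -> : \sum_j d j * pe (dword j (k :: w)) h =
          d k * wev h w + h k * \sum_j d j * pe (dword j w) h.
  under eq_bigr do rewrite pe_dword_cons mulrDr mulrCA [X in _ + X]mulrCA.
  rewrite big_split /= -mulr_sumr; congr (_ + _).
  rewrite (bigD1 k) //= eqxx mul1r big1 ?addr0 // => j /negPf jk.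
  by rewrite eq_sym jk mul0r.
have D := wev_diff_le w r0 bh bhd bd.
set W' := wev _ w in IH D *; set W := wev _ w in IH D *; set S := \sum_j _ in IH *.
have -> : (h k + d k) * W' - h k * W - (d k * W + h k * S) =
   h k * (W' - W - S) + d k * (W' - W) by ring.
apply: le_trans (ler_wpM2l (exprn_ge0 2 r0) (ler_normD _ _)) _; rewrite mulrDr !normrM.
have e0 : 0 <= e by apply: le_trans (bd k).
have h1 : `|h k| * (rho ^+ 2 * `|W' - W - S|) <=
          rho * ((size w)%:R ^+ 2 * rho ^+ size w * e ^+ 2).
  by apply: ler_pM => //; rewrite mulr_ge0 // exprn_ge0.
have h2 : rho * (`|d k| * (rho * `|W' - W|)) <= rho * (e * ((size w)%:R * rho ^+ size w * e)).
  by rewrite ler_wpM2l //; apply: ler_pM => //; rewrite mulr_ge0.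
have h3 : 0 <= rho * rho ^+ size w * e ^+ 2 by rewrite !mulr_ge0 ?exprn_ge0 ?sqr_ge0.
have h4 : 0 <= (size w)%:R * (rho * rho ^+ size w * e ^+ 2) by rewrite mulr_ge0.
by rewrite [rho ^+ (size w).+1]exprS; lra.
Qed.

Lemma sqr_le_exp2 n : n%:R ^+ 2 <= 2 * 2 ^+ n :> R.
Proof.
rewrite -!natrX -natrM ler_nat.
have H m : (3 <= m -> m ^ 2 <= 2 * 2 ^ m)%N.
  elim: m => // m IH; rewrite ltnS leq_eqVlt => /orP[/eqP <-//|m3].
  have := IH m3; rewrite !expnS !expn0; nia.
by case: n => [|[|[|n]]] //; exact: H.
Qed.

Lemma pe_taylor_le rho (e : R) h d q : 0 < rho -> inbox rho h ->
  inbox rho (fun k => h k + d k) -> inbox e d ->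
  `|pe q (fun k => h k + d k) - pe q h - \sum_j d j * pe (dpoly j q) h|
  <= 2 / rho ^+ 2 * e ^+ 2 * pn (2 * rho) q.
Proof.
move=> r0 bh bhd bd.
have -> : \sum_j d j * pe (dpoly j q) h =
          \sum_(m <- q) m.1 * \sum_j d j * pe (dword j m.2) h.
  under eq_bigr do rewrite /dpoly pe_tpoly mulr_sumr.
  rewrite exchange_big /=; apply: eq_bigr => m _; rewrite mulr_sumr.
  by apply: eq_bigr => j _; rewrite mulrCA.
rewrite /pe -!sumrB; apply: le_trans (ler_norm_sum _ _ _) _.
rewrite /pn mulr_sumr; apply: ler_sum => m _.
rewrite -!mulrBr normrM mulrCA; apply: ler_wpM2l => //.
rewrite -(ler_pM2l (exprn_gt0 2 r0)).
apply: le_trans (wev_taylor_le _ (ltW r0) bh bhd bd) _.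
rewrite [leRHS](_ : _ = 2 * 2 ^+ size m.2 * rho ^+ size m.2 * e ^+ 2); last first.
  by rewrite exprMn; field; rewrite gt_eqF.
rewrite ler_wpM2r ?sqr_ge0 // ler_wpM2r ?exprn_ge0 ?(ltW r0) //.
exact: sqr_le_exp2.
Qed.

End WordDerivation.

(** * Absolutely convergent series of word polynomials *)

Section AbsSeries.
Context {R : realType} {r : nat}.
Implicit Types (h : 'I_r -> R) (q : nat -> seq (R * seq 'I_r)) (g : ('I_r -> R) -> R).

(** The bound [M] is part of the data: it composes under sums, products and power series, and it
    bounds [g] on the whole box. *)
Definition aser (rho M : R) q g :=
  (forall N, \sum_(0 <= n < N) pn rho (q n) <= M) /\
  (forall h, inbox rho h -> series (fun n => pe (q n) h) @ \oo --> g h).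

Definition has_ser (rho M : R) g := exists q, aser rho M q g.

Lemma has_ser_ext rho M g g' :
  (forall h, inbox rho h -> g h = g' h) -> has_ser rho M g -> has_ser rho M g'.
Proof. by move=> E [q [a b]]; exists q; split=> // h hb; rewrite -E //; exact: b. Qed.

Lemma aser_bound rho M q g h : aser rho M q g -> inbox rho h -> `|g h| <= M.
Proof.
move=> [a b] hb.
have C : (fun N => `|series (fun n => pe (q n) h) N|) @ \oo --> `|g h|.
  by apply: cvg_norm; exact: b.
rewrite -(cvg_lim _ C) //; apply: limr_le; first exact/cvgP/C.
near=> N; rewrite /series /=; apply: le_trans (ler_norm_sum _ _ _) _.
by apply: le_trans (a N); apply: ler_sum => n _; exact: pe_le.
Unshelve. all: end_near. Qed.

Lemma aser_le rho' rho M q g : 0 <= rho' -> rho' <= rho -> aser rho M q g -> aser rho' M q g.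
Proof.
move=> r0 rr [a b]; split=> [N|h hb].
  by apply: le_trans (a N); apply: ler_sum => n _; exact: pn_le.
by apply: b => k; exact: le_trans (hb k) rr.
Qed.

Lemma aser_lim rho M q : (forall N, \sum_(0 <= n < N) pn rho (q n) <= M) ->
  exists g, aser rho M q g.
Proof.
move=> a; exists (fun h => lim (series (fun n => pe (q n) h) @ \oo)); split=> // h hb.
apply: normed_cvg; apply: (@series_le_cvg _ _ (fun n => pn rho (q n))) => //.
- by move=> n /=.
- by move=> n; apply: le_trans (pe_le (q n) hb).
- by move=> n; exact: pe_le.
apply: nondecreasing_is_cvgn.
  apply/nondecreasing_seqP => n; rewrite seriesSr lerDl.
  by apply: le_trans (pe_le (q n) hb).
by exists M => _ [n _ <-]; exact: a.
Qed.

Definition unitseq (p : seq (R * seq 'I_r)) : nat -> seq (R * seq 'I_r) :=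
  fun n => if n is 0 then p else [::].

Lemma unitseq_sum (v : seq (R * seq 'I_r) -> R) p N : v [::] = 0 ->
  \sum_(0 <= n < N.+1) v (unitseq p n) = v p.
Proof.
by move=> v0; rewrite big_nat_recl // big1 ?addr0 //= => n _.
Qed.

Lemma has_ser_poly rho p : 0 <= rho -> has_ser rho (pn rho p) (pe p).
Proof.
move=> r0; exists (unitseq p); split=> [[|N]|h _].
- by rewrite big_geq // pn_ge0.
- by rewrite unitseq_sum // pn_nil.
rewrite -(cvg_shiftS (series _)) /=; apply: cvg_near_cst; near=> N.
by rewrite /series /= (unitseq_sum (v := fun p => pe p h)) // pe_nil.
Unshelve. all: end_near. Qed.

Lemma has_ser_const rho (c : R) : 0 <= rho -> has_ser rho `|c| (fun=> c).
Proof.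
move=> r0; have := has_ser_poly [:: (c, [::])] r0; rewrite pn_cons pn_nil expr0 mulr1 addr0.
by apply: has_ser_ext => h _; rewrite pe_cons pe_nil /wev big_nil mulr1 addr0.
Qed.

Lemma has_ser_coord rho k : 0 <= rho -> has_ser rho rho (fun h => h k).
Proof.
move=> r0; have := has_ser_poly [:: (1, [:: k])] r0.
rewrite pn_cons pn_nil normr1 expr1 mul1r addr0.
by apply: has_ser_ext => h _; rewrite pe_cons pe_nil wev_cons /wev big_nil mulr1 mul1r addr0.
Qed.

Lemma has_ser_add rho M M' g g' : has_ser rho M g -> has_ser rho M' g' ->
  has_ser rho (M + M') (fun h => g h + g' h).
Proof.
move=> [q [a b]] [q' [a' b']]; exists (fun n => q n ++ q' n); split=> [N|h hb].
  by under eq_bigr do rewrite pn_cat; rewrite big_split lerD.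
rewrite [X in X @ _](_ : _ = series (fun n => pe (q n) h) + series (fun n => pe (q' n) h)).
  by apply: cvgD; [exact: b|exact: b'].
apply/funext => N; rewrite /series /= fctE.
by under eq_bigr do rewrite pe_cat; rewrite big_split.
Qed.

(** The product is arranged in square shells: term [n] collects the pairs of indices with maximum
    [n]. The partial sums are then exactly the products of the partial sums, so no rearrangement is
    involved. *)
Definition mulseq q q' (n : nat) :=
  flatten [seq pmul (q i) (q' n) | i <- index_iota 0 n.+1] ++
  flatten [seq pmul (q n) (q' j) | j <- index_iota 0 n].

Lemma flat_sum (v : seq (R * seq 'I_r) -> R) (s : seq nat) (G : nat -> seq (R * seq 'I_r)) :
  v [::] = 0 -> (forall p p', v (p ++ p') = v p + v p') ->
  v (flatten [seq G i | i <- s]) = \sum_(i <- s) v (G i).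
Proof.
move=> v0 vD; elim: s => [|i s IH] /=; first by rewrite big_nil.
by rewrite vD big_cons IH.
Qed.

Lemma mulseq_sum (v : seq (R * seq 'I_r) -> R) q q' N : v [::] = 0 ->
  (forall p p', v (p ++ p') = v p + v p') ->
  (forall p p', v (pmul p p') = v p * v p') ->
  \sum_(0 <= n < N) v (mulseq q q' n) =
  (\sum_(0 <= n < N) v (q n)) * (\sum_(0 <= n < N) v (q' n)).
Proof.
move=> v0 vD vM; elim: N => [|N IH]; first by rewrite !big_geq ?mulr0.
rewrite !big_nat_recr //= IH /mulseq vD !flat_sum //.
rewrite big_nat_recr //= !(eq_bigr _ (fun i _ => vM _ _)) -mulr_suml -mulr_sumr vM; ring.
Qed.

Lemma aser_mul rho M M' q q' g g' : 0 <= rho -> aser rho M q g -> aser rho M' q' g' ->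
  aser rho (M * M') (mulseq q q') (fun h => g h * g' h).
Proof.
move=> r0 [a b] [a' b']; split=> [N|h hb].
  rewrite (mulseq_sum (v := pn rho)) ?pn_nil //; [|exact: pn_cat|exact: pn_mul].
  by apply: ler_pM => //; apply: sumr_ge0 => n _; exact: pn_ge0.
rewrite [X in X @ _](_ : _ = series (fun n => pe (q n) h) * series (fun n => pe (q' n) h)).
  by apply: cvgM; [exact: b|exact: b'].
apply/funext => N; rewrite /series /= fctE.
apply: (mulseq_sum (v := fun p => pe p h)) => [|p p'|p p'].
- exact: pe_nil.
- exact: pe_cat.
- exact: pe_mul.
Qed.

Lemma has_ser_mul rho M M' g g' : 0 <= rho -> has_ser rho M g -> has_ser rho M' g' ->
  has_ser rho (M * M') (fun h => g h * g' h).
Proof. by move=> r0 [q a] [q' a']; exists (mulseq q q'); exact: aser_mul. Qed.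

Fixpoint powseq q (m : nat) : nat -> seq (R * seq 'I_r) :=
  if m is m'.+1 then mulseq q (powseq q m') else unitseq [:: (1, [::])].

(** The same shells for a composition: the partial sum up to [N] is [\sum_(m < N) c m * S ^+ m],
    where [S] is the partial sum of [q] up to the same [N]. *)
Definition compseq (c : nat -> R) q (n : nat) :=
  flatten [seq pmul [:: (c m, [::])] (powseq q m n) | m <- index_iota 0 n.+1] ++
  flatten [seq pmul [:: (c n, [::])] (powseq q n j) | j <- index_iota 0 n].

Lemma powseq_sum (v : seq (R * seq 'I_r) -> R) q m N : v [::] = 0 ->
  (forall p p', v (p ++ p') = v p + v p') ->
  (forall p p', v (pmul p p') = v p * v p') -> v [:: (1, [::])] = 1 ->
  \sum_(0 <= n < N.+1) v (powseq q m n) = (\sum_(0 <= n < N.+1) v (q n)) ^+ m.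
Proof.
move=> v0 vD vM v1; elim: m => [|m IH]; first by rewrite unitseq_sum.
by rewrite /= mulseq_sum // IH exprS.
Qed.

Lemma compseq_sum (v : seq (R * seq 'I_r) -> R) (c : nat -> R) (vc : R -> R) q N : v [::] = 0 ->
  (forall p p', v (p ++ p') = v p + v p') ->
  (forall p p', v (pmul p p') = v p * v p') -> v [:: (1, [::])] = 1 ->
  (forall x, v [:: (x, [::])] = vc x) ->
  \sum_(0 <= n < N) v (compseq c q n) =
  \sum_(0 <= m < N) vc (c m) * (\sum_(0 <= n < N) v (q n)) ^+ m.
Proof.
move=> v0 vD vM v1 vcE.
have -> : \sum_(0 <= m < N) vc (c m) * (\sum_(0 <= n < N) v (q n)) ^+ m =
   \sum_(0 <= m < N) vc (c m) * \sum_(0 <= n < N) v (powseq q m n).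
  by case: N => [|N]; [rewrite !big_geq|apply: eq_bigr => m _; rewrite powseq_sum].
elim: N => [|N IH]; first by rewrite !big_geq.
rewrite big_nat_recr //= IH /compseq vD !flat_sum //.
rewrite !(eq_bigr _ (fun i _ => vM _ _)).
rewrite [in RHS]big_nat_recr //= -mulr_sumr [in RHS]big_nat_recr //=.
rewrite [X in _ + (X + _)]big_nat_recr //=.
under [X in _ = X + _]eq_bigr do rewrite big_nat_recr //= mulrDr.
rewrite big_split /= !vcE mulrDr.
under [X in _ + (X + _ + _) = _]eq_bigr do rewrite vcE.
ring.
Qed.

Lemma powser_tail (c : nat -> R) M K (F : R -> R) : 0 <= M ->
  (forall N, \sum_(0 <= m < N) `|c m| * M ^+ m <= K) ->
  (forall y, `|y| <= M -> series (fun m => c m * y ^+ m) @ \oo --> F y) ->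
  exists e : nat -> R, e @ \oo --> 0 /\
    forall N y, `|y| <= M -> `|F y - \sum_(0 <= m < N) c m * y ^+ m| <= e N.
Proof.
move=> M0 bK cF; pose u := series (fun m => `|c m| * M ^+ m).
have nd : nondecreasing_seq u.
  by apply/nondecreasing_seqP => n; rewrite /u seriesSr lerDl mulr_ge0 ?exprn_ge0.
have cu : cvgn u by apply: nondecreasing_is_cvgn => //; exists K => _ [n _ <-]; exact: bK.
exists (fun N => lim (u @ \oo) - u N); split.
  by rewrite -[X in _ --> X](subrr (lim (u @ \oo))); apply: cvgB => //; exact: cvg_cst.
move=> N y yM.
have C : (fun n => `|series (fun m => c m * y ^+ m) n - \sum_(0 <= m < N) c m * y ^+ m|)
    @ \oo --> `|F y - \sum_(0 <= m < N) c m * y ^+ m|.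
  by apply: cvg_norm; apply: cvgB; [exact: cF|exact: cvg_cst].
rewrite -(cvg_lim _ C) //; apply: limr_le; first exact/cvgP/C.
near=> n; have Nn : (N <= n)%N by near: n; exact: nbhs_infty_ge.
rewrite /series /= (@big_cat_nat _ _ _ N 0 n) //= addrAC subrr add0r.
apply: le_trans (_ : u n - u N <= _); last by rewrite lerB // nondecreasing_cvgn_le.
rewrite /u /series /= (@big_cat_nat _ _ _ N 0 n) //= addrAC subrr add0r.
apply: le_trans (ler_norm_sum _ _ _) _; apply: ler_sum => m _.
by rewrite normrM normrX ler_wpM2l // lerXn2r // nnegrE.
Unshelve. all: end_near. Qed.

(** The partial sums of [compseq] differ from [F (S N)] by a tail of the power series at the moving
    point [S N]. This is why [powser_tail] is uniform in [y]; continuity of [F] at [g h] does the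
    rest. *)
Lemma has_ser_comp rho M K g (c : nat -> R) (F : R -> R) : 0 <= rho ->
  (forall N, \sum_(0 <= m < N) `|c m| * M ^+ m <= K) ->
  (forall y, `|y| <= M -> series (fun m => c m * y ^+ m) @ \oo --> F y) ->
  (forall h, inbox rho h -> {for g h, continuous F}) ->
  has_ser rho M g -> has_ser rho K (fun h => F (g h)).
Proof.
move=> r0 bK cF Fc [q [a b]].
have M0 : 0 <= M by apply: le_trans (a 0%N); rewrite big_geq.
exists (compseq c q); split=> [N|h hb].
  rewrite (compseq_sum (v := pn rho) _ (vc := fun x => `|x|)) ?pn_nil //; first last.
  - by move=> x; rewrite pn_cons pn_nil expr0 mulr1 addr0.
  - by rewrite pn_cons pn_nil normr1 expr0 mulr1 addr0.
  - exact: pn_mul.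
  - exact: pn_cat.
  apply: le_trans (bK N); apply: ler_sum => m _; rewrite ler_wpM2l //.
  by rewrite lerXn2r ?nnegrE //; apply: sumr_ge0 => n _; exact: pn_ge0.
have [e [e0 eF]] := powser_tail M0 bK cF.
pose S := series (fun n => pe (q n) h).
have SE : series (fun n => pe (compseq c q n) h) =
          fun N => \sum_(0 <= m < N) c m * S N ^+ m.
  apply/funext => N; rewrite /series /=.
  rewrite (compseq_sum (v := fun p => pe p h) _ (vc := id)) ?pe_nil //.
  - by move=> p p'; rewrite pe_cat.
  - by move=> p p'; rewrite pe_mul.
  - by rewrite pe_cons pe_nil /wev big_nil mulr1 addr0.
  - by move=> x; rewrite pe_cons pe_nil /wev big_nil mulr1 addr0.
rewrite SE.
have SM N : `|S N| <= M.
  apply: le_trans (ler_norm_sum _ _ _) _; apply: le_trans (a N).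
  by apply: ler_sum => n _; exact: pe_le.
have CF : (F \o S) @ \oo --> F (g h).
  by apply: continuous_cvg; [exact: Fc|exact: b].
have -> : (fun N => \sum_(0 <= m < N) c m * S N ^+ m) =
   (fun N => (F \o S) N - (F (S N) - \sum_(0 <= m < N) c m * S N ^+ m)).
  by apply/funext => N /=; rewrite opprB addrC subrK.
rewrite -[X in _ --> X]subr0; apply: cvgB => //.
apply: norm_cvg0; apply: (@squeeze_cvgr _ _ _ _ (fun=> 0) e) => //; last exact: cvg_cst.
by near=> N; rewrite normr_ge0 /=; exact: eF.
Unshelve. all: end_near. Qed.

End AbsSeries.

(** * Exponential, inverse, divided differences and Taylor expansion of series *)

Section SeriesCalculus.
Context {R : realType} {r : nat}.
Implicit Types (h : 'I_r -> R) (q : nat -> seq (R * seq 'I_r)) (g : ('I_r -> R) -> R).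

Lemma has_ser_le rho' rho M M' g : 0 <= rho' -> rho' <= rho -> M <= M' ->
  has_ser rho M g -> has_ser rho' M' g.
Proof.
move=> r0 rr MM [q Hq]; exists q; have [a b] := aser_le r0 rr Hq.
by split=> // N; exact: le_trans (a N) MM.
Qed.

(** Without its constant term every word has at least one letter, so a radius smaller by [th] gains
    a factor [th] in the norm, as in Schwarz's lemma. *)
Lemma has_ser_shrink rho M th g : 0 <= rho -> 0 <= th -> th <= 1 -> has_ser rho M g ->
  has_ser (th * rho) (th * M) (fun h => g h - g (fun=> 0)).
Proof.
move=> r0 t0 t1 [q [a b]].
pose p n := [seq m <- q n | m.2 != [::]].
have w0 (w : seq 'I_r) : wev (fun=> 0 : R) w = (w == [::])%:R.
  by case: w => [|k w]; [rewrite /wev big_nil|rewrite wev_cons mul0r].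
have peE n h : pe (p n) h = pe (q n) h - pe (q n) (fun=> 0).
  rewrite /p /pe big_filter big_mkcond -sumrB; apply: eq_bigr => -[c w] _ /=.
  rewrite w0; case: eqP => [->|_] /=; last by rewrite mulr0 subr0.
  by rewrite /wev big_nil subrr.
have pnE n : pn (th * rho) (p n) <= th * pn rho (q n).
  rewrite /p /pn big_filter big_mkcond mulr_sumr; apply: ler_sum => -[c w] _ /=.
  case: w => [|k w] /=; first by rewrite !mulr_ge0 ?exprn_ge0.
  rewrite mulrCA ler_wpM2l // exprMn exprS -!mulrA ler_wpM2l //.
  by rewrite ler_piMl ?exprn_ge0 // exprn_ile1.
exists p; split=> [N|h hb].
  apply: le_trans (_ : th * \sum_(0 <= n < N) pn rho (q n) <= _).
    by rewrite mulr_sumr; apply: ler_sum => n _; exact: pnE.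
  by rewrite ler_wpM2l.
have -> : series (fun n => pe (p n) h) =
          series (fun n => pe (q n) h) - series (fun n => pe (q n) (fun=> 0)).
  by apply/funext => N; rewrite /series /= fctE /= -sumrB; apply: eq_bigr => n _.
apply: cvgB; apply: b => k; last by rewrite normr0.
by apply: le_trans (hb k) _; rewrite ler_piMl.
Qed.

Lemma aser_tpoly (c : 'I_r -> R) (tau : 'I_r -> R * 'I_r) rho M q :
  (forall k, `|c k| <= 2) -> (forall k, `|(tau k).1| <= 1) -> 0 < rho ->
  (forall N, \sum_(0 <= n < N) pn (2 * rho) (q n) <= M) ->
  exists g', aser rho (2 / rho * M) (fun n => tpoly c tau (q n)) g'.
Proof.
move=> c2 t1 r0 a; apply: aser_lim => N.
apply: le_trans (_ : 2 / rho * \sum_(0 <= n < N) pn (2 * rho) (q n) <= _).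
  by rewrite mulr_sumr; apply: ler_sum => n _; exact: pn_tpoly_le.
by rewrite ler_wpM2l // divr_ge0 // ltW.
Qed.

Lemma aser_dvd (c : 'I_r -> R) (tau : 'I_r -> R * 'I_r) (al : ('I_r -> R) -> R) rho M M' q g g' :
  (forall k, `|(tau k).1| <= 1) -> (forall h k, h k - tact tau h k = c k * al h) ->
  aser rho M q g -> aser rho M' (fun n => tpoly c tau (q n)) g' ->
  forall h, inbox rho h -> al h * g' h = g h - g (tact tau h).
Proof.
move=> t1 E [a b] [a' b'] h hb.
have tb : inbox rho (tact tau h).
  move=> k; rewrite /tact normrM; apply: le_trans (_ : 1 * `|h (tau k).2| <= _).
    by rewrite ler_wpM2r.
  by rewrite mul1r.
have C1 : (fun N => al h * series (fun n => pe (tpoly c tau (q n)) h) N) @ \oo --> al h * g' h.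
  by apply: cvgM; [exact: cvg_cst|exact: b'].
have C2 : series (fun n => pe (q n) h) - series (fun n => pe (q n) (tact tau h)) @ \oo -->
    g h - g (tact tau h) by apply: cvgB; exact: b.
have E2 : series (fun n => pe (q n) h) - series (fun n => pe (q n) (tact tau h)) =
  (fun N => al h * series (fun n => pe (tpoly c tau (q n)) h) N).
  apply/funext => N; rewrite /series /= fctE /= mulr_sumr -sumrB; apply: eq_bigr => n _.
  by rewrite (dvd_tpoly (c := c)).
rewrite E2 in C2; exact: (cvg_unique _ C1 C2).
Qed.

Lemma aser_dpoly j rho M q : 0 < rho ->
  (forall N, \sum_(0 <= n < N) pn (2 * rho) (q n) <= M) ->
  exists g', aser rho (2 / rho * M) (fun n => dpoly j (q n)) g'.
Proof.
move=> r0 a; apply: aser_tpoly => // k; last by rewrite normr1.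
by case: (k == j); rewrite ?normr1 ?normr0; lra.
Qed.

Lemma cvg_sumr {T : Type} {F : set_system T} {FF : Filter F} (I : finType)
    (f : I -> T -> R) (l : I -> R) :
  (forall i, f i @ F --> l i) -> (fun N => \sum_i f i N) @ F --> \sum_i l i.
Proof. by move=> H; apply: cvg_big => //; exact: add_continuous. Qed.

Lemma aser_taylor rho M M' q g (g' : 'I_r -> ('I_r -> R) -> R) (e : R) h d : 0 < rho ->
  aser (2 * rho) M q g -> (forall j, aser rho M' (fun n => dpoly j (q n)) (g' j)) ->
  inbox rho h -> inbox rho (fun k => h k + d k) -> inbox e d ->
  `|g (fun k => h k + d k) - g h - \sum_j d j * g' j h| <= 2 / rho ^+ 2 * e ^+ 2 * M.
Proof.
move=> r0 [a b] H' hb hdb db.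
have wid h' : inbox rho h' -> inbox (2 * rho) h'.
  by move=> H k; apply: le_trans (H k) _; lra.
have C : (fun N => `|series (fun n => pe (q n) (fun k => h k + d k)) N
    - series (fun n => pe (q n) h) N
    - \sum_j d j * series (fun n => pe (dpoly j (q n)) h) N|) @ \oo -->
    `|g (fun k => h k + d k) - g h - \sum_j d j * g' j h|.
  apply: cvg_norm; apply: cvgB; first by apply: cvgB; apply: b; exact: wid.
  apply: cvg_sumr => j; apply: cvgM; [exact: cvg_cst|exact: (H' j).2].
rewrite -(cvg_lim _ C) //; apply: limr_le; first exact/cvgP/C.
near=> N; rewrite /series /=.
apply: le_trans (_ : 2 / rho ^+ 2 * e ^+ 2 * \sum_(0 <= n < N) pn (2 * rho) (q n) <= _); last first.
  by rewrite ler_wpM2l // mulr_ge0 ?sqr_ge0 // divr_ge0 ?sqr_ge0.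
have -> : \sum_(j < r) d j * \sum_(0 <= k < N) pe (dpoly j (q k)) h =
          \sum_(0 <= k < N) \sum_(j < r) d j * pe (dpoly j (q k)) h.
  by rewrite exchange_big /=; apply: eq_bigr => j _; rewrite mulr_sumr.
rewrite -!sumrB mulr_sumr; apply: le_trans (ler_norm_sum _ _ _) _.
by apply: ler_sum => n _; exact: pe_taylor_le.
Unshelve. all: end_near. Qed.

Lemma has_ser_exp rho M g : 0 <= rho -> has_ser rho M g ->
  has_ser rho (expR M) (fun h => expR (g h)).
Proof.
move=> r0 H; have M0 : 0 <= M by case: H => q [a _]; apply: le_trans (a 0%N); rewrite big_geq.
have E (y : R) : series (fun m => (m`!%:R)^-1 * y ^+ m) @ \oo --> expR y.
  have -> : (fun m => (m`!%:R)^-1 * y ^+ m) = exp_coeff y.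
    by apply/funext => m; rewrite /exp_coeff /= mulrC.
  exact: is_cvg_series_exp_coeff.
apply: (has_ser_comp (M := M) (c := fun m => (m`!%:R)^-1)) => //.
  move=> N; rewrite -(cvg_lim _ (E M)) //.
  under eq_bigr do rewrite ger0_norm ?invr_ge0 //.
  apply: (nondecreasing_cvgn_le (u_ := series (fun m => (m`!%:R)^-1 * M ^+ m))).
    by apply/nondecreasing_seqP => n; rewrite seriesSr lerDl mulr_ge0 ?exprn_ge0 ?invr_ge0.
  exact/cvgP/E.
by move=> h _; exact: continuous_expR.
Qed.

(** Geometric series in the relative deviation [c0^-1 * (g h - c0)], once the radius is so small
    that this deviation has norm at most one half. *)
Lemma has_ser_inv rho M g : 0 < rho -> g (fun=> 0) != 0 -> has_ser rho M g ->
  exists rho' M', 0 < rho' /\ has_ser rho' M' (fun h => (g h)^-1).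
Proof.
move=> r0 g0 H; set c0 := g _ in g0.
have M0 : 0 <= M by case: H => q [a _]; apply: le_trans (a 0%N); rewrite big_geq.
have nc0 : 0 < `|c0| by rewrite normr_gt0.
(* Makes [|c0^-1| * (th * M)] at most [1 / 2]; the [+ 1] keeps the denominator positive when
   [M = 0]. *)
pose th := Num.min 1 (`|c0| / (2 * (M + 1))).
have th0 : 0 < th by rewrite lt_min ltr01 divr_gt0 // mulr_gt0 //; lra.
have th1 : th <= 1 by rewrite ge_min lexx.
have thM : `|c0^-1| * (th * M) <= 2^-1.
  have h1 : th * (2 * (M + 1)) <= `|c0|.
    by rewrite -ler_pdivlMr ?ge_min ?lexx ?orbT //; lra.
  rewrite normfV mulrC ler_pdivrMr //.
  have h2 : 0 <= th * 1 by rewrite mulr1 ltW.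
  lra.
have r'0 : 0 < th * rho by rewrite mulr_gt0.
exists (th * rho), (`|c0^-1| * 2); split=> //.
have S := has_ser_shrink (ltW r0) (ltW th0) th1 H.
have S1 := has_ser_mul (ltW r'0) (has_ser_const c0^-1 (ltW r'0)) S.
have S2 : has_ser (th * rho) 2^-1 (fun h => c0^-1 * (g h - c0)).
  by apply: has_ser_le thM S1 => //; exact: ltW.
have bnd h : inbox (th * rho) h -> `|c0^-1 * (g h - c0)| <= 2^-1.
  by case: S2 => q Hq hb; exact: (aser_bound Hq hb).
have S3 : has_ser (th * rho) 2 (fun h => (1 + c0^-1 * (g h - c0))^-1).
  apply: (has_ser_comp (M := 2^-1) (c := fun m => (-1) ^+ m) (F := fun y => (1 + y)^-1)) S2.
  - exact: ltW.
  - move=> N; under eq_bigr do rewrite normrX normrN normr1 expr1n mul1r.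
    suff : \sum_(0 <= i < N) (2^-1 : R) ^+ i = 2 - 2 * 2^-1 ^+ N.
      by move=> ->; rewrite lerBlDr lerDl mulr_ge0 // exprn_ge0.
    elim: N => [|N IH]; first by rewrite big_geq // expr0 mulr1 subrr.
    by rewrite big_nat_recr //= IH exprS; field.
  - move=> y yb; have := @cvg_geometric_series R 1 (- y).
    rewrite normrN opprK div1r => /(_ _) C.
    have -> : (fun m => (-1) ^+ m * y ^+ m) = geometric 1 (- y).
      by apply/funext => m; rewrite /geometric /= mul1r [in RHS]exprNn.
    by apply: C; lra.
  - move=> h /bnd hb; apply: cvgV; last by apply: cvgD; [exact: cvg_cst|exact: cvg_id].
    by apply/eqP => E0; move: hb; rewrite ler_norml; lra.
have := has_ser_mul (ltW r'0) (has_ser_const c0^-1 (ltW r'0)) S3.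
apply: has_ser_ext => h _.
rewrite -invfM; congr (_^-1); rewrite mulrDr mulr1 mulrA divff // mul1r; ring.
Qed.

End SeriesCalculus.

(** * Analytic functions on tuples and their derivatives *)

Section TupleAnalytic.
Context {R : realType} {r : nat}.
Local Notation pt := (r.-tuple R).
Implicit Types (x y : pt) (h : 'I_r -> R) (f g : pt -> R).

Definition shift x h : pt := [tuple tnth x k + h k | k < r].

Lemma tnth_shift x h k : tnth (shift x h) k = tnth x k + h k.
Proof. by rewrite tnth_mktuple. Qed.

Lemma shift0 x : shift x (fun=> 0) = x.
Proof. by apply: eq_from_tnth => k; rewrite tnth_shift addr0. Qed.

Lemma shiftK x y : shift x (fun k => tnth y k - tnth x k) = y.
Proof. by apply: eq_from_tnth => k; rewrite tnth_shift addrC subrK. Qed.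

Lemma shift_shift x h d : shift (shift x h) d = shift x (fun k => h k + d k).
Proof. by apply: eq_from_tnth => k; rewrite !tnth_shift addrA. Qed.

(** Neighbourhoods are sup-norm boxes, the domains on which the series converge. *)
Definition nearp x (P : pt -> Prop) :=
  exists e : R, 0 < e /\ forall h, inbox e h -> P (shift x h).

Lemma inbox0 (e : R) : 0 <= e -> @inbox R r e (fun=> 0).
Proof. by move=> e0 k; rewrite normr0. Qed.

Lemma inbox_le (e e' : R) h : e <= e' -> inbox e h -> inbox e' h.
Proof. by move=> ee H k; exact: le_trans (H k) ee. Qed.

Lemma nearp_all x P : (forall y, P y) -> nearp x P.
Proof. by move=> H; exists 1. Qed.

Lemma nearp_and x P Q : nearp x P -> nearp x Q -> nearp x (fun y => P y /\ Q y).
Proof.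
move=> [e [e0 H]] [e' [e'0 H']]; exists (Num.min e e'); split; first by rewrite lt_min e0.
by move=> h hb; split; [apply: H|apply: H']; apply: inbox_le hb; rewrite ge_min lexx ?orbT.
Qed.

Lemma nearp_sub x (P Q : pt -> Prop) : (forall y, P y -> Q y) -> nearp x P -> nearp x Q.
Proof. by move=> PQ [e [e0 H]]; exists e; split=> // h hb; exact/PQ/H. Qed.

Lemma nearp_near x P : nearp x P -> nearp x (fun y => nearp y P).
Proof.
move=> [e [e0 H]]; exists (e / 2); split; first lra.
move=> h hb; exists (e / 2); split; first lra.
move=> d db; rewrite shift_shift; apply: H => k.
by apply: le_trans (ler_normD _ _) _; have := hb k; have := db k; lra.
Qed.

Definition An x f := exists rho M, 0 < rho /\ has_ser rho M (fun h => f (shift x h)).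

Lemma An_near x f g : nearp x (fun y => f y = g y) -> An x f -> An x g.
Proof.
move=> [e [e0 H]] [rho [M [r0 S]]]; exists (Num.min e rho), M; split.
  by rewrite lt_min e0.
have m0 : 0 <= Num.min e rho by rewrite le_min !ltW.
apply: (@has_ser_ext _ _ _ _ (fun h => f (shift x h))).
  by move=> h hb; apply: H; apply: inbox_le hb; rewrite ge_min lexx.
by apply: has_ser_le S => //; rewrite ge_min lexx orbT.
Qed.

Lemma An_ext x f g : f =1 g -> An x f -> An x g.
Proof. by move=> E; apply: An_near; exact: nearp_all. Qed.

Lemma An_cst x c : An x (fun=> c).
Proof. by exists 1, `|c|; split=> //; exact: has_ser_const. Qed.

Lemma AnD x f g : An x f -> An x g -> An x (fun y => f y + g y).
Proof.
move=> [rho [M [r0 S]]] [rho' [M' [r'0 S']]]; exists (Num.min rho rho'), (M + M').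
split; first by rewrite lt_min r0.
have m0 : 0 <= Num.min rho rho' by rewrite le_min !ltW.
apply: has_ser_add.
  by apply: has_ser_le S => //; rewrite ge_min lexx.
by apply: has_ser_le S' => //; rewrite ge_min lexx orbT.
Qed.

Lemma AnM x f g : An x f -> An x g -> An x (fun y => f y * g y).
Proof.
move=> [rho [M [r0 S]]] [rho' [M' [r'0 S']]]; exists (Num.min rho rho'), (M * M').
split; first by rewrite lt_min r0.
have m0 : 0 <= Num.min rho rho' by rewrite le_min !ltW.
apply: has_ser_mul => //.
  by apply: has_ser_le S => //; rewrite ge_min lexx.
by apply: has_ser_le S' => //; rewrite ge_min lexx orbT.
Qed.

Lemma AnZ x c f : An x f -> An x (fun y => c * f y).
Proof. by apply: AnM; exact: An_cst. Qed.

Lemma AnN x f : An x f -> An x (fun y => - f y).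
Proof. by move=> /(AnZ (-1)); apply: An_ext => y; rewrite mulN1r. Qed.

Lemma AnB x f g : An x f -> An x g -> An x (fun y => f y - g y).
Proof. by move=> Hf /AnN; exact: AnD. Qed.

Lemma An_sum (I : Type) (s : seq I) (P : pred I) x (F : I -> pt -> R) :
  (forall i, P i -> An x (F i)) -> An x (fun y => \sum_(i <- s | P i) F i y).
Proof.
move=> H; elim: s => [|i s IH].
  by apply: (@An_ext _ (fun=> 0)); [move=> y; rewrite big_nil|exact: An_cst].
case Pi: (P i); last by apply: An_ext IH => y; rewrite big_cons Pi.
by apply: An_ext (AnD (H i Pi) IH) => y; rewrite big_cons Pi.
Qed.

Lemma An_coord x k : An x (fun y => tnth y k).
Proof.
exists 1, (`|tnth x k| + 1); split=> //.
have := has_ser_add (has_ser_const (tnth x k) ler01) (has_ser_coord k ler01).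
by apply: has_ser_ext => h _; rewrite tnth_shift.
Qed.

Lemma An_exp x f : An x f -> An x (fun y => expR (f y)).
Proof.
by move=> [rho [M [r0 S]]]; exists rho, (expR M); split=> //; apply: has_ser_exp => //; exact: ltW.
Qed.

Lemma AnV x f : f x != 0 -> An x f -> An x (fun y => (f y)^-1).
Proof.
move=> f0 [rho [M [r0 S]]]; have [|rho' [M' [r'0 S']]] := has_ser_inv r0 _ S.
  by rewrite shift0.
by exists rho', M'.
Qed.

Lemma has_ser_tact (tau : 'I_r -> R * 'I_r) rho M (g : ('I_r -> R) -> R) : 0 <= rho ->
  (forall k, `|(tau k).1| <= 1) -> has_ser rho M g -> has_ser rho M (fun h => g (tact tau h)).
Proof.
move=> r0 t1 [q [a b]].
pose q' n := [seq (m.1 * \prod_(k <- m.2) (tau k).1, [seq (tau k).2 | k <- m.2]) | m <- q n].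
exists q'; split=> [N|h hb].
  apply: le_trans (a N); apply: ler_sum => n _; rewrite /pn big_map; apply: ler_sum => m _ /=.
  rewrite size_map ler_wpM2r ?exprn_ge0 // normrM ler_piMr //.
  elim: m.2 => [|k w IH]; first by rewrite big_nil normr1.
  by rewrite big_cons normrM -[leRHS]mul1r ler_pM.
have tb : inbox rho (tact tau h).
  by move=> k; rewrite /tact normrM; apply: le_trans (hb (tau k).2); rewrite ler_piMl.
rewrite [X in X @ _ --> _](_ : _ = series (fun n => pe (q n) (tact tau h))); first exact: b.
apply/funext => N; rewrite /series /=; apply: eq_bigr => n _; rewrite /pe big_map.
apply: eq_bigr => m _ /=; rewrite -mulrA; congr (_ * _).
by rewrite /wev big_map -big_split.
Qed.

Definition tactp (tau : 'I_r -> R * 'I_r) y : pt :=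
  [tuple (tau k).1 * tnth y (tau k).2 | k < r].

Lemma tactp_shift tau x h : tactp tau (shift x h) = shift (tactp tau x) (tact tau h).
Proof.
by apply: eq_from_tnth => k; rewrite tnth_shift !tnth_mktuple mulrDr.
Qed.

Lemma An_tact tau x f : (forall k, `|(tau k).1| <= 1) -> An (tactp tau x) f ->
  An x (fun y => f (tactp tau y)).
Proof.
move=> t1 [rho [M [r0 S]]]; exists rho, M; split=> //.
have := has_ser_tact (ltW r0) t1 S; apply: has_ser_ext => h _; by rewrite tactp_shift.
Qed.

(* A quadratic remainder bound is all that is needed for differentiability. *)
Lemma is_derive_quad (F : R -> R) (s0 l C e : R) : 0 < e ->
  (forall d, `|d| <= e -> `|F (s0 + d) - F s0 - d * l| <= C * d ^+ 2) -> is_derive s0 1 F l.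
Proof.
move=> e0 H.
have L : d^-1 *: (F (d *: 1 + s0) - F s0) @[d --> 0^'] --> l.
  have -> : (fun d => d^-1 *: (F (d *: 1 + s0) - F s0)) =
            (fun d => l + (d^-1 *: (F (d *: 1 + s0) - F s0) - l)).
    by apply/funext => d; rewrite [RHS]addrC subrK.
  rewrite -[X in _ --> X]addr0; apply: cvgD; first exact: cvg_cst.
  apply: norm_cvg0; apply: (@squeeze_cvgr _ _ _ _ (fun=> 0) (fun d : R => C * `|d|)).
  - near=> d; rewrite normr_ge0 /=.
    have d0 : d != 0 by near: d; exact: nbhs_dnbhs_neq.
    have de : `|d| <= e.
      near: d; apply: dnbhs0_le => //.
    have := H d de; rewrite [s0 + d]addrC => Hd.
    rewrite /GRing.scale /= mulr1.
    rewrite -(ler_pM2l (_ : 0 < `|d|)) ?normr_gt0 // -normrM mulrBr mulrA divff // mul1r.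
    by apply: le_trans Hd _; rewrite -real_normK ?num_real //; lra.
  - exact: cvg_cst.
  - rewrite -[X in _ --> X](mulr0 C); apply: cvgM; first exact: cvg_cst.
    rewrite -[X in _ --> X](@normr0 _ R); apply: cvg_norm; exact: cvg_within.
have E : 'D_1 F s0 = l by apply: cvg_lim.
by apply: DeriveDef => //; apply/cvgP/L.
Unshelve. all: end_near. Qed.

Definition der (j : 'I_r) f y : R := derive1 (fun s => f (upd y j s)) (tnth y j).

Lemma upd_shift j y s : upd y j s = shift y (fun k => (k == j)%:R * (s - tnth y j)).
Proof.
apply: eq_from_tnth => k; rewrite tnth_shift tnth_mktuple.
by case: eqP => [->|_]; rewrite ?mul1r ?mul0r ?addr0 // addrC subrK.
Qed.

Lemma upd_id j y : upd y j (tnth y j) = y.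
Proof. by apply: eq_from_tnth => k; rewrite tnth_mktuple; case: eqP => // ->. Qed.

Lemma der_near j f g y : nearp y (fun z => f z = g z) -> der j f y = der j g y.
Proof.
move=> [e [e0 H]]; rewrite /der !derive1E; apply: near_eq_derive.
near=> s; rewrite upd_shift; apply: H => k.
case: eqP => _; rewrite ?mul1r ?mul0r ?normr0; last exact: ltW.
by near: s; exists e => //= z; rewrite /= distrC => /ltW.
Unshelve. all: end_near. Qed.

Definition path (p v : pt) (s : R) : pt := [tuple tnth p k + s * tnth v k | k < r].

Lemma aser_path rho M M' q f x (g' : 'I_r -> ('I_r -> R) -> R) h (v : pt) (p : pt) s0 :
  0 < rho -> aser (2 * rho) M q (fun h => f (shift x h)) ->
  (forall j, aser rho M' (fun n => dpoly j (q n)) (g' j)) ->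
  inbox (rho / 2) h -> shift x h = path p v s0 ->
  is_derive s0 1 (fun s => f (path p v s)) (\sum_j tnth v j * g' j h).
Proof.
move=> r0 A B hb E.
(* Dominates all [|v_k|] and is positive even for [v = 0], so that [rho / 2 / V] is an admissible
   time step. *)
pose V := 1 + \sum_k `|tnth v k|.
have V0 : 0 < V by rewrite ltr_pwDl // sumr_ge0.
have Vk k : `|tnth v k| <= V.
  by rewrite /V (bigD1 k) //= addrCA lerDl addr_ge0 // sumr_ge0.
apply: (@is_derive_quad _ _ _ (2 / rho ^+ 2 * V ^+ 2 * M) (rho / 2 / V)).
  by rewrite !divr_gt0.
move=> d db.
have dv k : `|d * tnth v k| <= `|d| * V by rewrite normrM ler_wpM2l.
have dV : `|d| * V <= rho / 2 by rewrite -ler_pdivlMr.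
have := aser_taylor (e := `|d| * V) (d := fun k => d * tnth v k) (h := h) r0 A B.
rewrite -!E (_ : path p v (s0 + d) = shift x (fun k => h k + d * tnth v k)); last first.
  rewrite -shift_shift E; apply: eq_from_tnth => k.
  by rewrite tnth_shift !tnth_mktuple mulrDl addrA.
rewrite mulr_sumr; under eq_bigr do rewrite -mulrA.
move=> H; apply: le_trans (H _ _ _) _ => //.
- by apply: inbox_le hb; lra.
- move=> k; apply: le_trans (ler_normD _ _) _.
  by have := hb k; have := dv k; lra.
- by rewrite exprMn real_normK ?num_real //; lra.
Qed.

Lemma upd_path j y s : upd y j s = path (upd y j 0) [tuple (k == j)%:R | k < r] s.
Proof.
apply: eq_from_tnth => k; rewrite !tnth_mktuple.
by case: eqP => _; rewrite ?mulr1 ?mulr0 ?addr0 ?add0r.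
Qed.

Lemma aser_der rho M M' q f x (g' : 'I_r -> ('I_r -> R) -> R) h j :
  0 < rho -> aser (2 * rho) M q (fun h => f (shift x h)) ->
  (forall j, aser rho M' (fun n => dpoly j (q n)) (g' j)) ->
  inbox (rho / 2) h -> der j f (shift x h) = g' j h.
Proof.
move=> r0 A B hb; rewrite /der derive1E.
set y := shift x h.
have E : shift x h = path (upd y j 0) [tuple (k == j)%:R | k < r] (tnth y j).
  by rewrite -upd_path upd_id.
have D := aser_path r0 A B hb E.
rewrite (_ : (fun s => f (upd y j s)) =
  (fun s => f (path (upd y j 0) [tuple (k == j)%:R | k < r] s))); last first.
  by apply/funext => s; rewrite -upd_path.
rewrite (@derive_val _ _ _ _ _ _ _ D) (bigD1 j) //= tnth_mktuple eqxx mul1r big1 ?addr0 //.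
by move=> k /negPf kj; rewrite tnth_mktuple kj mul0r.
Qed.

Lemma An_aser x f : An x f -> exists rho M q, [/\ 0 < rho,
  aser (2 * rho) M q (fun h => f (shift x h)) & exists M' (g' : 'I_r -> ('I_r -> R) -> R),
  forall j, aser rho M' (fun n => dpoly j (q n)) (g' j)].
Proof.
move=> [rho [M [r0 [q A]]]]; exists (rho / 2), M, q.
have r20 : 0 < rho / 2 by lra.
have E : 2 * (rho / 2) = rho by field.
rewrite E; split=> //; exists (2 / (rho / 2) * M).
have /choice [g' Hg'] : forall j, exists g' : ('I_r -> R) -> R,
    aser (rho / 2) (2 / (rho / 2) * M) (fun n => dpoly j (q n)) g'.
  by move=> j; apply: aser_dpoly => //; rewrite E; exact: A.1.
by exists g'.
Qed.

Lemma An_path f (p v : pt) s0 : An (path p v s0) f ->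
  is_derive s0 1 (fun s => f (path p v s)) (\sum_j tnth v j * der j f (path p v s0)).
Proof.
move=> /An_aser [rho [M [q [r0 A [M' [g' B]]]]]].
have hb : @inbox R r (rho / 2) (fun=> 0) by apply: inbox0; lra.
rewrite (eq_bigr (fun j => tnth v j * g' j (fun=> 0))); last first.
  by move=> j _; rewrite -{1}(shift0 (path p v s0)) (aser_der j r0 A B).
by apply: (aser_path r0 A B) => //; rewrite shift0.
Qed.

Lemma An_upd f y j : An y f ->
  is_derive (tnth y j) 1 (fun s => f (upd y j s)) (der j f y).
Proof.
move=> A; have := @An_path f (upd y j 0) [tuple (k == j)%:R | k < r] (tnth y j).
rewrite -upd_path upd_id => /(_ A).
rewrite (_ : (fun s => f (upd y j s)) =
  (fun s => f (path (upd y j 0) [tuple (k == j)%:R | k < r] s))); last first.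
  by apply/funext => s; rewrite -upd_path.
rewrite (bigD1 j) //= tnth_mktuple eqxx mul1r big1 ?addr0 //.
by move=> k /negPf kj; rewrite tnth_mktuple kj mul0r.
Qed.

Lemma An_der j x f : An x f -> An x (der j f).
Proof.
move=> /An_aser [rho [M [q [r0 A [M' [g' B]]]]]].
have h0 : 0 <= rho / 2 by lra.
have h1 : rho / 2 <= rho by lra.
exists (rho / 2), M'; split; first lra.
exists (fun n => dpoly j (q n)).
have [a b] := aser_le h0 h1 (B j).
by split=> // h hb; rewrite (aser_der j r0 A B) //; exact: b.
Qed.

(** Both mixed derivatives are sums of formal ones, which commute word by word. The second
    derivation consumes another half of the radius, hence [rho / 4]. *)
Lemma An_der_comm i j x f : An x f -> der i (der j f) x = der j (der i f) x.
Proof.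
move=> /An_aser [rho [M [q [r0 A [M' [g' B]]]]]].
have r4 : 0 < rho / 4 by lra.
have E4 : 2 * (rho / 4) = rho / 2 by field.
have B2 k : aser (2 * (rho / 4)) M' (fun n => dpoly k (q n)) (fun h => der k f (shift x h)).
  have h0 : 0 <= rho / 2 by lra.
  have h1 : rho / 2 <= rho by lra.
  rewrite E4; have [a b] := aser_le h0 h1 (B k).
  by split=> // h hb; rewrite (aser_der k r0 A B) //; exact: b.
have /choice [g2 H2] : forall k, exists g2 : 'I_r -> ('I_r -> R) -> R, forall l,
    aser (rho / 4) (2 / (rho / 4) * M') (fun n => dpoly l (dpoly k (q n))) (g2 l).
  move=> k; have F l : exists g2 : ('I_r -> R) -> R,
      aser (rho / 4) (2 / (rho / 4) * M') (fun n => dpoly l (dpoly k (q n))) g2.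
    by apply: aser_dpoly => //; exact: (B2 k).1.
  by have /choice [g2 Hg2] := F; exists g2.
have b0 e : 0 <= e -> @inbox R r e (fun=> 0) by exact: inbox0.
have D k l : der l (der k f) x = g2 k l (fun=> 0).
  by rewrite -{1}(shift0 x) (aser_der l r4 (B2 k) (H2 k)) //; apply: b0; lra.
rewrite !D; have [_ c1] := H2 j i; have [_ c2] := H2 i j.
have hb : @inbox R r (rho / 4) (fun=> 0) by apply: b0; lra.
have := c2 _ hb; have := c1 _ hb.
rewrite (_ : (fun n => pe (dpoly i (dpoly j (q n))) (fun=> 0)) =
   (fun n => pe (dpoly j (dpoly i (q n))) (fun=> 0))).
  exact: cvg_unique.
by apply/funext => n; rewrite pe_dpoly_comm.
Qed.

End TupleAnalytic.

(** * From multi-index power series to word series *)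

Section AnalyticAt.
Context {R : realType} {r : nat}.

Definition mword (al : 'I_r -> nat) : seq 'I_r := flatten [seq nseq (al k) k | k <- enum 'I_r].

Lemma wev_mword (h : 'I_r -> R) al : wev h (mword al) = \prod_k h k ^+ al k.
Proof.
rewrite /mword -big_enum /=; elim: (enum 'I_r) => [|k s IH] /=.
  by rewrite /wev !big_nil.
rewrite wev_cat IH big_cons; congr (_ * _).
by elim: (al k) => [|n IHn]; [rewrite /wev big_nil expr0|rewrite /= wev_cons IHn exprS].
Qed.

Lemma norm_wev_mword (rho : R) al : rho ^+ size (mword al) = \prod_(k < r) rho ^+ al k.
Proof.
rewrite -wev_mword /wev; elim: mword => [|k w IH] /=; first by rewrite big_nil.
by rewrite big_cons exprS IH.
Qed.

(** The shell of multi-indices with maximum [n]. The disjunct [n == 0] puts the empty multi-index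
    into shell 0 when [r = 0]. *)
Definition toptuple n : pred (r.-tuple 'I_n.+1) :=
  fun al => (n == 0)%N || [exists k, tnth al k == n :> nat].

Definition aseq (c : r.-tuple nat -> R) n : seq (R * seq 'I_r) :=
  [seq (c (map_tuple (@nat_of_ord n.+1) al), mword (fun k => tnth al k))
   | al <- [seq al <- enum {: r.-tuple 'I_n.+1} | toptuple al]].

(** The shells up to [N] fill the cube of multi-indices with entries at most [N]: the part of the
    cube below its top shell is the previous cube, embedded by [widen_ord]. *)
Lemma aseq_sum (c : r.-tuple nat -> R) (G : R -> ('I_r -> nat) -> R) (v : R * seq 'I_r -> R) N :
  (forall x al, v (x, mword al) = G x al) ->
  (forall x al al', al =1 al' -> G x al = G x al') ->
  \sum_(0 <= n < N.+1) \sum_(m <- aseq c n) v m =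
  \sum_(al : r.-tuple 'I_N.+1) G (c (map_tuple (@nat_of_ord N.+1) al)) (fun k => tnth al k).
Proof.
move=> vG Gext.
have E n : \sum_(m <- aseq c n) v m =
  \sum_(al : r.-tuple 'I_n.+1 | toptuple al) G (c (map_tuple (@nat_of_ord n.+1) al)) (fun k => tnth al k).
  by rewrite /aseq big_map big_filter big_enum_cond /=; apply: eq_bigr => al _; rewrite vG.
elim: N => [|N IH].
  by rewrite big_nat1 E; apply: eq_bigl => al.
rewrite big_nat_recr //= IH E [RHS](bigID (@toptuple N.+1)) /= [RHS]addrC; congr (_ + _).
rewrite [RHS](reindex_onto (map_tuple (widen_ord (leqnSn N.+1))) (map_tuple (fun i : 'I_N.+2 => inord i))) /=.
  apply: eq_big => [al|al _].
    symmetry; apply/andP; split.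
      apply/negP => /existsP[k]; rewrite tnth_map /= => /eqP E1.
      by have := ltn_ord (tnth al k); rewrite E1 ltnn.
    apply/eqP/eq_from_tnth => k; rewrite !tnth_map; apply/val_inj => /=.
    by rewrite inordK.
  have -> : map_tuple (@nat_of_ord N.+2) (map_tuple (widen_ord (leqnSn N.+1)) al) =
            map_tuple (@nat_of_ord N.+1) al.
    by apply: eq_from_tnth => k; rewrite !tnth_map.
  by apply: Gext => k; rewrite tnth_map.
move=> al /existsPn ntop; apply: eq_from_tnth => k; rewrite !tnth_map; apply/val_inj => /=.
rewrite inordK //; have := ntop k; have := ltn_ord (tnth al k); rewrite ltnS leq_eqVlt.
by case: eqP.
Qed.

Lemma An_of_analytic (f : r.-tuple R -> R[i]) (part : R[i] -> R) x :
  (forall z w, part (z + w) = part z + part w) -> part 0 = 0 ->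
  (forall z, `|part z| <= cabs z) ->
  (forall z s, part (z * toC s) = part z * s) ->
  analytic_at f x -> An x (fun y => part (f y)).
Proof.
move=> pD p0 pb pM [d [c [d0 H]]].
have toCX (s : R) n : toC s ^+ n = toC (s ^+ n).
  elim: n => [|n IH]; first by rewrite !expr0.
  rewrite !exprS IH; apply/eqP; rewrite eq_complex /= !mul0r !mulr0 subr0 addr0 !eqxx //.
have toCprod (F : 'I_r -> R) : \prod_k toC (F k) = toC (\prod_k F k).
  elim/big_rec2: _ => // k y1 y2 _ ->.
  by apply/eqP; rewrite eq_complex /= !mul0r !mulr0 subr0 addr0 !eqxx.
have psum (I : finType) (F : I -> R[i]) : part (\sum_i F i) = \sum_i part (F i).
  by elim/big_rec2: _ => // i y1 y2 _ <-.
have rho0 : 0 < d / 2 by lra.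
(* At this corner every monomial is a power of [d / 2], so the absolute bound given there is the
   norm bound at radius [d / 2]. *)
pose y0 := shift x (fun=> d / 2).
have [M HM] : exists M : R, forall N : nat, \sum_(al : r.-tuple 'I_N)
    cabs (c (map_tuple (@nat_of_ord N) al)) * \prod_(k < r) `|tnth y0 k - tnth x k| ^+ tnth al k <= M.
  have [|//] := (H y0 _).
  by move=> k; rewrite tnth_shift addrAC subrr add0r ger0_norm; lra.
have cabs0 z : 0 <= @cabs R z by exact: sqrtr_ge0.
exists (d / 2), M; split=> //; exists (aseq (fun al => part (c al))); split.
  move=> N; have M0 : 0 <= M.
    apply: le_trans (HM 0%N); apply: sumr_ge0 => al _; rewrite mulr_ge0 //.
    by apply: prodr_ge0 => k _; rewrite exprn_ge0.
  case: N => [|N]; first by rewrite big_geq.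
  rewrite /pn (@aseq_sum _ (fun x al => `|x| * \prod_(k < r) (d / 2) ^+ al k)
     (fun m => `|m.1| * (d / 2) ^+ size m.2)); last 2 first.
  - by move=> z al /=; rewrite norm_wev_mword.
  - by move=> z al al' E; congr (_ * _); apply: eq_bigr => k _; rewrite E.
  apply: le_trans (HM N.+1); apply: ler_sum => al _.
  have -> : \prod_(k < r) `|tnth y0 k - tnth x k| ^+ tnth al k = \prod_(k < r) (d / 2) ^+ tnth al k.
    by apply: eq_bigr => k _; rewrite tnth_shift addrAC subrr add0r ger0_norm // ltW.
  rewrite ler_wpM2r ?pb //; apply: prodr_ge0 => k _; rewrite exprn_ge0 // ltW //.
move=> h hb.
have [|_ Hc] := H (shift x h) _.
  by move=> k; rewrite tnth_shift addrAC subrr add0r; apply: le_lt_trans (hb k) _; lra.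
rewrite -(cvg_shiftS (series _)) /=.
apply/cvgrPdist_lt => e e0; have [N0 HN] := Hc e e0.
near=> N; rewrite /series /= (_ : \sum_(0 <= k < N.+1) _ =
   part (\sum_(al : r.-tuple 'I_N.+1) c (map_tuple (@nat_of_ord N.+1) al)
                 * \prod_(k < r) toC (tnth (shift x h) k - tnth x k) ^+ tnth al k)).
  have nN : (N0 <= N.+1)%N by apply: leqW; near: N; exact: nbhs_infty_ge.
  rewrite distrC; apply: le_lt_trans (HN _ nN).
  have pN z : part (- z) = - part z by apply/eqP; rewrite -addr_eq0 -pD addNr p0.
  by rewrite -pN -pD pb.
rewrite psum /pe (@aseq_sum _ (fun z al => z * \prod_k h k ^+ al k) (fun m => m.1 * wev h m.2)).
- apply: eq_bigr => al _; rewrite -pM; congr (part (_ * _)).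
  rewrite -toCprod; apply: eq_bigr => k _.
  by rewrite tnth_shift addrAC subrr add0r toCX.
- by move=> z al /=; rewrite wev_mword.
- by move=> z al al' E; congr (_ * _); apply: eq_bigr => k _; rewrite E.
Unshelve. all: end_near. Qed.

End AnalyticAt.

(** * The regular set, reflections as signed permutations, and the function [kap] *)

Section Reflections.
Context {R : realType} {r : nat}.
Local Notation pt := (r.-tuple R).
Implicit Types (x y t : pt) (F G : pt -> R).

(** The oscillation on the box shrunk by [th] is at most [th * M], by [has_ser_shrink]. *)
Lemma An_cont x F (e : R) : 0 < e -> An x F -> nearp x (fun y => `|F y - F x| <= e).
Proof.
move=> e0 [rho [M [r0 S]]].
have M0 : 0 <= M by case: S => q [a _]; apply: le_trans (a 0%N); rewrite big_geq.
pose th := Num.min 1 (e / (M + 1)).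
have th0 : 0 < th by rewrite lt_min ltr01 divr_gt0 //; lra.
have th1 : th <= 1 by rewrite ge_min lexx.
have thM : th * M <= e.
  have h1 : th * (M + 1) <= e by rewrite -ler_pdivlMr ?ge_min ?lexx ?orbT //; lra.
  by apply: le_trans h1; rewrite ler_wpM2l ?ltW //; lra.
have [q Hq] := has_ser_shrink (ltW r0) (ltW th0) th1 S.
exists (th * rho); split; first by rewrite mulr_gt0.
move=> h hb; have := aser_bound Hq hb; rewrite shift0 => /le_trans; exact.
Qed.

Lemma An_neq0_near x F : An x F -> F x != 0 -> nearp x (fun y => F y != 0).
Proof.
move=> A F0; have e0 : 0 < `|F x| / 2 by rewrite divr_gt0 // normr_gt0.
apply: nearp_sub (An_cont e0 A) => y; apply: contraTneq => ->; rewrite sub0r normrN -ltNge.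
by move: e0; lra.
Qed.

Lemma nearp_forall (I : finType) x (P : I -> pt -> Prop) :
  (forall i, nearp x (P i)) -> nearp x (fun y => forall i, P i y).
Proof.
move=> H; have [e He] := choice H.
exists (\big[Num.min/1]_i e i); split.
  by apply: lt_bigmin => // i _; exact: (He i).1.
move=> h hb i; apply: (He i).2; apply: inbox_le hb; exact: bigmin_le_cond.
Qed.

Lemma regular_near t : regular t -> nearp t regular.
Proof.
move=> [H1 H2]; apply: nearp_and.
  by apply: nearp_forall => j; apply: An_neq0_near => //; exact: An_coord.
apply: nearp_forall => i; apply: nearp_forall => j.
have [->|ij] := eqVneq i j; first by apply: nearp_all => y /eqP.
have [n1 n2] := H2 i j ij.
have A1 : An t (fun y => tnth y i - tnth y j) by apply: AnB; exact: An_coord.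
have A2 : An t (fun y => tnth y i + tnth y j) by apply: AnD; exact: An_coord.
rewrite -subr_eq0 in n1; rewrite -addr_eq0 in n2.
apply: nearp_sub (nearp_and (An_neq0_near A1 n1) (An_neq0_near A2 n2)) => y [].
by rewrite subr_eq0 addr_eq0.
Qed.

Definition tsw (i j : 'I_r) : 'I_r -> R * 'I_r :=
  fun k => (1, if k == i then j else if k == j then i else k).
Definition tsg (i j : 'I_r) : 'I_r -> R * 'I_r :=
  fun k => (if (k == i) || (k == j) then -1 else 1, if k == i then j else if k == j then i else k).
Definition tng (i : 'I_r) : 'I_r -> R * 'I_r := fun k => (if k == i then -1 else 1, k).

Lemma s_ijE i j : s_ij i j = tactp (tsw i j) :> (pt -> pt).
Proof.
apply/funext => t; apply: eq_from_tnth => k; rewrite !tnth_mktuple /= mul1r.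
by case: eqP => // _; case: eqP.
Qed.

Lemma sigma_ijE i j : sigma_ij i j = tactp (tsg i j) :> (pt -> pt).
Proof.
apply/funext => t; apply: eq_from_tnth => k; rewrite !tnth_mktuple /=.
by case: eqP => _ /=; rewrite ?mulN1r //; case: eqP => _; rewrite ?mulN1r ?mul1r.
Qed.

Lemma sigma_iE i : sigma_i i = tactp (tng i) :> (pt -> pt).
Proof.
apply/funext => t; apply: eq_from_tnth => k; rewrite !tnth_mktuple /=.
by case: eqP => [->|_] /=; rewrite ?mulN1r ?mul1r.
Qed.

Definition unimod (tau : 'I_r -> R * 'I_r) :=
  (forall k, (tau k).1 = 1 \/ (tau k).1 = -1) /\ injective (fun k => (tau k).2).

Lemma unimod_le tau : unimod tau -> forall k, `|(tau k).1| <= 1.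
Proof. by move=> [H _] k; case: (H k) => ->; rewrite ?normrN normr1. Qed.

Lemma unimod_tsw i j : unimod (tsw i j).
Proof.
split=> [k|]; first by left.
apply: (can_inj (g := fun k => if k == i then j else if k == j then i else k)) => k /=.
case: (eqVneq k i) => [->|ki].
  by case: (eqVneq j i) => [->|]; rewrite ?eqxx // => _; rewrite eqxx.
case: (eqVneq k j) => [->|kj]; first by rewrite eqxx.
by rewrite (negPf ki) (negPf kj).
Qed.

Lemma unimod_tsg i j : unimod (tsg i j).
Proof.
by split=> [k|]; [rewrite /tsg /=; case: ifP => _; [right|left]|exact: (unimod_tsw i j).2].
Qed.

Lemma unimod_tng i : unimod (tng i).
Proof. by split=> [k|k l] //=; case: ifP => _; [right|left]. Qed.

Lemma regular_tactp tau t : unimod tau -> regular t -> regular (tactp tau t).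
Proof.
move=> [U1 U2] [H1 H2]; split=> [j|i j ij].
  by rewrite tnth_mktuple; case: (U1 j) => ->; rewrite ?mulN1r ?oppr_eq0 ?mul1r.
have ij' : (tau i).2 != (tau j).2 by apply: contra_neq ij; exact: U2.
have [/eqP n1 /eqP n2] := H2 _ _ ij'; rewrite !tnth_mktuple.
by case: (U1 i) (U1 j) => -> [] ->; rewrite ?mulN1r ?mul1r; split; apply/eqP => E;
  first [apply: n1; lra|apply: n2; lra].
Qed.

Lemma der_tactp tau i F t : An (tactp tau t) F ->
  der i (fun y => F (tactp tau y)) t =
  \sum_k (tau k).1 * ((tau k).2 == i)%:R * der k F (tactp tau t).
Proof.
move=> A; rewrite {1}/der derive1E.
pose v : pt := [tuple (tau k).1 * ((tau k).2 == i)%:R | k < r].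
pose p : pt := tactp tau (upd t i 0).
have E s : tactp tau (upd t i s) = path p v s.
  apply: eq_from_tnth => k; rewrite !tnth_mktuple.
  by case: ((tau k).2 == i); rewrite ?mulr1 ?mulr0 ?addr0 ?add0r // mulrC.
rewrite (_ : (fun s => F (tactp tau (upd t i s))) = (fun s => F (path p v s))); last first.
  by apply/funext => s; rewrite E.
have Et : path p v (tnth t i) = tactp tau t by rewrite -E upd_id.
have D := @An_path _ _ F p v (tnth t i); rewrite Et in D.
have D' := D A; rewrite (@derive_val _ _ _ _ _ _ _ D').
by apply: eq_bigr => k _; rewrite tnth_mktuple.
Qed.

Lemma derD i F G t : An t F -> An t G -> der i (fun y => F y + G y) t = der i F t + der i G t.
Proof.
move=> /(An_upd i) HF /(An_upd i) HG; rewrite {1}/der derive1E.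
have := is_deriveD HF HG => D.
exact: (@derive_val _ _ _ _ _ _ _ D).
Qed.

Lemma derM i F G t : An t F -> An t G ->
  der i (fun y => F y * G y) t = F t * der i G t + G t * der i F t.
Proof.
move=> /(An_upd i) HF /(An_upd i) HG; rewrite {1}/der derive1E.
have D := is_deriveM HF HG; have := @derive_val _ _ _ _ _ _ _ D.
by rewrite !upd_id.
Qed.

Lemma der_cst i c t : der i (fun=> c) t = 0.
Proof. by rewrite /der derive1E derive_cst. Qed.

Lemma derN i F t : An t F -> der i (fun y => - F y) t = - der i F t.
Proof.
move=> A; have := derM i (An_cst t (-1)) A; rewrite der_cst mulr0 addr0 mulN1r => <-.
by congr der; apply/funext => y; rewrite mulN1r.
Qed.

Lemma derB i F G t : An t F -> An t G -> der i (fun y => F y - G y) t = der i F t - der i G t.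
Proof. by move=> A B; rewrite derD ?derN //; exact: AnN. Qed.

Lemma derZ i c F t : An t F -> der i (fun y => c * F y) t = c * der i F t.
Proof. by move=> A; rewrite derM ?der_cst ?mulr0 ?addr0 //; exact: An_cst. Qed.

Lemma der_sum (I : Type) (s : seq I) (P : pred I) (i : 'I_r) (F : I -> pt -> R) t :
  (forall l, P l -> An t (F l)) ->
  der i (fun y => \sum_(l <- s | P l) F l y) t = \sum_(l <- s | P l) der i (F l) t.
Proof.
move=> H; elim: s => [|l s IH].
  rewrite big_nil (_ : (fun y => _) = fun=> 0) ?der_cst //.
  by apply/funext => y; rewrite big_nil.
rewrite big_cons -IH; case: ifP => Pl.
  rewrite -derD; [|exact: H|exact: An_sum].
  by congr der; apply/funext => y; rewrite big_cons Pl.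
by congr der; apply/funext => y; rewrite big_cons Pl.
Qed.

(* [kap s = (1 + coth s) / 2] *)
Definition kap (s : R) : R := (1 - expR (- 2 * s))^-1.

Lemma exp_neq1 (s : R) : s != 0 -> 1 - expR (- 2 * s) != 0.
Proof.
move=> s0; rewrite subr_eq0 eq_sym -[X in _ == X]expR0 (inj_eq (@expR_inj R)).
by rewrite mulf_neq0 // oppr_eq0 pnatr_eq0.
Qed.

Lemma kapN (s : R) : s != 0 -> kap (- s) = 1 - kap s.
Proof.
move=> s0; rewrite /kap; have e0 := exp_neq1 s0.
have : expR (- 2 * - s) * expR (- 2 * s) = 1 by rewrite -expRD -(@expR0 R); congr expR; ring.
have p0 := expR_gt0 (- 2 * s); have q0 := @exp_neq1 (- s); rewrite oppr_eq0 in q0.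
move: (q0 s0) e0; set u := expR (- 2 * - s); set v := expR _ in p0 *.
move=> u0 v0 E; apply: (mulfI u0); rewrite divff //; apply: (mulfI v0).
by rewrite mulrA mulrBr mulr1 mulrAC [_ * (1 - u) / _]mulrAC divff // mul1r; lra.
Qed.

Lemma An_kap t F : An t F -> F t != 0 -> An t (fun y => kap (F y)).
Proof.
move=> A F0; apply: AnV; first exact: exp_neq1.
by apply: AnB; [exact: An_cst|apply: An_exp; exact: AnZ].
Qed.

Lemma is_derive_kap (s : R) : s != 0 -> is_derive s 1 kap (2 * kap s * (1 - kap s)).
Proof.
move=> s0; have e0 := exp_neq1 s0; rewrite /kap.
have D : is_derive s 1 (fun u : R => 1 - expR (- 2 * u)) (2 * expR (- 2 * s)).
  have D1 : is_derive s 1 (fun u : R => -2 * u) (-2).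
    by have := is_deriveZ (-2) (is_derive_id s 1); rewrite /GRing.scale /= mulr1.
  have D2 := is_derive1_comp (is_derive_expR (-2 * s)) D1.
  have D3 := is_deriveB (is_derive_cst (1 : R) s (1 : R)) D2.
  apply: is_derive_eq D3 _; ring.
have e0' : (fun u : R => 1 - expR (- 2 * u)) s != 0 by [].
have D2 := @is_deriveV R (fun u : R => 1 - expR (- 2 * u)) s _ 1 e0' D.
apply: is_derive_eq D2 _; rewrite /GRing.scale /=.
by field.
Qed.

Lemma der_kap i F t : An t F -> F t != 0 ->
  der i (fun y => kap (F y)) t = 2 * kap (F t) * (1 - kap (F t)) * der i F t.
Proof.
move=> A F0; rewrite {1}/der derive1E.
have F0' : F (upd t i (tnth t i)) != 0 by rewrite upd_id.
have D := is_derive1_comp (is_derive_kap F0') (An_upd i A).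
have := @derive_val _ _ _ _ _ _ _ D; rewrite upd_id => <- //.
Qed.

Lemma der_coord i k t : der i (fun y => tnth y k) t = (k == i)%:R.
Proof.
rewrite /der derive1E; case: eqP => [->|/eqP/negPf ki].
  rewrite (_ : (fun _ => _) = id) ?derive_id //.
  by apply/funext => s; rewrite tnth_mktuple eqxx.
rewrite (_ : (fun _ => _) = fun=> tnth t k) ?derive_cst //.
by apply/funext => s; rewrite tnth_mktuple ki.
Qed.

End Reflections.

(** * Cherednik operators on real functions analytic off the walls *)

Section CherednikOperators.
Context {R : realType} {r : nat}.
Variables (a b iota : R).
Implicit Types (t : r.-tuple R) (F G : r.-tuple R -> R).

(** One formula for both orders of the indices: for [j < i] the operator carries
    [- kap (t_j - t_i)], which equals [kap (t_i - t_j) - 1]. *)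
Definition opA (i j : 'I_r) F t : R :=
  a * (kap (tnth t i - tnth t j) - (j < i)%:R) * (F t - F (s_ij i j t))
  + a * kap (tnth t i + tnth t j) * (F t - F (sigma_ij i j t)).

Definition opB (i : 'I_r) F t : R :=
  (2 * iota * kap (2 * tnth t i) + 2 * b * kap (tnth t i)) * (F t - F (sigma_i i t)).

(** The part of [D_i] that involves no index other than [i] and [j]: a rank-two operator, but with
    the constant [rho_j] of the full rank. *)
Definition opN (i j : 'I_r) F t : R :=
  der i F t + opA i j F t + opB i F t - rho_j a b iota i * F t.

Definition Dch (i : 'I_r) F t : R :=
  der i F t + \sum_(j | j != i) opA i j F t + opB i F t - rho_j a b iota i * F t.

Definition good F := forall t, regular t -> An t F.

Lemma reg_s (i j : 'I_r) t : regular t -> regular (s_ij i j t).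
Proof. by rewrite s_ijE; apply: regular_tactp; exact: unimod_tsw. Qed.
Lemma reg_sg (i j : 'I_r) t : regular t -> regular (sigma_ij i j t).
Proof. by rewrite sigma_ijE; apply: regular_tactp; exact: unimod_tsg. Qed.
Lemma reg_ng (i : 'I_r) t : regular t -> regular (sigma_i i t).
Proof. by rewrite sigma_iE; apply: regular_tactp; exact: unimod_tng. Qed.

Lemma good_s (i j : 'I_r) F : good F -> good (fun t => F (s_ij i j t)).
Proof.
move=> gF t /(reg_s i j) rt; rewrite s_ijE in rt *.
by apply: An_tact; [exact/unimod_le/unimod_tsw|exact: gF].
Qed.
Lemma good_sg (i j : 'I_r) F : good F -> good (fun t => F (sigma_ij i j t)).
Proof.
move=> gF t /(reg_sg i j) rt; rewrite sigma_ijE in rt *.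
by apply: An_tact; [exact/unimod_le/unimod_tsg|exact: gF].
Qed.
Lemma good_ng (i : 'I_r) F : good F -> good (fun t => F (sigma_i i t)).
Proof.
move=> gF t /(reg_ng i) rt; rewrite sigma_iE in rt *.
by apply: An_tact; [exact/unimod_le/unimod_tng|exact: gF].
Qed.

Lemma good_ext F G : (forall t, regular t -> F t = G t) -> good F -> good G.
Proof.
move=> E gF t rt; apply: An_near (gF t rt); exact: nearp_sub E (regular_near rt).
Qed.
Lemma goodD F G : good F -> good G -> good (fun t => F t + G t).
Proof. by move=> gF gG t rt; apply: AnD; [exact: gF|exact: gG]. Qed.
Lemma goodB F G : good F -> good G -> good (fun t => F t - G t).
Proof. by move=> gF gG t rt; apply: AnB; [exact: gF|exact: gG]. Qed.
Lemma goodM F G : good F -> good G -> good (fun t => F t * G t).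
Proof. by move=> gF gG t rt; apply: AnM; [exact: gF|exact: gG]. Qed.
Lemma good_cst c : good (fun=> c).
Proof. by move=> t _; exact: An_cst. Qed.
Lemma goodZ c F : good F -> good (fun t => c * F t).
Proof. by move=> gF; apply: goodM => //; exact: good_cst. Qed.
Lemma good_der i F : good F -> good (der i F).
Proof. by move=> gF t rt; apply: An_der; exact: gF. Qed.
Lemma good_sum (I : Type) (s : seq I) (P : pred I) (F : I -> r.-tuple R -> R) :
  (forall l, P l -> good (F l)) -> good (fun t => \sum_(l <- s | P l) F l t).
Proof. by move=> H t rt; apply: An_sum => l Pl; exact: H. Qed.

Lemma reg_sub_neq0 t (i j : 'I_r) : regular t -> i != j -> tnth t i - tnth t j != 0.
Proof. by move=> [_ H] ij; rewrite subr_eq0; have [] := H i j ij. Qed.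
Lemma reg_add_neq0 t (i j : 'I_r) : regular t -> i != j -> tnth t i + tnth t j != 0.
Proof. by move=> [_ H] ij; rewrite addr_eq0; have [] := H i j ij. Qed.

Lemma An_sub_coord t (i j : 'I_r) : An t (fun y => tnth y i - tnth y j).
Proof. by apply: AnB; exact: An_coord. Qed.
Lemma An_add_coord t (i j : 'I_r) : An t (fun y => tnth y i + tnth y j).
Proof. by apply: AnD; exact: An_coord. Qed.
Lemma An_dbl_coord t (i : 'I_r) : An t (fun y => 2 * tnth y i).
Proof. by apply: AnZ; exact: An_coord. Qed.

Lemma good_kap_sub (i j : 'I_r) : i != j -> good (fun t => kap (tnth t i - tnth t j)).
Proof. by move=> ij t rt; apply: An_kap; [exact: An_sub_coord|exact: reg_sub_neq0]. Qed.
Lemma good_kap_add (i j : 'I_r) : i != j -> good (fun t => kap (tnth t i + tnth t j)).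
Proof. by move=> ij t rt; apply: An_kap; [exact: An_add_coord|exact: reg_add_neq0]. Qed.
Lemma good_kap1 (i : 'I_r) : good (fun t => kap (tnth t i)).
Proof. by move=> t [H _]; apply: An_kap; [exact: An_coord|exact: H]. Qed.
Lemma good_kap2 (i : 'I_r) : good (fun t => kap (2 * tnth t i)).
Proof.
move=> t [H _]; apply: An_kap; first exact: An_dbl_coord.
by rewrite mulf_neq0 ?H ?pnatr_eq0.
Qed.

Lemma good_opA (i j : 'I_r) F : i != j -> good F -> good (opA i j F).
Proof.
move=> ij gF; apply: goodD; apply: goodM.
- by apply: goodZ; apply: goodB; [exact: good_kap_sub|exact: good_cst].
- by apply: goodB => //; exact: good_s.
- by apply: goodZ; exact: good_kap_add.
- by apply: goodB => //; exact: good_sg.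
Qed.

Lemma good_opB (i : 'I_r) F : good F -> good (opB i F).
Proof.
move=> gF; apply: goodM.
  by apply: goodD; apply: goodZ; [exact: good_kap2|exact: good_kap1].
by apply: goodB => //; exact: good_ng.
Qed.

Lemma good_opN (i j : 'I_r) F : i != j -> good F -> good (opN i j F).
Proof.
move=> ij gF; apply: goodB; last exact: goodZ.
apply: goodD; last exact: good_opB.
by apply: goodD; [exact: good_der|exact: good_opA].
Qed.

Lemma good_Dch i F : good F -> good (Dch i F).
Proof.
move=> gF; apply: goodB; last exact: goodZ.
apply: goodD; last exact: good_opB.
apply: goodD; first exact: good_der.
by apply: good_sum => j ji; apply: good_opA; rewrite 1?eq_sym.
Qed.

Definition swp (i j m : 'I_r) := if m == i then j else if m == j then i else m.

Lemma swpK (i j m : 'I_r) : swp i j (swp i j m) = m.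
Proof.
rewrite /swp; case: (eqVneq m i) => [->|mi].
  by case: (eqVneq j i) => [->|]; rewrite ?eqxx // => _; rewrite eqxx.
case: (eqVneq m j) => [->|mj]; first by rewrite eqxx.
by rewrite (negPf mi) (negPf mj).
Qed.

Lemma swp_eq (i j k m : 'I_r) : (swp i j k == m) = (k == swp i j m).
Proof. by apply/eqP/eqP => [<-|->]; rewrite swpK. Qed.

Lemma der_s (i j m : 'I_r) F t : good F -> regular t ->
  der m (fun y => F (s_ij i j y)) t = der (swp i j m) F (s_ij i j t).
Proof.
move=> gF rt; have := reg_s i j rt; rewrite s_ijE => rt'.
rewrite der_tactp; last exact: gF.
rewrite (bigD1 (swp i j m)) //= -/(swp i j _) swpK eqxx !mul1r big1 ?addr0 // => k km.
by rewrite -/(swp i j k) swp_eq (negPf km) mulr0 mul0r.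
Qed.

Lemma der_sg (i j m : 'I_r) F t : good F -> regular t ->
  der m (fun y => F (sigma_ij i j y)) t =
  (if (m == i) || (m == j) then -1 else 1) * der (swp i j m) F (sigma_ij i j t).
Proof.
move=> gF rt; have := reg_sg i j rt; rewrite sigma_ijE => rt'.
rewrite der_tactp; last exact: gF.
rewrite (bigD1 (swp i j m)) //= -/(swp i j _) swpK eqxx big1 ?addr0 => [|k km].
  rewrite mulr1; congr (_ * _); rewrite /swp; case: (eqVneq m i) => [->|mi] /=.
    by rewrite eqxx orbT.
  by case: (eqVneq m j) => [_|mj]; rewrite ?eqxx // (negPf mi) (negPf mj).
by rewrite -/(swp i j k) swp_eq (negPf km) mulr0 mul0r.
Qed.

Lemma der_ng (i m : 'I_r) F t : good F -> regular t ->
  der m (fun y => F (sigma_i i y)) t = (if m == i then -1 else 1) * der m F (sigma_i i t).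
Proof.
move=> gF rt; have := reg_ng i rt; rewrite sigma_iE => rt'.
rewrite der_tactp; last exact: gF.
rewrite (bigD1 m) //= eqxx mulr1 big1 ?addr0 // => k km.
by rewrite (negPf km) mulr0 mul0r.
Qed.

Lemma der_opA (i j m : 'I_r) F t : i != j -> good F -> regular t ->
  der m (opA i j F) t =
   a * (2 * kap (tnth t i - tnth t j) * (1 - kap (tnth t i - tnth t j)) * ((i == m)%:R - (j == m)%:R))
     * (F t - F (s_ij i j t))
   + a * (kap (tnth t i - tnth t j) - (j < i)%:R) * (der m F t - der (swp i j m) F (s_ij i j t))
   + a * (2 * kap (tnth t i + tnth t j) * (1 - kap (tnth t i + tnth t j)) * ((i == m)%:R + (j == m)%:R))
     * (F t - F (sigma_ij i j t))
   + a * kap (tnth t i + tnth t j)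
     * (der m F t - (if (m == i) || (m == j) then -1 else 1) * der (swp i j m) F (sigma_ij i j t)).
Proof.
move=> ij gF rt; have AF := gF t rt.
have As := good_s i j gF rt; have Asg := good_sg i j gF rt.
have AK1 := good_kap_sub ij rt; have AK2 := good_kap_add ij rt.
have n1 := reg_sub_neq0 rt ij; have n2 := reg_add_neq0 rt ij.
have A1 : An t (fun y => kap (tnth y i - tnth y j) - (j < i)%:R).
  by apply: AnB => //; exact: An_cst.
rewrite /opA derD; last 2 first.
- by apply: AnM; [exact: AnZ|exact: AnB].
- by apply: AnM; [exact: AnZ|exact: AnB].
rewrite !derM //; try by [exact: AnZ|exact: AnB|exact: An_cst].
rewrite !derB ?der_cst ?subr0 //; try exact: An_cst.
rewrite (der_kap _ (An_sub_coord t i j)) // (der_kap _ (An_add_coord t i j)) //.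
rewrite derB ?derD ?der_coord; try exact: An_coord.
rewrite der_s // der_sg //; ring.
Qed.

Lemma der_opB (i m : 'I_r) F t : good F -> regular t ->
  der m (opB i F) t =
   (2 * iota * (2 * kap (2 * tnth t i) * (1 - kap (2 * tnth t i)) * (2 * (i == m)%:R))
    + 2 * b * (2 * kap (tnth t i) * (1 - kap (tnth t i)) * (i == m)%:R)) * (F t - F (sigma_i i t))
   + (2 * iota * kap (2 * tnth t i) + 2 * b * kap (tnth t i))
     * (der m F t - (if m == i then -1 else 1) * der m F (sigma_i i t)).
Proof.
move=> gF rt; have AF := gF t rt; have As := good_ng i gF rt.
have AK1 := good_kap1 i rt; have AK2 := good_kap2 i rt.
have n1 := rt.1 i.
have n2 : 2 * tnth t i != 0 by rewrite mulf_neq0 ?pnatr_eq0.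
rewrite /opB derM; last 2 first.
- by apply: AnD; exact: AnZ.
- exact: AnB.
rewrite derB // derD; try exact: AnZ.
rewrite !(derZ _ (2 * _)) //.
rewrite (der_kap _ (An_dbl_coord t i)) // (der_kap _ (An_coord t i)) //.
rewrite derZ ?der_coord; try exact: An_coord.
rewrite der_ng //; ring.
Qed.

Lemma der_opN (i j m : 'I_r) F t : i != j -> good F -> regular t ->
  der m (opN i j F) t =
  der m (der i F) t + der m (opA i j F) t + der m (opB i F) t - rho_j a b iota i * der m F t.
Proof.
move=> ij gF rt; have AF := gF t rt; have A1 := good_opA ij gF rt.
have A2 := good_opB i gF rt; have A3 := good_der i gF rt.
rewrite /opN derB; last 2 first.
- by apply: AnD => //; exact: AnD.
- exact: AnZ.
by rewrite derD ?derZ //; [rewrite derD|exact: AnD].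
Qed.

End CherednikOperators.

(** * Exponential coordinates and points with exposed entries *)

Section PointCoordinates.
Context {R : realType} {r : nat}.

Lemma kap_sub (x y : R) : x - y != 0 -> kap (x - y) = expR (2 * x) / (expR (2 * x) - expR (2 * y)).
Proof.
move=> /exp_neq1; rewrite /kap.
have -> : expR (-2 * (x - y)) = expR (2 * y) / expR (2 * x).
  by rewrite -expRN -expRD; congr expR; ring.
have X0 := expR_gt0 (2 * x).
rewrite -[X in X - _](divff (lt0r_neq0 X0)) -mulrBl mulf_eq0 negb_or => /andP[n _].
by rewrite invf_div.
Qed.

Lemma kap_add (x y : R) : x + y != 0 ->
  kap (x + y) = expR (2 * x) * expR (2 * y) / (expR (2 * x) * expR (2 * y) - 1).
Proof.
move=> n; rewrite -[y]opprK kap_sub ?opprK // mulrN expRN.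
have Y0 := expR_gt0 (2 * y); have : expR (2 * x) - (expR (2 * y))^-1 != 0.
  by rewrite -expRN subr_eq0 (inj_eq (@expR_inj R)) -subr_eq0 -mulrN -mulrBr opprK mulf_neq0 ?pnatr_eq0.
move: Y0; set X := expR (2 * x); set Y := expR _ => Y0 h.
have h' : X * Y - 1 != 0.
  by apply: contra_neq h => E; apply: (mulIf (lt0r_neq0 Y0)); rewrite mulrBl mulVf ?lt0r_neq0 // mul0r.
by field; rewrite h' (lt0r_neq0 Y0).
Qed.

Lemma kap_one (x : R) : x != 0 -> kap x = expR (2 * x) / (expR (2 * x) - 1).
Proof. by move=> n; rewrite -[x in LHS]subr0 kap_sub ?subr0 // mulr0 expR0. Qed.

Lemma kap_two (x : R) : x != 0 ->
  kap (2 * x) = expR (2 * x) * expR (2 * x) / (expR (2 * x) * expR (2 * x) - 1).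
Proof.
move=> n; have -> : kap (2 * x) = kap (x + x) by congr kap; ring.
by rewrite kap_add // -mulr2n mulrn_eq0.
Qed.

(** With two or three entries exposed, reflections become substitutions in the arguments, and an
    operator identity becomes an identity in a few real variables. *)
Definition pt2 (t : r.-tuple R) i j x y := upd (upd t i x) j y.
Definition pt3 (t : r.-tuple R) i j l x y z := upd (upd (upd t i x) j y) l z.

Ltac tupcase := apply: eq_from_tnth => k; rewrite !tnth_mktuple;
  repeat (case: eqP => [?|?]; subst => //=); try congruence.

Lemma pt2_id t i j : pt2 t i j (tnth t i) (tnth t j) = t.
Proof. by tupcase. Qed.
Lemma pt3_id t i j l : pt3 t i j l (tnth t i) (tnth t j) (tnth t l) = t.
Proof. by tupcase. Qed.

End PointCoordinates.

(** * Values of [kap] at reflected roots *)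

Section KapIdentities.
Context {R : realType}.
Implicit Types x y : R.

Lemma kap_NB x y : x + y != 0 -> kap (- x - y) = 1 - kap (x + y).
Proof. by move=> n; have -> : - x - y = - (x + y); [ring|exact: kapN]. Qed.
Lemma kap_NB' x y : x + y != 0 -> kap (- y - x) = 1 - kap (x + y).
Proof. by move=> n; have -> : - y - x = - (x + y); [ring|exact: kapN]. Qed.
Lemma kap_ND x y : x - y != 0 -> kap (- x + y) = 1 - kap (x - y).
Proof. by move=> n; have -> : - x + y = - (x - y); [ring|exact: kapN]. Qed.
Lemma kap_Bsym x y : x - y != 0 -> kap (y - x) = 1 - kap (x - y).
Proof. by move=> n; have -> : y - x = - (x - y); [ring|exact: kapN]. Qed.

Lemma exp_sub_neq0 x y : x - y != 0 -> expR (2 * x) - expR (2 * y) != 0.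
Proof.
by move=> n; rewrite subr_eq0 (inj_eq (@expR_inj R)) -subr_eq0 -mulrBr mulf_neq0 ?pnatr_eq0.
Qed.
Lemma exp_add_neq0 x y : x + y != 0 -> expR (2 * x) * expR (2 * y) - 1 != 0.
Proof.
move=> n; rewrite -expRD -[1]expR0 subr_eq0 (inj_eq (@expR_inj R)) -mulrDr.
by rewrite mulf_neq0 ?pnatr_eq0.
Qed.

End KapIdentities.

(** * Commutation in two indices *)

Section RankTwo.
Context {R : realType} {r : nat}.
Variables (a b iota : R) (t : r.-tuple R) (i j : 'I_r).
Hypothesis ij : i != j.
Local Notation P := (pt2 t i j).
Implicit Types (F G : r.-tuple R -> R) (x y : R).

Local Ltac tupcase := move: ij => /eqP ?; apply: eq_from_tnth => k; rewrite !tnth_mktuple;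
  repeat (case: eqP => [?|?]; subst => //=); try congruence.

Lemma tnth_P1 x y : tnth (P x y) i = x.
Proof. by rewrite !tnth_mktuple (negPf ij) eqxx. Qed.
Lemma tnth_P2 x y : tnth (P x y) j = y.
Proof. by rewrite !tnth_mktuple eqxx. Qed.
Lemma s_P1 x y : s_ij i j (P x y) = P y x. Proof. tupcase. Qed.
Lemma s_P2 x y : s_ij j i (P x y) = P y x. Proof. tupcase. Qed.
Lemma sg_P1 x y : sigma_ij i j (P x y) = P (- y) (- x). Proof. tupcase. Qed.
Lemma sg_P2 x y : sigma_ij j i (P x y) = P (- y) (- x). Proof. tupcase. Qed.
Lemma ng_P1 x y : sigma_i i (P x y) = P (- x) y. Proof. tupcase. Qed.
Lemma ng_P2 x y : sigma_i j (P x y) = P x (- y). Proof. tupcase. Qed.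

Lemma opA_P1 G x y : opA a i j G (P x y) =
  a * (kap (x - y) - (j < i)%:R) * (G (P x y) - G (P y x))
  + a * kap (x + y) * (G (P x y) - G (P (- y) (- x))).
Proof. by rewrite /opA tnth_P1 tnth_P2 s_P1 sg_P1. Qed.
Lemma opA_P2 G x y : opA a j i G (P x y) =
  a * (kap (y - x) - (i < j)%:R) * (G (P x y) - G (P y x))
  + a * kap (y + x) * (G (P x y) - G (P (- y) (- x))).
Proof. by rewrite /opA tnth_P1 tnth_P2 s_P2 sg_P2. Qed.
Lemma opB_P1 G x y : opB b iota i G (P x y) =
  (2 * iota * kap (2 * x) + 2 * b * kap x) * (G (P x y) - G (P (- x) y)).
Proof. by rewrite /opB tnth_P1 ng_P1. Qed.
Lemma opB_P2 G x y : opB b iota j G (P x y) =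
  (2 * iota * kap (2 * y) + 2 * b * kap y) * (G (P x y) - G (P x (- y))).
Proof. by rewrite /opB tnth_P2 ng_P2. Qed.
Lemma opN_P1 G x y : opN a b iota i j G (P x y) =
  der i G (P x y) + opA a i j G (P x y) + opB b iota i G (P x y)
  - rho_j a b iota i * G (P x y).
Proof. by []. Qed.
Lemma opN_P2 G x y : opN a b iota j i G (P x y) =
  der j G (P x y) + opA a j i G (P x y) + opB b iota j G (P x y)
  - rho_j a b iota j * G (P x y).
Proof. by []. Qed.

(** In [u = e^(2x)] and [v = e^(2y)] all coefficients are rational. The values of [F] and of its
    derivatives on the orbit are treated as independent unknowns; beyond the symmetry of the mixed
    derivative nothing about them is used. The two constants [rho] are generalised as well, since
    scalars commute with everything. *)
Lemma rank2_comm F x y : good F -> regular (P x y) ->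
  opN a b iota i j (opN a b iota j i F) (P x y) = opN a b iota j i (opN a b iota i j F) (P x y).
Proof.
move=> gF rP; have ji : j != i by rewrite eq_sym.
have Cm : der i (der j F) (P x y) = der j (der i F) (P x y).
  by apply: An_der_comm; exact: gF.
have x0 : x != 0 by have := rP.1 i; rewrite tnth_P1.
have y0 : y != 0 by have := rP.1 j; rewrite tnth_P2.
have sxy : x - y != 0 by have := reg_sub_neq0 rP ij; rewrite tnth_P1 tnth_P2.
have axy : x + y != 0 by have := reg_add_neq0 rP ij; rewrite tnth_P1 tnth_P2.
have xx0 : 2 * x != 0 by rewrite mulf_neq0 ?pnatr_eq0.
have yy0 : 2 * y != 0 by rewrite mulf_neq0 ?pnatr_eq0.
rewrite opN_P1 [RHS]opN_P2.
rewrite (der_opN _ _ _ _ ji gF rP) (der_opN _ _ _ _ ij gF rP).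
rewrite !(der_opA _ _ ji gF rP) !(der_opA _ _ ij gF rP) !(der_opB _ _ _ _ gF rP).
rewrite !opA_P1 !opA_P2 !opB_P1 !opB_P2 !opN_P1 !opN_P2.
rewrite !opA_P1 !opA_P2 !opB_P1 !opB_P2 Cm.
rewrite !tnth_P1 !tnth_P2 !s_P1 !s_P2 !sg_P1 !sg_P2 !ng_P1 !ng_P2.
rewrite /swp !eqxx ?(negPf ij) ?(negPf ji) /= ?eqxx !opprK.
have K1 := kap_NB axy; have K2 := kap_NB' axy.
have K3 := kap_ND sxy; have K4 := kap_Bsym sxy.
have K5 : kap (- y + x) = kap (x - y) by congr kap; exact: addrC.
have K6 : kap (y + x) = kap (x + y) by congr kap; exact: addrC.
have K7 : kap (2 * - x) = 1 - kap (2 * x) by rewrite mulrN; exact: kapN.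
have K8 : kap (2 * - y) = 1 - kap (2 * y) by rewrite mulrN; exact: kapN.
have K9 := kapN x0; have K0 := kapN y0.
rewrite ?(K1, K2, K3, K4, K5, K6, K7, K8, K9, K0).
rewrite (kap_sub sxy) (kap_add axy) (kap_one x0) (kap_one y0) (kap_two x0) (kap_two y0).
have n1 := exp_sub_neq0 sxy; have n2 := exp_add_neq0 axy.
have n3 (z : R) : z != 0 -> expR (2 * z) - 1 != 0.
  by move=> z0; rewrite -[1]expR0 subr_eq0 (inj_eq (@expR_inj R)) mulf_neq0 ?pnatr_eq0.
have n4 (z : R) : z != 0 -> expR (2 * z) * expR (2 * z) - 1 != 0.
  by move=> z0; apply: exp_add_neq0; rewrite -mulr2n mulrn_eq0.
have n3x := n3 x x0; have n3y := n3 y y0; have n4x := n4 x x0; have n4y := n4 y y0.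
move: (expR (2 * x)) (expR (2 * y)) n1 n2 n3x n3y n4x n4y => u v n1 n2 n3x n3y n4x n4y.
repeat match goal with |- context [der ?k ?G ?z] => move: (der k G z) => ? end.
repeat match goal with |- context [F ?z] => move: (F z) => ? end.
move: (rho_j _ _ _ i) (rho_j _ _ _ j) => ri rj.
case: (ltngtP i j) => [lt|lt|/val_inj E]; last by move/eqP: E; rewrite (negPf ij).
all: by rewrite /=; field; rewrite ?n1 ?n2 ?n3x ?n3y ?n4x ?n4y.
Qed.

End RankTwo.

(** The six orders of three distinct indices, through the four truth values that occur in the
    coefficients of [opA]. *)
Lemma order_cases (i j l : nat) : i <> j -> i <> l -> j <> l ->
  [\/ [/\ (j < i)%N = false, (i < j)%N = true, (l < i)%N = false & (l < j)%N = false],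
   [/\ (j < i)%N = false, (i < j)%N = true, (l < i)%N = false & (l < j)%N = true],
   [/\ (j < i)%N = false, (i < j)%N = true, (l < i)%N = true & (l < j)%N = true] |
   [\/ [/\ (j < i)%N = true, (i < j)%N = false, (l < i)%N = false & (l < j)%N = false],
   [/\ (j < i)%N = true, (i < j)%N = false, (l < i)%N = true & (l < j)%N = false] |
   [/\ (j < i)%N = true, (i < j)%N = false, (l < i)%N = true & (l < j)%N = true] ] ].
Proof.
move=> h1 h2 h3; case: (ltngtP i j) => c1; last by [].
all: case: (ltnP l i) => c2; case: (ltnP l j) => c3; try by (exfalso; lia).
- by apply: Or43.
- by apply: Or42.
- by apply: Or41.
- by apply: Or44; apply: Or33.
- by apply: Or44; apply: Or32.
- by apply: Or44; apply: Or31.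
Qed.

(** * The three-index identity *)

Section RankThree.
Context {R : realType} {r : nat}.
Variables (a b iota : R) (t : r.-tuple R) (i j l : 'I_r).
Hypotheses (ij : i != j) (il : i != l) (jl : j != l).
Local Notation Q := (pt3 t i j l).
Implicit Types (F G : r.-tuple R -> R) (x y z : R).

Local Ltac tupcase := move: ij il jl => /eqP ? /eqP ? /eqP ?;
  apply: eq_from_tnth => k; rewrite !tnth_mktuple;
  repeat (case: eqP => [?|?]; subst => //=); try congruence.

Lemma tnth_Q1 x y z : tnth (Q x y z) i = x.
Proof. by rewrite !tnth_mktuple (negPf ij) (negPf il) eqxx. Qed.
Lemma tnth_Q2 x y z : tnth (Q x y z) j = y.
Proof. by rewrite !tnth_mktuple (negPf jl) eqxx. Qed.
Lemma tnth_Q3 x y z : tnth (Q x y z) l = z.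
Proof. by rewrite !tnth_mktuple eqxx. Qed.
Lemma s_Q12 x y z : s_ij i j (Q x y z) = Q y x z. Proof. tupcase. Qed.
Lemma s_Q21 x y z : s_ij j i (Q x y z) = Q y x z. Proof. tupcase. Qed.
Lemma s_Q13 x y z : s_ij i l (Q x y z) = Q z y x. Proof. tupcase. Qed.
Lemma s_Q23 x y z : s_ij j l (Q x y z) = Q x z y. Proof. tupcase. Qed.
Lemma sg_Q12 x y z : sigma_ij i j (Q x y z) = Q (- y) (- x) z. Proof. tupcase. Qed.
Lemma sg_Q21 x y z : sigma_ij j i (Q x y z) = Q (- y) (- x) z. Proof. tupcase. Qed.
Lemma sg_Q13 x y z : sigma_ij i l (Q x y z) = Q (- z) y (- x). Proof. tupcase. Qed.
Lemma sg_Q23 x y z : sigma_ij j l (Q x y z) = Q x (- z) (- y). Proof. tupcase. Qed.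
Lemma ng_Q1 x y z : sigma_i i (Q x y z) = Q (- x) y z. Proof. tupcase. Qed.

Lemma opA_Q12 G x y z : opA a i j G (Q x y z) =
  a * (kap (x - y) - (j < i)%:R) * (G (Q x y z) - G (Q y x z))
  + a * kap (x + y) * (G (Q x y z) - G (Q (- y) (- x) z)).
Proof. by rewrite /opA tnth_Q1 tnth_Q2 s_Q12 sg_Q12. Qed.
Lemma opA_Q21 G x y z : opA a j i G (Q x y z) =
  a * (kap (y - x) - (i < j)%:R) * (G (Q x y z) - G (Q y x z))
  + a * kap (y + x) * (G (Q x y z) - G (Q (- y) (- x) z)).
Proof. by rewrite /opA tnth_Q1 tnth_Q2 s_Q21 sg_Q21. Qed.
Lemma opA_Q13 G x y z : opA a i l G (Q x y z) =
  a * (kap (x - z) - (l < i)%:R) * (G (Q x y z) - G (Q z y x))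
  + a * kap (x + z) * (G (Q x y z) - G (Q (- z) y (- x))).
Proof. by rewrite /opA tnth_Q1 tnth_Q3 s_Q13 sg_Q13. Qed.
Lemma opA_Q23 G x y z : opA a j l G (Q x y z) =
  a * (kap (y - z) - (l < j)%:R) * (G (Q x y z) - G (Q x z y))
  + a * kap (y + z) * (G (Q x y z) - G (Q x (- z) (- y))).
Proof. by rewrite /opA tnth_Q2 tnth_Q3 s_Q23 sg_Q23. Qed.
Lemma opB_Q1 G x y z : opB b iota i G (Q x y z) =
  (2 * iota * kap (2 * x) + 2 * b * kap x) * (G (Q x y z) - G (Q (- x) y z)).
Proof. by rewrite /opB tnth_Q1 ng_Q1. Qed.

Lemma opB_opA_comm F x y z :
  opB b iota i (opA a j l F) (Q x y z) = opA a j l (opB b iota i F) (Q x y z).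
Proof. by rewrite !opA_Q23 !opB_Q1 !opA_Q23; ring. Qed.

Lemma der_opA_comm F x y z : good F -> regular (Q x y z) ->
  der i (opA a j l F) (Q x y z) = opA a j l (der i F) (Q x y z).
Proof.
move=> gF rQ; rewrite der_opA // /opA /swp [j == i]eq_sym (negPf ij) [l == i]eq_sym (negPf il).
by rewrite /=; ring.
Qed.

(** A relation of Yang-Baxter type. The three commutators are exactly what a third index [l]
    contributes to the commutator of [D_i] and [D_j]. Again a rational identity, now in three
    exponentials and once for each order of the indices. *)
Lemma rank3_comm F x y z : regular (Q x y z) ->
  opA a i j (opA a j l F) (Q x y z) - opA a j l (opA a i j F) (Q x y z)
  + (opA a i l (opA a j i F) (Q x y z) - opA a j i (opA a i l F) (Q x y z))
  + (opA a i l (opA a j l F) (Q x y z) - opA a j l (opA a i l F) (Q x y z)) = 0.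
Proof.
move=> rQ.
have sxy : x - y != 0 by have := reg_sub_neq0 rQ ij; rewrite tnth_Q1 tnth_Q2.
have axy : x + y != 0 by have := reg_add_neq0 rQ ij; rewrite tnth_Q1 tnth_Q2.
have sxz : x - z != 0 by have := reg_sub_neq0 rQ il; rewrite tnth_Q1 tnth_Q3.
have axz : x + z != 0 by have := reg_add_neq0 rQ il; rewrite tnth_Q1 tnth_Q3.
have syz : y - z != 0 by have := reg_sub_neq0 rQ jl; rewrite tnth_Q2 tnth_Q3.
have ayz : y + z != 0 by have := reg_add_neq0 rQ jl; rewrite tnth_Q2 tnth_Q3.
rewrite !opA_Q12 !opA_Q21 !opA_Q13 !opA_Q23 !opA_Q12 !opA_Q21 !opA_Q13 !opprK.
have K5 (u v : R) : kap (- v + u) = kap (u - v) by congr kap; exact: addrC.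
have K6 (u v : R) : kap (v + u) = kap (u + v) by congr kap; exact: addrC.
rewrite ?(kap_NB axy, kap_NB axz, kap_NB ayz, kap_NB' axy, kap_NB' axz, kap_NB' ayz).
rewrite ?(kap_ND sxy, kap_ND sxz, kap_ND syz, K5 x y, K5 x z, K5 y z).
rewrite ?(kap_Bsym sxy, kap_Bsym sxz, kap_Bsym syz, K6 x y, K6 x z, K6 y z).
rewrite (kap_sub sxy) (kap_add axy) (kap_sub sxz) (kap_add axz) (kap_sub syz) (kap_add ayz).
have n1xy := exp_sub_neq0 sxy; have n1xz := exp_sub_neq0 sxz; have n1yz := exp_sub_neq0 syz.
have n2xy := exp_add_neq0 axy; have n2xz := exp_add_neq0 axz; have n2yz := exp_add_neq0 ayz.
move: (expR (2 * x)) (expR (2 * y)) (expR (2 * z)) n1xy n1xz n1yz n2xy n2xz n2yz => u v w n1xy n1xz n1yz n2xy n2xz n2yz.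
repeat match goal with |- context [F ?p] => move: (F p) => ? end.
have tr := order_cases (i := i) (j := j) (l := l).
have {}tr := tr (fun E => negP ij (introT eqP (val_inj E))) (fun E => negP il (introT eqP (val_inj E)))
  (fun E => negP jl (introT eqP (val_inj E))).
case: tr => [||| []] [-> -> -> ->] /=; field; by rewrite ?n1xy ?n1xz ?n1yz ?n2xy ?n2xz ?n2yz.
Qed.

End RankThree.

(** * Commutation in any rank, and the module on which the operators act *)

Section FullCommutation.
Context {R : realType} {r : nat}.
Variables (a b iota : R).
Local Notation pt := (r.-tuple R).
Implicit Types (t : pt) (F G : pt -> R).
Local Notation opA := (opA a).
Local Notation opN := (opN a b iota).
Local Notation Dch := (Dch a b iota).

Lemma opA_add (i j : 'I_r) F G t :
  opA i j (fun y => F y + G y) t = opA i j F t + opA i j G t.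
Proof. by rewrite /opA; ring. Qed.

Lemma opA_sum (I : Type) (s : seq I) (P : pred I) (i j : 'I_r) (F : I -> pt -> R) t :
  opA i j (fun y => \sum_(l <- s | P l) F l y) t = \sum_(l <- s | P l) opA i j (F l) t.
Proof.
rewrite /opA -!sumrB !mulr_sumr -big_split /=; apply: eq_bigr => l _ //.
Qed.

Lemma opN_add (i j : 'I_r) F G t : An t F -> An t G ->
  opN i j (fun y => F y + G y) t = opN i j F t + opN i j G t.
Proof. by move=> AF AG; rewrite /opN opA_add derD // /opB; ring. Qed.

Lemma opN_sum (I : Type) (s : seq I) (P : pred I) (i j : 'I_r) (F : I -> pt -> R) t :
  (forall l, P l -> An t (F l)) ->
  opN i j (fun y => \sum_(l <- s | P l) F l y) t = \sum_(l <- s | P l) opN i j (F l) t.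
Proof.
move=> H; rewrite /opN opA_sum der_sum // /opB -sumrB !mulr_sumr -!big_split /= -sumrB.
by apply: eq_bigr => l _.
Qed.

Lemma DchE (i j : 'I_r) F t : i != j ->
  Dch i F t = opN i j F t + \sum_(l | (l != i) && (l != j)) opA i l F t.
Proof.
move=> ij; rewrite /Dch (bigD1 j) 1?eq_sym //= /opN; ring.
Qed.

Lemma disjoint_opA_comm (i j k l : 'I_r) F t :
  i != j -> i != l -> k != j -> k != l ->
  opA i k (opA j l F) t = opA j l (opA i k F) t.
Proof.
move=> ij il kj kl.
have T1 (y : pt) m : m != i -> m != k -> tnth (s_ij i k y) m = tnth y m.
  by move=> mi mk; rewrite tnth_mktuple (negPf mi) (negPf mk).
have T2 (y : pt) m : m != i -> m != k -> tnth (sigma_ij i k y) m = tnth y m.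
  by move=> mi mk; rewrite tnth_mktuple (negPf mi) (negPf mk).
have T3 (y : pt) m : m != j -> m != l -> tnth (s_ij j l y) m = tnth y m.
  by move=> mi mk; rewrite tnth_mktuple (negPf mi) (negPf mk).
have T4 (y : pt) m : m != j -> m != l -> tnth (sigma_ij j l y) m = tnth y m.
  by move=> mi mk; rewrite tnth_mktuple (negPf mi) (negPf mk).
have ji : j != i by rewrite eq_sym. have li : l != i by rewrite eq_sym.
have jk : j != k by rewrite eq_sym. have lk : l != k by rewrite eq_sym.
have C1 : s_ij j l (s_ij i k t) = s_ij i k (s_ij j l t).
  apply: eq_from_tnth => m; rewrite !tnth_mktuple (negPf ji) (negPf jk) (negPf li) (negPf lk).
  rewrite (negPf ij) (negPf il) (negPf kj) (negPf kl).
  by repeat case: eqP => ?; subst => //; rewrite ?eqxx in ij il kj kl.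
have C2 : sigma_ij j l (s_ij i k t) = s_ij i k (sigma_ij j l t).
  apply: eq_from_tnth => m; rewrite !tnth_mktuple (negPf ji) (negPf jk) (negPf li) (negPf lk).
  rewrite (negPf ij) (negPf il) (negPf kj) (negPf kl).
  by repeat case: eqP => ?; subst => //; rewrite ?eqxx in ij il kj kl.
have C3 : s_ij j l (sigma_ij i k t) = sigma_ij i k (s_ij j l t).
  apply: eq_from_tnth => m; rewrite !tnth_mktuple (negPf ji) (negPf jk) (negPf li) (negPf lk).
  rewrite (negPf ij) (negPf il) (negPf kj) (negPf kl).
  by repeat case: eqP => ?; subst => //; rewrite ?eqxx in ij il kj kl.
have C4 : sigma_ij j l (sigma_ij i k t) = sigma_ij i k (sigma_ij j l t).
  apply: eq_from_tnth => m; rewrite !tnth_mktuple (negPf ji) (negPf jk) (negPf li) (negPf lk).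
  rewrite (negPf ij) (negPf il) (negPf kj) (negPf kl).
  by repeat case: eqP => ?; subst => //; rewrite ?eqxx in ij il kj kl.
by rewrite /opA !T1 // !T2 // !T3 // !T4 // C1 C2 C3 C4; ring.
Qed.

(** The derivative, the sign change and the constant at [i] do not see the pair [(j, l)]; only the
    two pair operators fail to commute. *)
Lemma opN_opA_comm (i j l : 'I_r) F t : i != j -> i != l -> j != l -> good F -> regular t ->
  opN i j (opA j l F) t - opA j l (opN i j F) t =
  opA i j (opA j l F) t - opA j l (opA i j F) t.
Proof.
move=> ij il jl gF rt.
have rQ : regular (pt3 t i j l (tnth t i) (tnth t j) (tnth t l)) by rewrite pt3_id.
have := der_opA_comm a ij il jl gF rQ.
have := opB_opA_comm a b iota t ij il jl F (tnth t i) (tnth t j) (tnth t l).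
rewrite pt3_id /opN => E1 E2.
have -> : opA j l (fun y => der i F y + opA i j F y + opB b iota i F y - rho_j a b iota i * F y) t =
  opA j l (der i F) t + opA j l (opA i j F) t + opA j l (opB b iota i F) t - rho_j a b iota i * opA j l F t.
  by rewrite /opA; ring.
by rewrite E1 E2; ring.
Qed.

Lemma Dch2E (i j : 'I_r) F t : i != j -> good F -> regular t ->
  Dch i (Dch j F) t = opN i j (opN j i F) t
    + \sum_(l | (l != i) && (l != j)) opN i j (opA j l F) t
    + (\sum_(k | (k != i) && (k != j)) opA i k (opN j i F) t
       + \sum_(k | (k != i) && (k != j)) \sum_(l | (l != i) && (l != j)) opA i k (opA j l F) t).
Proof.
move=> ij gF rt; have ji : j != i by rewrite eq_sym.
pose G y := \sum_(l | (l != i) && (l != j)) opA j l F y.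
have E2 : Dch j F = fun y => opN j i F y + G y.
  by apply/funext => y; rewrite (DchE _ _ ji); congr (_ + _); apply: eq_bigl => l; rewrite andbC.
have g1 : An t (opN j i F) by exact: good_opN.
have g3 l : (l != i) && (l != j) -> An t (opA j l F).
  by case/andP=> _ lj; apply: good_opA; rewrite 1?eq_sym.
have gG : An t G by exact: An_sum.
rewrite (DchE _ _ ij) E2 (@opN_add i j (opN j i F) G t g1 gG); congr (_ + _ + _).
  exact: opN_sum.
rewrite -big_split /=; apply: eq_bigr => k _.
by rewrite (@opA_add i k (opN j i F) G t) /G opA_sum.
Qed.

(** The terms are sorted by the indices they involve: only [i] and [j] ([rank2_comm]), one further
    index ([rank3_comm]), or two different further indices, where the reflections act on disjoint
    pairs and commute. *)
Lemma Dch_comm (i j : 'I_r) F t : good F -> regular t ->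
  Dch i (Dch j F) t = Dch j (Dch i F) t.
Proof.
move=> gF rt; have [->//|ij] := eqVneq i j; have ji : j != i by rewrite eq_sym.
rewrite (Dch2E ij gF rt) (Dch2E ji gF rt).
pose P l := (l != i) && (l != j).
have Pc : (fun l => (l != j) && (l != i)) =1 P by move=> l; rewrite /P andbC.
rewrite !(eq_bigl _ _ Pc) (eq_bigr _ (fun k _ => eq_bigl _ _ Pc)) -!/(P _).
have -> : opN i j (opN j i F) t = opN j i (opN i j F) t.
  have rP : regular (pt2 t i j (tnth t i) (tnth t j)) by rewrite pt2_id.
  by have := rank2_comm a b iota ij gF rP; rewrite pt2_id.
have D3 l : P l -> opN i j (opA j l F) t - opA j l (opN i j F) t
    + (opA i l (opN j i F) t - opN j i (opA i l F) t)
    + (opA i l (opA j l F) t - opA j l (opA i l F) t) = 0.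
  move=> /andP[li lj]; have il : i != l by rewrite eq_sym.
  have jl : j != l by rewrite eq_sym.
  rewrite (opN_opA_comm ij il jl gF rt).
  rewrite -[X in _ + X + _]opprB (opN_opA_comm ji jl il gF rt) opprB.
  have rQ : regular (pt3 t i j l (tnth t i) (tnth t j) (tnth t l)) by rewrite pt3_id.
  by have := rank3_comm a ij il jl F rQ; rewrite pt3_id.
have D4 : \sum_(k | P k) \sum_(l | P l) opA i k (opA j l F) t
   - \sum_(k | P k) \sum_(l | P l) opA j k (opA i l F) t =
   \sum_(l | P l) (opA i l (opA j l F) t - opA j l (opA i l F) t).
  rewrite [X in _ - X]exchange_big /= -sumrB; apply: eq_bigr => k Pk.
  rewrite -sumrB (bigD1 k) //= big1 ?addr0 // => l /andP[Pl lk].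
  move: Pk Pl => /andP[ki kj] /andP[li lj].
  by rewrite disjoint_opA_comm ?subrr // 1?eq_sym.
apply/eqP; rewrite -subr_eq0; apply/eqP.
transitivity (\sum_(l | P l) (opN i j (opA j l F) t - opA j l (opN i j F) t
    + (opA i l (opN j i F) t - opN j i (opA i l F) t)
    + (opA i l (opA j l F) t - opA j l (opA i l F) t))); last exact: big1.
have S6 (f1 f2 f3 f4 f5 : 'I_r -> R) : \sum_(l | P l) (f1 l - f2 l + (f3 l - f4 l) + f5 l) =
  \sum_(l | P l) f1 l - \sum_(l | P l) f2 l + (\sum_(l | P l) f3 l - \sum_(l | P l) f4 l)
  + \sum_(l | P l) f5 l by rewrite -!sumrB -!big_split.
by rewrite (S6 (fun l => opN i j (opA j l F) t) (fun l => opA j l (opN i j F) t)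
  (fun l => opA i l (opN j i F) t) (fun l => opN j i (opA i l F) t)
  (fun l => opA i l (opA j l F) t - opA j l (opA i l F) t)) -D4 /P; ring.
Qed.

Lemma Dch_eq_reg i F G t : (forall y, regular y -> F y = G y) -> regular t ->
  Dch i F t = Dch i G t.
Proof.
move=> E rt; rewrite /Dch /opA /opB E //.
rewrite (der_near i (nearp_sub E (regular_near rt))) E; last exact: reg_ng.
congr (_ + _ + _ - _); apply: eq_bigr => k _.
by rewrite !E //; [exact: reg_sg|exact: reg_s].
Qed.

(** Extension by zero to the walls makes two functions equal as soon as they agree at regular
    points. The [D_j] thereby become commuting linear endomorphisms of a module, to which the
    abstract algebra below applies. *)
Definition goodz : {pred (pt -> R)} :=
  fun F => `[< good F /\ forall t, ~ regular t -> F t = 0 >].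

Lemma goodzP F : reflect (good F /\ forall t, ~ regular t -> F t = 0) (F \in goodz).
Proof. by apply: (iffP idP) => [/asboolP|H]; last exact/asboolP. Qed.

Lemma goodz_submod : submod_closed goodz.
Proof.
split=> [|c F G /goodzP[gF zF] /goodzP[gG zG]]; apply/goodzP.
  by split=> // t _; exact: An_cst.
split=> [|t nt]; first by apply: goodD => //; exact: goodZ.
by rewrite fctE /= zG // addr0 /GRing.scale /= zF // /GRing.scale /= mulr0.
Qed.

HB.instance Definition _ := GRing.isSubmodClosed.Build R (pt -> R) goodz goodz_submod.

Record gfun := Gfun { gval :> pt -> R; gvalP : gval \in goodz }.
HB.instance Definition _ := [isSub for gval].
HB.instance Definition _ := [Choice of gfun by <:].
HB.instance Definition _ := [SubChoice_isSubLmodule of gfun by <:].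

Lemma gfun_good (F : gfun) : good F.
Proof. by have /goodzP[] := gvalP F. Qed.

Lemma gfun_eq (F G : gfun) : (forall t, regular t -> F t = G t) -> F = G.
Proof.
move=> E; apply/val_inj/funext => t /=; have [rt|nt] := pselect (regular t); first exact: E.
by have /goodzP[_ z1] := gvalP F; have /goodzP[_ z2] := gvalP G; rewrite z1 ?z2.
Qed.

Definition cut F : pt -> R := fun t => if `[< regular t >] then F t else 0.

Lemma cutE F t : regular t -> cut F t = F t.
Proof. by move=> rt; rewrite /cut; case: asboolP. Qed.

Lemma cutP F : good F -> cut F \in goodz.
Proof.
move=> gF; apply/goodzP; split=> [|t nt]; last by rewrite /cut; case: asboolP.
by apply: good_ext gF => t rt; rewrite cutE.
Qed.

Definition gcut F (gF : good F) : gfun := Gfun (cutP gF).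

Definition DV (i : 'I_r) (F : gfun) : gfun := gcut (good_Dch a b iota i (gfun_good F)).

Lemma DVE i (F : gfun) t : regular t -> DV i F t = Dch i F t.
Proof. exact: cutE. Qed.

Lemma DV_linear i : linear (DV i).
Proof.
move=> c F G; apply: gfun_eq => t rt.
have -> : (c *: DV i F + DV i G : gfun) t = c * DV i F t + DV i G t by [].
pose H : gfun := c *: F + G.
have E y : H y = c * F y + G y by [].
have EA j : opA i j H t = c * opA i j F t + opA i j G t.
  by rewrite /opA (E t) (E (s_ij i j t)) (E (sigma_ij i j t)); ring.
rewrite -[c *: F + G]/H !DVE // /Dch.
have -> : der i H t = c * der i F t + der i G t.
  have gF := gfun_good F rt; have gG := gfun_good G rt.
  by rewrite -derZ // -derD //; exact: AnZ.
rewrite !E /opB !E.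
have -> : \sum_(j | j != i) opA i j H t =
  c * \sum_(j | j != i) opA i j F t + \sum_(j | j != i) opA i j G t.
  by rewrite mulr_sumr -big_split /=; apply: eq_bigr => j _; exact: EA.
ring.
Qed.

HB.instance Definition _ i := GRing.isLinear.Build R gfun gfun _ (DV i) (DV_linear i).

Lemma DV_comm i j (F : gfun) : DV i (DV j F) = DV j (DV i F).
Proof.
apply: gfun_eq => t rt; rewrite !DVE //.
rewrite (@Dch_eq_reg _ _ (Dch j F)) //; last by move=> y ry; rewrite DVE.
rewrite Dch_comm //; last exact: gfun_good.
by apply: Dch_eq_reg => // y ry; rewrite DVE.
Qed.

End FullCommutation.

Lemma sum_pair (W : nmodType) (I J : finType) (F : I * J -> W) :
  \sum_p F p = \sum_i \sum_j F (i, j).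
Proof. by rewrite pair_bigA; apply: eq_bigr => -[]. Qed.

(** * A closed first-order system with small numerical range *)

Section ClosedSystem.
Context {R : rcfType} {r : nat}.
Variables (eps : R) (y : nat -> R).
Hypothesis eps0 : 0 < eps.

Definition qsq m := Num.sqrt (y m ^+ 2 + eps ^+ 2).
Definition kfac m := (eps ^+ 2)^-1 ^+ m.

Lemma qsq_ge m : eps <= qsq m.
Proof.
rewrite /qsq -[leLHS]gtr0_norm // -sqrtr_sqr ler_sqrt ?lerDr ?sqr_ge0 //.
by rewrite addr_ge0 ?sqr_ge0.
Qed.
Lemma qsq_gt0 m : 0 < qsq m. Proof. exact: lt_le_trans eps0 (qsq_ge m). Qed.
Lemma qsq2 m : qsq m ^+ 2 = y m ^+ 2 + eps ^+ 2.
Proof. by rewrite sqr_sqrtr // addr_ge0 ?sqr_ge0. Qed.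

Section OneVariable.
Variables (V : lmodType R).

Fixpoint Nop (T : V -> V) m (v : V) : V :=
  if m is m'.+1 then T (T (Nop T m' v)) + y m' ^+ 2 *: Nop T m' v else v.

(* The basis in which [T] has small numerical range. *)
Definition cop (T : V -> V) (p : 'I_r * bool) (v : V) : V :=
  kfac p.1 *: (if p.2 then T (Nop T p.1 v) else qsq p.1 *: Nop T p.1 v).

(** The matrix of [T] in the family [cop]. Between [(m, true)] and [(m, false)] it is nearly
    antisymmetric: [qsq m] against [- y m ^ 2 / qsq m]. The scaling by [kfac] reduces the coupling
    to [m + 1], which produces Jordan blocks when values of [y ^ 2] coincide, to [eps ^ 2 / qsq]. *)
Definition cmat (p n : 'I_r * bool) : R :=
  if p.2 then (if n.2 then 0 else
     (n.1 == p.1.+1 :> nat)%:R * (eps ^+ 2 / qsq n.1) - (n.1 == p.1)%:R * (y p.1 ^+ 2 / qsq p.1))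
  else (n == (p.1, true))%:R * qsq p.1.

Lemma sum_pairb (W : nmodType) (F : 'I_r * bool -> W) :
  \sum_p F p = \sum_m (F (m, true) + F (m, false)).
Proof.
by rewrite sum_pair; apply: eq_bigr => m _; rewrite big_bool.
Qed.

Lemma cop_mul (T : {linear V -> V}) p v : Nop T r v = 0 ->
  T (cop T p v) = \sum_n cmat p n *: cop T n v.
Proof.
move=> N0; case: p => m [] /=; last first.
  rewrite (bigD1 (m, true)) //= big1 ?addr0 => [|n /negPf nm]; last first.
    by rewrite /cmat /= nm mul0r scale0r.
  rewrite /cmat /cop /= eqxx mul1r linearZ_LR /= linearZ_LR /= !scalerA.
  by congr (_ *: _); exact: mulrC.
rewrite sum_pairb /cmat /cop /=.
under eq_bigr do rewrite scale0r add0r scalerBl !scalerA.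
rewrite big_split /= sumrN (bigD1 m (P := predT)) //=.
rewrite [X in _ - X](bigD1 m) //= eqxx mul1r [X in _ - (_ + X)]big1 ?addr0; last first.
  by move=> n /negPf nm; rewrite nm !mul0r scale0r.
have q0 := gt_eqF (qsq_gt0 m).
have TT : T (T (Nop T m v)) = Nop T m.+1 v - y m ^+ 2 *: Nop T m v by rewrite /= addrK.
rewrite linearZ_LR /= TT scalerBr scalerA; congr (_ - _); last first.
  by congr (_ *: _); field; rewrite q0.
have mE : (m == m.+1 :> nat) = false by lia.
rewrite mE !mul0r scale0r add0r.
have [lt|ge] := ltnP m.+1 r; last first.
  have -> : Nop T m.+1 v = 0 by have -> : m.+1 = r by have := ltn_ord m; lia.
  rewrite scaler0 big1 // => n nm.
  have -> : (n == m.+1 :> nat) = false by have := ltn_ord n; lia.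
  by rewrite !mul0r scale0r.
rewrite (bigD1 (Ordinal lt)) /=; last by rewrite -val_eqE /=; lia.
rewrite eqxx mul1r big1 ?addr0; last first.
  move=> n /andP[_ nm]; have -> : (n == m.+1 :> nat) = false.
    by apply: contraNF nm => /eqP E; apply/eqP/val_inj.
  by rewrite !mul0r scale0r.
congr (_ *: _); rewrite /kfac [_ ^+ m.+1]exprS; have := gt_eqF (qsq_gt0 m.+1) => q1.
by set K := _ ^+ m; field; rewrite q1 gt_eqF.
Qed.

End OneVariable.

Lemma sum_ind_le1 (I : finType) (P : pred I) : (forall i j, P i -> P j -> i = j) ->
  \sum_i (P i)%:R <= 1 :> R.
Proof.
move=> H; have [[i Pi]|N] := pselect (exists i, P i).
  rewrite (bigD1 i) //= Pi big1 ?addr0 // => j ji.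
  by case Pj: (P j) => //; rewrite (H _ _ Pj Pi) eqxx in ji.
by rewrite big1 // => i _; case Pi: (P i) => //; case: N; exists i.
Qed.

Lemma amgm2 (s u v : R) : `|s| <= eps -> `|u * s * v| <= eps / 2 * (u ^+ 2 + v ^+ 2).
Proof.
move=> se; rewrite mulrAC normrM.
have h : `|u * v| <= (u ^+ 2 + v ^+ 2) / 2.
  rewrite ler_norml; have := sqr_ge0 (u - v); have := sqr_ge0 (u + v).
  by rewrite sqrrD sqrrB => h1 h2; apply/andP; split; lra.
apply: le_trans (_ : (u ^+ 2 + v ^+ 2) / 2 * eps <= _); last lra.
by apply: ler_pM.
Qed.

(** The antisymmetric part drops out of the quadratic form. What is left has coefficients
    [eps ^ 2 / qsq m <= eps], and each variable enters at most two of the products, each costing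
    [eps / 2] times its square. *)
Lemma cmat_bound (v : 'I_r * bool -> R) :
  `|\sum_p \sum_n v p * cmat p n * v n| <= eps * \sum_p v p ^+ 2.
Proof.
have small m : `|eps ^+ 2 / qsq m| <= eps.
  have q0 := qsq_gt0 m; rewrite ger0_norm; last by rewrite divr_ge0 ?sqr_ge0 // ltW.
  by rewrite ler_pdivrMr // expr2; apply: ler_wpM2l; [exact: ltW|exact: qsq_ge].
have qE m : qsq m - y m ^+ 2 / qsq m = eps ^+ 2 / qsq m.
  have q0 := gt_eqF (qsq_gt0 m); have -> : eps ^+ 2 = qsq m ^+ 2 - y m ^+ 2 by rewrite qsq2; ring.
  by field; rewrite q0.
have -> : \sum_p \sum_n v p * cmat p n * v n =
  \sum_(m < r) v (m, true) * (eps ^+ 2 / qsq m) * v (m, false)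
  + \sum_(m < r) \sum_(n < r) (n == m.+1 :> nat)%:R * (v (m, true) * (eps ^+ 2 / qsq n) * v (n, false)).
  rewrite sum_pairb -big_split /=; apply: eq_bigr => m _.
  rewrite (sum_pairb (fun n => v (m, true) * _ * _)) /cmat /=.
  rewrite [X in _ + X = _](bigD1 (m, true)) //= eqxx mul1r [X in _ + (_ + X) = _]big1 ?addr0; last first.
    by move=> n /negPf nm; rewrite nm mul0r mulr0 mul0r.
  rewrite -qE; under eq_bigr do rewrite mulr0 mul0r add0r mulrBr mulrBl.
  rewrite big_split /= sumrN [X in _ - X](bigD1 m) //= eqxx mul1r.
  rewrite [X in _ - (_ + X)]big1 ?addr0; last first.
    by move=> n /negPf nm; rewrite nm mul0r mulr0 mul0r.
  have -> : \sum_(i < r) v (m, true) * ((i == m.+1 :> nat)%:R * (eps ^+ 2 / qsq i)) * v (i, false) =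
    \sum_(n < r) (n == m.+1 :> nat)%:R * (v (m, true) * (eps ^+ 2 / qsq n) * v (n, false)).
    by apply: eq_bigr => n _; ring.
  ring.
apply: le_trans (ler_normD _ _) _.
have h1 : `|\sum_(m < r) v (m, true) * (eps ^+ 2 / qsq m) * v (m, false)| <=
   \sum_m eps / 2 * (v (m, true) ^+ 2 + v (m, false) ^+ 2).
  by apply: le_trans (ler_norm_sum _ _ _) _; apply: ler_sum => m _; exact: amgm2.
have e20 : 0 <= eps / 2 by rewrite divr_ge0 // ltW.
have h2 : `|\sum_(m < r) \sum_(n < r) (n == m.+1 :> nat)%:R * (v (m, true) * (eps ^+ 2 / qsq n) * v (n, false))|
  <= \sum_m eps / 2 * (v (m, true) ^+ 2 + v (m, false) ^+ 2).
  apply: le_trans (ler_norm_sum _ _ _) _.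
  apply: le_trans (_ : \sum_(m < r) \sum_(n < r) (n == m.+1 :> nat)%:R * (eps / 2 * v (m, true) ^+ 2) +
     \sum_(m < r) \sum_(n < r) (n == m.+1 :> nat)%:R * (eps / 2 * v (n, false) ^+ 2) <= _).
    rewrite -big_split /=; apply: ler_sum => m _; apply: le_trans (ler_norm_sum _ _ _) _.
    rewrite -big_split /=; apply: ler_sum => n _.
    rewrite -mulrDr normrM normr_nat ler_wpM2l // -mulrDr; exact: amgm2.
  under [leRHS]eq_bigr do rewrite mulrDr.
  rewrite big_split /= lerD //; last rewrite exchange_big /=.
    apply: ler_sum => m _; rewrite -mulr_suml ler_piMl; [by []|by apply: mulr_ge0 => //; exact: sqr_ge0|].
    by apply: sum_ind_le1 => i j /eqP E /eqP E'; apply/val_inj; rewrite /= E.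
  apply: ler_sum => n _; rewrite -mulr_suml ler_piMl; [by []|by apply: mulr_ge0 => //; exact: sqr_ge0|].
  by apply: sum_ind_le1 => i j /eqP E /eqP E'; apply/val_inj => /=; lia.
apply: le_trans (lerD h1 h2) _; rewrite sum_pairb mulr_sumr -big_split /=.
by apply: ler_sum => m _; lra.
Qed.

Variables (V : lmodType R) (D : 'I_r -> {linear V -> V}).
Hypothesis D_comm : forall i j v, D i (D j v) = D j (D i v).

Lemma Nop_comm (T U : {linear V -> V}) m v : (forall w, T (U w) = U (T w)) ->
  T (Nop U m v) = Nop U m (T v).
Proof.
by move=> TU; elim: m => //= m IH; rewrite linearD linearZ_LR /= !TU IH.
Qed.

Lemma cop_comm (T U : {linear V -> V}) p v : (forall w, T (U w) = U (T w)) ->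
  T (cop U p v) = cop U p (T v).
Proof.
move=> TU; rewrite /cop linearZ_LR; congr (_ *: _); case: p.2.
  by rewrite /= TU Nop_comm.
by rewrite linearZ_LR Nop_comm.
Qed.

Lemma Nop_lin (U : {linear V -> V}) m c v w :
  Nop U m (c *: v + w) = c *: Nop U m v + Nop U m w.
Proof.
elim: m => //= m IH; rewrite IH !linearP /= !scalerDr !scalerA !(mulrC c).
by rewrite -!addrA; congr (_ + _); rewrite addrCA.
Qed.

Lemma cop_lin (U : {linear V -> V}) p c v w :
  cop U p (c *: v + w) = c *: cop U p v + cop U p w.
Proof.
rewrite /cop; case: p => m [] /=; rewrite Nop_lin.
  by rewrite linearP /= scalerDr !scalerA (mulrC c).
rewrite !scalerDr !scalerA; congr (_ *: _ + _); ring.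
Qed.

Lemma cop0 (U : {linear V -> V}) p : cop U p 0 = 0.
Proof. by have := cop_lin U p (-1) 0 0; rewrite scaler0 add0r scaleN1r addNr. Qed.

Lemma cop_sum (U : {linear V -> V}) p (I : finType) (c : I -> R) (F : I -> V) :
  cop U p (\sum_i c i *: F i) = \sum_i c i *: cop U p (F i).
Proof.
elim/big_rec2: _ => [|i v1 v2 _ <-]; first exact: cop0.
exact: cop_lin.
Qed.

Lemma Nop_lin_comm (T U : {linear V -> V}) m p v : (forall w, T (U w) = U (T w)) ->
  Nop T m (cop U p v) = cop U p (Nop T m v).
Proof.
move=> TU; elim: m => //= m IH.
by rewrite IH !(cop_comm _ _ TU) [in RHS]addrC cop_lin addrC.
Qed.

Variable Q : V -> Prop.
Hypotheses (Q_D : forall j v, Q v -> Q (D j v))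
  (Q_lin : forall c v w, Q v -> Q w -> Q (c *: v + w)).

Lemma Q_cop j p v : Q v -> Q (cop (D j) p v).
Proof.
move=> Qv; have QZ c w : Q w -> Q (c *: w).
  by move=> Qw; rewrite -[c](subrK 1) scalerDl scale1r; exact: Q_lin.
have QN m : Q (Nop (D j) m v) by elim: m => //= m IH; rewrite addrC; apply: Q_lin => //; do 2!apply: Q_D.
by rewrite /cop; apply: (QZ (kfac p.1)); case: p.2; [exact: Q_D|exact: (QZ (qsq p.1))].
Qed.

(** A finite family containing [u] up to a factor, stable under the [D j] with [j \in s], each of
    which has numerical radius at most [eps] there. Its members also keep the annihilation by
    [Nop (D k) r] for every [k], so that a further index can be adjoined, and the property [Q],
    later analyticity at the origin. *)
Definition closed_system (s : seq 'I_r) (u : V) := exists (I : finType) (Psi : I -> V)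
  (M : 'I_r -> I -> I -> R) (i0 : I) (c0 : R),
  [/\ u = c0 *: Psi i0, forall i, Q (Psi i) /\ (forall k, Nop (D k) r (Psi i) = 0),
      forall j i, j \in s -> D j (Psi i) = \sum_i' M j i i' *: Psi i' &
      forall j (v : I -> R), j \in s ->
        `|\sum_i \sum_i' v i * M j i i' * v i'| <= eps * \sum_i v i ^+ 2].

(** Adjoining [k] tensors the family with [cop (D k)]. By commutativity the old matrices act on the
    first factor and [cmat] on the second, and the bound on the quadratic form holds fibre by
    fibre. *)
Lemma closed_system_exists (s : seq 'I_r) (u : V) : uniq s ->
  (forall k, Nop (D k) r u = 0) -> Q u -> closed_system s u.
Proof.
move=> us N0 Qu; elim: s us => [_|k s IH /= /andP[ks us]].
  by exists unit, (fun=> u), (fun _ _ _ => 0), tt, 1; split=> //; rewrite scale1r.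
have [I [Psi [M [i0 [c0 [uE NP DP MP]]]]]] := IH us.
have o0 : (0 < r)%N by exact: leq_ltn_trans (ltn_ord k).
exists (I * ('I_r * bool))%type, (fun ip => cop (D k) ip.2 (Psi ip.1)),
  (fun j ip ip' => if j == k then (ip.1 == ip'.1)%:R * cmat ip.2 ip'.2
                   else (ip.2 == ip'.2)%:R * M j ip.1 ip'.1),
  (* [cop] at [(0, false)] multiplies by [qsq 0], which the constant undoes. *)
  (i0, (Ordinal o0, false)), (c0 / qsq 0); split.
- rewrite /cop /= /kfac expr0 scale1r scalerA divfK ?gt_eqF ?qsq_gt0 //.
- move=> [i p] /=; have [Qi Ni] := NP i; split=> [|k']; first exact: Q_cop.
  by rewrite Nop_lin_comm ?Ni ?cop0 // => w; exact: D_comm.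
- move=> j [i p] /=; rewrite inE; have [->|jk] /= := eqVneq j k => js.
    rewrite (cop_mul _ ((NP i).2 k)) [RHS]sum_pair.
    rewrite [RHS](bigD1 i) //= [X in _ = _ + X]big1 ?addr0 => [|i' /negPf ii].
      by apply: eq_bigr => n _; rewrite eqxx mul1r.
    by rewrite big1 // => n _; rewrite eq_sym ii mul0r scale0r.
  rewrite cop_comm; last by move=> w; exact: D_comm.
  rewrite DP // cop_sum [RHS]sum_pair.
  apply: eq_bigr => i' _; rewrite (bigD1 p) //= eqxx mul1r big1 ?addr0 // => n /negPf np.
  by rewrite eq_sym np mul0r scale0r.
- move=> j v; rewrite inE; have [->|jk] /= := eqVneq j k => js.
    rewrite !sum_pair mulr_sumr.
    apply: le_trans (ler_norm_sum _ _ _) _; apply: ler_sum => i _.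
    apply: le_trans (cmat_bound (fun p => v (i, p))).
    rewrite le_eqVlt; apply/orP; left; apply/eqP; congr `|_|; apply: eq_bigr => p _.
    rewrite sum_pair.
    rewrite (bigD1 i) //= [X in _ + X = _]big1 ?addr0 => [|i' /negPf ii].
      by apply: eq_bigr => n _; rewrite eqxx mul1r.
    by rewrite big1 // => n _; rewrite eq_sym ii mul0r mulr0 mul0r.
  rewrite !sum_pair exchange_big [in leRHS]exchange_big /= mulr_sumr.
  apply: le_trans (ler_norm_sum _ _ _) _; apply: ler_sum => p _.
  apply: le_trans (MP j (fun i => v (i, p)) js).
  rewrite le_eqVlt; apply/orP; left; apply/eqP; congr `|_|; apply: eq_bigr => i _.
  rewrite sum_pair.
  apply: eq_bigr => i' _; rewrite (bigD1 p) //= eqxx mul1r big1 ?addr0 // => n /negPf np.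
  by rewrite eq_sym np mul0r mulr0 mul0r.
Qed.

End ClosedSystem.

(** * Elementary symmetric functions of commuting operators *)

Section ElementarySymmetric.
Context {R : comNzRingType} {r : nat}.
Variables (V : lmodType R) (D : 'I_r -> {linear V -> V}).
Hypothesis D_comm : forall i j v, D i (D j v) = D j (D i v).
Implicit Types (s : seq 'I_r) (u v : V).

(** The [i]-th elementary symmetric polynomial in the operators [D k ^ 2], [k \in s], applied to
    [u]; [esc] is its scalar counterpart. *)
Fixpoint Eop u s i : V :=
  match s, i with
  | [::], 0 => u
  | [::], _ => 0
  | k :: s', 0 => Eop u s' 0
  | k :: s', i'.+1 => Eop u s' i'.+1 + D k (D k (Eop u s' i'))
  end.

Fixpoint esc (z : 'I_r -> R) s i : R :=
  match s, i with
  | [::], 0 => 1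
  | [::], _ => 0
  | k :: s', 0 => esc z s' 0
  | k :: s', i'.+1 => esc z s' i'.+1 + z k * esc z s' i'
  end.

Lemma Eop_big u s i : (size s < i)%N -> Eop u s i = 0.
Proof.
elim: s i => [|k s IH] [|i] //= si; rewrite !IH ?linear0 ?addr0 //.
by apply: leq_trans si; exact: leqnSn.
Qed.

Lemma esc_big z s i : (size s < i)%N -> esc z s i = 0.
Proof.
elim: s i => [|k s IH] [|i] //= si; rewrite !IH ?mulr0 ?addr0 //.
by apply: leq_trans si; exact: leqnSn.
Qed.

Lemma esc_coef z s i : esc z s i = (\prod_(k <- s) (1 + (z k)%:P * 'X))`_i.
Proof.
elim: s i => [|k s IH] i; first by rewrite big_nil coef1; case: i.
rewrite big_cons mulrDl mul1r coefD -mulrA coefCM coefXM.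
by case: i => [|i] /=; rewrite !IH ?mulr0 ?addr0.
Qed.

(* [X] stands either for [D j ^ 2] or for a scalar. *)
Variables (X : {linear V -> V}) (X_comm : forall j v, X (D j v) = D j (X v)).

Definition Hop u s : V := foldr (fun k v => X v - D k (D k v)) u s.
Definition Hsc (z : 'I_r -> R) u s : V := foldr (fun k v => X v - z k *: v) u s.

(** Vieta's formula for [\prod_(k <- s) (X - D k ^ 2)]. *)
Lemma HopE u s : Hop u s = \sum_(0 <= i < (size s).+1) (-1) ^+ i *: iter (size s - i) X (Eop u s i).
Proof.
elim: s => [|k s IH]; first by rewrite big_nat1 /= expr0 scale1r.
have iD n v : iter n X (D k v) = D k (iter n X v) by elim: n => //= n ->; rewrite X_comm.
have i0 n : iter n X 0 = 0 by elim: n => //= n ->; rewrite linear0.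
have iadd n v w : iter n X (v + w) = iter n X v + iter n X w by elim: n => //= n ->; rewrite linearD.
rewrite /= -/(Hop u s) IH !linear_sum /= big_nat_recl //= [in RHS]big_nat_recl //=.
rewrite !expr0 !scale1r !subn0 -iterS -addrA; congr (_ + _).
have -> : \sum_(0 <= i < (size s).+1) (-1) ^+ i.+1 *:
    iter (size s - i) X (Eop u s i.+1 + D k (D k (Eop u s i))) =
   \sum_(0 <= i < size s) X ((-1) ^+ i.+1 *: iter (size s - i.+1) X (Eop u s i.+1))
   - \sum_(0 <= i < (size s).+1) D k (D k ((-1) ^+ i *: iter (size s - i) X (Eop u s i))).
  have E : \sum_(0 <= i < size s) X ((-1) ^+ i.+1 *: iter (size s - i.+1) X (Eop u s i.+1)) =
     \sum_(0 <= i < (size s).+1) ((-1) ^+ i.+1 *: iter (size s - i) X (Eop u s i.+1)).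
    rewrite big_nat_recr //= Eop_big // i0 scaler0 addr0; apply: eq_big_nat => i /andP[_ si].
    by rewrite linearZ_LR /= -iterS -subSn // subSS.
  rewrite E -sumrB; apply: eq_bigr => i _.
  by rewrite iadd !iD scalerDr exprS mulN1r !scaleNr !linearZ_LR.
by rewrite sumrN.
Qed.

Lemma HscE z u s :
  Hsc z u s = \sum_(0 <= i < (size s).+1) ((-1) ^+ i * esc z s i) *: iter (size s - i) X u.
Proof.
elim: s => [|k s IH]; first by rewrite big_nat1 /= expr0 mul1r scale1r.
rewrite /= -/(Hsc z u s) IH linear_sum /= scaler_sumr big_nat_recl //= [in RHS]big_nat_recl //=.
rewrite !expr0 !mul1r linearZ_LR /= !subn0 -iterS -addrA; congr (_ + _).
have -> : \sum_(0 <= i < (size s).+1) ((-1) ^+ i.+1 * (esc z s i.+1 + z k * esc z s i)) *: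
    iter (size s - i) X u =
   \sum_(0 <= i < size s) X (((-1) ^+ i.+1 * esc z s i.+1) *: iter (size s - i.+1) X u)
   - \sum_(0 <= i < (size s).+1) (z k *: (((-1) ^+ i * esc z s i) *: iter (size s - i) X u)).
  have E : \sum_(0 <= i < size s) X (((-1) ^+ i.+1 * esc z s i.+1) *: iter (size s - i.+1) X u) =
     \sum_(0 <= i < (size s).+1) (((-1) ^+ i.+1 * esc z s i.+1) *: iter (size s - i) X u).
    rewrite big_nat_recr //= esc_big // mulr0 scale0r addr0; apply: eq_big_nat => i /andP[_ si].
    by rewrite linearZ_LR /= -iterS -subSn // subSS.
  rewrite E -sumrB; apply: eq_bigr => i _.
  by rewrite scalerA -scalerBl; congr (_ *: _); rewrite exprS; ring.
by congr (_ + _); rewrite big_nat_recl //= expr0 mul1r subn0.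
Qed.

(** Used twice: for [X = D k ^ 2] the left side vanishes and [u] satisfies a polynomial equation in
    the single operator [D k]; for [X] a scalar it gives the eigenvalue of the operator in the
    recursion. *)
Lemma Hop_eigen z u s : (forall i, Eop u s i = esc z s i *: u) -> Hop u s = Hsc z u s.
Proof.
move=> H; rewrite HopE HscE; apply: eq_bigr => i _; rewrite H -scalerA; congr (_ *: _).
by elim: (size s - i)%N => //= n ->; rewrite linearZ_LR.
Qed.

Lemma Hop0 u s k : k \in s -> (forall v, X v = D k (D k v)) -> Hop u s = 0.
Proof.
move=> + Xk; elim: s => // j s IH; rewrite inE => /orP[/eqP <-|/IH E] /=.
  by rewrite Xk subrr.
by rewrite -/(Hop u s) E (linear0 X) (linear0 (D j)) (linear0 (D j)) subr0.
Qed.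

(* [E_i] written with exponent vectors, in the order in which [Dmono] applies them. *)
Definition Mop (al : 'I_r -> nat) u s : V := foldr (fun j v => iter (al j) (D j) v) u s.

Fixpoint eexp s i : seq ('I_r -> nat) :=
  match s, i with
  | [::], 0 => [:: fun=> 0]
  | [::], _ => [::]
  | k :: s', 0 => eexp s' 0
  | k :: s', i'.+1 => eexp s' i'.+1 ++ [seq (fun j => al j + 2 * (j == k))%N | al <- eexp s' i']
  end.

Lemma Mop_add2 al u s k : uniq s -> k \in s ->
  Mop (fun j => al j + 2 * (j == k))%N u s = D k (D k (Mop al u s)).
Proof.
have iC j n v : D k (iter n (D j) v) = iter n (D j) (D k v).
  by elim: n => //= n IH; rewrite D_comm IH.
elim: s => //= j s IH /andP[js us]; rewrite inE => /orP[/eqP E|ks].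
  subst j; rewrite eqxx muln1 addn2 /=; congr (D k (D k (iter _ _ _))).
  elim: s {IH us} js => //= l s IH; rewrite inE negb_or => /andP[kl /IH ->].
  by rewrite [l == k]eq_sym (negPf kl) muln0 addn0.
have jk : j != k by apply: contraNneq js => ->.
by rewrite IH // (negPf jk) muln0 addn0 !iC.
Qed.

Lemma Eop_Mop u (s0 : seq 'I_r) s i : uniq s0 -> {subset s <= s0} ->
  Eop u s i = \sum_(al <- eexp s i) Mop al u s0.
Proof.
move=> us0; elim: s i => [|k s IH] [|i] /= ss0.
- by rewrite big_seq1 /Mop; elim: s0 {us0 ss0} => //= j s ->.
- by rewrite big_nil.
- by apply: IH => j js; apply: ss0; rewrite inE js orbT.
- have sub : {subset s <= s0} by move=> j js; apply: ss0; rewrite inE js orbT.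
  rewrite big_cat big_map /= !IH // !linear_sum /=; congr (_ + _); apply: eq_bigr => al _.
  by rewrite Mop_add2 // ss0 // inE eqxx.
Qed.

Lemma esc_eexp (z : 'I_r -> R) (s0 : seq 'I_r) s i : uniq s0 -> {subset s <= s0} ->
  esc (fun k => z k ^+ 2) s i = \sum_(al <- eexp s i) \prod_(j <- s0) z j ^+ al j.
Proof.
move=> us0; elim: s i => [|k s IH] [|i] /= ss0.
- by rewrite big_seq1 big1 // => j _; rewrite expr0.
- by rewrite big_nil.
- by apply: IH => j js; apply: ss0; rewrite inE js orbT.
- have sub : {subset s <= s0} by move=> j js; apply: ss0; rewrite inE js orbT.
  rewrite big_cat big_map /= !IH // mulr_sumr; congr (_ + _); apply: eq_bigr => al _.
  under [RHS]eq_bigr do rewrite exprD; rewrite big_split /= mulrC; congr (_ * _).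
  have ks : k \in s0 by rewrite ss0 // inE eqxx.
  rewrite (bigD1_seq k) //= eqxx muln1 big1 ?mulr1 // => j /negPf jk.
  by rewrite jk muln0 expr0.
Qed.

End ElementarySymmetric.

Definition DL {R : realType} {r : nat} (a b iota : R) (j : 'I_r) :
  {linear @gfun R r -> @gfun R r} := DV a b iota j.

(** * Reduction to real and imaginary parts *)

Section RealParts.
Context {R : realType} {r : nat}.
Variables (a b iota : R).
Local Notation DV := (DV a b iota).

Lemma toCM (x y : R) : toC (x * y) = toC x * toC y.
Proof. by apply/eqP; rewrite eq_complex /= !mul0r !mulr0 subr0 addr0 !eqxx. Qed.
Lemma toCD (x y : R) : toC (x + y) = toC x + toC y.
Proof. by apply/eqP; rewrite eq_complex /= addr0 !eqxx. Qed.
Lemma toCV (x : R) : (toC x)^-1 = toC x^-1.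
Proof.
have [->|x0] := eqVneq x 0; first by rewrite [in RHS]invr0 -[toC 0]/(0 : R[i]) invr0.
have n0 : toC x != 0 by rewrite eq_complex /= negb_and x0.
by apply: (mulfI n0); rewrite divff // -toCM divff.
Qed.

(* [part] is the real or the imaginary part. *)
Record is_part (part : R[i] -> R) : Prop := IsPart {
  partD : forall z w, part (z + w) = part z + part w;
  part0 : part 0 = 0;
  part_le : forall z, `|part z| <= cabs z;
  partM : forall z s, part (z * toC s) = part z * s;
  part_pderiv : forall (f : r.-tuple R -> R[i]) j t,
    part (pderiv j f t) = der j (fun y => part (f y)) t }.

Lemma is_part_cre : is_part (@cre R).
Proof.
split=> // [[x y] [z w] //|[x y]|[x y] s].
- rewrite /cabs /= -(sqrtr_sqr x) ler_sqrt ?addr_ge0 ?sqr_ge0 // lerDl sqr_ge0 //.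
- by rewrite /= mulr0 subr0.
Qed.

Lemma is_part_cim : is_part (@cim R).
Proof.
split=> // [[x y] [z w] //|[x y]|[x y] s].
- rewrite /cabs /= -(sqrtr_sqr y) ler_sqrt ?addr_ge0 ?sqr_ge0 // lerDr sqr_ge0 //.
- by rewrite /= mulr0 add0r.
Qed.

Variables (part : R[i] -> R) (P : is_part part).

Lemma partN z : part (- z) = - part z.
Proof. by apply/eqP; rewrite -addr_eq0 -(partD P) addNr (part0 P). Qed.
Lemma partB z w : part (z - w) = part z - part w.
Proof. by rewrite (partD P) partN. Qed.
Lemma partMl z s : part (toC s * z) = s * part z.
Proof. by rewrite mulrC (partM P) mulrC. Qed.
Lemma partdiv z s : part (z / toC s) = part z / s.
Proof. by rewrite toCV (partM P). Qed.
Lemma part_sum (I : Type) (s : seq I) (Q : pred I) (F : I -> R[i]) :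
  part (\sum_(i <- s | Q i) F i) = \sum_(i <- s | Q i) part (F i).
Proof. exact: (big_morph _ (partD P) (part0 P)). Qed.

Definition agree (f : r.-tuple R -> R[i]) (U : gfun) := forall t, regular t -> part (f t) = U t.

Lemma s_ijC (i j : 'I_r) : s_ij i j = s_ij j i :> (r.-tuple R -> r.-tuple R).
Proof.
apply/funext => t; apply: eq_from_tnth => k; rewrite !tnth_mktuple.
by case: (k =P i) => E1; case: (k =P j) => E2 //; rewrite -E1 -E2.
Qed.

Lemma part_Cherednik f U j : agree f U -> agree (Cherednik a b iota j f) (DV j U).
Proof.
move=> H t rt; rewrite DVE // /Cherednik /Dch.
rewrite !(partD P, partN, partMl, partdiv, part_sum).
rewrite (part_pderiv P) (der_near j (nearp_sub H (regular_near rt))) H //.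
rewrite -[_ * \sum_(i < r | (i < j)%N) _]/(_ * _).
have E1 : \sum_(i < r | (i < j)%N) part ((f t - f (s_ij i j t)) / toC (1 - expR (-2 * (tnth t i - tnth t j))))
   = \sum_(i < r | (i < j)%N) (U t - U (s_ij j i t)) * (1 - kap (tnth t j - tnth t i)).
  apply: eq_bigr => i ij; rewrite partdiv partB !H //; last exact: reg_s.
  rewrite s_ijC -/(kap _) -kapN ?opprB //.
  by rewrite reg_sub_neq0 //; apply: contraTneq ij => ->; rewrite ltnn.
have E2 : \sum_(k < r | (j < k)%N) part ((f t - f (s_ij j k t)) / toC (1 - expR (-2 * (tnth t j - tnth t k))))
   = \sum_(k < r | (j < k)%N) (U t - U (s_ij j k t)) * kap (tnth t j - tnth t k).
  by apply: eq_bigr => i ij; rewrite partdiv partB !H //; exact: reg_s.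
have E3 : \sum_(k < r | k != j) part ((f t - f (sigma_ij j k t)) / toC (1 - expR (-2 * (tnth t j + tnth t k))))
   = \sum_(k < r | k != j) (U t - U (sigma_ij j k t)) * kap (tnth t j + tnth t k).
  by apply: eq_bigr => i ij; rewrite partdiv partB !H //; exact: reg_sg.
rewrite E1 E2 E3 !H; try exact: reg_ng.
have E4 : \sum_(k | k != j) opA a j k U t =
   a * \sum_(k < r | (j < k)%N) (U t - U (s_ij j k t)) * kap (tnth t j - tnth t k)
   - a * \sum_(i < r | (i < j)%N) (U t - U (s_ij j i t)) * (1 - kap (tnth t j - tnth t i))
   + a * \sum_(k < r | k != j) (U t - U (sigma_ij j k t)) * kap (tnth t j + tnth t k).
  rewrite !mulr_sumr /opA big_split /=; congr (_ + _); last first.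
    by apply: eq_bigr => k _; ring.
  rewrite (bigID (fun k : 'I_r => (j < k)%N)) /= -sumrN; congr (_ + _).
    apply: eq_big => [k|k /andP[_ jk]]; last by rewrite ltnNge (ltnW jk) /=; ring.
    by case: (ltnP j k) => jk; rewrite ?andbF ?andbT //; apply/negP => /eqP E; rewrite E ltnn in jk.
  apply: eq_big => [k|k /andP[kj]]; first by rewrite -leqNgt ltn_neqAle -val_eqE.
  by rewrite -leqNgt leq_eqVlt val_eqE (negPf kj) /= => -> /=; ring.
rewrite E4 /opB /kap.
have -> : -4 * tnth t j = -2 * (2 * tnth t j) by ring.
ring.
Qed.

Lemma part_Dmono f U (al : r.-tuple nat) : agree f U ->
  agree (Dmono a b iota al f) (Mop (DL a b iota) (fun j => tnth al j) U (enum 'I_r)).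
Proof.
move=> H; rewrite /Dmono /Mop; elim: (enum 'I_r) => //= j s IH.
elim: (tnth al j) => //= n IHn; exact: part_Cherednik.
Qed.

End RealParts.

(** * Eigen-equations for the elementary symmetric operators *)

Section SphericalEigen.
Context {R : realType} {r : nat}.
Variables (a b iota : R).

Local Notation DL := (DL a b iota).

Definition ecp i : cpoly R r :=
  [seq (1, [tuple al k | k < r]) | al <- eexp (enum 'I_r) i].

Lemma peval_ecp i (z : r.-tuple R[i]) :
  peval (ecp i) z = esc (fun k => tnth z k ^+ 2) (enum 'I_r) i.
Proof.
rewrite /peval big_map (esc_eexp (fun k => tnth z k) i (enum_uniq 'I_r)) //.
apply: eq_bigr => al _ /=; rewrite mul1r -big_enum /=; apply: eq_bigr => k _.
by rewrite tnth_mktuple.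
Qed.

(** [esc] is a coefficient of [\prod_k (1 + z_k ^ 2 X)], on which the invariance under permutations
    and sign changes is visible. *)
Lemma ecp_inv i : W_invariant_poly (ecp i).
Proof.
move=> s e z; rewrite !peval_ecp !esc_coef; congr (nth 0 (polyseq _) i).
rewrite !big_enum /= [RHS](reindex_perm s) /=; apply: eq_bigr => k _.
by rewrite tnth_mktuple; case: ifP; rewrite ?sqrrN.
Qed.

Lemma esc_toC (z : 'I_r -> R) s i : esc (fun k => toC (z k)) s i = toC (esc z s i).
Proof. by elim: s i => [|k s IH] [|i] //=; rewrite !IH toCD toCM. Qed.

(** For imaginary [lam] the squares are the real numbers [- cim (lam_k) ^ 2], so the real and the
    imaginary part of [phi] satisfy the equations separately. *)
Lemma HO_eigen (lam : r.-tuple R[i]) (phi : r.-tuple R -> R[i]) (part : R[i] -> R) :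
  @is_part R r part -> (forall j, cre (tnth lam j) = 0) ->
  is_HO_spherical a b iota lam phi ->
  exists U : gfun, (forall t, regular t -> part (phi t) = U t) /\
    forall i, Eop DL U (enum 'I_r) i =
              esc (fun k => - cim (tnth lam k) ^+ 2) (enum 'I_r) i *: U.
Proof.
move=> P lam0 [_ an _ eig].
have gphi : good (fun t => part (phi t)).
  move=> t _; apply: An_of_analytic (an t); [exact: (partD P)|exact: (part0 P)|exact: (part_le P)|exact: (partM P)].
exists (gcut gphi); split=> [t rt|i]; first by rewrite /= cutE.
have H : agree part phi (gcut gphi) by move=> t rt; rewrite /= cutE.
apply: gfun_eq => t rt.
have := congr1 part (eig (ecp i) (@ecp_inv i) t rt).
rewrite peval_ecp (_ : (fun k => tnth lam k ^+ 2) = (fun k => toC (- cim (tnth lam k) ^+ 2))); last first.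
  apply/funext => k; have := lam0 k; case: (tnth lam k) => x y /= ->.
  by apply/eqP; rewrite eq_complex expr2 /= !mul0r !mulr0 addr0 sub0r expr2 !eqxx.
rewrite esc_toC (partMl P) (H t rt) => E.
have -> : (esc (fun k => - cim (tnth lam k) ^+ 2) (enum 'I_r) i *: gcut gphi : gfun) t =
  esc (fun k => - cim (tnth lam k) ^+ 2) (enum 'I_r) i * gcut gphi t by [].
rewrite -E /polyD (part_sum P) big_map.
rewrite (Eop_Mop (D := DL) (DV_comm a b iota) (gcut gphi) i (enum_uniq 'I_r)) //.
have -> : (\sum_(al <- eexp (enum 'I_r) i) Mop DL al (gcut gphi) (enum 'I_r) : gfun) t =
  \sum_(al <- eexp (enum 'I_r) i) (Mop DL al (gcut gphi) (enum 'I_r) : gfun) t.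
  by elim: (eexp _ _) => [|al s IH]; rewrite ?big_nil // !big_cons -IH.
apply: eq_bigr => al _ /=; rewrite mul1r.
rewrite (part_Dmono a b iota P [tuple al k | k < r] H rt); congr (gval (Mop _ _ _ _) _).
by apply/funext => k; rewrite tnth_mktuple.
Qed.

End SphericalEigen.

(** * Analyticity at the origin under the Cherednik operators *)

Section AtOrigin.
Context {R : realType} {r : nat}.
Variables (a b iota : R).
Local Notation pt := (r.-tuple R).
Implicit Types (F G : pt -> R).

Definition opt : r.-tuple R := [tuple 0 | _ < r].

Lemma shift_opt (h : 'I_r -> R) k : tnth (shift opt h) k = h k.
Proof. by rewrite tnth_shift tnth_mktuple add0r. Qed.

(** Analytic at the origin up to values on the walls. The class is stable under the [D_j] although
    [kap] is singular there, and it bounds the iterates near the origin, where the energy estimate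
    starts. *)
Definition AnR F := exists G, An opt G /\ nearp opt (fun y => regular y -> F y = G y).

Lemma AnR_An F : An opt F -> AnR F.
Proof. by move=> A; exists F; split=> //; exact: nearp_all. Qed.

Lemma AnR_near F G : nearp opt (fun y => regular y -> F y = G y) -> AnR F -> AnR G.
Proof.
move=> E [H [A N]]; exists H; split=> //.
by apply: nearp_sub (nearp_and E N) => y [E1 E2] ry; rewrite -E1 ?E2.
Qed.

Lemma AnR_ext F G : (forall y, regular y -> F y = G y) -> AnR F -> AnR G.
Proof. by move=> E; apply: AnR_near; exact: nearp_all. Qed.

Lemma AnRD F G : AnR F -> AnR G -> AnR (fun y => F y + G y).
Proof.
move=> [f [A N]] [g [A' N']]; exists (fun y => f y + g y); split; first exact: AnD.
by apply: nearp_sub (nearp_and N N') => y [E1 E2] ry; rewrite E1 ?E2.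
Qed.
Lemma AnRM F G : AnR F -> AnR G -> AnR (fun y => F y * G y).
Proof.
move=> [f [A N]] [g [A' N']]; exists (fun y => f y * g y); split; first exact: AnM.
by apply: nearp_sub (nearp_and N N') => y [E1 E2] ry; rewrite E1 ?E2.
Qed.
Lemma AnRZ c F : AnR F -> AnR (fun y => c * F y).
Proof. by apply: AnRM; apply: AnR_An; exact: An_cst. Qed.
Lemma AnRB F G : AnR F -> AnR G -> AnR (fun y => F y - G y).
Proof.
move=> HF /(AnRZ (-1)) HG; apply: AnR_ext (AnRD HF HG) => y _; by rewrite mulN1r.
Qed.
Lemma AnR_sum (I : Type) (s : seq I) (Q : pred I) (F : I -> r.-tuple R -> R) :
  (forall i, Q i -> AnR (F i)) -> AnR (fun y => \sum_(i <- s | Q i) F i y).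
Proof.
move=> H; elim: s => [|i s IH].
  apply: (@AnR_ext (fun=> 0)); first by move=> y _; rewrite big_nil.
  by apply: AnR_An; exact: An_cst.
case Qi: (Q i); last by apply: AnR_ext IH => y _; rewrite big_cons Qi.
by apply: AnR_ext (AnRD (H i Qi) IH) => y _; rewrite big_cons Qi.
Qed.

Lemma AnR_der i F : AnR F -> AnR (der i F).
Proof.
move=> [f [A N]]; exists (der i f); split; first exact: An_der.
apply: nearp_sub (nearp_near N) => y Ny ry; apply: der_near.
by apply: nearp_sub (nearp_and Ny (regular_near ry)) => z [H rz]; exact: H.
Qed.

Lemma AnR_bounded F : AnR F ->
  exists C, nearp opt (fun y => regular y -> `|F y| <= C).
Proof.
move=> [f [A N]]; exists (`|f opt| + 1).
apply: nearp_sub (nearp_and N (An_cont ltr01 A)) => y [E B] ry; rewrite E //.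
have -> : f y = f opt + (f y - f opt) by ring.
by apply: le_trans (ler_normD _ _) _; rewrite lerD2l.
Qed.

Section OneRoot.
Variables (tau : 'I_r -> R * 'I_r) (c : 'I_r -> R) (al : pt -> R) (d : 'I_r -> R).
Hypotheses (tauU : unimod tau) (c2 : forall k, `|c k| <= 2) (alA : An opt al)
  (alE : forall y k, tnth y k - tnth (tactp tau y) k = c k * al y)
  (alT : forall y, al (tactp tau y) = - al y) (d1 : forall k, `|d k| <= 1)
  (ald : forall e, al (shift opt (fun k => e * d k)) = e)
  (al0 : forall y, regular y -> al y != 0).

Lemma tactp_shift_opt (h : 'I_r -> R) : tactp tau (shift opt h) = shift opt (tact tau h).
Proof.
rewrite tactp_shift; congr shift; apply: eq_from_tnth => k.
by rewrite !tnth_mktuple mulr0.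
Qed.

(** The quotient is the twisted derivation of the series of [F], which converges on half the
    radius. *)
Lemma An_dvd F : An opt F ->
  exists G, An opt G /\ nearp opt (fun y => al y * G y = F y - F (tactp tau y)).
Proof.
move=> [rho [M [r0 [q Hq]]]].
have r20 : 0 < rho / 2 by rewrite divr_gt0.
have A0 N : \sum_(0 <= n < N) pn (2 * (rho / 2)) (q n) <= M.
  by have -> : 2 * (rho / 2) = rho; [field|exact: Hq.1].
have [g'' H''] := aser_tpoly c2 (unimod_le tauU) r20 A0.
have Hq' : aser (rho / 2) M q (fun h => F (shift opt h)).
    by apply: aser_le Hq; [exact: ltW|lra].
  exists (fun y => g'' (tnth y)); split.
    exists (rho / 2), (2 / (rho / 2) * M); split=> //.
    apply: (@has_ser_ext _ _ _ _ g''); last by exists (fun n => tpoly c tau (q n)).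
    by move=> h _; congr g''; apply/funext => k; rewrite shift_opt.
  exists (rho / 2); split=> // h hb.
  have E1 h' k : h' k - tact tau h' k = c k * al (shift opt h').
    have := alE (shift opt h') k; rewrite tactp_shift_opt !shift_opt //.
  have := aser_dvd (al := fun h => al (shift opt h)) (unimod_le tauU) E1 Hq' H'' hb.
  rewrite tactp_shift_opt => <-; congr (_ * g'' _).
  by apply/funext => k; rewrite shift_opt.
Qed.

(* [al * kap al] is analytic at the origin: [kap al = exp al / (exp al - exp (- al))] and
   the denominator is divisible by [al]. *)
Lemma An_al_kap : exists Z, An opt Z /\
  nearp opt (fun y => al y != 0 -> kap (al y) * al y = Z y).
Proof.
have [G [AG NG]] := An_dvd (An_exp (AnN alA)).
(* Otherwise [|G| <= 1 / 2] near the origin; along the direction [d], where [al = s], this makes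
   [e^s - e^(-s)] at most [s / 2], which is too small. *)
have G0 : G opt != 0.
  apply/eqP => G0; have h2 : (0 : R) < 1 / 2 by rewrite divr_gt0.
  have [e [e0 He]] := nearp_and NG (An_cont h2 AG).
  pose s := Num.min e 1.
  have s0 : 0 < s by rewrite lt_min e0 ltr01.
  have s1 : s <= 1 by rewrite ge_min lexx orbT.
  have hb : inbox e (fun k => s * d k).
    move=> k; rewrite normrM gtr0_norm //; apply: le_trans (_ : s * 1 <= _).
      by rewrite ler_wpM2l // ltW.
    by rewrite mulr1 ge_min lexx.
  have [] := He _ hb; rewrite G0 subr0 ald alT ald opprK => E1 E2.
  have h3 := expR_ge1Dx s.
  have h4 : expR (- s) * (1 + s) <= 1.
    rewrite -[leRHS]expR0 -(addNr s) expRD ler_wpM2l ?expR_ge0 //.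
  have h5 : `|s * G (shift opt (fun k => s * d k))| <= s / 2.
    by rewrite normrM (gtr0_norm s0); apply: le_trans (ler_wpM2l (ltW s0) E2) _; lra.
  rewrite E1 ler_norml in h5; case/andP: h5 => h5 h6.
  by have h7 := expR_gt0 (- s); nra.
exists (fun y => - (expR (al y) / G y)); split.
  by apply: AnN; apply: AnM; [exact: An_exp|exact: AnV].
apply: nearp_sub (nearp_and NG (An_neq0_near AG G0)) => y [E Gy] ay.
rewrite alT opprK in E.
have E2 : 1 - expR (-2 * al y) = - (al y * G y) / expR (al y).
  rewrite E opprB mulrBl divff ?gt_eqF ?expR_gt0 //; congr (_ - _).
  by rewrite -expRN -expRD; congr expR; ring.
rewrite /kap E2; have p := gt_eqF (expR_gt0 (al y)).
by field; rewrite p ay Gy.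
Qed.

(** The pole of [kap al] meets the zero of the difference on the wall: the product is [kap al * al]
    times a divided difference, both analytic. *)
Lemma AnR_root F : AnR F -> AnR (fun y => kap (al y) * (F y - F (tactp tau y))).
Proof.
move=> [f [A [e [e0 N]]]]; have [Z [AZ NZ]] := An_al_kap; have [G [AG NG]] := An_dvd A.
exists (fun y => Z y * G y); split; first exact: AnM.
have N2 : nearp opt (fun y => regular y -> F y = f y /\ F (tactp tau y) = f (tactp tau y)).
  exists e; split=> // h hb ry; split; first exact: N.
  have rt := regular_tactp tauU ry; rewrite tactp_shift_opt in rt *.
  apply: N => // k; rewrite /tact normrM; apply: le_trans (hb (tau k).2).
  by rewrite ler_piMl // unimod_le.
apply: nearp_sub (nearp_and N2 (nearp_and NZ NG)) => y [E [E1 E2]] ry.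
have [-> ->] := E ry; rewrite -E2 -E1 ?al0 //; ring.
Qed.

End OneRoot.

Lemma tactp_tnth (tau : 'I_r -> R * 'I_r) y k :
  tnth (tactp tau y) k = (tau k).1 * tnth y (tau k).2.
Proof. by rewrite tnth_mktuple. Qed.

Lemma AnR_tactp tau F : unimod tau -> AnR F -> AnR (fun y => F (tactp tau y)).
Proof.
move=> tU [f [A [e [e0 N]]]]; exists (fun y => f (tactp tau y)); split.
  apply: An_tact; first exact: unimod_le.
  rewrite (_ : tactp tau opt = opt) //.
  by apply: eq_from_tnth => k; rewrite !tnth_mktuple mulr0.
exists e; split=> // h hb /(regular_tactp tU); rewrite tactp_shift_opt => ry.
apply: N => // k; rewrite /tact normrM; apply: le_trans (hb (tau k).2).
by rewrite ler_piMl // unimod_le.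
Qed.

Lemma AnR_opA (i j : 'I_r) F : i != j -> AnR F -> AnR (opA a i j F).
Proof.
move=> ij HF; have ji : (j == i) = false by rewrite eq_sym (negPf ij).
have H1 : AnR (fun y => kap (tnth y i - tnth y j) * (F y - F (tactp (tsw i j) y))).
  apply: (@AnR_root _ (fun k => (k == i)%:R - (k == j)%:R) _ (fun k => (k == i)%:R)) => //.
  - exact: unimod_tsw.
  - by move=> k; case: (k == i); case: (k == j); rewrite ?subrr ?subr0 ?sub0r ?normr0 ?normrN ?normr1; lra.
  - exact: An_sub_coord.
  - move=> y k; rewrite tactp_tnth /= mul1r.
    case: (eqVneq k i) => [->|ki]; first by rewrite (negPf ij) subr0 mul1r.
    by case: (eqVneq k j) => [->|kj] /=; ring.
  - by move=> y; rewrite !tactp_tnth /= !eqxx ji !mul1r opprB.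
  - by move=> k; case: eqP; rewrite ?normr1 ?normr0.
  - by move=> e; rewrite !shift_opt eqxx ji mulr1 mulr0 subr0.
  - by move=> y ry; exact: reg_sub_neq0.
have H2 : AnR (fun y => kap (tnth y i + tnth y j) * (F y - F (tactp (tsg i j) y))).
  apply: (@AnR_root _ (fun k => (k == i)%:R + (k == j)%:R) _ (fun k => (k == i)%:R)) => //.
  - exact: unimod_tsg.
  - by move=> k; case: (k == i); case: (k == j); rewrite /= ?addr0 ?add0r ?normr0 ?normr1 ?ger0_norm; lra.
  - exact: An_add_coord.
  - move=> y k; rewrite tactp_tnth /=.
    case: (eqVneq k i) => [->|ki]; first by rewrite (negPf ij) /=; ring.
    by case: (eqVneq k j) => [->|kj] /=; ring.
  - by move=> y; rewrite !tactp_tnth /= !eqxx ji orbT /=; ring.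
  - by move=> k; case: eqP; rewrite ?normr1 ?normr0.
  - by move=> e; rewrite !shift_opt eqxx ji mulr1 mulr0 addr0.
  - by move=> y ry; exact: reg_add_neq0.
have H3 := AnR_tactp (unimod_tsw i j) HF.
have := AnRD (AnRZ a H1) (AnRD (AnRZ (- a * (j < i)%:R) (AnRB HF H3)) (AnRZ a H2)).
by apply: AnR_ext => y _; rewrite /opA s_ijE sigma_ijE; ring.
Qed.

Lemma AnR_opB (i : 'I_r) F : AnR F -> AnR (opB b iota i F).
Proof.
move=> HF.
have H1 : AnR (fun y => kap (2 * tnth y i) * (F y - F (tactp (tng i) y))).
  apply: (@AnR_root _ (fun k => (k == i)%:R) _ (fun k => (k == i)%:R / 2)) => //.
  - exact: unimod_tng.
  - by move=> k; case: (k == i); rewrite ?normr0 ?normr1; lra.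
  - exact: An_dbl_coord.
  - move=> y k; rewrite tactp_tnth /=; case: (eqVneq k i) => [->|ki] /=; ring.
  - by move=> y; rewrite !tactp_tnth /= !eqxx; ring.
  - by move=> k; case: (k == i) => /=; rewrite ?mul0r ?normr0 ?mul1r ?ger0_norm; lra.
  - by move=> e; rewrite !shift_opt eqxx /=; field.
  - by move=> y [ry _]; rewrite mulf_neq0 ?pnatr_eq0.
have H2 : AnR (fun y => kap (tnth y i) * (F y - F (tactp (tng i) y))).
  apply: (@AnR_root _ (fun k => (k == i)%:R * 2) _ (fun k => (k == i)%:R)) => //.
  - exact: unimod_tng.
  - by move=> k; case: (k == i); rewrite ?mul1r ?mul0r ?normr0 ?ger0_norm; lra.
  - exact: An_coord.
  - move=> y k; rewrite tactp_tnth /=; case: (eqVneq k i) => [->|ki] /=; ring.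
  - by move=> y; rewrite !tactp_tnth /= !eqxx; ring.
  - by move=> k; case: eqP; rewrite ?normr0 ?normr1.
  - by move=> e; rewrite !shift_opt eqxx mulr1.
  - by move=> y [ry _].
have := AnRD (AnRZ (2 * iota) H1) (AnRZ (2 * b) H2).
by apply: AnR_ext => y _; rewrite /opB sigma_iE; ring.
Qed.

Lemma AnR_Dch i F : AnR F -> AnR (Dch a b iota i F).
Proof.
move=> HF; apply: AnRB; last exact: AnRZ.
apply: AnRD; last exact: AnR_opB.
apply: AnRD; first exact: AnR_der.
by apply: AnR_sum => j ji; apply: AnR_opA; rewrite 1?eq_sym.
Qed.

Lemma AnR_DV i (U : gfun) : AnR U -> AnR (DV a b iota i U).
Proof. by move=> /(AnR_Dch i); apply: AnR_ext => y ry; rewrite DVE. Qed.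

End AtOrigin.

(** * Signed permutations as a finite index set *)

Section SignedPermutations.
Context {R : realType} {r : nat}.

(** Sums over an orbit run over this type; of the group structure only left translation by an
    involution, [wrefl], is used. *)
Definition hyp := ('S_r * {ffun 'I_r -> bool})%type.
Implicit Types (w g : hyp) (z : r.-tuple R).

Definition wt w : 'I_r -> R * 'I_r := fun k => (if w.2 k then -1 else 1, w.1 k).
Definition act w z : r.-tuple R := tactp (wt w) z.

Lemma unimod_wt w : unimod (wt w).
Proof.
by split=> [k|]; [rewrite /wt /=; case: ifP; [right|left]|exact: (@perm_inj _ w.1)].
Qed.

Definition wrefl g w : hyp := ((g.1 * w.1)%g, [ffun k => g.2 k (+) w.2 (g.1 k)]).

Lemma act_wrefl g w z : act (wrefl g w) z = tactp (wt g) (act w z).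
Proof.
apply: eq_from_tnth => k; rewrite !tnth_mktuple /= permM ffunE.
by case: (g.2 k); case: (w.2 (g.1 k)) => /=; ring.
Qed.

Definition invol g := (forall k, g.1 (g.1 k) = k) /\ (forall k, g.2 (g.1 k) = g.2 k).

Lemma wreflK g : invol g -> involutive (wrefl g).
Proof.
move=> [i1 i2] [p e]; congr (_, _); first by apply/permP => k; rewrite !permM i1.
by apply/ffunP => k; rewrite !ffunE /= i2 i1 addbA addbb.
Qed.

Definition gsw (i j : 'I_r) : hyp := (tperm i j, [ffun=> false]).
Definition gsg (i j : 'I_r) : hyp := (tperm i j, [ffun k => (k == i) || (k == j)]).
Definition gng (i : 'I_r) : hyp := (1%g, [ffun k => k == i]).

Lemma tpermE' (i j k : 'I_r) : tperm i j k = if k == i then j else if k == j then i else k.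
Proof. by case: tpermP => [->|->|/eqP/negPf-> /eqP/negPf->] //; rewrite ?eqxx //; case: eqP => [->|]. Qed.

Lemma invol_gsw i j : invol (gsw i j).
Proof. by split=> k /=; [rewrite tpermK|rewrite !ffunE]. Qed.
Lemma invol_gsg i j : invol (gsg i j).
Proof.
split=> k /=; first by rewrite tpermK.
rewrite !ffunE; case: tpermP => [->|->|] //; rewrite ?eqxx ?orbT //.
Qed.
Lemma invol_gng i : invol (gng i).
Proof. by split=> k /=; rewrite !perm1. Qed.

Lemma wt_gsw i j : wt (gsw i j) = tsw i j.
Proof. by apply/funext => k; rewrite /wt /= ffunE tpermE'. Qed.
Lemma wt_gsg i j : wt (gsg i j) = tsg i j.
Proof. by apply/funext => k; rewrite /wt /= ffunE tpermE'. Qed.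
Lemma wt_gng i : wt (gng i) = tng i.
Proof. by apply/funext => k; rewrite /wt /= ffunE perm1. Qed.

Lemma act_id z : act (1%g, [ffun=> false]) z = z.
Proof. by apply: eq_from_tnth => k; rewrite tnth_mktuple /= ffunE perm1 mul1r. Qed.

Lemma regular_act w z : regular z -> regular (act w z).
Proof. by apply: regular_tactp; exact: unimod_wt. Qed.

Definition l1 z : R := \sum_k `|tnth z k|.

Lemma l1_act w z : l1 (act w z) = l1 z.
Proof.
rewrite /l1 [RHS](reindex_perm w.1) /=; apply: eq_bigr => k _.
by rewrite tnth_mktuple /=; case: ifP; rewrite ?mulN1r ?normrN ?mul1r.
Qed.

End SignedPermutations.

(** * The reflection terms have a sign along rays *)

Section Dissipation.
Context {R : realType} {r : nat}.
Variables (a b iota : R).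
Hypotheses (a0 : 0 <= a) (b0 : 0 <= b) (i0 : 0 <= iota).
Local Notation pt := (r.-tuple R).
Implicit Types (w : @hyp r) (z t : pt) (F : pt -> R).

(** [kap x - 1 / 2] is half of [coth x] and has the sign of [x]. *)
Lemma kap_half (x : R) : x != 0 -> 0 <= x * (kap x - 1 / 2).
Proof.
move=> x0; have e0 := exp_neq1 x0.
have -> : x * (kap x - 1 / 2) = x * (1 - expR (-2 * x)) * (1 + expR (-2 * x)) / (2 * (1 - expR (-2 * x)) ^+ 2).
  by rewrite /kap; field.
have p := expR_gt0 (-2 * x).
apply: divr_ge0; last by rewrite mulr_ge0 ?sqr_ge0.
apply: mulr_ge0; last by lra.
case: (ltrgt0P x) x0 => // [xp|xn] _.
  by rewrite mulr_ge0 ?ltW // subr_gt0 -[ltRHS]expR0 ltr_expR; lra.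
by rewrite mulr_le0 ?ltW // subr_lt0 -[ltLHS]expR0 ltr_expR; lra.
Qed.

(** The summands at [w] and at the reflected [wrefl g w] are paired: [al] changes sign and [kap]
    becomes [1 - kap]. With [x = al (act w z)] and the two values [u], [v] of [F], the pair exceeds
    its share of the left side by [x * (kap x - 1 / 2) * (u - v) ^ 2]. *)
Lemma root_dissipation (g : @hyp r) (al : pt -> R) F z : invol g -> regular z ->
  (forall y, al (tactp (wt g) y) = - al y) -> (forall y, regular y -> al y != 0) ->
  1 / 2 * (\sum_w al (act w z) * F (act w z) ^+ 2) <=
  \sum_w F (act w z) * (al (act w z) * kap (al (act w z))) * (F (act w z) - F (tactp (wt g) (act w z))).
Proof.
move=> ig rz alN al0.
have inj : injective (wrefl g) by exact: inv_inj (wreflK ig).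
set S := leRHS.
have S2 : S = \sum_w F (act (wrefl g w) z) * (al (act (wrefl g w) z) * kap (al (act (wrefl g w) z)))
   * (F (act (wrefl g w) z) - F (tactp (wt g) (act (wrefl g w) z))).
  exact: (reindex_inj inj).
have A2 : \sum_w al (act w z) * F (act w z) ^+ 2 =
  - \sum_w al (act w z) * F (act (wrefl g w) z) ^+ 2.
  rewrite (reindex_inj inj) /= -sumrN; apply: eq_bigr => w _.
  by rewrite {1}act_wrefl alN mulNr.
have E : 1 / 2 * (\sum_w al (act w z) * F (act w z) ^+ 2 - \sum_w al (act w z) * F (act (wrefl g w) z) ^+ 2)
   <= S + S; last by move: E; rewrite A2; lra.
rewrite {2}S2 -sumrB mulr_sumr -big_split /=; apply: ler_sum => w _.
have tt : tactp (wt g) (act (wrefl g w) z) = act w z by rewrite -act_wrefl wreflK.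
rewrite tt -act_wrefl.
have -> : al (act (wrefl g w) z) = - al (act w z) by rewrite act_wrefl alN.
have n0 := al0 _ (regular_act w rz); rewrite (kapN n0).
have h := kap_half n0; set x := al _ in h *; set u := F _; set v := F (act _ _).
have h2 : 0 <= x * (kap x - 1 / 2) * (u - v) ^+ 2 by rewrite mulr_ge0 ?sqr_ge0.
rewrite -subr_ge0; apply: le_trans h2 _; rewrite le_eqVlt; apply/orP; left; apply/eqP; by field.
Qed.

Lemma count_gt n (j : nat) : (j < n)%N -> (\sum_(k < n | (j < k)%N) 1 = n - 1 - j)%N.
Proof.
elim: n => // n IH; rewrite ltnS leq_eqVlt big_mkcond big_ord_recr /= -big_mkcond /=.
case: (ltngtP j n) => //= [lt _|-> _].
  by rewrite IH //; lia.
rewrite big_pred0 ?subSS ?subn0 ?subnn //.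
by move=> k; apply/negbTE; rewrite -leqNgt ltnW.
Qed.

Lemma sum_off_diag (f : 'I_r -> 'I_r -> R) :
  \sum_j \sum_(k | k != j) f j k = \sum_(j < r) \sum_(k < r | (j < k)%N) (f j k + f k j).
Proof.
have -> : \sum_(j < r) \sum_(k < r | (j < k)%N) (f j k + f k j) =
  \sum_(j < r) \sum_(k < r | (j < k)%N) f j k + \sum_(j < r) \sum_(k < r | (k < j)%N) f j k.
  rewrite [X in _ = _ + X](exchange_big_dep xpredT) //= -big_split /=; apply: eq_bigr => j _.
  by rewrite big_split.
rewrite -big_split /=; apply: eq_bigr => j _; rewrite (bigID (fun k : 'I_r => (j < k)%N)) /=.
congr (_ + _); apply: eq_bigl => k.
  by case: (ltnP j k) => jk; rewrite ?andbF ?andbT //; apply/negP => /eqP E; rewrite E ltnn in jk.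
by rewrite -leqNgt ltn_neqAle -val_eqE.
Qed.

Lemma sigma_ijC (i j : 'I_r) : sigma_ij i j = sigma_ij j i :> (pt -> pt).
Proof.
apply/funext => t; apply: eq_from_tnth => k; rewrite !tnth_mktuple.
by case: (k =P i) => E1; case: (k =P j) => E2 //; rewrite -E1 -E2.
Qed.

(** [\sum_j rho_j t_j] is half the sum of the positive roots with multiplicities. Distributing it
    over the roots gives each reflection term the correction [- 1 / 2 * al * F] that
    [root_dissipation] needs. *)
Lemma radial_expand F t : regular t ->
  \sum_j tnth t j * (\sum_(k | k != j) opA a j k F t + opB b iota j F t - rho_j a b iota j * F t) =
  \sum_(j < r) \sum_(k < r | (j < k)%N)
    (a * (((tnth t j - tnth t k) * kap (tnth t j - tnth t k)) * (F t - F (s_ij j k t))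
      - 1 / 2 * (tnth t j - tnth t k) * F t)
    + a * (((tnth t j + tnth t k) * kap (tnth t j + tnth t k)) * (F t - F (sigma_ij j k t))
      - 1 / 2 * (tnth t j + tnth t k) * F t))
  + \sum_j (iota * ((2 * tnth t j * kap (2 * tnth t j)) * (F t - F (sigma_i j t)) - 1 / 2 * (2 * tnth t j) * F t)
      + 2 * b * ((tnth t j * kap (tnth t j)) * (F t - F (sigma_i j t)) - 1 / 2 * tnth t j * F t)).
Proof.
move=> rt.
have -> : \sum_j tnth t j * (\sum_(k | k != j) opA a j k F t + opB b iota j F t - rho_j a b iota j * F t) =
  \sum_j \sum_(k | k != j) tnth t j * opA a j k F t + \sum_j tnth t j * opB b iota j F t
  - \sum_j tnth t j * rho_j a b iota j * F t.
  rewrite -big_split -sumrB /=; apply: eq_bigr => j _; rewrite -mulr_sumr; ring.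
have -> : \sum_j tnth t j * rho_j a b iota j * F t =
  \sum_(j < r) \sum_(k < r | (j < k)%N) a * tnth t j * F t + \sum_j (iota + b) * tnth t j * F t.
  rewrite -big_split /=; apply: eq_bigr => j _.
  have -> : \sum_(k < r | (j < k)%N) a * tnth t j * F t = a * tnth t j * F t * (r - 1 - j)%:R.
    by rewrite -(count_gt (ltn_ord j)) natr_sum mulr_sumr; apply: eq_bigr => k _; rewrite mulr1.
  by rewrite /rho_j; ring.
rewrite sum_off_diag opprD addrACA -sumrB -sumrB; congr (_ + _).
  apply: eq_bigr => j _; rewrite -sumrB; apply: eq_bigr => k jk.
  have jk' : j != k by apply: contraTneq jk => ->; rewrite ltnn.
  rewrite /opA [s_ij k j]s_ijC [sigma_ij k j]sigma_ijC jk ltnNge (ltnW jk) /=.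
  rewrite (kap_Bsym (reg_sub_neq0 rt jk')) [tnth t k + tnth t j]addrC.
  by field.
by apply: eq_bigr => j _; rewrite /opB; field.
Qed.

Lemma dissipation F z : regular z ->
  0 <= \sum_w F (act w z) * \sum_j tnth (act w z) j *
    (\sum_(k | k != j) opA a j k F (act w z) + opB b iota j F (act w z)
     - rho_j a b iota j * F (act w z)).
Proof.
move=> rz; have rw w := regular_act w rz.
under eq_bigr do rewrite radial_expand // mulrDr !mulr_sumr.
under eq_bigr do under eq_bigr do rewrite mulr_sumr.
rewrite big_split /=; apply: addr_ge0.
  rewrite exchange_big; apply: sumr_ge0 => j _; rewrite exchange_big; apply: sumr_ge0 => k jk.
  have jk' : j != k by apply: contraTneq jk => ->; rewrite ltnn.
  have kj : (k == j) = false by rewrite eq_sym (negPf jk').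
  have D1 := @root_dissipation (gsw j k) (fun t => tnth t j - tnth t k) F z (invol_gsw j k) rz _ _.
  have D2 := @root_dissipation (gsg j k) (fun t => tnth t j + tnth t k) F z (invol_gsg j k) rz _ _.
  have {}D1 := D1 ltac:(by move=> y; rewrite wt_gsw !tactp_tnth /= !eqxx kj !mul1r opprB)
                  ltac:(by move=> y ry; exact: reg_sub_neq0).
  have {}D2 := D2 ltac:(by move=> y; rewrite wt_gsg !tactp_tnth /= !eqxx kj orbT /=; ring)
                  ltac:(by move=> y ry; exact: reg_add_neq0).
  under eq_bigr do rewrite mulrDr.
  rewrite big_split /=; apply: addr_ge0.
    under eq_bigr do rewrite mulrCA.
    rewrite -mulr_sumr mulr_ge0 //; move: D1; rewrite -subr_ge0 mulr_sumr -sumrB.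
    move=> /le_trans; apply; rewrite le_eqVlt; apply/orP; left; apply/eqP; apply: eq_bigr => w _.
    by rewrite wt_gsw -s_ijE; ring.
  under eq_bigr do rewrite mulrCA.
  rewrite -mulr_sumr mulr_ge0 //; move: D2; rewrite -subr_ge0 mulr_sumr -sumrB.
  move=> /le_trans; apply; rewrite le_eqVlt; apply/orP; left; apply/eqP; apply: eq_bigr => w _.
  by rewrite wt_gsg -sigma_ijE; ring.
rewrite exchange_big; apply: sumr_ge0 => j _.
have D1 := @root_dissipation (gng j) (fun t => 2 * tnth t j) F z (invol_gng j) rz _ _.
have D2 := @root_dissipation (gng j) (fun t => tnth t j) F z (invol_gng j) rz _ _.
have {}D1 := D1 ltac:(by move=> y; rewrite wt_gng !tactp_tnth /= !eqxx /=; ring)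
                ltac:(by move=> y [ry _]; rewrite mulf_neq0 ?pnatr_eq0).
have {}D2 := D2 ltac:(by move=> y; rewrite wt_gng !tactp_tnth /= !eqxx /=; ring)
                ltac:(by move=> y [ry _]).
under eq_bigr do rewrite mulrDr.
rewrite big_split /=; apply: addr_ge0.
  under eq_bigr do rewrite mulrCA.
  rewrite -mulr_sumr mulr_ge0 //; move: D1; rewrite -subr_ge0 mulr_sumr -sumrB.
  move=> /le_trans; apply; rewrite le_eqVlt; apply/orP; left; apply/eqP; apply: eq_bigr => w _.
  by rewrite wt_gng -sigma_iE; ring.
under eq_bigr do rewrite mulrCA.
rewrite -mulr_sumr mulr_ge0 ?mulr_ge0 //; move: D2; rewrite -subr_ge0 mulr_sumr -sumrB.
move=> /le_trans; apply; rewrite le_eqVlt; apply/orP; left; apply/eqP; apply: eq_bigr => w _.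
by rewrite wt_gng -sigma_iE; ring.
Qed.

End Dissipation.

(** * Energy estimate along rays *)

Section EnergyBound.
Context {R : realType} {r : nat}.
Variables (a b iota : R).
Hypotheses (a0 : 0 <= a) (b0 : 0 <= b) (i0 : 0 <= iota).
Local Notation DL := (@DL R r a b iota).
Implicit Types (w : @hyp r) (x z t : r.-tuple R) (F : r.-tuple R -> R).

Lemma act_path w x s : act w (path opt x s) = path opt (act w x) s.
Proof. by apply: eq_from_tnth => k; rewrite !tnth_mktuple !add0r mulrCA. Qed.

Lemma tnth_path0 x s k : tnth (path opt x s) k = s * tnth x k.
Proof. by rewrite !tnth_mktuple add0r. Qed.

Lemma regular_path x s : s != 0 -> regular x -> regular (path opt x s).
Proof.
move=> s0 [H1 H2]; split=> [j|i j ij]; rewrite !tnth_path0; first by rewrite mulf_neq0.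
by have [n1 n2] := H2 i j ij; rewrite -mulrN !(inj_eq (mulfI s0)).
Qed.

Lemma is_derive_sumf (I : Type) (s : seq I) (f : I -> R -> R) (df : I -> R) (u : R) :
  (forall i, is_derive u 1 (f i) (df i)) ->
  is_derive u 1 (fun v => \sum_(i <- s) f i v) (\sum_(i <- s) df i).
Proof.
move=> H; elim: s => [|i s IH].
  rewrite big_nil (_ : (fun v => _) = cst 0); first exact: is_derive_cst.
  by apply/funext => v; rewrite big_nil.
rewrite big_cons (_ : (fun v => _) = (f i + (fun v => \sum_(i <- s) f i v))).
  exact: is_deriveD.
by apply/funext => v; rewrite big_cons.
Qed.

Lemma is_derive_nonincr (f df : R -> R) (u v : R) : 0 < u -> u <= v ->
  (forall s : R, 0 < s -> is_derive s 1 f (df s)) -> (forall s : R, 0 < s -> df s <= 0) -> f v <= f u.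
Proof.
move=> u0 uv D le0.
apply: (@ler0_derive1_nincr R f u v) => //.
- by move=> s; rewrite in_itv /= => /andP[us _]; have Ds := D s (lt_trans u0 us); exact: ex_derive.
- move=> s; rewrite in_itv /= => /andP[us _]; have Ds := D s (lt_trans u0 us).
  by rewrite derive1E derive_val; exact: le0 (lt_trans u0 us).
- apply: derivable_within_continuous => s; rewrite in_itv /= => /andP[us _].
  by have Ds := D s (lt_le_trans u0 us); exact: ex_derive.
Qed.

Variables (eps : R) (I : finType) (Psi : I -> @gfun R r) (M : 'I_r -> I -> I -> R).
Hypotheses (eps0 : 0 < eps)
  (DPsi : forall j i, DL j (Psi i) = \sum_i' M j i i' *: Psi i')
  (Mb : forall j (v : I -> R), `|\sum_i \sum_i' v i * M j i i' * v i'| <= eps * \sum_i v i ^+ 2).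

(** The reflection terms couple the values at all points of the orbit of [s x]; only their sum over
    the orbit has a sign. *)
Definition energy x s : R := \sum_w \sum_i Psi i (path opt (act w x) s) ^+ 2.

Definition denergy x s : R := \sum_w \sum_i 2 * Psi i (path opt (act w x) s) *
  \sum_j tnth (act w x) j * der j (Psi i) (path opt (act w x) s).

Lemma is_derive_energy x (s : R) : regular x -> s != 0 -> is_derive s 1 (energy x) (denergy x s).
Proof.
move=> rx s0; rewrite /energy /denergy; apply: is_derive_sumf => w; apply: is_derive_sumf => i.
have D := An_path (gfun_good (Psi i) (regular_path s0 (regular_act w rx))).
have := is_deriveM D D; set P := fun _ => _ => D2.
rewrite (_ : (fun v => _) = P * P); last by apply/funext => v; rewrite expr2.
by apply: is_derive_eq D2 _; rewrite /GRing.scale /=; rewrite /P; ring.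
Qed.

Lemma gfun_sumE (J : finType) (c : J -> R) (G : J -> gfun) t :
  (\sum_i c i *: G i : gfun) t = \sum_i c i * G i t.
Proof. by elim/big_rec2: _ => // i y1 y2 _ <-. Qed.

(** Each derivative is [D_j] minus its reflection part. The reflection part can only lower the
    energy ([dissipation]), and [D_j] acts through [M j] with numerical radius [eps]; the weights
    [|x_j|] add up to [l1 x], which is constant on the orbit. *)
Lemma denergy_le x s : regular x -> 0 < s -> denergy x s <= 2 * eps * l1 x * energy x s.
Proof.
move=> rx s0; have sn := lt0r_neq0 s0.
have rz := regular_path sn rx; set z := path opt x s in rz.
have zE w : path opt (act w x) s = act w z by rewrite -act_path.
rewrite -(ler_pM2l s0).
have -> : s * denergy x s = 2 * \sum_w \sum_i Psi i (act w z) *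
   \sum_j tnth (act w z) j * der j (Psi i) (act w z).
  rewrite /denergy !mulr_sumr; apply: eq_bigr => w _; rewrite !mulr_sumr; apply: eq_bigr => i _.
  rewrite zE -!mulrA mulrCA; congr (_ * _); rewrite mulrCA; congr (_ * _).
  by rewrite mulr_sumr; apply: eq_bigr => j _; rewrite -zE tnth_path0 mulrA.
have -> : energy x s = \sum_w \sum_i Psi i (act w z) ^+ 2.
  by apply: eq_bigr => w _; rewrite zE.
have El1 : s * l1 x = l1 z.
  by rewrite /l1 mulr_sumr; apply: eq_bigr => k _; rewrite tnth_path0 normrM gtr0_norm.
have -> : s * (2 * eps * l1 x * (\sum_w \sum_i Psi i (act w z) ^+ 2)) =
   2 * \sum_w (l1 z * (eps * \sum_i Psi i (act w z) ^+ 2)).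
  by rewrite -El1 -mulr_sumr -mulr_sumr; ring.
rewrite ler_pM2l //.
apply: le_trans (_ : \sum_w \sum_i Psi i (act w z) * \sum_j tnth (act w z) j * DL j (Psi i) (act w z) <= _).
  rewrite -subr_ge0 -sumrB.
  have E w : \sum_i Psi i (act w z) * (\sum_j tnth (act w z) j * DL j (Psi i) (act w z)) -
      \sum_i Psi i (act w z) * (\sum_j tnth (act w z) j * der j (Psi i) (act w z)) =
      \sum_i Psi i (act w z) * \sum_j tnth (act w z) j *
        (\sum_(k | k != j) opA a j k (Psi i) (act w z) + opB b iota j (Psi i) (act w z)
         - rho_j a b iota j * Psi i (act w z)).
    rewrite -sumrB; apply: eq_bigr => i _; rewrite -mulrBr -sumrB; congr (_ * _).
    apply: eq_bigr => j _; rewrite -mulrBr; congr (_ * _).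
    rewrite /DL DVE /Dch; last exact: regular_act.
    ring.
  under eq_bigr do rewrite E.
  rewrite exchange_big; apply: sumr_ge0 => i _; exact: dissipation.
apply: ler_sum => w _.
have -> : \sum_i Psi i (act w z) * (\sum_j tnth (act w z) j * DL j (Psi i) (act w z)) =
  \sum_j tnth (act w z) j * \sum_i \sum_i' Psi i (act w z) * M j i i' * Psi i' (act w z).
  have DE j i t : DL j (Psi i) t = \sum_i' M j i i' * Psi i' t by rewrite DPsi gfun_sumE.
  under eq_bigr do (rewrite mulr_sumr; under eq_bigr do rewrite DE).
  rewrite exchange_big /=; apply: eq_bigr => j _; rewrite mulr_sumr; apply: eq_bigr => i _.
  rewrite mulrCA; congr (_ * _); rewrite mulr_sumr; apply: eq_bigr => i' _.
  by rewrite mulrA.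
rewrite -(l1_act w z) /l1 mulr_suml; apply: ler_sum => j _.
apply: le_trans (ler_norm _) _; rewrite normrM ler_wpM2l //.
Qed.

Lemma energy_ge x i : Psi i x ^+ 2 <= energy x 1.
Proof.
rewrite /energy (bigD1 (1%g, [ffun=> false])) //= (bigD1 i) //= act_id.
have -> : path opt x 1 = x by apply: eq_from_tnth => k; rewrite tnth_path0 mul1r.
rewrite -addrA lerDl addr_ge0 ?sumr_ge0 // => [j _|w _]; first exact: sqr_ge0.
by apply: sumr_ge0 => j _; exact: sqr_ge0.
Qed.

(** Gronwall's inequality from a point [s x] near the origin, where [AnR] bounds all members of the
    family, out to [x]. The bound at the starting point does not depend on [x]. *)
Lemma energy_bound : (forall i, AnR (Psi i)) ->
  exists2 C, 0 <= C & forall x i, regular x -> `|Psi i x| <= C * expR (eps * l1 x).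
Proof.
move=> A0; have /choice [c Hc] := fun i => AnR_bounded (A0 i).
have [d [d0 Hd]] := nearp_forall Hc.
pose K := \sum_(w : @hyp r) \sum_i c i ^+ 2.
have K0 : 0 <= K by do 2!(apply: sumr_ge0 => ? _); exact: sqr_ge0.
exists (Num.sqrt K); first exact: sqrtr_ge0.
move=> x i rx.
have L0 : 0 <= l1 x by apply: sumr_ge0.
have xk k : `|tnth x k| <= l1 x by rewrite /l1 (bigD1 k) //= lerDl sumr_ge0.
(* Brings the whole orbit of [s x] into the box of radius [d]. *)
pose s := Num.min 1 (d / (l1 x + 1)).
have s0 : 0 < s by rewrite lt_min ltr01 divr_gt0 //; lra.
have s1 : s <= 1 by rewrite ge_min lexx.
have sd : s * l1 x <= d.
  apply: le_trans (_ : s * (l1 x + 1) <= _); first by rewrite ler_wpM2l ?ltW //; lra.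
  by rewrite -ler_pdivlMr ?ge_min ?lexx ?orbT //; lra.
have hb w : inbox d (fun k => tnth (path opt (act w x) s) k - tnth opt k).
  move=> k; rewrite tnth_path0 [tnth opt k]tnth_mktuple subr0 normrM gtr0_norm //.
  apply: le_trans sd; apply: ler_wpM2l; first exact: ltW.
  rewrite -(l1_act w x) /l1 (bigD1 k) //= lerDl.
  exact: sumr_ge0.
have Es : energy x s <= K.
  apply: ler_sum => w _; apply: ler_sum => j _.
  have rp : regular (path opt (act w x) s).
    by apply: regular_path; [exact: lt0r_neq0|exact: regular_act].
  have B : `|Psi j (path opt (act w x) s)| <= c j.
    by have := Hd _ (hb w) j; rewrite shiftK; exact.
  rewrite -real_normK ?num_real // lerXn2r ?nnegrE //.
  exact: le_trans (normr_ge0 _) B.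
pose m := 2 * eps * l1 x.
have m0 : 0 <= m by rewrite !mulr_ge0 // ltW.
have N : energy x 1 * expR (- m * 1) <= energy x s * expR (- m * s).
  apply: (@is_derive_nonincr (fun u => energy x u * expR (- m * u))
     (fun u => (denergy x u - m * energy x u) * expR (- m * u))) => // u u0.
    have D1 := is_derive_energy rx (lt0r_neq0 u0).
    have D2 : is_derive u 1 (fun v : R => - m * v) (- m).
      by have := is_deriveZ (- m) (is_derive_id u 1); rewrite /GRing.scale /= mulr1.
    have D3 := is_derive1_comp (is_derive_expR (- m * u)) D2.
    have D4 := is_deriveM D1 D3.
    by apply: is_derive_eq D4 _; rewrite /GRing.scale /=; ring.
  rewrite pmulr_lle0 ?expR_gt0 // subr_le0; exact: denergy_le.
have E1 : energy x 1 <= K * expR m.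
  rewrite -(ler_pM2r (expR_gt0 (- m))) -mulrA -expRD subrr expR0 mulr1.
  move: N; rewrite mulr1 => /le_trans; apply; rewrite -[leRHS]mulr1.
  apply: ler_pM => //; first by do 2!(apply: sumr_ge0 => ? _); exact: sqr_ge0.
  by rewrite -[leRHS]expR0 ler_expR mulNr oppr_le0 mulr_ge0 // ltW.
rewrite -(ler_pXn2r (_ : 0 < 2)%N) ?nnegrE ?mulr_ge0 ?sqrtr_ge0 ?expR_ge0 //.
rewrite real_normK ?num_real // exprMn sqr_sqrtr // -expRM_natl.
apply: le_trans (energy_ge x i) (le_trans E1 _).
by rewrite /m mulr2n; rewrite le_eqVlt; apply/orP; left; apply/eqP; congr (_ * expR _); ring.
Qed.

End EnergyBound.

(** * Growth of the spherical function and its iterates *)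

Lemma Nop_nth (R : rcfType) (V : lmodType R) (T : V -> V) (l : seq R) (v : V) :
  Nop (nth 0 l) T (size l) v = foldr (fun c w => T (T w) + c ^+ 2 *: w) v (rev l).
Proof.
have E (y y' : nat -> R) m : (forall n, (n < m)%N -> y n = y' n) -> Nop y T m v = Nop y' T m v.
  by elim: m => //= m IH H; rewrite IH ?H // => n nm; apply: H; exact: ltnW.
elim/last_ind: l => // l c IH; rewrite size_rcons rev_rcons /= nth_rcons ltnn eqxx -IH.
by rewrite (E _ (nth 0 l)) // => n nl; rewrite nth_rcons nl.
Qed.

Section Tempered.
Context {R : realType} {r : nat}.
Variables (a b iota : R).
Hypotheses (a0 : 0 <= a) (b0 : 0 <= b) (i0 : 0 <= iota).
Local Notation DL := (@DL R r a b iota).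

Definition bnd (eps : R) (F : r.-tuple R -> R) :=
  exists2 C, 0 <= C & forall x, regular x -> `|F x| <= C * expR (eps * l1 x).

(* Closed under the operators [D_j], which is what the integrations by parts need. *)
Definition tempered (eps : R) (F : @gfun R r) :=
  forall s : seq 'I_r, bnd eps (foldr (fun j G => DL j G) F s).

Lemma bnd_lin eps c F G : bnd eps F -> bnd eps G -> bnd eps (fun y => c * F y + G y).
Proof.
move=> [C C0 HF] [C' C'0 HG]; exists (`|c| * C + C'); first by rewrite addr_ge0 ?mulr_ge0.
move=> x rx; apply: le_trans (ler_normD _ _) _; rewrite mulrDl lerD ?HG //.
by rewrite normrM -mulrA ler_wpM2l // HF.
Qed.

Lemma tempered_bnd eps F : tempered eps F -> bnd eps F.
Proof. exact: (fun H => H [::]). Qed.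

Lemma tempered_DL eps j F : tempered eps F -> tempered eps (DL j F).
Proof.
move=> H s; have := H (rcons s j); rewrite -cats1 foldr_cat //.
Qed.

Lemma tempered_lin eps c F G : tempered eps F -> tempered eps G -> tempered eps (c *: F + G).
Proof.
move=> HF HG s.
have -> : foldr (fun j G => DL j G) (c *: F + G) s =
  c *: foldr (fun j G => DL j G) F s + foldr (fun j G => DL j G) G s.
  by elim: s => //= j s ->; rewrite linearP.
exact: (bnd_lin c (HF s) (HG s)).
Qed.

Lemma tempered_spherical (lam : r.-tuple R[i]) (phi : r.-tuple R -> R[i]) (part : R[i] -> R) :
  @is_part R r part -> (forall j, cre (tnth lam j) = 0) ->
  is_HO_spherical a b iota lam phi ->
  exists U : gfun, [/\ forall t, regular t -> part (phi t) = U t,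
    forall i, Eop DL U (enum 'I_r) i =
              esc (fun k => - cim (tnth lam k) ^+ 2) (enum 'I_r) i *: U &
    forall eps, 0 < eps -> tempered eps U].
Proof.
move=> P lam0 HO; have [U [UE UM]] := HO_eigen P lam0 HO.
exists U; split=> // eps eps0.
(* Reversed because [Nop_nth] reverses the list once more. *)
pose l := [seq cim (tnth lam k) | k <- rev (enum 'I_r)].
pose y := nth 0 l.
have A0 : AnR U.
  apply: (@AnR_ext _ _ (fun t => part (phi t))) => //; apply: AnR_An.
  case: HO => _ an _ _.
  apply: An_of_analytic (an _); [exact: (partD P)|exact: (part0 P)|exact: (part_le P)|exact: (partM P)].
(* In Vieta's formula with [X = D_k ^ 2] the factor of index [k] vanishes on the operator side; the
   scalar side is [\prod_j (D_k ^ 2 + y_j ^ 2)]. *)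
have N0 k : Nop y (DL k) r U = 0.
  pose X : {linear @gfun R r -> @gfun R r} := (DL k \o DL k)%FUN.
  have Xc j v : X (DL j v) = DL j (X v).
    exact: (etrans (congr1 (DL k) (DV_comm a b iota k j v)) (DV_comm a b iota k j (DL k v))).
  have H0 : Hop DL X U (enum 'I_r) = 0 by apply: (@Hop0 _ _ _ _ _ _ _ k) => //; rewrite mem_enum.
  rewrite (Hop_eigen Xc UM) in H0; rewrite -[RHS]H0.
  have sl : size l = r by rewrite size_map size_rev -cardE card_ord.
  have := Nop_nth (DL k) l U; rewrite sl -/y => ->; rewrite /l -map_rev revK /Hsc; elim: (enum 'I_r) => //= j s ->.
  by rewrite scaleNr opprK.
have AnR_D j (v : @gfun R r) : AnR v -> AnR (DL j v) by exact: AnR_DV.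
have AnR_lin c (v w : @gfun R r) : AnR v -> AnR w -> AnR (c *: v + w : gfun).
  by move=> Av Aw; exact: (AnRD (AnRZ c Av) Aw).
have [J [Psi [M [j0 [c0 [uE NP DP MP]]]]]] :=
  closed_system_exists eps0 (DV_comm a b iota : forall i j v, DL i (DL j v) = DL j (DL i v)) AnR_D AnR_lin (enum_uniq 'I_r) N0 A0.
(* Every iterate stays in the span of [Psi], so the bound on the finite family serves all words in
   the [D_j]. *)
have Sp (s : seq 'I_r) : exists c : J -> R, foldr (fun j G => DL j G) U s = \sum_i c i *: Psi i.
  elim: s => [|j s [c E]] /=.
    exists (fun i => (i == j0)%:R * c0); rewrite uE (bigD1 j0) //= eqxx mul1r big1 ?addr0 // => i /negPf ij.
    by rewrite ij mul0r scale0r.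
  exists (fun i' => \sum_i c i * M j i i'); rewrite E linear_sum /=.
  under eq_bigr do rewrite linearZ_LR /= (DP j _ (mem_enum _ j)) scaler_sumr.
  rewrite exchange_big /=; apply: eq_bigr => i' _; rewrite scaler_suml.
  by apply: eq_bigr => i _; rewrite scalerA.
have AP i : AnR (Psi i) := (NP i).1.
have [C C0 HC] := energy_bound a0 b0 i0 eps0 (fun j i => DP j i (mem_enum _ j))
  (fun j v => MP j v (mem_enum _ j)) AP.
move=> s; have [c E] := Sp s; exists (\sum_i `|c i| * C); first by apply: sumr_ge0 => i _; rewrite mulr_ge0.
move=> x rx; rewrite E gfun_sumE mulr_suml; apply: le_trans (ler_norm_sum _ _ _) _.
by apply: ler_sum => i _; rewrite normrM -mulrA ler_wpM2l // HC.
Qed.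

End Tempered.

(** * Image of a sigma-finite measure under an injection *)

Section ImageMeasure.
Local Open Scope ereal_scope.
Context d d' (T : measurableType d) (T' : measurableType d') (R : realType).
Variables (m : {measure set T -> \bar R}) (f : T -> T') (g : T' -> T).

(* The arguments [g] and the proofs only serve to carry the sigma-finite structure. *)
Definition imeas (sm : sigma_finite setT m) (mf : measurable_fun setT f) (mg : measurable_fun setT g) (fK : cancel f g) :
  set T' -> \bar R := pushforward m f.

Hypotheses (sm : sigma_finite setT m) (mf : measurable_fun setT f) (mg : measurable_fun setT g) (fK : cancel f g).

Let imeas0 : imeas sm mf mg fK set0 = 0.
Proof. by rewrite /imeas /pushforward preimage_set0 measure0. Qed.

Let imeas_ge0 A : 0 <= imeas sm mf mg fK A.
Proof. exact: measure_ge0. Qed.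

Let imeas_sigma : semi_sigma_additive (imeas sm mf mg fK).
Proof.
move=> F mF tF mUF; rewrite /imeas /pushforward preimage_bigcup.
apply: measure_semi_sigma_additive.
- by move=> n; rewrite -[X in measurable X]setTI; exact: mf.
- apply/trivIsetP => /= i j _ _ ij; rewrite -preimage_setI.
  by move/trivIsetP : tF => /(_ _ _ _ _ ij) ->//; rewrite preimage_set0.
- by rewrite -preimage_bigcup -[X in measurable X]setTI; exact: mf.
Qed.

HB.instance Definition _ := isMeasure.Build _ _ _ (imeas sm mf mg fK) imeas0 imeas_ge0 imeas_sigma.

Let imeas_sfin : sigma_finite setT (imeas sm mf mg fK).
Proof.
have [F UF Ff] := sm.
exists (fun n => g @^-1` (F n)); first by rewrite -preimage_bigcup -UF.
move=> n; have [mFn Foo] := Ff n; split.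
  by rewrite -[X in measurable X]setTI; exact: mg.
by rewrite /imeas /pushforward -comp_preimage (_ : g \o f = id) //; apply/funext.
Qed.

HB.instance Definition _ := Measure_isSigmaFinite.Build _ _ _ (imeas sm mf mg fK) imeas_sfin.

End ImageMeasure.

(** * Products of sigma-finite measures *)

Section PairMeasure.
Local Open Scope ereal_scope.
Context d1 d2 d' (T1 : measurableType d1) (T2 : measurableType d2) (T' : measurableType d') (R : realType).
Variables (m1 : {sigma_finite_measure set T1 -> \bar R}) (m2 : {sigma_finite_measure set T2 -> \bar R}).
Variables (f : T1 * T2 -> T') (g : T' -> T1 * T2).

Lemma product_sigma_finite : sigma_finite setT (m1 \x m2).
Proof.
have /sigma_finiteP[F [TF ndF Foo]] := sigma_finiteT m1.
have /sigma_finiteP[G [TG ndG Goo]] := sigma_finiteT m2.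
exists (fun n => F n `*` G n).
  rewrite -setXTT TF TG predeqE => -[x y]; split.
    move=> [/= [n _ Fnx] [k _ Gky]]; exists (maxn n k) => //; split.
    - by move: x Fnx; exact/subsetPset/ndF/leq_maxl.
    - by move: y Gky; exact/subsetPset/ndG/leq_maxr.
  by move=> [n _ []/= ? ?]; split; exists n.
move=> k; have [? ?] := Foo k; have [? ?] := Goo k.
split; first exact: measurableX.
by rewrite product_measure1E// lte_mul_pinfty// ge0_fin_numE.
Qed.

Definition pmeas (mf : measurable_fun setT f) (mg : measurable_fun setT g) (fK : cancel f g) :
  {sigma_finite_measure set T' -> \bar R} := @imeas _ _ (T1 * T2)%type T' R (m1 \x m2) f g product_sigma_finite mf mg fK.
End PairMeasure.

(** * Lebesgue measure on tuples *)

Section TupleLebesgue.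
Context {R : realType}.
Local Open Scope ereal_scope.
Local Notation RR := (measurableTypeR R).
Definition TT n : measurableType _ := (n.-tuple R).

Definition consT n (p : RR * TT n) : TT n.+1 := [tuple of p.1 :: p.2].
Definition unconsT n (t : TT n.+1) : RR * TT n := (thead t, [tuple of behead t]).

Lemma measurable_consT n : measurable_fun setT (@consT n).
Proof. exact: (@measurable_cons _ _ (RR * TT n)%type R fst n snd). Qed.

Lemma measurable_unconsT n : measurable_fun setT (@unconsT n).
Proof.
apply/measurable_fun_pairP; split; last exact: measurable_behead.
exact: (measurable_tnth ord0).
Qed.

Lemma consTK n : cancel (@consT n) (@unconsT n).
Proof. by case=> x t; congr pair; apply/val_inj. Qed.

(** A measure whose integral is [iint] on nonnegative measurable functions ([iintE]). It brings
    integrability, comparison and invariance under reflections to bear on iterated integrals. *)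
Fixpoint leb n : {sigma_finite_measure set (TT n) -> \bar R} :=
  match n with
  | 0 => @dirac _ (TT 0) [tuple] R
  | n'.+1 => pmeas (@lebesgue_measure R) (leb n') (@measurable_consT n') (@measurable_unconsT n') (@consTK n')
  end.

Lemma ge0_leb0 (f : TT 0 -> \bar R) : measurable_fun setT f -> \int[leb 0]_t f t = f [tuple].
Proof. by move=> mf; rewrite integral_dirac // diracT mul1e. Qed.

Lemma ge0_lebS n (f : TT n.+1 -> \bar R) : measurable_fun setT f -> (forall t, 0 <= f t) ->
  \int[leb n.+1]_t f t = \int[@lebesgue_measure R]_x \int[leb n]_t f (consT (x, t)).
Proof.
move=> mf f0; rewrite [LHS](@ge0_integral_pushforward _ _ (RR * TT n)%type (TT n.+1) R (@consT n)) //; last exact: measurable_consT.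
rewrite preimage_setT fubini_tonelli1 //; last by move=> x; exact: f0.
by apply: measurableT_comp => //; exact: measurable_consT.
Qed.

Lemma iintE n (f : TT n -> \bar R) : measurable_fun setT f -> (forall t, 0 <= f t) ->
  iint f = \int[leb n]_t f t.
Proof.
elim: n f => [|n IH] f mf f0; first by rewrite ge0_leb0.
rewrite ge0_lebS //=; apply: eq_integral => x _; rewrite IH //.
apply: measurableT_comp => //.
exact: (@measurable_cons _ _ (TT n) R (cst x) n id).
Qed.

Definition ins n (j : 'I_n.+1) (p : RR * TT n) : TT n.+1 :=
  [tuple (if unlift j k is Some k' then tnth p.2 k' else p.1) | k < n.+1].

Lemma tnth_ins n j (p : RR * TT n) : tnth (ins j p) j = p.1.
Proof. by rewrite tnth_mktuple unlift_none. Qed.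

Lemma tnth_ins_lift n j k (p : RR * TT n) : tnth (ins j p) (lift j k) = tnth p.2 k.
Proof. by rewrite tnth_mktuple liftK. Qed.

Lemma measurable_ins n j : measurable_fun setT (@ins n j).
Proof.
apply/measurable_fun_tnthP => k.
rewrite (_ : _ \o _ = fun p => if unlift j k is Some k' then tnth p.2 k' else p.1); last first.
  by apply/funext => p /=; rewrite tnth_mktuple.
case: (unlift j k) => [k'|]; last exact: measurable_fst.
by apply: (measurableT_comp (measurable_tnth k')); exact: measurable_snd.
Qed.

Lemma consT_ins n (p : RR * TT n) : consT p = ins ord0 p.
Proof.
apply: eq_from_tnth => k; rewrite tnth_mktuple; case: unliftP => [k' ->|->] //.
by rewrite /consT tnthS.
Qed.

Lemma ins_consT n j' x y (u : TT n) : ins (lift ord0 j') (x, consT (y, u)) = consT (y, ins j' (x, u)).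
Proof.
apply: eq_from_tnth => k; case: (unliftP (lift ord0 j') k) => [k' ->|->].
  rewrite tnth_ins_lift /=; case: (unliftP ord0 k') => [k'' ->|->].
    rewrite [in LHS]consT_ins tnth_ins_lift consT_ins.
    have -> : lift (lift ord0 j') (lift ord0 k'') = lift ord0 (lift j' k'').
      by apply/val_inj; rewrite /= /bump /= !add1n ltnS addnS.
    by rewrite tnth_ins_lift tnth_ins_lift.
  rewrite [in LHS]consT_ins tnth_ins consT_ins.
  have -> : lift (lift ord0 j') ord0 = ord0 by apply/val_inj.
  by rewrite tnth_ins.
by rewrite tnth_ins [in RHS]consT_ins tnth_ins_lift tnth_ins.
Qed.

Lemma measurable_ins1 n j (f : TT n.+1 -> \bar R) x : measurable_fun setT f ->
  measurable_fun setT (fun t : TT n => f (ins j (x, t))).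
Proof.
move=> mf; apply: measurableT_comp mf _.
by apply: (measurableT_comp (measurable_ins j)); exact: pair1_measurable.
Qed.

Lemma measurable_ins2 n j (f : TT n.+1 -> \bar R) (t : TT n) : measurable_fun setT f ->
  measurable_fun setT (fun x : RR => f (ins j (x, t))).
Proof.
move=> mf; apply: measurableT_comp mf _.
by apply: (measurableT_comp (measurable_ins j)); exact: pair2_measurable.
Qed.

(** Any coordinate may be integrated separately: by induction the [j]-th one is pulled to the front
    and then exchanged with the first by Tonelli. *)
Lemma ge0_leb_ins n j (f : TT n.+1 -> \bar R) : measurable_fun setT f -> (forall t, 0 <= f t) ->
  \int[leb n.+1]_t f t = \int[@lebesgue_measure R]_x \int[leb n]_t f (ins j (x, t)).
Proof.
elim: n j f => [|n IH] j f mf f0.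
  by rewrite (ge0_lebS mf f0); have -> : j = ord0 by [exact: ord1]; apply: eq_integral => x _;
    apply: eq_integral => t _; rewrite consT_ins.
case: (unliftP ord0 j) => [j' ->|->]; last first.
  by rewrite (ge0_lebS mf f0); apply: eq_integral => x _; apply: eq_integral => t _; rewrite consT_ins.
rewrite (ge0_lebS mf f0).
pose G (p : RR * RR) : \bar R := \int[leb n]_u f (consT (p.1, ins j' (p.2, u))).
have mF : measurable_fun setT (fun q : (RR * RR) * TT n => f (consT (q.1.1, ins j' (q.1.2, q.2)))).
  apply: measurableT_comp mf _; apply: (measurableT_comp (measurable_consT (n:=n.+1))).
  apply/measurable_fun_pairP; split => /=.
    exact: (measurableT_comp measurable_fst measurable_fst).
  apply: (measurableT_comp (measurable_ins j')).
  apply/measurable_fun_pairP; split => /=; last exact: measurable_snd.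
  exact: (measurableT_comp measurable_snd measurable_fst).
have mG : measurable_fun setT G.
  apply: (@measurable_fun_fubini_tonelli_F _ _ (RR * RR)%type (TT n) R (leb n)
    (fun q : (RR * RR) * TT n => f (consT (q.1.1, ins j' (q.1.2, q.2))))) => //.
have G0 p : 0 <= G p by apply: integral_ge0 => u _; exact: f0.
transitivity (\int[@lebesgue_measure R]_y \int[@lebesgue_measure R]_x G (y, x)).
  apply: eq_integral => y _; rewrite (IH j') //.
  have := @measurable_ins1 _ ord0 f y mf; congr (measurable_fun _ _).
  by apply/funext => t; rewrite consT_ins.
rewrite (@fubini_tonelli _ _ RR RR R (@lebesgue_measure R) (@lebesgue_measure R) G mG G0).
apply: eq_integral => x _; rewrite ge0_lebS; last 2 first.
- exact: measurable_ins1.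
- by move=> t; exact: f0.
by apply: eq_integral => y _; apply: eq_integral => u _; rewrite ins_consT.
Qed.

Lemma ge0_leb_ins2 n j (f : TT n.+1 -> \bar R) : measurable_fun setT f -> (forall t, 0 <= f t) ->
  \int[leb n.+1]_t f t = \int[leb n]_t \int[@lebesgue_measure R]_x f (ins j (x, t)).
Proof.
move=> mf f0; rewrite (ge0_leb_ins j) //.
apply: (@fubini_tonelli _ _ RR (TT n) R (@lebesgue_measure R) (leb n) (f \o ins j)) => /=.
  by apply: measurableT_comp mf _; exact: measurable_ins.
by move=> p; exact: f0.
Qed.

Lemma integrable_ins n j (f : TT n.+1 -> \bar R) : (leb n.+1).-integrable setT f ->
  (@lebesgue_measure R \x leb n).-integrable setT (f \o ins j).
Proof.
move=> /integrableP[mf foo]; apply/integrable12ltyP.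
  by apply: measurableT_comp mf _; exact: measurable_ins.
rewrite -(@ge0_leb_ins _ j (fun t => `|f t|)) //; first exact: measurableT_comp.
Qed.

Lemma ge0_leb_prod n j (f : TT n.+1 -> \bar R) : measurable_fun setT f -> (forall t, 0 <= f t) ->
  \int[leb n.+1]_t f t = \int[@lebesgue_measure R \x leb n]_p (f \o ins j) p.
Proof.
move=> mf f0; rewrite (@ge0_leb_ins _ j) //.
rewrite -(@fubini_tonelli1 _ _ RR (TT n) R (@lebesgue_measure R) (leb n) (f \o ins j)) //.
  by apply: measurableT_comp mf _; exact: measurable_ins.
by move=> p; exact: f0.
Qed.

Lemma leb_ins n j (f : TT n.+1 -> \bar R) : (leb n.+1).-integrable setT f ->
  \int[leb n.+1]_t f t = \int[leb n]_t \int[@lebesgue_measure R]_x f (ins j (x, t)).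
Proof.
move=> intf; have mf := measurable_int _ intf; have intj := integrable_ins j intf.
rewrite (@integral21_prod_meas1 _ _ RR (TT n) R (@lebesgue_measure R) (leb n) (f \o ins j)) //.
rewrite [LHS]integralE [RHS]integralE; congr (_ - _).
  apply: etrans (@ge0_leb_prod n j f^\+ (measurable_funepos mf) _) _ => //.
  by have -> : (f \o ins j)^\+ = f^\+ \o ins j by exact: funepos_comp.
apply: etrans (@ge0_leb_prod n j f^\- (measurable_funeneg mf) _) _ => //.
by have -> : (f \o ins j)^\- = f^\- \o ins j by exact: funeneg_comp.
Qed.

(** Almost every line in direction [j] carries an integrable restriction, so the line integrals need
    to vanish on those lines only. *)
Lemma leb_line0 n j (f : TT n.+1 -> \bar R) : (leb n.+1).-integrable setT f ->
  (forall t, (@lebesgue_measure R).-integrable setT (fun x => f (ins j (x, t))) ->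
     \int[@lebesgue_measure R]_x f (ins j (x, t)) = 0) ->
  \int[leb n.+1]_t f t = 0.
Proof.
move=> intf H; rewrite (leb_ins j) //.
have intj := integrable_ins j intf.
have := @ae_integrable2 _ _ RR (TT n) R (@lebesgue_measure R) (leb n) (f \o ins j) intj => ae.
have mG := @measurable_fubini_G _ _ RR (TT n) R (@lebesgue_measure R) (leb n) (f \o ins j) intj.
rewrite (ae_eq_integral (cst 0)) ?integral0 //=.
by apply: filterS ae => t /= Ht _; exact: H.
Qed.

Lemma ge0_lebesgueN (f : RR -> \bar R) : measurable_fun setT f -> (forall x, 0 <= f x) ->
  \int[@lebesgue_measure R]_x f (- x)%R = \int[@lebesgue_measure R]_x f x.
Proof.
move=> mf f0; rewrite -(preimage_setT (-%R : RR -> RR)).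
rewrite -(@ge0_integral_pushforward _ _ RR RR R (-%R : RR -> RR)) //=.
by apply: eq_measure_integral => //= A mA _; exact: lebesgue_measureN.
Qed.

Lemma measurable_mktuple n m (F : TT n -> 'I_m -> R) :
  (forall k, measurable_fun setT (F ^~ k)) -> measurable_fun setT (fun t => [tuple F t k | k < m] : TT m).
Proof.
move=> mF; apply/measurable_fun_tnthP => k; rewrite (_ : _ \o _ = F ^~ k) //.
by apply/funext => t /=; rewrite tnth_mktuple.
Qed.

Lemma measurable_sigma_i n (i : 'I_n) : measurable_fun setT (sigma_i i : TT n -> TT n).
Proof.
apply: (@measurable_mktuple n n (fun t k => if k == i then - tnth t i else tnth t k))%R => k.
case: (k == i); last exact: measurable_tnth.
by apply: (@measurableT_comp _ _ _ _ _ _ (-%R : R -> R)); last exact: measurable_tnth.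
Qed.

Lemma measurable_s_ij n (i j : 'I_n) : measurable_fun setT (s_ij i j : TT n -> TT n).
Proof. apply: (@measurable_mktuple n n (fun t k => if k == i then tnth t j else if k == j then tnth t i else tnth t k)) => k.
by case: (k == i); [|case: (k == j)]; exact: measurable_tnth. Qed.

Lemma ge0_leb_sigma_i n (i : 'I_n) (f : TT n -> \bar R) : measurable_fun setT f -> (forall t, 0 <= f t) ->
  \int[leb n]_t f (sigma_i i t) = \int[leb n]_t f t.
Proof.
case: n i f => [[]//|n] i f mf f0.
have mfs : measurable_fun setT (fun t => f (sigma_i i t)).
  by apply: measurableT_comp mf _; exact: measurable_sigma_i.
rewrite (ge0_leb_ins2 i mfs (fun t => f0 _)) (ge0_leb_ins2 i mf f0); apply: eq_integral => t _.
rewrite -[RHS]ge0_lebesgueN; last by move=> x; exact: f0.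
  apply: eq_integral => x _; congr f; apply: eq_from_tnth => k; rewrite !tnth_mktuple.
  by case: (unliftP i k) => [k' ->|->]; rewrite ?eqxx ?unlift_none //= eq_sym (negbTE (neq_lift _ _)).
exact: measurable_ins2.
Qed.

Lemma ge0_leb_s_ij n (i j : 'I_n) (f : TT n -> \bar R) : i != j ->
  measurable_fun setT f -> (forall t, 0 <= f t) ->
  \int[leb n]_t f (s_ij i j t) = \int[leb n]_t f t.
Proof.
case: n i j f => [[]//|n] i j f ij mf f0.
case: (unliftP i j) ij => [j' ->|->]; last by rewrite eqxx.
move=> _; clear j; case: n j' i f mf f0 => [[]//|n] j' i f mf f0.
have H (g : TT n.+2 -> \bar R) : measurable_fun setT g -> (forall t, 0 <= g t) -> \int[leb n.+2]_t g t =
    \int[@lebesgue_measure R]_x \int[@lebesgue_measure R]_y \int[leb n]_t g (ins i (x, ins j' (y, t))).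
  move=> mg g0; rewrite (ge0_leb_ins i) //; apply: eq_integral => x _.
  rewrite (ge0_leb_ins j') //; first exact: measurable_ins1.
have mfs' : measurable_fun setT (fun t => f (s_ij i (lift i j') t)).
  by apply: measurableT_comp mf _; exact: measurable_s_ij.
rewrite (H _ mfs' (fun t => f0 _)) (H _ mf f0).
pose G (p : RR * RR) : \bar R := \int[leb n]_u f (ins i (p.1, ins j' (p.2, u))).
have mF : measurable_fun setT (fun q : (RR * RR) * TT n => f (ins i (q.1.1, ins j' (q.1.2, q.2)))).
  apply: measurableT_comp mf _; apply: (measurableT_comp (measurable_ins i)).
  apply/measurable_fun_pairP; split => /=.
    exact: (measurableT_comp measurable_fst measurable_fst).
  apply: (measurableT_comp (measurable_ins j')).
  apply/measurable_fun_pairP; split => /=; last exact: measurable_snd.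
  exact: (measurableT_comp measurable_snd measurable_fst).
have mG : measurable_fun setT G.
  apply: (@measurable_fun_fubini_tonelli_F _ _ (RR * RR)%type (TT n) R (leb n)
    (fun q : (RR * RR) * TT n => f (ins i (q.1.1, ins j' (q.1.2, q.2))))) => //.
have G0 p : 0 <= G p by apply: integral_ge0 => u _; exact: f0.
rewrite -[RHS]/(\int[@lebesgue_measure R]_x \int[@lebesgue_measure R]_y G (x, y)).
rewrite (@fubini_tonelli _ _ RR RR R (@lebesgue_measure R) (@lebesgue_measure R) G mG G0).
apply: eq_integral => x _; apply: eq_integral => y _; apply: eq_integral => u _; congr f.
apply: eq_from_tnth => k; rewrite tnth_mktuple.
case: (unliftP i k) => [k' ->|->]; last by rewrite eqxx tnth_ins_lift !tnth_ins.
rewrite eq_sym (negbTE (neq_lift _ _)) (inj_eq lift_inj) !tnth_ins_lift.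
by case: (unliftP j' k') => [k'' ->|->]; rewrite ?eqxx ?tnth_ins // eq_sym (negbTE (neq_lift _ _)) !tnth_ins_lift.
Qed.

End TupleLebesgue.

(** * The fundamental theorem of calculus with exceptional points *)

Section LineFTC.
Context {R : realType}.
Local Open Scope ereal_scope.
Local Notation mu := (@lebesgue_measure R).

Lemma cvg_exhaust d (T : measurableType d) (m : {measure set T -> \bar R}) (D : (set T)^nat) (f : T -> \bar R) :
  nondecreasing_seq D -> (forall n, measurable (D n)) -> m.-integrable (\bigcup_n D n) f ->
  \int[m]_(x in D n) f x @[n --> \oo] --> \int[m]_(x in \bigcup_n D n) f x.
Proof.
move=> nd mD intf.
have mf n : measurable_fun (D n) f.
  by apply: measurable_funS (measurable_int m intf) => //; [exact: bigcup_measurable|exact: bigcup_sup].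
rewrite (_ : (fun n => _) = fun n => \int[m]_(x in D n) f^\+ x - \int[m]_(x in D n) f^\- x); last first.
  by apply/funext => n; rewrite integralE.
rewrite [X in _ --> X]integralE; apply: cvgeB.
- by apply: fin_num_adde_defl; rewrite fin_numN; apply: integrable_neg_fin_num; first exact: bigcup_measurable.
- by apply: ge0_nondecreasing_set_cvg_integral => // n; exact: measurable_funepos.
- by apply: ge0_nondecreasing_set_cvg_integral => // n; exact: measurable_funeneg.
Qed.

Local Close Scope ereal_scope.

Lemma FTC_closed (F f : R -> R) (p q : R) : p < q ->
  (forall x : R, p <= x <= q -> is_derive x 1 F (f x) /\ {for x, continuous f}) ->
  (\int[mu]_(x in `[p, q]) (f x)%:E = (F q - F p)%:E)%E.
Proof.
move=> pq H.
have cF x : p <= x <= q -> {for x, continuous F}.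
  move=> /H[D _]; apply: differentiable_continuous; apply/derivable1_diffP; exact: ex_derive.
rewrite (continuous_FTC2 pq (F := F)) //.
- by apply: continuous_in_subspaceT => x; rewrite inE /= in_itv /= => /H[].
- split.
  + move=> x; rewrite in_itv /= => /andP[a b]; have [|D _] := H x; first by rewrite !ltW.
    exact: ex_derive.
  + by apply: cvg_at_right_filter; apply: cF; rewrite lexx ltW.
  + by apply: cvg_at_left_filter; apply: cF; rewrite lexx ltW.
- move=> x; rewrite in_itv /= => /andP[a b]; rewrite derive1E.
  by have [|D _] := H x; [rewrite !ltW|exact: derive_val].
Qed.

Lemma FTC_open (F f : R -> R) (p q : R) : p < q ->
  mu.-integrable `]p, q[ (EFin \o f) -> continuous F ->
  (forall x : R, p < x < q -> is_derive x 1 F (f x) /\ {for x, continuous f}) ->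
  (\int[mu]_(x in `]p, q[) (f x)%:E = (F q - F p)%:E)%E.
Proof.
(* A third of the length: then [u n < v n] already holds for [n = 0]. *)
move=> pq intf cF H; pose d := (q - p) / 3; have d0 : 0 < d by rewrite divr_gt0 // subr_gt0.
pose u n := p + d * n.+1%:R^-1; pose v n := q - d * n.+1%:R^-1.
have dn n : 0 < d * n.+1%:R^-1 by rewrite mulr_gt0 // invr_gt0.
have dle n : d * n.+1%:R^-1 <= d by rewrite -[leRHS]mulr1; apply: ler_wpM2l; [exact: ltW|rewrite invf_le1 // ler1n].
have d3 : q = p + 3 * d by rewrite /d; field.
pose D n : set R := `[u n, v n]%classic.
have cvg0 : d * n.+1%:R^-1 @[n --> \oo] --> (0 : R).
  by rewrite -[X in _ --> X](mulr0 d); apply: cvgM; [exact: cvg_cst|exact: cvg_harmonic].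
have UD : \bigcup_n D n = `]p, q[%classic.
  apply/seteqP; split => [x [n _]|x] /=; rewrite /D /= !in_itv /=.
    by move: (dn n); rewrite /u /v; move: (d / _) => e e0 /andP[a b]; apply/andP; split; lra.
  move=> /andP[a b].
  have /cvgrPdist_lt/(_ (Num.min (x - p) (q - x))) := cvg0.
  rewrite lt_min !subr_gt0 a b => /(_ isT)[N _ /(_ N (leqnn N))].
  rewrite /= sub0r normrN gtr0_norm // lt_min => /andP[h1 h2].
  exists N => //; rewrite /D /= in_itv /=; move: h1 h2; rewrite /u /v; move: (d / _) => e h1 h2.
  by apply/andP; split; lra.
have := @cvg_exhaust _ _ mu D (EFin \o f); rewrite UD => /(_ _ _ intf).
have nd : nondecreasing_seq D.
  move=> n m nm; apply/subsetPset => x; rewrite /D /= !in_itv /= => /andP[a b].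
  have : d * m.+1%:R^-1 <= d * n.+1%:R^-1 by rewrite ler_pM2l // lef_pV2 ?posrE // ler_nat ltnS.
  move: a b; rewrite /u /v; move: (d / _) (d / _) => e e' a b ee; apply/andP; split; lra.
move=> /(_ nd (fun n => measurable_itv _)) lim.
have E n : (\int[mu]_(x in D n) (EFin \o f) x = (F (v n) - F (u n))%:E)%E.
  move: (dn n) (dle n); rewrite /D /u /v; move: (d / _) => e e0 ed.
  apply: FTC_closed; first by lra.
  by move=> x /andP[a b]; apply: H; apply/andP; split; lra.
apply: cvg_unique lim _ => //=.
under eq_fun do rewrite E.
apply: cvg_EFin; first by near=> n.
apply: cvgB; apply: continuous_cvg.
- exact: cF.
- by rewrite -[X in _ --> X]subr0; apply: cvgB; [exact: cvg_cst|exact: cvg0].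
- exact: cF.
- by rewrite -[X in _ --> X]addr0; apply: cvgD; [exact: cvg_cst|exact: cvg0].
Unshelve. all: end_near. Qed.

Lemma FTC_finite (S : seq R) (F f : R -> R) (p q : R) : p < q ->
  mu.-integrable setT (EFin \o f) -> continuous F ->
  (forall x : R, p < x < q -> x \notin S -> is_derive x 1 F (f x) /\ {for x, continuous f}) ->
  (\int[mu]_(x in `]p, q[) (f x)%:E = (F q - F p)%:E)%E.
Proof.
move=> + intf cF; have intS (A : set R) : measurable A -> mu.-integrable A (EFin \o f).
  by move=> mA; apply: integrableS intf.
elim: S p q => [|s S IH] p q pq H.
  by apply: FTC_open => // [|x /H]; [exact: intS|exact].
have [/andP[ps sq]|nps] := boolP (p < s < q); last first.
  apply: IH => // x xpq xS; apply: H => //; rewrite inE negb_or xS andbT.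
  by apply: contra nps => /eqP <-.
have E : `]p, q[%classic = `]p, s] `|` `]s, q[ :> set R.
  apply/seteqP; split => x /=; rewrite !in_itv /=; first by move=> /andP[-> ->]; case: (leP x s); [left|right].
  by case=> /andP[h1 h2]; apply/andP; split => //; [exact: le_lt_trans h2 sq|exact: lt_trans ps h1].
rewrite E integral_setU //=.
- rewrite -(@integral_itv_bndo_bndc _ (BRight p) s); last first.
    by apply: measurable_funS (measurable_int _ intf).
  rewrite (IH p s) // ?(IH s q) //.
  + by rewrite -EFinD; congr EFin; ring.
  + by move=> x /andP[a b] xS; apply: H; rewrite ?(lt_trans ps a) // inE negb_or xS (gt_eqF a).
  + by move=> x /andP[a b] xS; apply: H; rewrite ?a ?(lt_trans b sq) // inE negb_or xS (lt_eqF b).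
- rewrite -E; exact: measurable_funS (measurable_int _ intf).
- by apply/disj_setPS => x [] /=; rewrite !in_itv /= => /andP[_ h] /andP[h' _]; rewrite ltNge h in h'.
Qed.

(** [S] stands for the finitely many points at which a coordinate line crosses the walls; there [F]
    is continuous but no derivative is asked for. *)
Lemma FTC_line (S : seq R) (F f : R -> R) :
  mu.-integrable setT (EFin \o f) -> continuous F ->
  (forall x : R, x \notin S -> is_derive x 1 F (f x) /\ {for x, continuous f}) ->
  F x @[x --> +oo%R] --> (0 : R) -> F x @[x --> -oo%R] --> (0 : R) ->
  (\int[mu]_x (f x)%:E = 0)%E.
Proof.
move=> intf cF H Fy FNy; pose D n : set R := `](- n.+1%:R), n.+1%:R[%classic.
have UD : \bigcup_n D n = setT.
  apply/seteqP; split => // x _; have [n xn] : exists n : nat, `|x| < n.+1%:R.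
    exists (Num.truncn `|x|); exact: truncnS_gt.
  by exists n => //; rewrite /D /= in_itv /= -ltr_norml.
have := @cvg_exhaust _ _ mu D (EFin \o f); rewrite UD => /(_ _ _ intf).
have nd : nondecreasing_seq D.
  move=> n m nm; apply/subsetPset => x; rewrite /D /= !in_itv /= -!ltr_norml => /lt_le_trans; apply.
  by rewrite ler_nat ltnS.
move=> /(_ nd (fun n => measurable_itv _)) lim.
have E n : (\int[mu]_(x in D n) (EFin \o f) x = (F n.+1%:R - F (- n.+1%:R))%:E)%E.
  by apply: (@FTC_finite S) => //; [rewrite gtrN|move=> x _; exact: H].
apply: cvg_unique lim _ => //=.
under eq_fun do rewrite E.
apply: cvg_EFin; first by near=> n.
rewrite -[X in _ --> X](subrr (0 : R)).
have ny : (n.+1%:R : R) @[n --> \oo] --> +oo%R.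
  have := @cvgr_idn R; rewrite -(cvg_shiftS (fun n => n%:R : R)); exact.
apply: cvgB.
  by apply: cvg_comp ny Fy.
apply: cvg_comp FNy.
by have /cvgNrNy := ny.
Unshelve. all: end_near. Qed.

End LineFTC.

(** * Integration on the half-line *)

Section HalfLine.
Context {R : realType}.
Local Notation mu := (@lebesgue_measure R).
Local Notation HL := (`]0, +oo[%classic : set R).

Definition hl_box (n : nat) : set R := `[n.+2%:R^-1, n.+2%:R]%classic.

Lemma bigcup_hl_box : \bigcup_n hl_box n = HL.
Proof.
apply/seteqP; split => [x [n _]|x] /=; rewrite /hl_box /= !in_itv /= ?andbT.
  by move=> /andP[+ _]; apply: lt_le_trans; rewrite invr_gt0.
move=> x0; pose n := Num.truncn (x + x^-1).
have H : x + x^-1 < n.+1%:R by exact: truncnS_gt.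
have v0 : 0 < x^-1 by rewrite invr_gt0.
exists n => //; rewrite /hl_box /= in_itv /=.
have n12 : n.+1%:R <= n.+2%:R :> R by rewrite ler_nat.
apply/andP; split; last by lra.
rewrite -[leRHS]invrK lef_pV2 ?posrE //; lra.
Qed.

Lemma hl_box_nd : nondecreasing_seq hl_box.
Proof.
move=> n m nm; apply/subsetPset => x; rewrite /hl_box /= !in_itv /= => /andP[a b].
apply/andP; split; last by apply: le_trans b _; rewrite ler_nat !ltnS.
by apply: le_trans a; rewrite lef_pV2 ?posrE // ler_nat !ltnS.
Qed.

Lemma hl_boxE (F f : R -> R) n :
  (forall x : R, 0 < x -> is_derive x 1 F (f x) /\ {for x, continuous f}) ->
  (\int[mu]_(x in hl_box n) (f x)%:E = (F n.+2%:R - F n.+2%:R^-1)%:E)%E.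
Proof.
move=> H; apply: FTC_closed.
  by apply: (@lt_trans _ _ 1); [rewrite invf_lt1 // ltr1n|rewrite ltr1n].
by move=> x /andP[a _]; apply: H; apply: lt_le_trans a; rewrite invr_gt0.
Qed.

Lemma measurable_hl (f : R -> R) : (forall x : R, 0 < x -> {for x, continuous f}) -> measurable_fun HL f.
Proof.
move=> H; apply: open_continuous_measurable_fun; first exact: interval_open.
by move=> x; rewrite inE /= in_itv /= andbT; exact: H.
Qed.

Lemma integrable_hl (F f : R -> R) (M : R) :
  (forall x : R, 0 < x -> is_derive x 1 F (f x) /\ {for x, continuous f}) ->
  (forall x : R, 0 < x -> 0 <= f x) -> (forall x : R, 0 < x -> `|F x| <= M) ->
  mu.-integrable HL (EFin \o f).
Proof.
move=> H f0 FM; have mf : measurable_fun HL f by apply: measurable_hl => x /H[].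
apply/integrableP; split; first exact/measurable_EFinP.
have -> : (\int[mu]_(x in HL) `|(EFin \o f) x| = \int[mu]_(x in HL) (f x)%:E)%E.
  by apply: eq_integral => x; rewrite inE /= in_itv /= andbT => x0; rewrite ger0_norm // f0.
apply: (@le_lt_trans _ _ (2 * M)%:E); last exact: ltry.
rewrite -bigcup_hl_box.
have mfn n : measurable_fun (hl_box n) (EFin \o f).
  apply/measurable_EFinP; apply: measurable_funS mf => //.
  by rewrite -bigcup_hl_box; exact: bigcup_sup.
have := @ge0_nondecreasing_set_cvg_integral _ (measurableTypeR R) R hl_box (EFin \o f) mu hl_box_nd
  (fun n => measurable_itv _) mfn.
have f0n n x : hl_box n x -> (0 <= (EFin \o f) x)%E.
  move=> bx; rewrite lee_fin f0 //.
  have : HL x by rewrite -bigcup_hl_box; exists n.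
  by rewrite /= in_itv /= andbT.
move=> /(_ f0n) lim; apply: cvge_le lim; apply: nearW => n.
rewrite (hl_boxE _ H) lee_fin.
have n0 : 0 < n.+2%:R :> R by [].
have n1 : 0 < n.+2%:R^-1 :> R by rewrite invr_gt0.
have := FM _ n0; have := FM _ n1; rewrite !ler_norml => /andP[? ?] /andP[? ?]; lra.
Qed.

Lemma hl_FTC0 (F f : R -> R) :
  (forall x : R, 0 < x -> is_derive x 1 F (f x) /\ {for x, continuous f}) ->
  mu.-integrable HL (EFin \o f) ->
  F n.+2%:R @[n --> \oo] --> (0 : R) -> F n.+2%:R^-1 @[n --> \oo] --> (0 : R) ->
  (\int[mu]_(x in HL) (f x)%:E = 0)%E.
Proof.
move=> H intf F1 F2; rewrite -bigcup_hl_box in intf *.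
have := @cvg_exhaust _ _ _ mu hl_box (EFin \o f) hl_box_nd (fun n => measurable_itv _) intf.
move=> lim; apply: cvg_unique lim _ => //=.
under eq_fun do rewrite (hl_boxE _ H).
apply: cvg_EFin; first by near=> n.
by rewrite -[X in _ --> X](subrr (0 : R)); apply: cvgB.
Unshelve. all: end_near. Qed.

End HalfLine.

(** * Gamma integrals: recursion, log-convexity and modulus *)

Section Gamma.
Context {R : realType}.
Local Notation mu := (@lebesgue_measure R).
Local Notation HL := (`]0, +oo[%classic : set R).
Local Notation conton := (fun f : R -> R => forall t : R, 0 < t -> {for t, continuous f}).

(** The density [t^(x-1) e^(-t)] for [t > 0], as a single exponential. *)
Definition gw (x t : R) : R := expR ((x - 1) * ln t - t).
Definition Jg (x : R) (f : R -> R) : R := (\int[mu]_(t in HL) (f t * gw x t))%R.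
Definition gam (x : R) : R := Jg x (cst 1).

Lemma HLP (t : R) : (t \in HL) = (0 < t).
Proof. by apply/idP/idP; rewrite inE /= in_itv /= andbT. Qed.

Lemma gwE (x t : R) : 0 < t -> powR t (x - 1) * expR (- t) = gw x t.
Proof. by move=> t0; rewrite /powR gt_eqF // -expRD. Qed.

Lemma gw_add (x c t : R) : 0 < t -> gw (x + c) t = expR (c * ln t) * gw x t.
Proof. by move=> t0; rewrite -expRD; congr expR; ring. Qed.

Lemma gwS (x t : R) : 0 < t -> gw (x + 1) t = t * gw x t.
Proof. by move=> t0; rewrite gw_add // mul1r lnK. Qed.

Lemma is_derive_cont (f : R -> R) (t l : R) : is_derive t 1 f l -> {for t, continuous f}.
Proof. by move=> D; apply: differentiable_continuous; apply/derivable1_diffP; exact: ex_derive. Qed.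

Lemma is_derive_explin (p q t : R) : 0 < t ->
  is_derive t 1 (fun s : R => expR (p * ln s - q * s)) ((p * t^-1 - q) * expR (p * ln t - q * t)).
Proof.
move=> t0.
have D1 := is_deriveZ p (is_derive1_ln t0).
have D2 := is_deriveZ q (is_derive_id t (1 : R)).
have D3 := is_deriveB D1 D2.
have D := is_derive1_comp (is_derive_expR _) D3.
apply: is_derive_eq D _; rewrite /GRing.scale /=; ring.
Qed.

Lemma gw_explin (x : R) : gw x = fun s : R => expR ((x - 1) * ln s - 1 * s).
Proof. by apply/funext => s; rewrite mul1r. Qed.

Lemma cont_gw (x : R) : conton (gw x).
Proof. by move=> t t0; rewrite gw_explin; exact: is_derive_cont (is_derive_explin _ _ t0). Qed.

Lemma ln_le_linear (p t : R) : 0 < p -> 0 < t -> p * ln t <= p * ln p - p + t.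
Proof.
move=> p0 t0; have /le_ln1Dx : -1 < t / p - 1 by have := divr_gt0 t0 p0; lra.
rewrite addrC subrK ln_div ?posrE // => H.
have := ler_wpM2l (ltW p0) H; have -> : p * (t / p - 1) = t - p by field; exact: lt0r_neq0.
by rewrite mulrBr; lra.
Qed.

(** Comparison with the derivative [x t^(x-1) (1 + t)^(-x-1)] of the bounded function
    [(t / (1 + t))^x]: same behaviour at 0, slower decay at infinity. *)
Lemma integrable_gw (x : R) : 0 < x -> mu.-integrable HL (EFin \o gw x).
Proof.
move=> x0.
pose F (t : R) := expR (x * (ln t - ln (1 + t))).
pose f (t : R) := x * (t^-1 - (1 + t)^-1) * F t.
have D (t : R) : 0 < t -> is_derive t 1 F (f t).
  move=> t0; have t1 : 0 < 1 + t by lra.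
  have D0 := is_deriveD (is_derive_cst (1 : R) t (1 : R)) (is_derive_id t (1 : R)).
  have D1 := is_deriveB (is_derive1_ln t0) (is_derive1_comp (is_derive1_ln t1) D0).
  have D2 := is_derive1_comp (is_derive_expR _) (is_deriveZ x D1).
  apply: is_derive_eq D2 _; rewrite /GRing.scale /= /f /F; ring.
have cf : conton f.
  move=> t t0; have t1 : 1 + t != 0 by rewrite gt_eqF //; lra.
  apply: cvgM; last exact: is_derive_cont (D t t0).
  apply: cvgM; first exact: cvg_cst.
  apply: cvgB; apply: cvgV.
  - exact: lt0r_neq0.
  - exact: cvg_id.
  - by [].
  - by apply: cvgD; [exact: cvg_cst|exact: cvg_id].
have fE (t : R) : 0 < t -> f t = x * expR ((x - 1) * ln t - (x + 1) * ln (1 + t)).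
  move=> t0; have t1 : 0 < 1 + t by lra.
  have -> : (x - 1) * ln t - (x + 1) * ln (1 + t) = x * (ln t - ln (1 + t)) - ln t - ln (1 + t) by ring.
  rewrite 2!expRB !lnK ?posrE // /f /F; field; rewrite !gt_eqF //.
have intf : mu.-integrable HL (EFin \o f).
  apply: (@integrable_hl _ F f 1) => [t t0|t t0|t t0].
  - by split; [exact: D|exact: cf].
  - by rewrite fE // mulr_ge0 ?expR_ge0 // ltW.
  - rewrite ger0_norm ?expR_ge0 // -expR0 ler_expR pmulr_rle0 // subr_le0 ler_ln ?posrE //; lra.
pose C := (x + 1) * ln (x + 1) - (x + 1) + 1.
have le t : 0 < t -> `|gw x t| <= x^-1 * expR C * f t.
  move=> t0; have t1 : 0 < 1 + t by lra.
  rewrite ger0_norm ?expR_ge0 // fE //; set E := expR (_ - _).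
  have -> : x^-1 * expR C * (x * E) = expR C * E by field; exact: lt0r_neq0.
  rewrite -expRD ler_expR.
  have x1 : 0 < x + 1 by lra.
  have := ln_le_linear x1 t1; rewrite /C; lra.
apply: (@le_integrable _ _ R mu HL _ (EFin \o gw x) (EFin \o (fun t => x^-1 * expR C * f t))) => //.
- by apply/measurable_EFinP; apply: measurable_hl; exact: cont_gw.
- move=> t /mem_set; rewrite HLP => t0; rewrite /= lee_fin; apply: le_trans (le t t0) _; exact: ler_norm.
- by have := integrableZl _ (x^-1 * expR C) intf; apply.
Qed.

Lemma integrable_Jg (x M : R) (f : R -> R) : 0 < x -> conton f -> (forall t, 0 < t -> `|f t| <= M) ->
  mu.-integrable HL (EFin \o (fun t => f t * gw x t)).
Proof.
move=> x0 cf fM.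
have := integrableZl _ M (integrable_gw x0) => /(_ (measurable_itv _)) intM.
apply: (@le_integrable _ _ R mu HL _ _ (fun t => M%:E * (EFin \o gw x) t)%E) => //.
- apply/measurable_EFinP; apply: measurable_hl => t t0.
  by apply: cvgM; [exact: cf|exact: cont_gw].
- move=> t /mem_set; rewrite HLP => t0; rewrite /= lee_fin !normrM.
  by apply: ler_wpM2r => //; apply: le_trans (fM t t0) (ler_norm _).
Qed.

Lemma JgD (x : R) (f g : R -> R) : mu.-integrable HL (EFin \o (fun t => f t * gw x t)) ->
  mu.-integrable HL (EFin \o (fun t => g t * gw x t)) ->
  Jg x (fun t => f t + g t) = Jg x f + Jg x g.
Proof.
move=> If Ig; rewrite /Jg -RintegralD //.
by apply: eq_Rintegral => t _; rewrite mulrDl.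
Qed.

Lemma JgZ (x c : R) (f : R -> R) : mu.-integrable HL (EFin \o (fun t => f t * gw x t)) ->
  Jg x (fun t => c * f t) = c * Jg x f.
Proof.
by move=> If; rewrite /Jg -RintegralZl //; apply: eq_Rintegral => t _; rewrite mulrA.
Qed.

Lemma Jg_le (x y : R) (f g : R -> R) : mu.-integrable HL (EFin \o (fun t => f t * gw x t)) ->
  mu.-integrable HL (EFin \o (fun t => g t * gw y t)) ->
  (forall t, 0 < t -> f t * gw x t <= g t * gw y t) -> Jg x f <= Jg y g.
Proof.
move=> If Ig fg; apply: le_Rintegral => // t /mem_set; rewrite HLP; exact: fg.
Qed.

Lemma integrable_gam (x : R) : 0 < x -> mu.-integrable HL (EFin \o (fun t => cst 1 t * gw x t)).
Proof. by move=> x0; apply: eq_integrable (integrable_gw x0) => // t _ /=; rewrite mul1r. Qed.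

Lemma gam_gt0 (x : R) : 0 < x -> 0 < gam x.
Proof.
move=> x0; pose c := expR (- (`|x - 1| + 2)).
apply: (@lt_le_trans _ _ c); first exact: expR_gt0.
have -> : c = \int[mu]_(t in `[1, 2]) cst c t.
  rewrite Rintegral_cst //= lebesgue_measure_itv /= lte_fin ltr1n /=; lra.
have intc : mu.-integrable `[1, 2] (EFin \o gw x).
  apply: integrableS (integrable_gw x0) => // t /=; rewrite !in_itv /= andbT => /andP[a _].
  exact: lt_le_trans a.
apply: (@le_trans _ _ (\int[mu]_(t in `[1, 2]) gw x t)).
  apply: le_Rintegral => //.
    by apply: continuous_compact_integrable; [exact: segment_compact|apply: continuous_subspaceT => ?; exact: cvg_cst].
  move=> t /=; rewrite in_itv /= => /andP[a b]; have t0 : 0 < t by lra.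
  rewrite /cst /c ler_expR.
  have l0 : 0 <= ln t by rewrite ln_ge0.
  have l1 : ln t <= 1.
    by have := @le_ln1Dx R (t - 1); rewrite [1 + _]addrC subrK => H; have := H ltac:(lra); lra.
  have : `|x - 1| * ln t <= `|x - 1| by rewrite ler_piMr.
  have : - (`|x - 1| * ln t) <= (x - 1) * ln t.
    by rewrite -mulNr; apply: ler_wpM2r => //; have := ler_norm (- (x - 1)); rewrite normrN; lra.
  lra.
rewrite /gam /Jg /Rintegral fine_le //.
- by apply: integrable_fin_num.
- by apply: integrable_fin_num => //; exact: integrable_gam.
apply: (@le_trans _ _ (\int[mu]_(t in HL) (gw x t)%:E)%E).
  apply: ge0_subset_integral => //.
  - by apply/measurable_EFinP; apply: measurable_hl; exact: cont_gw.
  - by move=> t _; rewrite lee_fin expR_ge0.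
  - move=> t /=; rewrite !in_itv /= andbT => /andP[a _]; exact: lt_le_trans a.
by under [leRHS]eq_integral do rewrite /= mul1r.
Qed.

(** Real combinations of the two parts of [t^(i y)]. The family is stable under [t d/dt], which
    keeps the recursion of the complex Gamma function within real integrals. *)
Definition osc (y al be t : R) : R := al * cos (y * ln t) + be * sin (y * ln t).

Lemma osc_le y al be t : `|osc y al be t| <= `|al| + `|be|.
Proof.
rewrite /osc; apply: le_trans (ler_normD _ _) _; rewrite !normrM.
by apply: lerD; rewrite ler_piMr // ler_norml ?cos_geN1 ?cos_le1 ?sin_geN1 ?sin_le1.
Qed.

Lemma is_derive_osc (y al be t : R) : 0 < t ->
  is_derive t 1 (osc y al be) (y * t^-1 * osc y be (- al) t).
Proof.
move=> t0; have D1 := is_deriveZ y (is_derive1_ln t0).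
have Dc := is_deriveZ al (is_derive1_comp (is_derive_cos _) D1).
have Ds := is_deriveZ be (is_derive1_comp (is_derive_sin _) D1).
apply: is_derive_eq (is_deriveD Dc Ds) _; rewrite /GRing.scale /= /osc; ring.
Qed.

Lemma cont_osc y al be : conton (osc y al be).
Proof. by move=> t t0; exact: is_derive_cont (is_derive_osc y al be t0). Qed.

Lemma integrable_osc x y al be : 0 < x -> mu.-integrable HL (EFin \o (fun t => osc y al be t * gw x t)).
Proof.
by move=> x0; apply: integrable_Jg => //; [exact: cont_osc|move=> t _; exact: osc_le].
Qed.

Lemma Jg_oscD x y al be al' be' c d : 0 < x ->
  Jg x (osc y (c * al + d * al') (c * be + d * be')) = c * Jg x (osc y al be) + d * Jg x (osc y al' be').
Proof.
move=> x0; rewrite -!JgZ; try exact: integrable_osc.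
have Ic k al1 be1 : mu.-integrable HL (EFin \o (fun t => (k * osc y al1 be1 t) * gw x t)).
  apply: eq_integrable (integrableZl _ k (integrable_osc y al1 be1 x0)) => // t _ /=.
  by rewrite -EFinM mulrA.
rewrite -JgD //.
by apply: eq_Rintegral => t _; rewrite /osc; ring.
Qed.

Lemma cvg0_le (u v : nat -> R) : (forall n, `|u n| <= v n) -> v @ \oo --> (0 : R) -> u @ \oo --> (0 : R).
Proof.
move=> uv v0; apply: (@squeeze_cvgr _ _ _ _ (- v) v) => //.
  by near=> n; rewrite -ler_norml.
by rewrite -oppr0; exact: cvgN.
Unshelve. all: end_near. Qed.

Lemma cvg_powN (x : R) : 0 < x -> expR (- x * ln n.+2%:R) @[n --> \oo] --> (0 : R).
Proof.
move=> x0; apply/cvgr0Pnorm_lt => e e0; near=> n.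
rewrite ger0_norm ?expR_ge0 // -[ltRHS]lnK ?posrE // ltr_expR.
have : ln (expR (- ln e / x)) < ln n.+2%:R.
  rewrite ltr_ln ?posrE ?expR_gt0 //; apply: (@lt_trans _ _ n%:R); last by rewrite ltr_nat.
  by near: n; exact: nbhs_infty_gtr.
by rewrite expRK ltr_pdivrMr // => H; rewrite mulNr ltrNl mulrC.
Unshelve. all: end_near. Qed.

(** [Gamma (z + 1) = z Gamma (z)] in real form, from integrating the derivative of
    [osc y al be t * t^x e^(-t)], which vanishes at both ends. *)
Lemma Jg_osc_rec (x y al be : R) : 0 < x ->
  Jg (x + 1) (osc y al be) = x * Jg x (osc y al be) + y * Jg x (osc y be (- al)).
Proof.
move=> x0; have x1 : 0 < x + 1 by lra.
pose f t := (y * osc y be (- al) t + x * osc y al be t) * gw x t - osc y al be t * gw (x + 1) t.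
pose F t := osc y al be t * expR (x * ln t - 1 * t).
have D (t : R) : 0 < t -> is_derive t 1 F (f t).
  move=> t0; apply: is_derive_eq (is_deriveM (is_derive_osc y al be t0) (is_derive_explin x 1 t0)) _.
  have -> : expR (x * ln t - 1 * t) = t * gw x t.
    by rewrite -gwS // gw_explin; congr expR; ring.
  by rewrite /GRing.scale /= /f gwS //; field; exact: lt0r_neq0.
have cf : conton f.
  move=> t t0; apply: cvgB; apply: cvgM; try exact: cont_gw; try exact: cont_osc.
  by apply: cvgD; apply: cvgM; try exact: cvg_cst; exact: cont_osc.
have I1 := integrable_osc y (x * al + y * be) (x * be - y * al) x0.
have I2 := integrable_osc y al be x1.
have fE t : f t = osc y (x * al + y * be) (x * be - y * al) t * gw x t - osc y al be t * gw (x + 1) t.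
  by rewrite /f /osc; ring.
have If : mu.-integrable HL (EFin \o f).
  by apply: eq_integrable (integrableB _ I1 I2) => // t _ /=; rewrite fE EFinB.
set M := `|al| + `|be|; have M0 : 0 <= M by rewrite addr_ge0.
have B t : `|F t| <= M * expR (x * ln t - 1 * t).
  by rewrite normrM [X in _ * X]ger0_norm ?expR_ge0 //; apply: ler_wpM2r; [exact: expR_ge0|exact: osc_le].
have lim1 : F n.+2%:R @[n --> \oo] --> (0 : R).
  pose C := (x + 1) * ln (x + 1) - (x + 1).
  apply: (@cvg0_le _ (fun n => M * expR C * expR (- 1 * ln n.+2%:R))) => [n|].
    apply: le_trans (B _) _; rewrite -mulrA; apply: ler_wpM2l => //; rewrite -expRD ler_expR.
    have n0 : 0 < n.+2%:R :> R by [].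
    by have := ln_le_linear x1 n0; rewrite /C; lra.
  by rewrite -[X in _ --> X](mulr0 (M * expR C)); apply: cvgM; [exact: cvg_cst|exact: cvg_powN].
have lim2 : F n.+2%:R^-1 @[n --> \oo] --> (0 : R).
  apply: (@cvg0_le _ (fun n => M * expR (- x * ln n.+2%:R))) => [n|].
    apply: le_trans (B _) _; apply: ler_wpM2l => //; rewrite ler_expR lnV ?posrE //.
    by rewrite mulrN mulNr mul1r gerBl invr_ge0.
  by rewrite -[X in _ --> X](mulr0 M); apply: cvgM; [exact: cvg_cst|exact: cvg_powN].
have Z := hl_FTC0 (fun t t0 => conj (D t t0) (cf t t0)) If lim1 lim2.
have : Jg x (osc y (x * al + y * be) (x * be - y * al)) - Jg (x + 1) (osc y al be) = 0.
  rewrite /Jg -RintegralB // /Rintegral.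
  by under eq_integral do rewrite -fE; rewrite Z.
move=> /eqP; rewrite subr_eq0 => /eqP <-.
have -> : x * be - y * al = x * be + y * (- al) by ring.
exact: Jg_oscD.
Qed.

Lemma gam_osc x : gam x = Jg x (osc 0 1 0).
Proof. by apply: eq_Rintegral => t _; rewrite /osc mul0r cos0 sin0; congr (_ * _); rewrite /cst; ring. Qed.

Lemma gam_rec (x : R) : 0 < x -> gam (x + 1) = x * gam x.
Proof. by move=> x0; rewrite !gam_osc Jg_osc_rec // mul0r addr0. Qed.

(** With [d = x - y], choose [l] such that [q = e^(d l)] is [gam x / gam y], and put [k = e^(c l)].
    The factors of [(t^d - q) * (t^c - k)] change sign together at [ln t = l], so the product is
    nonnegative; it is integrated against [t^(y-1) e^(-t)]. *)
Lemma gam_convex (x y c : R) : 0 < y -> y <= x -> 0 <= c -> gam x * gam (y + c) <= gam (x + c) * gam y.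
Proof.
move=> y0; rewrite le_eqVlt => /predU1P[<-|yx] c0; first by rewrite mulrC.
have aux (A B C D p e : R) : 0 < C -> e * C = A -> p * A + e * D <= 1 * B + p * e * C -> A * D <= B * C.
  by move=> C0 <- H; rewrite mulrAC; apply: ler_wpM2r; [exact: ltW|lra].
have x0 : 0 < x by lra.
have gx := gam_gt0 x0; have gy := gam_gt0 y0.
pose d := x - y; have d0 : 0 < d by rewrite subr_gt0.
pose l := ln (gam x / gam y) / d; pose q := expR (d * l).
have qE : q * gam y = gam x.
  have E : d * l = ln (gam x / gam y) by rewrite mulrC divfK // gt_eqF.
  by rewrite /q E lnK ?posrE; [rewrite divfK // gt_eqF|exact: divr_gt0].
pose k := expR (c * l).
have Ixc := integrable_gam (ltr_wpDr c0 x0).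
have Ix := integrable_gam x0.
have Iy := integrable_gam y0.
have Iyc := integrable_gam (ltr_wpDr c0 y0).
have IZ (e : R) (f : R -> R) : mu.-integrable HL (EFin \o (fun t => cst 1 t * f t)) ->
    mu.-integrable HL (EFin \o (fun t => e * f t)).
  by move=> I; apply: eq_integrable (integrableZl _ e I) => // t _ /=; rewrite -EFinM mul1r.
have H : \int[mu]_(t in HL) (k * (gw x t) + q * gw (y + c) t) <= \int[mu]_(t in HL) (1 * gw (x + c) t + k * q * gw y t).
  apply: le_Rintegral => //.
  - apply: eq_integrable (integrableD _ (IZ k _ Ix) (IZ q _ Iyc)) => // t _ /=; by rewrite EFinD.
  - apply: eq_integrable (integrableD _ Ixc (IZ (k * q) _ Iy)) => // t _ /=; by rewrite EFinD mul1r.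
  move=> t /mem_set; rewrite HLP => t0.
  have yd : y + d = x by rewrite /d; ring.
  have ydc : y + (d + c) = x + c by rewrite /d; ring.
  rewrite mul1r; have -> : gw x t = expR (d * ln t) * gw y t by rewrite -(gw_add y d t0) yd.
  have -> : gw (y + c) t = expR (c * ln t) * gw y t by exact: gw_add.
  have -> : gw (x + c) t = expR (d * ln t) * expR (c * ln t) * gw y t.
    by rewrite -expRD -mulrDl -(gw_add y (d + c) t0) ydc.
  rewrite -subr_ge0.
  have -> : forall A B G : R, A * B * G + k * q * G - (k * (A * G) + q * (B * G)) = (A - q) * (B - k) * G by move=> *; ring.
  rewrite mulr_ge0 ?expR_ge0 //.
  have [lt|lt] := leP l (ln t).
    by apply: mulr_ge0; rewrite subr_ge0 ler_expR ler_wpM2l // ltW.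
  by apply: mulr_le0; rewrite subr_le0 ler_expR ler_wpM2l // ltW.
have E (p p' e e' : R) : 0 < p -> 0 < p' -> \int[mu]_(t in HL) (e * gw p t + e' * gw p' t) = e * gam p + e' * gam p'.
  move=> p0 p0'; have := integrable_gam p0; have := integrable_gam p0' => I' I1.
  rewrite RintegralD // ?(IZ _ _ I1) ?(IZ _ _ I') // !RintegralZl //; last 2 first.
  - by apply: eq_integrable I' => // t _ /=; rewrite mul1r.
  - by apply: eq_integrable I1 => // t _ /=; rewrite mul1r.
  by congr (_ * _ + _ * _); apply: eq_Rintegral => t _; rewrite mul1r.
have xc0 := ltr_pwDl x0 c0; have yc0 := ltr_pwDl y0 c0.
have H' : k * gam x + q * gam (y + c) <= 1 * gam (x + c) + k * q * gam y.
  by have := H; rewrite (E _ _ _ _ x0 yc0) (E _ _ _ _ xc0 y0).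
exact: aux gy qE H'.
Qed.

Lemma cos_ge_quad (u : R) : 1 - u ^+ 2 / 2 <= cos u.
Proof.
wlog u0 : u / 0 <= u.
  by move=> H; case: (leP 0 u) => [/H//|u0]; rewrite -cosN -sqrrN; apply: H; lra.
have sinle (v : R) : 0 <= v -> sin v <= v.
  move=> v0; rewrite -subr_le0 -[X in _ <= X](_ : sin 0 - 0 = 0); last by rewrite sin0 subr0.
  have [->//|vn0] := eqVneq v 0; have vpos : 0 < v by rewrite lt0r vn0.
  apply: (@ler0_derive1_nincr R (fun s => sin s - s) 0 v) => //.
  - move=> s _; have D := is_deriveB (is_derive_sin s) (is_derive_id s (1 : R)).
    by rewrite derive1E derive_val; have := cos_le1 s; lra.
  - apply: derivable_within_continuous => s _; exact: derivableB.
have [->|un0] := eqVneq u 0; first by rewrite cos0 expr0n /= mul0r subr0.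
rewrite -subr_ge0 -[X in X <= _](_ : cos 0 - (1 - 0 ^+ 2 / 2) = 0 :> R); last by rewrite cos0 expr0n /= mul0r subr0 subrr.
have D (s : R) : is_derive s 1 (fun s => cos s - (1 - s ^+ 2 / 2)) (- sin s + s).
  have D1 := is_deriveM (is_derive_id s (1 : R)) (is_derive_id s (1 : R)).
  have D2 := is_deriveB (is_derive_cos s) (is_deriveB (is_derive_cst (1:R) s (1:R)) (is_deriveZ (2^-1 : R) D1)).
  rewrite (_ : (fun s => _) = (fun s : R => cos s - (1 - 2^-1 * (s * s)))); last first.
    by apply/funext => v; rewrite expr2 mulrC.
  by apply: is_derive_eq D2 _; rewrite /GRing.scale /=; field.
apply: (@le0r_derive1_ndecr R (fun s => cos s - (1 - s ^+ 2 / 2)) 0 u) => //.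
- move=> s; rewrite in_itv /= => /andP[s0 _]; have Ds := D s.
  by rewrite derive1E derive_val; have := sinle s (ltW s0); lra.
- by apply: derivable_within_continuous => s _; apply: ex_derive.
Qed.

(** For [s = e^(2u)] this compares [u ^ 2] with [(e^u - e^(-u)) ^ 2]. *)
Lemma ln_sqr_le (s : R) : 0 < s -> ln s ^+ 2 <= 4 * (s - 2 + s^-1).
Proof.
move=> s0; pose u := ln s / 2; have E : s = expR u ^+ 2.
  by rewrite -expRM_natl /u mulrC divfK ?lnK.
have -> : s - 2 + s^-1 = (expR u - expR (- u)) ^+ 2.
  by rewrite expRN {1 2}E; field; rewrite gt_eqF ?expR_gt0.
have -> : ln s ^+ 2 = 4 * u ^+ 2 by rewrite /u; field.
rewrite ler_pM2l //.
have e1 := expR_ge1Dx u; have e2 := expR_ge1Dx (- u).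
have [u0|u0] := leP 0 u.
  have : expR (- u) <= 1 by rewrite expR_le1; lra.
  by move=> h; rewrite ler_sqr ?nnegrE; lra.
have : expR u <= 1 by rewrite expR_le1; lra.
by move=> h; rewrite -[leLHS]sqrrN -[leRHS]sqrrN ler_sqr ?nnegrE; lra.
Qed.

(** The middle term is [|Gamma (x + i y)| ^ 2]. From above, its projection on any unit vector is at
    most [gam x]. From below, it is projected on the phase of [t = x], near which the density
    concentrates. *)
Lemma Jg_osc_sqr (x y : R) : 1 < x -> (1 - 4 * y ^+ 2 / (x - 1)) * gam x ^+ 2 <=
  Jg x (osc y 1 0) ^+ 2 + Jg x (osc y 0 1) ^+ 2 <= gam x ^+ 2.
Proof.
move=> x1; have x0 : 0 < x by lra.
have gx := gam_gt0 x0.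
set C := Jg x (osc y 1 0); set S := Jg x (osc y 0 1).
have E al be : Jg x (osc y al be) = al * C + be * S.
  have := @Jg_oscD x y 1 0 0 1 al be x0; rewrite !mulr1 !mulr0 addr0 add0r; exact.
have up al be : al ^+ 2 + be ^+ 2 = 1 -> al * C + be * S <= gam x.
  move=> ab; rewrite -E; apply: Jg_le; [exact: integrable_osc|exact: integrable_gam|].
  move=> t t0; apply: ler_wpM2r; rewrite ?expR_ge0 // /cst /osc.
  have := cos2Dsin2 (y * ln t); set c := cos _; set s := sin _ => cs.
  have := sqr_ge0 (al - c); have := sqr_ge0 (be - s); rewrite !sqrrB; lra.
apply/andP; split; last first.
  have [q0|q0] := leP (C ^+ 2 + S ^+ 2) 0; first by apply: le_trans q0 (sqr_ge0 _).
  pose n := Num.sqrt (C ^+ 2 + S ^+ 2).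
  have n2 : n ^+ 2 = C ^+ 2 + S ^+ 2 by rewrite sqr_sqrtr // ltW.
  have n0 : 0 < n by rewrite sqrtr_gt0.
  have : C / n * C + S / n * S <= gam x by apply: up; rewrite !expr_div_n -mulrDl -n2 divff // gt_eqF // exprn_gt0.
  have -> : C / n * C + S / n * S = n.
    by rewrite mulrAC [S / n * S]mulrAC -mulrDl -!expr2 -n2 expr2 mulfK // gt_eqF.
  by rewrite -n2 ler_sqr ?nnegrE // ltW.
set th := y * ln x.
pose del := 2 * y ^+ 2 / (x - 1).
have d0 : 0 <= del.
  by rewrite /del; apply: divr_ge0; [apply: mulr_ge0 => //; exact: sqr_ge0|lra].
have low : (1 - del) * gam x <= cos th * C + sin th * S.
  rewrite -E.
  (* [cos u >= 1 - u ^ 2 / 2] and [ln_sqr_le] bound the phase below by [1 - k * (s - 2 + 1 / s)]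
     with [s = t / x]. Under the Gamma density [s] has mean 1 and [1 / s] has mean [x / (x - 1)],
     whence the loss [k / (x - 1)], which is [del]. *)
  pose k := 2 * y ^+ 2.
  have gm : gam x = (x - 1) * gam (x - 1).
    by rewrite -gam_rec ?subrK //; lra.
  have -> : (1 - del) * gam x = (1 + 2 * k) * gam x - k / x * gam (x + 1) - k * x * gam (x - 1).
    by rewrite (gam_rec x0) gm /del /k; field; rewrite !gt_eqF ?subr_gt0.
  have x1' : 0 < x - 1 by lra.
  have x2' : 0 < x + 1 by lra.
  have IZ (e p : R) : 0 < p -> mu.-integrable HL (EFin \o (fun t => e * gw p t)).
    by move=> p0; apply: eq_integrable (integrableZl _ e (integrable_gw p0)) => // t _ /=; rewrite -EFinM.
  have -> : (1 + 2 * k) * gam x - k / x * gam (x + 1) - k * x * gam (x - 1) =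
     \int[mu]_(t in HL) ((1 + 2 * k) * gw x t - k / x * gw (x + 1) t - k * x * gw (x - 1) t).
    have GE p : gam p = \int[mu]_(t in HL) gw p t by apply: eq_Rintegral => t _; rewrite mul1r.
    rewrite RintegralB //; [|by apply: eq_integrable (integrableB _ (IZ _ _ x0) (IZ _ _ x2'))|exact: IZ].
    rewrite RintegralB //; [|exact: IZ|exact: IZ].
    by rewrite !RintegralZl ?GE //; exact: integrable_gw.
  apply: le_Rintegral => //.
  - apply: eq_integrable (integrableB _ (integrableB _ (IZ (1 + 2 * k) _ x0) (IZ (k / x) _ x2')) (IZ (k * x) _ x1')) => //.
  - exact: integrable_osc.
  move=> t /mem_set; rewrite HLP => t0; rewrite gwS //.
  have -> : gw (x - 1) t = t^-1 * gw x t.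
    by rewrite -[in RHS](subrK 1 x) gwS // mulrA mulVf ?gt_eqF // mul1r.
  have -> : (1 + 2 * k) * gw x t - k / x * (t * gw x t) - k * x * (t^-1 * gw x t) =
            (1 - k * (t / x - 2 + (t / x)^-1)) * gw x t by field; rewrite !gt_eqF.
  apply: ler_wpM2r; first exact: expR_ge0.
  have -> : osc y (cos th) (sin th) t = cos (y * ln (t / x)).
    by rewrite ln_div ?posrE // mulrBr cosB -/th /osc; ring.
  apply: le_trans (cos_ge_quad _).
  have := ln_sqr_le (divr_gt0 t0 x0); rewrite exprMn /k => H.
  have := ler_wpM2l (sqr_ge0 y) H; lra.
have H : (cos th * C + sin th * S) ^+ 2 <= C ^+ 2 + S ^+ 2.
  have := cos2Dsin2 th; set c := cos _; set s := sin _ => cs.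
  rewrite -subr_ge0 -[X in 0 <= X](_ : (c * S - s * C) ^+ 2 = _) ?sqr_ge0 //.
  have -> : C ^+ 2 + S ^+ 2 = (c ^+ 2 + s ^+ 2) * (C ^+ 2 + S ^+ 2) by rewrite cs mul1r.
  by ring.
have -> : 4 * y ^+ 2 / (x - 1) = 2 * del by rewrite /del; ring.
have [d1|d1] := leP del 1; last first.
  by apply: (@le_trans _ _ 0); [apply: mulr_le0_ge0; [lra|exact: sqr_ge0]|rewrite addr_ge0 ?sqr_ge0].
apply: le_trans H; apply: (@le_trans _ _ (((1 - del) * gam x) ^+ 2)).
  rewrite exprMn; apply: ler_wpM2r; first exact: sqr_ge0.
  by have := sqr_ge0 del; rewrite !expr2; lra.
have h0 : 0 <= (1 - del) * gam x by apply: mulr_ge0; [lra|exact: ltW].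
by rewrite ler_sqr ?nnegrE // (le_trans h0 low).
Qed.

Lemma GammaC_cre (z : R[i]) : cre (GammaC z) = Jg (cre z) (osc (cim z) 1 0).
Proof.
rewrite /GammaC /=; apply: eq_Rintegral => t; rewrite HLP => t0.
by rewrite -gwE // /osc; ring.
Qed.

Lemma GammaC_cim (z : R[i]) : cim (GammaC z) = Jg (cre z) (osc (cim z) 0 1).
Proof.
rewrite /GammaC /=; apply: eq_Rintegral => t; rewrite HLP => t0.
by rewrite -gwE // /osc; ring.
Qed.

Lemma GammaRE (x : R) : GammaR x = gam x.
Proof. by rewrite /GammaR GammaC_cre gam_osc. Qed.

End Gamma.

(** * Measurability of functions analytic off the walls *)

Section Measurability.
Context {R : realType} {r : nat}.

(** [O] is a union of boxes with rational centres and radii [1 / (n + 1)], of which there are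
    countably many. *)
Lemma boxopen_measurable (O : set (TT (R:=R) r)) : (forall x, O x -> nearp x O) -> measurable O.
Proof.
move=> HO.
pose box (i : r.-tuple rat * nat) : set (TT (R:=R) r) :=
  [set y | forall k, `|tnth y k - ratr (tnth i.1 k)| < i.2.+1%:R^-1].
have mbox i : measurable (box i).
  rewrite (_ : box i = \bigcap_(k in [set: 'I_r])
      ((fun y : TT r => tnth y k) @^-1` `]ratr (tnth i.1 k) - i.2.+1%:R^-1, ratr (tnth i.1 k) + i.2.+1%:R^-1[)).
    apply: fin_bigcap_measurable => // k _.
    by rewrite -[X in measurable X]setTI; exact: measurable_tnth.
  apply/seteqP; split => y H k; have := H k.
    by rewrite /= in_itv /= -ltr_distl.
  by move=> /(_ I); rewrite /= in_itv /= -ltr_distl.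
have -> : O = \bigcup_(i in [set i | box i `<=` O]) box i.
  apply/seteqP; split => [x Ox|x [i /= sub] /sub //].
  have [e [e0 He]] := HO x Ox.
  pose n := Num.truncn (2 / e); have n2 : 2 / e < n.+1%:R by exact: truncnS_gt.
  have n0 : 0 < n.+1%:R^-1 :> R by rewrite invr_gt0.
  have ne : n.+1%:R^-1 * 2 <= e.
    by rewrite mulrC ler_pdivrMr // mulrC -ler_pdivrMr // ltW.
  have Q (k : 'I_r) : exists q : rat, `|tnth x k - ratr q| < n.+1%:R^-1.
    have [|q] := @rat_in_itvoo R (tnth x k - n.+1%:R^-1) (tnth x k + n.+1%:R^-1).
      by rewrite ltrD2l gtrN.
    by rewrite in_itv /= => q1; exists q; rewrite distrC ltr_distl.
  have [q Hq] := choice Q.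
  exists ([tuple q k | k < r], n); last by move=> k /=; rewrite tnth_mktuple.
  move=> y /= yb; have := He (fun k => tnth y k - tnth x k); rewrite shiftK; apply => k.
  have h1 := Hq k; have h2 := yb k; rewrite tnth_mktuple in h2.
  rewrite (_ : tnth y k - tnth x k = (tnth y k - ratr (q k)) - (tnth x k - ratr (q k))); last by ring.
  rewrite /= in h2; set m := n.+1%:R^-1 in ne h1 h2 *.
  apply: le_trans (ler_normB _ _) _; lra.
rewrite bigcup_mkcond; apply: countable_bigcupT_measurable; first exact: countableP.
by move=> i; case: ifP.
Qed.

Lemma measurable_cut (F : r.-tuple R -> R) : good F -> measurable_fun setT (cut F : TT r -> R).
Proof.
move=> gF _; apply: (measurability _ (RGenOInfty.measurableE R)) => // _ [_ [x ->] <-].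
rewrite setTI.
have -> : (cut F : TT r -> R) @^-1` `]x, +oo[%classic =
   [set t | regular t /\ x < F t] `|` (if x < 0 then ~` [set t : TT r | regular t] else set0).
  apply/seteqP; split => t /=; rewrite in_itv /= andbT /cut; case: asboolP => rt.
  - by left.
  - by move=> ->; right.
  - by case=> [[]//|]; case: ifP.
  - by case=> [[]//|]; case: ifP.
apply: measurableU.
  apply: boxopen_measurable => t [rt xF].
  apply: nearp_and; first exact: regular_near.
  have d0 : 0 < (F t - x) / 2 by rewrite divr_gt0 // subr_gt0.
  apply: nearp_sub (An_cont d0 (gF t rt)) => y; rewrite ler_distl => /andP[h _]; lra.
case: ifP => _ //; apply: measurableC; apply: boxopen_measurable => t; exact: regular_near.
Qed.

Lemma measurable_gfun (F : @gfun R r) : measurable_fun setT (F : TT r -> R).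
Proof.
rewrite (_ : (F : TT r -> R) = cut F); first exact: measurable_cut (gfun_good F).
apply/funext => t; rewrite /cut; case: asboolP => // nt.
by have /goodzP[_ ->] := gvalP F.
Qed.

End Measurability.

(** * Invariance of integrals over tuples, and dominating functions *)

Section TupleIntegrals.
Context {R : realType}.
Local Open Scope ereal_scope.
Local Notation mu := (@lebesgue_measure R).
Local Notation RR := (measurableTypeR R).

Lemma ge0_lebesgueD (f : RR -> \bar R) (c : R) : measurable_fun setT f -> (forall x, 0 <= f x) ->
  \int[mu]_x f (x + c)%R = \int[mu]_x f x.
Proof.
move=> mf f0.
have mD : measurable_fun setT (fun x : RR => (x + c)%R : RR).
  by apply: (@continuous_measurable_fun R) => x; apply: cvgD; [exact: cvg_id|exact: cvg_cst].
rewrite -(preimage_setT (fun x : RR => (x + c)%R : RR)).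
rewrite -(@ge0_integral_pushforward _ _ RR RR R (fun x : RR => (x + c)%R)) //=.
apply: eq_measure_integral => //= A mA _.
apply/esym/lebesgue_measure_unique => //= _ [[u v]] _ <-.
rewrite /pushforward (_ : _ @^-1` _ = `](u - c)%R, (v - c)%R]%classic); last first.
  by apply/seteqP; split => x /=; rewrite !in_itv /= ltrBlDr lerBrDr.
rewrite /= !lebesgue_measure_itv /= !lte_fin ltrD2r; case: ifP => // _.
by rewrite -!EFinB; congr EFin; ring.
Qed.

Definition leb_inv n (s : TT (R:=R) n -> TT n) :=
  measurable_fun setT s /\ forall f : TT n -> \bar R, measurable_fun setT f -> (forall t, 0 <= f t) ->
  \int[leb n]_t f (s t) = \int[leb n]_t f t.

Lemma leb_inv_comp n (s s' : TT (R:=R) n -> TT n) : leb_inv s -> leb_inv s' -> leb_inv (s \o s').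
Proof.
move=> [ms Is] [ms' Is']; split; first exact: measurableT_comp.
move=> f mf f0; rewrite -[RHS](Is f mf f0).
by apply: (Is' (f \o s)) => [|t]; [exact: measurableT_comp|exact: f0].
Qed.

Lemma leb_inv_s_ij n (i j : 'I_n) : i != j -> leb_inv (s_ij i j : TT (R:=R) n -> TT n).
Proof. by move=> ij; split; [exact: measurable_s_ij|move=> f; exact: ge0_leb_s_ij]. Qed.

Lemma leb_inv_sigma_i n (i : 'I_n) : leb_inv (sigma_i i : TT (R:=R) n -> TT n).
Proof. by split; [exact: measurable_sigma_i|move=> f; exact: ge0_leb_sigma_i]. Qed.

Lemma leb_inv_sigma_ij n (i j : 'I_n) : i != j -> leb_inv (sigma_ij i j : TT (R:=R) n -> TT n).
Proof.
move=> ij; have -> : sigma_ij i j = (sigma_i i \o sigma_i j) \o s_ij i j :> (TT (R:=R) n -> TT n).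
  apply: funext => t; apply: eq_from_tnth => k; rewrite /= !tnth_mktuple.
  by rewrite !eqxx (eq_sym j i) (negbTE ij); case: (k == i); case: (k == j).
by apply: leb_inv_comp; [apply: leb_inv_comp; exact: leb_inv_sigma_i|exact: leb_inv_s_ij].
Qed.

Lemma leb_inv_integrable n (s : TT (R:=R) n -> TT n) (f : TT n -> \bar R) : leb_inv s ->
  (leb n).-integrable setT f ->
  (leb n).-integrable setT (f \o s) /\ \int[leb n]_t f (s t) = \int[leb n]_t f t.
Proof.
move=> [ms Is] /integrableP[mf foo]; split.
  apply/integrableP; split; first exact: measurableT_comp.
  rewrite (_ : \int[leb n]_x _ = \int[leb n]_x (abse \o f) (s x)) //.
  by rewrite Is //; [exact: measurableT_comp|move=> t /=].
rewrite [LHS]integralE [RHS]integralE; congr (_ - _).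
  have -> : (fun t => f (s t))^\+ = f^\+ \o s by exact: funepos_comp.
  by apply: (Is f^\+) => //; exact: measurable_funepos.
have -> : (fun t => f (s t))^\- = f^\- \o s by exact: funeneg_comp.
by apply: (Is f^\-) => //; exact: measurable_funeneg.
Qed.

Local Close Scope ereal_scope.

Definition expl1 n (ka : R) (t : TT (R:=R) n) : R := expR (- ka * l1 t).

Lemma measurable_expR_lin (ka : R) : measurable_fun setT (fun x : R => expR (- ka * `|x|)).
Proof.
apply: continuous_measurable_fun => x; apply: continuous_comp; last exact: continuous_expR.
by apply: cvgM; [exact: cvg_cst|exact: norm_continuous].
Qed.

Lemma expl1_prod n ka (t : TT (R:=R) n) : expl1 ka t = \prod_(k < n) expR (- ka * `|tnth t k|).
Proof. by rewrite /expl1 /l1 mulr_sumr expR_sum. Qed.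

Lemma measurable_expl1 n ka : measurable_fun setT (@expl1 n ka).
Proof.
rewrite (_ : @expl1 n ka = fun t => \prod_(k < n) expR (- ka * `|tnth t k|)); last first.
  by apply/funext => t; exact: expl1_prod.
apply: measurable_prod => k _; apply: (measurableT_comp (measurable_expR_lin ka)); exact: measurable_tnth.
Qed.

Lemma expl1_ins n ka j x (t : TT (R:=R) n) : expl1 ka (ins j (x, t)) = expR (- ka * `|x|) * expl1 ka t.
Proof.
rewrite !expl1_prod (bigD1 j) //= tnth_ins; congr (_ * _).
rewrite (reindex_omap (lift j) (unlift j)) /=; last first.
  by move=> k kj; case: unliftP kj => [k' ->|->] //; rewrite eqxx.
apply: eq_big => k; last by rewrite tnth_ins_lift.
by rewrite liftK eqxx eq_sym neq_lift.
Qed.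

Definition evenize (A : set R) (f : R -> R) (x : R) : R := (f \_ A) x + (f \_ A) (- x).

Section evenize.
Variables (A : set R) (f : R -> R).
Hypotheses (mA : measurable A) (f0 : forall x, A x -> 0 <= f x) (mf : measurable_fun A f).

Let fA0 x : 0 <= (f \_ A) x.
Proof. by rewrite /patch; case: ifP => //; rewrite inE => /f0. Qed.

Let mfA : measurable_fun setT (f \_ A).
Proof. exact/(measurable_restrictT f). Qed.

Lemma evenize_ge0 x : 0 <= evenize A f x.
Proof. by rewrite addr_ge0. Qed.

Lemma measurable_evenize : measurable_fun setT (evenize A f).
Proof.
apply: measurable_funD => //.
by apply: (measurableT_comp mfA); exact: oppr_measurable.
Qed.

Lemma int_evenize : (\int[mu]_(x in A) (f x)%:E < +oo)%E -> (\int[mu]_x (evenize A f x)%:E < +oo)%E.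
Proof.
move=> foo; rewrite /evenize; under eq_integral do rewrite EFinD.
have mE : measurable_fun setT (fun x : RR => ((f \_ A) x)%:E) by exact/measurable_EFinP.
rewrite ge0_integralD //; last 3 first.
- by move=> x _; rewrite lee_fin.
- by move=> x _; rewrite lee_fin.
- by apply/measurable_EFinP; apply: (measurableT_comp mfA); exact: oppr_measurable.
have -> : (\int[mu]_x ((f \_ A) (- x))%:E = \int[mu]_x ((f \_ A) x)%:E)%E.
  by apply: (ge0_lebesgueN mE) => x; rewrite lee_fin.
suff H : (\int[mu]_x ((f \_ A) x)%:E < +oo)%E by rewrite lte_add_pinfty.
by rewrite integral_mkcond restrict_EFin in foo.
Qed.

End evenize.

(* Dominates [|2 sinh x|^m / |x|] near [0]. *)
Definition psi (p : R) : R -> R := evenize `]0, +oo[ (gw p).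

Lemma psi_ge0 p x : 0 <= psi p x.
Proof. by apply: evenize_ge0 => y _; exact: expR_ge0. Qed.

Lemma psiE p x : x != 0 -> psi p x = gw p `|x|.
Proof.
rewrite neq_lt /psi /evenize /patch !HLP oppr_gt0 => /orP[x0|x0].
  by rewrite (lt_gtF x0) x0 add0r ltr0_norm.
by rewrite x0 (lt_gtF x0) addr0 gtr0_norm.
Qed.

Lemma measurable_psi p : measurable_fun setT (psi p).
Proof. by apply: measurable_evenize => //; apply: measurable_hl; exact: cont_gw. Qed.

Lemma int_psi p : 0 < p -> (\int[mu]_x (psi p x)%:E < +oo)%E.
Proof.
move=> p0; apply: int_evenize => //.
- by move=> y _; exact: expR_ge0.
- by apply: measurable_hl; exact: cont_gw.
have /integrableP[_] := integrable_gw p0.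
by under eq_integral do rewrite /= ger0_norm ?expR_ge0 //.
Qed.

Lemma int_expR_lin (ka : R) : 0 < ka -> (\int[mu]_x (expR (- ka * `|x|))%:E < +oo)%E.
Proof.
move=> k0; pose f (x : R) := expR (- ka * x).
have D (x : R) : is_derive x 1 f (- ka * f x).
  have := is_derive1_comp (is_derive_expR _) (is_deriveZ (- ka) (is_derive_id x (1 : R))).
  by move=> D; apply: is_derive_eq D _; rewrite /GRing.scale /= /f; ring.
have cf : continuous f by move=> x; exact: is_derive_cont (D x).
have If : (\int[mu]_(x in `[0%R, +oo[) (f x)%:E < +oo)%E.
  rewrite -integral_itv_obnd_cbnd; last first.
    by apply/measurable_EFinP; apply: measurable_funS (continuous_measurable_fun cf).
  have /integrableP[_] : mu.-integrable `]0, +oo[ (EFin \o f).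
    apply: (@integrable_hl _ (fun x => - ka^-1 * f x) f ka^-1) => [x x0|x _|x x0].
    - split; last exact: cf.
      by have D1 := is_deriveZ (- ka^-1) (D x); apply: is_derive_eq D1 _; rewrite /GRing.scale /=; field; exact: lt0r_neq0.
    - exact: expR_ge0.
    - rewrite normrM normrN (ger0_norm (expR_ge0 _)) ger0_norm; last by rewrite invr_ge0 ltW.
      apply: ler_piMr; first by rewrite invr_ge0 ltW.
      by rewrite expR_le1 mulNr oppr_le0 mulr_ge0 // ltW.
  by under eq_integral do rewrite /= ger0_norm ?expR_ge0 //.
apply: le_lt_trans (int_evenize _ _ _ If) => //; last 2 first.
- by move=> x _; exact: expR_ge0.
- exact: measurable_funS (continuous_measurable_fun cf).
apply: ge0_le_integral => //.
- by apply/measurable_EFinP; exact: measurable_expR_lin.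
- apply/measurable_EFinP; apply: measurable_evenize => //.
  exact: measurable_funS (continuous_measurable_fun cf).
move=> x _; rewrite lee_fin /evenize /patch !mem_setE /= !in_itv /= !andbT oppr_ge0.
have [x0|x0] := leP 0 x.
  by rewrite ger0_norm // lerDl; case: ifP => // _; exact: expR_ge0.
by rewrite ltr0_norm // (ltW x0) add0r.
Qed.

Lemma int_expl1 n ka : 0 < ka -> (\int[leb n]_t (expl1 ka t)%:E < +oo)%E.
Proof.
move=> k0; elim: n => [|n IH].
  by rewrite ge0_leb0 ?ltry //; apply/measurable_EFinP; exact: measurable_expl1.
rewrite (@ge0_leb_ins _ _ ord0); last 2 first.
- by apply/measurable_EFinP; exact: measurable_expl1.
- by move=> t; rewrite lee_fin expR_ge0.
under eq_integral => x _ do under eq_integral => t _ do rewrite expl1_ins EFinM.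
under eq_integral => x _.
  rewrite ge0_integralZl //; [|by apply/measurable_EFinP; exact: measurable_expl1|by move=> t _; rewrite lee_fin expR_ge0].
  over.
rewrite ge0_integralZr //; last 2 first.
- by apply/measurable_EFinP; exact: measurable_expR_lin.
- by apply: integral_ge0 => t _; rewrite lee_fin expR_ge0.
rewrite lte_mul_pinfty //.
- by apply: integral_ge0 => t _; rewrite lee_fin expR_ge0.
- rewrite ge0_fin_numE; first exact: int_expR_lin.
  by apply: integral_ge0 => t _; rewrite lee_fin expR_ge0.
Qed.

(** On lines in direction [j] the function [al] is a translate of the coordinate. The exponential in
    this coordinate is bounded by 1, the line integral of [psi] is independent of the line, and the
    other coordinates keep their exponential decay. *)
Lemma int_expl1_psi n (j : 'I_n) (ka p : R) (al : TT (R:=R) n -> R) : 0 < ka -> 0 < p ->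
  measurable_fun setT al ->
  (forall t (x : R), al (upd t j x) = x + al (upd t j 0)) ->
  (\int[leb n]_t (expl1 ka t * psi p (al t))%:E < +oo)%E.
Proof.
case: n j al => [[]//|n] j al k0 p0 mal Hal.
have m1 : measurable_fun setT (fun t : TT n.+1 => (expl1 ka t * psi p (al t))%:E).
  apply/measurable_EFinP; apply: measurable_funM; first exact: measurable_expl1.
  by apply: (measurableT_comp (measurable_psi p)).
rewrite (@ge0_leb_ins2 _ _ j) //; last first.
  by move=> t; rewrite lee_fin mulr_ge0 ?expR_ge0 ?psi_ge0.
have Hup (x : R) (t : TT n) : ins j (x, t) = upd (ins j (0, t)) j x.
  by apply: eq_from_tnth => k; rewrite !tnth_mktuple; case: (unliftP j k) => [k' ->|->]; rewrite ?eqxx // eq_sym (negbTE (neq_lift _ _)).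
apply: (@le_lt_trans _ _ (\int[leb n]_t ((expl1 ka t)%:E * \int[mu]_x (psi p x)%:E))%E).
  apply: ge0_le_integral => //.
  - by move=> t _; apply: integral_ge0 => x _; rewrite lee_fin mulr_ge0 ?expR_ge0 ?psi_ge0.
  - apply: (@measurable_fun_fubini_tonelli_G _ _ RR (TT n) R mu ((fun t : TT n.+1 => (expl1 ka t * psi p (al t))%:E) \o ins j)).
      by apply: measurableT_comp m1 _; exact: measurable_ins.
    by move=> t; rewrite lee_fin mulr_ge0 ?expR_ge0 ?psi_ge0.
  - apply: emeasurable_funM; last exact: measurable_cst.
    by apply/measurable_EFinP; exact: measurable_expl1.
  move=> t _.
  rewrite -ge0_integralZl //; last 3 first.
  - by apply/measurable_EFinP; exact: measurable_psi.
  - by move=> x _; rewrite lee_fin psi_ge0.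
  - by rewrite lee_fin expR_ge0.
  have mx : measurable_fun setT (fun x : RR => ((expl1 ka t)%:E * (psi p x)%:E)%E).
    apply: emeasurable_funM; first exact: measurable_cst.
    by apply/measurable_EFinP; exact: measurable_psi.
  rewrite -(@ge0_lebesgueD (fun x => ((expl1 ka t)%:E * (psi p x)%:E)%E) (al (ins j (0, t)))) //; last first.
    by move=> x; rewrite mule_ge0 // lee_fin ?psi_ge0 ?expR_ge0.
  apply: ge0_le_integral => //.
  - by move=> x _; rewrite lee_fin mulr_ge0 ?expR_ge0 ?psi_ge0.
  - exact: (measurable_ins2 j t m1).
  - apply: measurableT_comp mx _.
    by apply: (@continuous_measurable_fun R) => x; apply: cvgD; [exact: cvg_id|exact: cvg_cst].
  move=> x _; rewrite -EFinM lee_fin expl1_ins -mulrA -[leRHS]mul1r.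
  have -> : al (ins j (x, t)) = x + al (ins j (0, t)).
    by rewrite Hup Hal; congr (_ + _); rewrite -Hup.
  apply: ler_wpM2r; first by rewrite mulr_ge0 ?expR_ge0 ?psi_ge0.
  by rewrite expR_le1 mulNr oppr_le0 mulr_ge0 // ltW.
rewrite ge0_integralZr //; last 3 first.
- by apply/measurable_EFinP; exact: measurable_expl1.
- by move=> t _; rewrite lee_fin expR_ge0.
- by apply: integral_ge0 => t _; rewrite lee_fin psi_ge0.
rewrite lte_mul_pinfty //.
- by apply: integral_ge0 => t _; rewrite lee_fin expR_ge0.
- rewrite ge0_fin_numE; first exact: int_expl1.
  by apply: integral_ge0 => t _; rewrite lee_fin expR_ge0.
- exact: int_psi.
Qed.

End TupleIntegrals.

(** * Bounds for powers of [sinh] and [cosh] *)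

Section DensityBounds.
Context {R : realType}.

Definition sh (x : R) : R := `|2 * sinhR x|.

Lemma shE x : sh x = `|expR x - expR (- x)|.
Proof. by rewrite /sh /sinhR mulrC divfK. Qed.

Lemma shN x : sh (- x) = sh x.
Proof. by rewrite !shE opprK distrC. Qed.

Lemma sh_norm x : sh x = expR `|x| - expR (- `|x|).
Proof.
wlog x0 : x / 0 <= x.
  by move=> H; case: (leP 0 x) => [/H//|x0]; rewrite -shN -normrN; apply: H; rewrite oppr_ge0 ltW.
by rewrite shE !ger0_norm // subr_ge0 ler_expR; lra.
Qed.

Lemma sh_ge0 x : 0 <= sh x. Proof. exact: normr_ge0. Qed.

Lemma sh0 : sh 0 = 0.
Proof. by rewrite shE oppr0 subrr normr0. Qed.

Lemma sh_le x : sh x <= expR `|x|.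
Proof. by rewrite sh_norm gerBl expR_ge0. Qed.

Lemma sh_le_lin x : sh x <= `|x| * (expR `|x| + 1).
Proof.
rewrite sh_norm; set y := `|x|; have y0 : 0 <= y by exact: normr_ge0.
have e0 := expR_gt0 y; have h1 := expR_ge1Dx (- y).
have : expR y * (1 + - y) <= expR y * expR (- y) by rewrite ler_pM2l.
rewrite expRxMexpNx_1; lra.
Qed.

Lemma powR_sh_le m x : 0 <= m -> powR (sh x) m <= expR (m * `|x|).
Proof.
move=> m0; rewrite mulrC expRM; apply: ge0_ler_powR => //; rewrite ?nnegrE ?expR_ge0 ?sh_ge0 //.
exact: sh_le.
Qed.

(** [(e + 1)^m] comes from [sh x <= |x| * (e + 1)] for [|x| <= 1]; the factor [e] compensates the
    [e^(-|x|)] in [psi]. *)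
Definition shC (m : R) : R := powR (expR 1 + 1) m * expR 1.

Lemma shC_ge1 m : 0 <= m -> 1 <= shC m.
Proof.
move=> m0; have e1 : 1 <= expR 1 :> R by have := expR_ge1Dx (1 : R); lra.
rewrite -[leLHS]mulr1; apply: ler_pM => //.
by rewrite -[leLHS](powRr0 (expR 1 + 1)); apply: ler_powR => //; lra.
Qed.

(** The summand 1 covers [|x| >= 1]. Near 0 the left side is of order [|x|^(m-1) <= |x|^(p-1)]; one
    [p] below all the multiplicities lets every root share the same dominating function. *)
Lemma powR_sh_sing m p x : 0 < p -> p <= m -> x != 0 ->
  powR (sh x) m * `|x|^-1 <= shC m * expR (m * `|x|) * (1 + psi p x).
Proof.
move=> p0 pm x0; have m0 : 0 <= m by lra.
have C1 := shC_ge1 m0; have psi0 := psi_ge0 p x.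
have y0 : 0 < `|x| by rewrite normr_gt0.
have [x1|x1] := leP 1 `|x|.
  apply: (@le_trans _ _ (expR (m * `|x|) * 1)).
    apply: ler_pM; rewrite ?powR_ge0 ?invr_ge0 //; first exact: powR_sh_le.
    by rewrite invf_le1.
  rewrite mulr1 -mulrA mulrCA -[leLHS]mulr1; apply: ler_wpM2l; first exact: expR_ge0.
  by rewrite -[leLHS]mulr1; apply: ler_pM => //; lra.
have e1 : 1 <= expR (m * `|x|) by rewrite -expR0 ler_expR mulr_ge0.
apply: (@le_trans _ _ (shC m * psi p x)); last first.
  apply: ler_pM => //; [by lra| |by lra].
  by rewrite -[leLHS]mulr1 ler_wpM2l //; lra.
have l0 : ln `|x| <= 0 by apply: ln_le0; exact: ltW.
have h1 : powR (sh x) m <= powR (expR 1 + 1) m * powR `|x| m.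
  rewrite -powRM ?addr_ge0 ?expR_ge0 //; apply: ge0_ler_powR => //.
  - by rewrite nnegrE sh_ge0.
  - by rewrite nnegrE mulr_ge0 // addr_ge0 // expR_ge0.
  apply: le_trans (sh_le_lin x) _; rewrite mulrC; apply: ler_wpM2r => //.
  by rewrite lerD2r ler_expR ltW.
apply: le_trans (ler_wpM2r _ h1) _; first by rewrite invr_ge0.
rewrite /shC -!mulrA; apply: ler_wpM2l; first exact: powR_ge0.
rewrite psiE // /powR gt_eqF // -[X in _ / X](lnK y0) -expRB /gw -expRD ler_expR.
have : (m - p) * ln `|x| <= 0 by rewrite mulr_ge0_le0 //; lra.
lra.
Qed.

Lemma powR_cosh_le (d x : R) : 0 <= d -> powR (coshR x) (- d) <= powR 2 d * expR (- d * `|x|).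
Proof.
move=> d0; have c2 : expR `|x| / 2 <= coshR x.
  rewrite /coshR ler_pM2r ?invr_gt0 //.
  by case: (leP 0 x) => x0; [rewrite ger0_norm|rewrite ltr0_norm]; rewrite ?lerDl ?lerDr ?expR_ge0.
have e0 := expR_gt0 `|x|.
have c0 : 0 < coshR x by apply: lt_le_trans c2; rewrite divr_gt0.
rewrite powRN -[leLHS]mul1r ler_pdivrMr; last exact: powR_gt0.
have H : powR (expR `|x| / 2) d <= powR (coshR x) d.
  by apply: ge0_ler_powR => //; rewrite nnegrE; [rewrite divr_ge0 ?expR_ge0|exact: ltW].
have t0 : 0 < powR 2 d :> R by exact: powR_gt0.
have E : powR (expR `|x| / 2) d = expR (d * `|x|) * (powR 2 d)^-1.
  by rewrite powRM ?expR_ge0 ?invr_ge0 // -expRM [_ * d]mulrC -(powR_inv1 (ler0n R 2)) -powRrM mulN1r powRN.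
rewrite E in H; have := ler_wpM2l (mulr_ge0 (ltW t0) (expR_ge0 (- d * `|x|))) H.
apply: le_trans; rewrite le_eqVlt; apply/orP; left; apply/eqP.
rewrite mulNr expRN; field; rewrite !gt_eqF ?expR_gt0 //.
Qed.

End DensityBounds.

Lemma ler_prod_at (R : realType) (I : finType) (P : pred I) (F G : I -> R) (i0 : I) (c d : R) :
  P i0 -> 0 <= d -> (forall i, P i -> 0 <= F i <= G i) -> F i0 * d <= c * G i0 ->
  (\prod_(i | P i) F i) * d <= c * \prod_(i | P i) G i.
Proof.
move=> P0 d0 FG H; rewrite (bigD1 i0) //= [in leRHS](bigD1 i0) //= mulrAC mulrA.
apply: ler_pM => //.
- by rewrite mulr_ge0 //; case/andP: (FG i0 P0).
- by apply: prodr_ge0 => i /andP[/FG/andP[]].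
- by apply: ler_prod => i /andP[/FG].
Qed.

(** * Bounds for the density and integrability against it *)

Section WeightBound.
Context {R : realType} {r : nat}.
Local Notation pt := (r.-tuple R).
Variables (a b iota : R).
Hypotheses (a0 : 0 < a) (b0 : 0 < b) (i0 : 0 < iota).
Implicit Types (t : pt).

Definition rho1 : R := iota + b + a * r.-1%:R.
Local Notation w := (mu_density a b iota).

Definition w1 (x : R) : R := powR (sh x) (2 * b) * powR (sh (2 * x)) iota.
Definition w2 (x y : R) : R := powR (sh (x - y)) a * powR (sh (x + y)) a.

Lemma wE t : w t = (\prod_(j < r) w1 (tnth t j)) *
  \prod_(p : 'I_r * 'I_r | (p.1 < p.2)%N) w2 (tnth t p.1) (tnth t p.2).
Proof. by rewrite /mu_density; congr (_ * _); rewrite pair_big_dep. Qed.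

Lemma w1_ge0 x : 0 <= w1 x. Proof. by rewrite mulr_ge0 ?powR_ge0. Qed.
Lemma w2_ge0 x y : 0 <= w2 x y. Proof. by rewrite mulr_ge0 ?powR_ge0. Qed.

Lemma w_ge0 t : 0 <= w t.
Proof.
by rewrite wE mulr_ge0 // prodr_ge0 // => *; [exact: w1_ge0|exact: w2_ge0].
Qed.

Definition v1 (x : R) : R := expR (2 * (b + iota) * `|x|).
Definition v2 (x y : R) : R := expR (2 * a * (`|x| + `|y|)).

Lemma w1_le x : w1 x <= v1 x.
Proof.
rewrite /v1 (_ : 2 * (b + iota) * `|x| = 2 * b * `|x| + iota * `|2 * x|); last first.
  by rewrite normrM ger0_norm //; ring.
rewrite expRD; apply: ler_pM; [exact: powR_ge0|exact: powR_ge0| |].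
  by apply: powR_sh_le; rewrite mulr_ge0 // ltW.
by apply: powR_sh_le; exact: ltW.
Qed.

Lemma exp_pair (x y : R) : expR (a * `|x - y|) * expR (a * `|x + y|) <= v2 x y.
Proof.
rewrite -expRD ler_expR -mulrDr -mulrA mulrCA; apply: ler_wpM2l; first exact: ltW.
by have := ler_normB x y; have := ler_normD x y; lra.
Qed.

Lemma w2_le x y : w2 x y <= v2 x y.
Proof.
apply: le_trans (exp_pair x y).
by apply: ler_pM; rewrite ?powR_ge0 //; apply: powR_sh_le; exact: ltW.
Qed.

(** Each coordinate occurs in [r - 1] pairs, so every coordinate receives the same exponent
    [2 * rho1]. Against the decay [2 * nu] of [f_delta] this is the origin of the condition
    [rho1 < nu]. *)
Lemma vE t : (\prod_(j < r) v1 (tnth t j)) *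
  \prod_(p : 'I_r * 'I_r | (p.1 < p.2)%N) v2 (tnth t p.1) (tnth t p.2) = expR (2 * rho1 * l1 t).
Proof.
rewrite -(big_morph _ (@expRD R) (@expR0 R)) -(big_morph _ (@expRD R) (@expR0 R)) -expRD; congr expR.
rewrite -!mulr_sumr -(pair_big_dep xpredT (fun i j : 'I_r => (i < j)%N) (fun i j => `|tnth t i| + `|tnth t j|)) /=.
have -> : \sum_(i < r) \sum_(j < r | (i < j)%N) (`|tnth t i| + `|tnth t j|) = r.-1%:R * l1 t.
  transitivity (\sum_(i < r) \sum_(j < r | j != i) `|tnth t i|).
    have -> : \sum_(i < r) \sum_(j < r | (i < j)%N) (`|tnth t i| + `|tnth t j|) =
      \sum_(i < r) \sum_(j < r | (i < j)%N) `|tnth t i| + \sum_(i < r) \sum_(j < r | (j < i)%N) `|tnth t i|.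
      under eq_bigr do rewrite big_split /=; rewrite big_split /=; congr (_ + _).
      by rewrite (exchange_big_dep xpredT).
    rewrite -big_split /=; apply: eq_bigr => i _.
    rewrite [RHS](bigID (fun j : 'I_r => (i < j)%N)) /=; congr (_ + _).
      by apply: eq_bigl => j; case: (ltngtP i j) => [h|h|/val_inj h]; rewrite ?andbT ?andbF // -val_eqE /= ?gtn_eqF // ltn_eqF.
    by apply: eq_bigl => j; rewrite -val_eqE /=; case: (ltngtP i j).
  rewrite /l1 mulr_sumr; apply: eq_bigr => i _; rewrite sumr_const cardC1 card_ord.
  by rewrite mulr_natl.
by rewrite /rho1 -/(l1 t); ring.
Qed.

Lemma w_le t : w t <= expR (2 * rho1 * l1 t).
Proof.
rewrite wE -vE; apply: ler_pM.
- by apply: prodr_ge0 => j _; exact: w1_ge0.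
- by apply: prodr_ge0 => j _; exact: w2_ge0.
- by apply: ler_prod => j _; rewrite w1_ge0 w1_le.
- by apply: ler_prod => j _; rewrite w2_ge0 w2_le.
Qed.

(** A common lower bound for the exponents used to absorb poles: [a] for the roots [t_j - t_k] and
    [t_j + t_k], and [2 * b] for [t_j], where [sinh (2 t_j)] is merely bounded. *)
Definition pmin : R := Num.min a (2 * b).

Lemma pmin_gt0 : 0 < pmin.
Proof. by rewrite lt_min a0 mulr_gt0. Qed.

Definition is_root (j : 'I_r) (al : pt -> R) : Prop :=
  al = (fun t => tnth t j) \/ exists2 k, k != j &
    al = (fun t => tnth t j - tnth t k) \/ al = (fun t => tnth t j + tnth t k).

Lemma root_neq0 j al t : is_root j al -> regular t -> al t != 0.
Proof.
case=> [->|[k kj [->|->]]] rt; first by have [H _] := rt; exact: H.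
- by apply: reg_sub_neq0 => //; rewrite eq_sym.
- by apply: reg_add_neq0 => //; rewrite eq_sym.
Qed.

Definition wC : R := shC a + shC (2 * b).

Lemma psiN (p x : R) : psi p (- x) = psi p x.
Proof. by rewrite /psi /evenize opprK addrC. Qed.

(** The factor of the density that belongs to the root absorbs the pole; all other factors are
    bounded as in [w_le]. *)
Lemma w_root j al t : is_root j al -> regular t ->
  w t * `|al t|^-1 <= wC * (1 + psi pmin (al t)) * expR (2 * rho1 * l1 t).
Proof.
move=> Hal rt; have al0 := root_neq0 Hal rt.
have p0 := pmin_gt0.
have pa : pmin <= a by rewrite /pmin ge_min lexx.
have pb : pmin <= 2 * b by rewrite /pmin ge_min lexx orbT.
have Ca := shC_ge1 (ltW a0); have Cb : 1 <= shC (2 * b) by apply: shC_ge1; lra.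
have ps0 := psi_ge0 pmin (al t).
have d0 : 0 <= `|al t|^-1 by rewrite invr_ge0.
rewrite wE -vE.
have P1 : 0 <= \prod_(j < r) w1 (tnth t j) <= \prod_(j < r) v1 (tnth t j).
  apply/andP; split; first by apply: prodr_ge0 => *; exact: w1_ge0.
  by apply: ler_prod => i _; rewrite w1_ge0 w1_le.
have P2 : 0 <= \prod_(p : 'I_r * 'I_r | (p.1 < p.2)%N) w2 (tnth t p.1) (tnth t p.2) <=
   \prod_(p : 'I_r * 'I_r | (p.1 < p.2)%N) v2 (tnth t p.1) (tnth t p.2).
  apply/andP; split; first by apply: prodr_ge0 => *; exact: w2_ge0.
  by apply: ler_prod => i _; rewrite w2_ge0 w2_le.
case/andP: P1 => P10 P1; case/andP: P2 => P20 P2.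
case: Hal => [E|[k kj E]].
  rewrite mulrAC [leRHS]mulrA; apply: ler_pM => //; first by rewrite mulr_ge0.
  apply: (@ler_prod_at _ _ _ _ _ j) => // [i _|]; first by rewrite w1_ge0 w1_le.
  have H := powR_sh_sing p0 pb al0; rewrite {2}E in H.
  rewrite /w1 mulrAC; have -> : `|al t|^-1 = `|tnth t j|^-1 by rewrite E.
  apply: (@le_trans _ _ (shC (2 * b) * expR (2 * b * `|al t|) * (1 + psi pmin (al t)) * expR (iota * `|2 * tnth t j|))).
    apply: ler_pM; [by apply: mulr_ge0; [exact: powR_ge0|rewrite invr_ge0]|exact: powR_ge0| |].
      by move: H; rewrite E.
    by apply: powR_sh_le; exact: ltW.
  have -> : v1 (tnth t j) = expR (2 * b * `|al t|) * expR (iota * `|2 * tnth t j|).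
    by rewrite /v1 -expRD E normrM ger0_norm //; congr expR; ring.
  have -> : forall c e q f : R, c * e * q * f = c * q * (e * f) by move=> *; ring.
  apply: ler_wpM2r; first by rewrite mulr_ge0 ?expR_ge0.
  by apply: ler_wpM2r; rewrite /wC; lra.
have key x y (s : bool) : 
   let z := if s then x - y else x + y in z != 0 ->
   w2 x y * `|z|^-1 <= wC * (1 + psi pmin z) * v2 x y.
  move=> z z0; have H := powR_sh_sing p0 pa z0.
  have psz := psi_ge0 pmin z.
  apply: (@le_trans _ _ (shC a * (1 + psi pmin z) * (expR (a * `|x - y|) * expR (a * `|x + y|)))).
    have H1 : powR (sh (x - y)) a <= expR (a * `|x - y|) by apply: powR_sh_le; exact: ltW.
    have H2 : powR (sh (x + y)) a <= expR (a * `|x + y|) by apply: powR_sh_le; exact: ltW.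
    have zi : 0 <= `|z|^-1 by rewrite invr_ge0.
    rewrite /w2; case: s @z z0 H psz zi => /= z0 H psz zi.
      rewrite mulrAC [leRHS]mulrA; apply: ler_pM; [by apply: mulr_ge0; [exact: powR_ge0|]|exact: powR_ge0| |exact: H2].
      by rewrite mulrAC.
    rewrite -mulrA [leRHS](_ : _ = expR (a * `|x - y|) * (shC a * expR (a * `|x + y|) * (1 + psi pmin (x + y)))); last by ring.
    by apply: ler_pM => //; rewrite ?mulr_ge0 ?powR_ge0.
  have shC0 : 0 <= shC a by lra.
  apply: ler_pM; [by apply: mulr_ge0; lra|by apply: mulr_ge0; exact: expR_ge0| |exact: exp_pair].
  by apply: ler_wpM2r; rewrite /wC; lra.
rewrite -mulrA [leRHS](_ : _ = (\prod_(j < r) v1 (tnth t j)) * (wC * (1 + psi pmin (al t)) *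
  \prod_(p : 'I_r * 'I_r | (p.1 < p.2)%N) v2 (tnth t p.1) (tnth t p.2))); last by ring.
apply: ler_pM => //; first by rewrite mulr_ge0.
have FG p : (fun p : 'I_r * 'I_r => p.1 < p.2)%N p ->
  0 <= w2 (tnth t p.1) (tnth t p.2) <= v2 (tnth t p.1) (tnth t p.2) by rewrite w2_ge0 w2_le.
case: (ltngtP j k) => jk; last by move/val_inj: jk kj => ->; rewrite eqxx.
  apply: (@ler_prod_at _ _ _ _ _ (j, k)) => //=.
  by case: E => E; [have := @key (tnth t j) (tnth t k) true|have := @key (tnth t j) (tnth t k) false]; rewrite /= E; apply; move: al0; rewrite E.
apply: (@ler_prod_at _ _ _ _ _ (k, j)) => //=.
case: E => E.
  have := @key (tnth t k) (tnth t j) true; rewrite /= -opprB normrN psiN oppr_eq0 E; apply.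
  by move: al0; rewrite E.
have := @key (tnth t k) (tnth t j) false; rewrite /= addrC E; apply.
by move: al0; rewrite E.
Qed.

Lemma f_delta_le (nu : R) t : 0 <= nu -> f_delta (- 2 * nu) t <= powR 2 (2 * nu) ^+ r * expl1 (2 * nu) t.
Proof.
move=> nu0; rewrite expl1_prod.
have -> : powR 2 (2 * nu) ^+ r = \prod_(j < r) powR 2 (2 * nu) :> R by rewrite prodr_const card_ord.
rewrite -big_split /=; apply: ler_prod => j _; rewrite powR_ge0 mulNr /=.
by apply: powR_cosh_le; rewrite mulr_ge0.
Qed.

Lemma f_delta_ge0 (de : R) t : 0 <= f_delta de t.
Proof. by apply: prodr_ge0 => *; exact: powR_ge0. Qed.

Lemma w_nonreg t : ~ regular t -> w t = 0.
Proof.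
move=> nr; apply: contrapT => /eqP w0; apply: nr.
move: w0; rewrite wE mulf_eq0 negb_or => /andP[h1 h2].
have H1 j : sh (tnth t j) != 0.
  apply: contraNneq h1 => e; rewrite prodf_seq_eq0; apply/hasP; exists j; rewrite ?mem_index_enum //=.
  by rewrite /w1 e powR0 ?mul0r // gt_eqF // mulr_gt0.
have H2 (j k : 'I_r) : j != k -> sh (tnth t j - tnth t k) != 0 /\ sh (tnth t j + tnth t k) != 0.
  wlog jk : j k / (j < k)%N.
    move=> H jk; case: (ltngtP j k) => [h|h|/val_inj e]; last by move: jk; rewrite e eqxx.
      exact: H.
    have kj : k != j by rewrite eq_sym.
    by have [q1 q2] := H k j h kj; rewrite -opprB shN [tnth t j + _]addrC.
  move=> _; suff : w2 (tnth t j) (tnth t k) != 0.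
    rewrite /w2 mulf_eq0 negb_or => /andP[q1 q2]; split.
      by apply: contraNneq q1 => ->; rewrite powR0 // gt_eqF.
    by apply: contraNneq q2 => ->; rewrite powR0 // gt_eqF.
  apply: contraNneq h2 => e; rewrite prodf_seq_eq0; apply/hasP; exists (j, k); rewrite ?mem_index_enum //=.
  by rewrite jk e eqxx.
split=> [j|j k jk].
  by apply: contraNneq (H1 j) => ->; rewrite sh0.
have [q1 q2] := H2 j k jk; split.
  by apply: contraNneq q1 => ->; rewrite subrr sh0.
by apply: contraNneq q2 => ->; rewrite addNr sh0.
Qed.

Lemma continuous_coshR : continuous (@coshR R).
Proof.
move=> x; apply: cvgM; last exact: cvg_cst.
apply: cvgD; first exact: continuous_expR.
by apply: (@continuous_comp _ _ _ -%R (@expR R)); [exact: continuousN|exact: continuous_expR].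
Qed.

Lemma coshR_gt0 (x : R) : 0 < coshR x.
Proof. by rewrite /coshR divr_gt0 // addr_gt0 ?expR_gt0. Qed.

Lemma measurable_f_delta (de : R) : measurable_fun setT (f_delta de : TT r -> R).
Proof.
apply: measurable_prod => k _.
apply: (measurableT_comp (f := fun x : R => powR (coshR x) de)); last exact: measurable_tnth.
apply: (measurableT_comp (measurable_powR de)).
exact: continuous_measurable_fun continuous_coshR.
Qed.

Lemma continuous_sh : continuous (@sh R).
Proof.
rewrite (_ : @sh R = fun x => `|expR x - expR (- x)|); last by apply/funext => x; exact: shE.
move=> x; apply: cvg_norm; apply: cvgB; first exact: continuous_expR.
by apply: (@continuous_comp _ _ _ -%R (@expR R)); [exact: continuousN|exact: continuous_expR].
Qed.

Lemma measurable_shp (m : R) (al : TT r -> R) : measurable_fun setT al ->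
  measurable_fun setT (fun t => powR (sh (al t)) m).
Proof.
move=> mal; apply: (measurableT_comp (measurable_powR m)).
by apply: (measurableT_comp (continuous_measurable_fun continuous_sh)).
Qed.

Lemma measurable_w : measurable_fun setT (w : TT r -> R).
Proof.
have mt (k : 'I_r) : measurable_fun setT (fun t : TT (R:=R) r => tnth t k) by exact: measurable_tnth.
apply: measurable_funM.
  apply: measurable_prod => k _; apply: measurable_funM; first exact: measurable_shp.
  by apply: measurable_shp; apply: measurable_funM => //; exact: measurable_cst.
apply: measurable_prod => k _.
rewrite (_ : (fun t => _) = fun t : TT r => \prod_(j < r) (if (k < j)%N then w2 (tnth t k) (tnth t j) else 1)); last first.
  by apply/funext => t; rewrite big_mkcond.
apply: measurable_prod => j _; case: (k < j)%N; last exact: measurable_cst.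
by apply: measurable_funM; apply: measurable_shp; [apply: measurable_funB|apply: measurable_funD].
Qed.

Definition fw (nu : R) t : R := f_delta (- 2 * nu) t * w t.

Lemma fw_ge0 nu t : 0 <= fw nu t.
Proof. by rewrite mulr_ge0 ?f_delta_ge0 ?w_ge0. Qed.

Lemma measurable_fw nu : measurable_fun setT (fw nu : TT r -> R).
Proof. by apply: measurable_funM; [exact: measurable_f_delta|exact: measurable_w]. Qed.

Lemma fw_nonreg nu t : ~ regular t -> fw nu t = 0.
Proof. by move=> /w_nonreg w0; rewrite /fw w0 mulr0. Qed.

Lemma rho1_gt0 : 0 < rho1.
Proof. apply: ltr_pwDl; [exact: addr_gt0|by apply: mulr_ge0 => //; exact: ltW]. Qed.

(** Allows a simple pole along one wall. Such poles appear when the two halves of a difference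
    quotient are integrated separately, as the change of variables by a reflection requires. *)
Lemma dom_integrable (nu eps C : R) (j : 'I_r) (al : pt -> R) (F : pt -> R) :
  0 <= eps -> eps < 2 * (nu - rho1) -> is_root j al -> 0 <= C ->
  measurable_fun setT (F : TT r -> R) ->
  (forall t, regular t -> `|F t| <= C * expR (eps * l1 t) * (1 + `|al t|^-1)) ->
  (leb r).-integrable setT (fun t : TT r => (F t * fw nu t)%:E).
Proof.
move=> e0 ep Hal C0 mF HF.
have rh0 := rho1_gt0; have nu0 : 0 <= nu by lra.
pose ka := 2 * nu - 2 * rho1 - eps; have k0 : 0 < ka by rewrite /ka; lra.
pose A := powR 2 (2 * nu) ^+ r : R; have A0 : 0 <= A by rewrite exprn_ge0 // powR_ge0.
have W0 : 0 <= wC.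
  have := shC_ge1 (ltW a0); have : 1 <= shC (2 * b) by apply: shC_ge1; rewrite mulr_ge0 // ltW.
  by rewrite /wC; lra.
have mal : measurable_fun setT (al : TT (R:=R) r -> R).
  have mt (k : 'I_r) : measurable_fun setT (fun t : TT (R:=R) r => tnth t k) by exact: measurable_tnth.
  by case: Hal => [->|[k _ [->|->]]] //; [apply: measurable_funB|apply: measurable_funD].
have up t (x : R) : al (upd t j x) = x + al (upd t j 0).
  have tu y k : tnth (upd t j y) k = if k == j then y else tnth t k by rewrite tnth_mktuple.
  case: Hal => [->|[k kj [->|->]]]; rewrite !tu eqxx ?(negbTE kj); ring.
have I1 : (leb r).-integrable setT (fun t : TT (R:=R) r => (expl1 ka t)%:E).
  apply/integrableP; split; first by apply/measurable_EFinP; exact: measurable_expl1.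
  by under eq_integral do rewrite gee0_abs ?lee_fin ?expR_ge0 //; exact: int_expl1.
have mp : measurable_fun setT (fun t : TT (R:=R) r => expl1 ka t * psi pmin (al t)).
  apply: measurable_funM; first exact: measurable_expl1.
  by apply: (measurableT_comp (measurable_psi _)).
have I2 : (leb r).-integrable setT (fun t : TT (R:=R) r => (expl1 ka t * psi pmin (al t))%:E).
  apply/integrableP; split; first exact/measurable_EFinP.
  under eq_integral do rewrite gee0_abs ?lee_fin ?mulr_ge0 ?expR_ge0 ?psi_ge0 //.
  exact: (int_expl1_psi k0 pmin_gt0 mal up).
have I := integrableD measurableT (integrableZl measurableT (C * A * (1 + wC)) I1)
  (integrableZl measurableT (C * A * wC) I2).
apply: le_integrable I => //.
  by apply/measurable_EFinP; apply: measurable_funM mF _; exact: measurable_fw.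
move=> t _; rewrite /= lee_fin.
have ps0 := psi_ge0 pmin (al t); have ex0 : 0 <= expl1 ka t by exact: expR_ge0.
have CA0 : 0 <= C * A by rewrite mulr_ge0.
apply: le_trans (ler_norm _); rewrite normrM (ger0_norm (fw_ge0 nu t)).
case: (pselect (regular t)) => [rt|nr]; last first.
  rewrite fw_nonreg // mulr0 addr_ge0 //; apply: mulr_ge0; rewrite ?mulr_ge0 //; lra.
have al0 := root_neq0 Hal rt; have ai0 : 0 <= `|al t|^-1 by rewrite invr_ge0.
apply: (@le_trans _ _ (C * expR (eps * l1 t) * (1 + `|al t|^-1) * (A * expl1 (2 * nu) t * w t))).
  apply: ler_pM => //; [exact: fw_ge0|exact: HF|].
  by apply: ler_wpM2r; [exact: w_ge0|exact: f_delta_le].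
have H : (1 + `|al t|^-1) * w t <= (1 + wC + wC * psi pmin (al t)) * expR (2 * rho1 * l1 t).
  have h1 := w_le t; have h2 := w_root Hal rt; rewrite mulrDl mul1r [_^-1 * _]mulrC.
  by apply: le_trans (lerD h1 h2) _; rewrite le_eqVlt; apply/orP; left; apply/eqP; ring.
have X0 : 0 <= C * A * (expR (eps * l1 t) * expl1 (2 * nu) t).
  by rewrite mulr_ge0 // mulr_ge0 // expR_ge0.
have -> : C * expR (eps * l1 t) * (1 + `|al t|^-1) * (A * expl1 (2 * nu) t * w t) =
  C * A * (expR (eps * l1 t) * expl1 (2 * nu) t) * ((1 + `|al t|^-1) * w t) by ring.
apply: le_trans (ler_wpM2l X0 H) _; rewrite le_eqVlt; apply/orP; left; apply/eqP.
have -> : expl1 ka t = expR (eps * l1 t) * expl1 (2 * nu) t * expR (2 * rho1 * l1 t).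
  by rewrite /expl1 -!expRD /ka; congr expR; ring.
ring.
Qed.

Lemma bnd_integrable (nu eps : R) (j : 'I_r) (F : pt -> R) :
  0 <= eps -> eps < 2 * (nu - rho1) -> bnd eps F -> measurable_fun setT (F : TT r -> R) ->
  (leb r).-integrable setT (fun t : TT r => (F t * fw nu t)%:E).
Proof.
move=> e0 ep [C C0 HF] mF; apply: (@dom_integrable nu eps C j (fun t => tnth t j)) => //; first by left.
move=> t rt; apply: le_trans (HF t rt) _; rewrite -[leLHS]mulr1; apply: ler_wpM2l.
  by rewrite mulr_ge0 ?expR_ge0.
by rewrite lerDl invr_ge0.
Qed.

End WeightBound.

(** * Logarithmic derivatives *)

Section LogDerivatives.
Context {R : realType}.

Lemma is_derive_prod_log (I : Type) (s : seq I) (P : pred I) (F : I -> R -> R) (l : I -> R) (x : R) :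
  (forall i, P i -> is_derive x 1 (F i) (l i * F i x)) ->
  is_derive x 1 (fun y : R => \prod_(i <- s | P i) F i y) ((\sum_(i <- s | P i) l i) * \prod_(i <- s | P i) F i x).
Proof.
move=> H; elim: s => [|i s IH].
  rewrite !big_nil mul0r (_ : (fun y => _) = cst 1); first exact: is_derive_cst.
  by apply/funext => y; rewrite big_nil.
rewrite !big_cons; case: ifP => Pi; last first.
  by rewrite (_ : (fun y => _) = (fun y : R => \prod_(i <- s | P i) F i y)) //; apply/funext => y; rewrite big_cons Pi.
rewrite (_ : (fun y => _) = F i * (fun y : R => \prod_(i <- s | P i) F i y)); last first.
  by apply/funext => y; rewrite big_cons Pi.
by apply: is_derive_eq (is_deriveM (H i Pi) IH) _; rewrite /GRing.scale /=; ring.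
Qed.

Lemma is_derive_mul (f g : R -> R) (x df dg : R) : is_derive x 1 f df -> is_derive x 1 g dg ->
  is_derive x 1 (fun y : R => f y * g y) (df * g x + f x * dg).
Proof. by move=> Df Dg; apply: is_derive_eq (is_deriveM Df Dg) _; rewrite /GRing.scale /=; ring. Qed.

Definition th (x : R) : R := sinhR x / coshR x.

Lemma is_derive_explin1 (c : R) (x : R) : is_derive x 1 (fun y : R => expR (c * y)) (c * expR (c * x)).
Proof.
apply: is_derive_eq (is_derive1_comp (is_derive_expR _) (is_deriveZ c (is_derive_id x (1 : R)))) _.
by rewrite /GRing.scale /=; ring.
Qed.

Lemma is_derive_coshR (x : R) : is_derive x 1 coshR (sinhR x).
Proof.
rewrite (_ : coshR = fun y : R => 2^-1 * (expR (1 * y) + expR (- 1 * y))); last first.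
  by apply/funext => y; rewrite /coshR mul1r mulN1r mulrC.
apply: is_derive_eq (is_deriveZ (2^-1 : R) (is_deriveD (is_derive_explin1 1 x) (is_derive_explin1 (-1) x))) _.
by rewrite /GRing.scale /= /sinhR mul1r mulN1r mul1r mulN1r mulrC.
Qed.

Lemma is_derive_powR_cosh (de x : R) :
  is_derive x 1 (fun y : R => powR (coshR y) de) (de * th x * powR (coshR x) de).
Proof.
have E y : powR (coshR y) de = expR (de * ln (coshR y)) by rewrite /powR gt_eqF // coshR_gt0.
rewrite (_ : (fun y => _) = fun y => expR (de * ln (coshR y))); last by apply/funext => y; exact: E.
have D1 := is_derive1_comp (is_derive1_ln (coshR_gt0 x)) (is_derive_coshR x).
apply: is_derive_eq (is_derive1_comp (is_derive_expR _) (is_deriveZ de D1)) _.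
by rewrite E /GRing.scale /= /th; ring.
Qed.

Lemma coth_kap (z : R) : z != 0 -> expR z + expR (- z) = (2 * kap z - 1) * (expR z - expR (- z)).
Proof.
move=> z0; have e0 := exp_neq1 z0; rewrite /kap.
have E2 : expR (- 2 * z) = expR (- z) ^+ 2 by rewrite -expRM_natl; congr expR; ring.
have Ez : expR z = (expR (- z))^-1 by rewrite expRN invrK.
rewrite E2 in e0 *; move: e0; rewrite Ez.
have := expR_gt0 (- z); move: (expR (- z)) => u u0 e0.
by field; rewrite e0 gt_eqF.
Qed.

Lemma sh_eq0 (z : R) : (sh z == 0) = (z == 0).
Proof.
rewrite sh_norm subr_eq0 (inj_eq (@expR_inj R)) -subr_eq0 opprK -mulr2n mulrn_eq0 /=.
by rewrite normr_eq0.
Qed.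

(** The absolute value is avoided by writing [|q| ^ m] as [exp (m / 2 * ln (q ^ 2))]; the factor
    [2 * kap - 1] is [coth]. *)
Lemma is_derive_powR_sh (m c d x : R) : c * x + d != 0 ->
  is_derive x 1 (fun y : R => powR (sh (c * y + d)) m)
    (m * c * (2 * kap (c * x + d) - 1) * powR (sh (c * x + d)) m).
Proof.
move=> z0; set z := c * x + d in z0 *.
pose q (y : R) := expR d * expR (c * y) - expR (- d) * expR (- c * y).
have qE y : q y = expR (c * y + d) - expR (- (c * y + d)).
  by rewrite /q -!expRD opprD mulNr [d + _]addrC [- d + _]addrC.
have shq y : sh (c * y + d) = `|q y| by rewrite shE qE.
have sh2 y : c * y + d != 0 -> powR (sh (c * y + d)) m = expR (m / 2 * ln (q y * q y)).
  move=> y0; have s0 : sh (c * y + d) != 0 by rewrite sh_eq0.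
  rewrite /powR (negbTE s0) -expr2 -real_normK ?num_real // -shq lnXn ?lt0r ?s0 ?sh_ge0 //.
  by congr expR; rewrite -mulr_natl; field.
have qx0 : q x != 0 by rewrite -normr_eq0 -shq sh_eq0.
have q2 : 0 < q x * q x by rewrite -expr2 exprn_even_gt0.
apply: (@near_eq_is_derive _ _ _ (fun y : R => expR (m / 2 * ln (q y * q y)))).
  have C : (fun y : R => c * y + d) y @[y --> x] --> z.
    by apply: cvgD; [apply: cvgM; [exact: cvg_cst|exact: cvg_id]|exact: cvg_cst].
  by apply: filterS (cvgr_neq0 z C z0) => y H; rewrite sh2.
have Dq : is_derive x 1 q (expR d * (c * expR (c * x)) - expR (- d) * (- c * expR (- c * x))).
  exact: is_deriveB (is_deriveZ (expR d) (is_derive_explin1 c x)) (is_deriveZ (expR (- d)) (is_derive_explin1 (- c) x)).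
have D1 := is_derive1_comp (f := @ln R) (g := fun y => q y * q y) (is_derive1_ln q2) (is_derive_mul Dq Dq).
apply: is_derive_eq (is_derive1_comp (is_derive_expR _) (is_deriveZ (m / 2) D1)) _.
rewrite sh2 // /GRing.scale /=.
have H := coth_kap z0; have qx : q x = expR z - expR (- z) by rewrite qE.
set E := expR (m / 2 * _).
have -> : expR d * (c * expR (c * x)) - expR (- d) * (- c * expR (- c * x)) = c * ((2 * kap z - 1) * q x).
  rewrite qx -H /z opprD !expRD !mulNr; ring.
by field.
Qed.

End LogDerivatives.

Lemma fwE {R : realType} {r : nat} (a b iota nu : R) (t : r.-tuple R) :
  fw a b iota nu t = f_delta (- 2 * nu) t * mu_density a b iota t.
Proof. by []. Qed.

(** * The weight along a coordinate line *)

Section WeightLine.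
Context {R : realType} {r : nat}.
Variables (a b iota : R).
Hypotheses (a0 : 0 < a) (b0 : 0 < b) (i0 : 0 < iota).
Variable (nu : R).
Implicit Types (t : r.-tuple R).
Local Notation fw := (@fw R r a b iota nu).

Definition c2 (x y : R) : R := a * (2 * kap (x - y) - 1) + a * (2 * kap (x + y) - 1).

(** The logarithmic derivative of [fw] in direction [j], with every [coth] written as
    [2 * kap - 1]. *)
Definition Ll (j : 'I_r) t : R :=
  - 2 * nu * th (tnth t j) +
  (2 * b * (2 * kap (tnth t j) - 1) + 2 * iota * (2 * kap (2 * tnth t j) - 1)) +
  \sum_(k | k != j) c2 (tnth t j) (tnth t k).

Lemma is_derive_w1 (x : R) : x != 0 ->
  is_derive x 1 (w1 b iota) ((2 * b * (2 * kap x - 1) + 2 * iota * (2 * kap (2 * x) - 1)) * w1 b iota x).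
Proof.
move=> x0.
have h1 : 1 * x + 0 != 0 by rewrite mul1r addr0.
have h2 : 2 * x + 0 != 0 by rewrite addr0 mulf_neq0.
have D := is_derive_mul (is_derive_powR_sh (2 * b) h1) (is_derive_powR_sh iota h2).
rewrite (_ : w1 b iota = (fun y : R => powR (sh (1 * y + 0)) (2 * b) * powR (sh (2 * y + 0)) iota)); last first.
  by apply/funext => y; rewrite mul1r !addr0.
by apply: is_derive_eq D _ => /=; rewrite mul1r !addr0; move: (powR _ _) (powR _ _) (kap _) (kap _) => *; ring.
Qed.

Lemma is_derive_w2l (x y : R) : x - y != 0 -> x + y != 0 ->
  is_derive x 1 (fun x => w2 a x y) (c2 x y * w2 a x y).
Proof.
move=> xy xy'.
have h1 : 1 * x + (- y) != 0 by rewrite mul1r.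
have h2 : 1 * x + y != 0 by rewrite mul1r.
have D := is_derive_mul (is_derive_powR_sh a h1) (is_derive_powR_sh a h2).
rewrite (_ : (fun x => w2 a x y) = (fun u : R => powR (sh (1 * u + (- y))) a * powR (sh (1 * u + y)) a)); last first.
  by apply/funext => u; rewrite mul1r.
by apply: is_derive_eq D _ => /=; rewrite mul1r /c2 /w2; move: (powR _ _) (powR _ _) (kap _) (kap _) => *; ring.
Qed.

Lemma w2C (x y : R) : w2 a x y = w2 a y x.
Proof. by rewrite /w2 -[x - y]opprB shN [x + y]addrC. Qed.

Lemma tnth_upd t j x k : tnth (upd t j x) k = if k == j then x else tnth t k.
Proof. by rewrite tnth_mktuple. Qed.

Lemma is_derive_fw j t : regular t -> is_derive (tnth t j) 1 (fun x => fw (upd t j x)) (Ll j t * fw t).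
Proof.
move=> rt; set x := tnth t j.
have D1 : is_derive x 1 (fun y => f_delta (- 2 * nu) (upd t j y)) (- 2 * nu * th x * f_delta (- 2 * nu) t).
  have H k : xpredT k -> is_derive x 1 (fun y : R => powR (coshR (tnth (upd t j y) k)) (- 2 * nu))
     ((if k == j then - 2 * nu * th x else 0) * powR (coshR (tnth (upd t j x) k)) (- 2 * nu)).
    move=> _; case: eqP => [->|/eqP/negPf kj].
      rewrite (_ : (fun y => _) = fun y : R => powR (coshR y) (- 2 * nu)); last first.
        by apply/funext => y; rewrite tnth_upd eqxx.
      by rewrite tnth_upd eqxx; exact: is_derive_powR_cosh.
    rewrite mul0r (_ : (fun y => _) = cst (powR (coshR (tnth t k)) (- 2 * nu))); first exact: is_derive_cst.
    by apply/funext => y; rewrite tnth_upd kj.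
  apply: is_derive_eq (is_derive_prod_log _ H) _.
  by rewrite -big_mkcond big_pred1_eq upd_id.
have D2 : is_derive x 1 (fun y => \prod_(k < r) w1 b iota (tnth (upd t j y) k))
   ((2 * b * (2 * kap x - 1) + 2 * iota * (2 * kap (2 * x) - 1)) * \prod_(k < r) w1 b iota (tnth t k)).
  set l := (X in X * _).
  have H k : xpredT k -> is_derive x 1 (fun y : R => w1 b iota (tnth (upd t j y) k))
     ((if k == j then l else 0) * w1 b iota (tnth (upd t j x) k)).
    move=> _; case: eqP => [->|/eqP/negPf kj].
      rewrite (_ : (fun y => _) = w1 b iota); last by apply/funext => y; rewrite tnth_upd eqxx.
      by rewrite tnth_upd eqxx; apply: is_derive_w1; have [h _] := rt; exact: h.
    rewrite mul0r (_ : (fun y => _) = cst (w1 b iota (tnth t k))); first exact: is_derive_cst.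
    by apply/funext => y; rewrite tnth_upd kj.
  apply: is_derive_eq (is_derive_prod_log _ H) _.
  by rewrite -big_mkcond big_pred1_eq upd_id.
pose l2 (p : 'I_r * 'I_r) := if p.1 == j then c2 x (tnth t p.2) else if p.2 == j then c2 x (tnth t p.1) else 0.
have D3 : is_derive x 1 (fun y => \prod_(p : 'I_r * 'I_r | (p.1 < p.2)%N) w2 a (tnth (upd t j y) p.1) (tnth (upd t j y) p.2))
   ((\sum_(p : 'I_r * 'I_r | (p.1 < p.2)%N) l2 p) * \prod_(p : 'I_r * 'I_r | (p.1 < p.2)%N) w2 a (tnth t p.1) (tnth t p.2)).
  have H (p : 'I_r * 'I_r) : (p.1 < p.2)%N -> is_derive x 1 (fun y : R => w2 a (tnth (upd t j y) p.1) (tnth (upd t j y) p.2))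
     (l2 p * w2 a (tnth (upd t j x) p.1) (tnth (upd t j x) p.2)).
    move=> p12; have pn : p.1 != p.2 by rewrite -val_eqE /= ltn_eqF.
    rewrite upd_id /l2; case: (eqVneq p.1 j) => [e|n1].
      rewrite (_ : (fun y => _) = fun y => w2 a y (tnth t p.2)); last first.
        by apply/funext => y; rewrite !tnth_upd e eqxx -e eq_sym (negbTE pn).
      rewrite e; apply: is_derive_w2l; rewrite /x -e; [exact: reg_sub_neq0|exact: reg_add_neq0].
    case: (eqVneq p.2 j) => [e|n2].
      rewrite (_ : (fun y => _) = fun y => w2 a y (tnth t p.1)); last first.
        by apply/funext => y; rewrite !tnth_upd e eqxx (negbTE n1) w2C.
      rewrite w2C e; apply: is_derive_w2l; rewrite /x -e; [apply: reg_sub_neq0|apply: reg_add_neq0] => //; by rewrite eq_sym.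
    rewrite mul0r (_ : (fun y => _) = cst (w2 a (tnth t p.1) (tnth t p.2))); first exact: is_derive_cst.
    by apply/funext => y; rewrite !tnth_upd (negbTE n1) (negbTE n2).
  by apply: is_derive_eq (is_derive_prod_log _ H) _; rewrite upd_id.
have E2 : \sum_(p : 'I_r * 'I_r | (p.1 < p.2)%N) l2 p = \sum_(k | k != j) c2 x (tnth t k).
  rewrite -(pair_big_dep xpredT (fun i k : 'I_r => (i < k)%N) (fun i k => l2 (i, k))) /= (bigD1 j) //=.
  have -> : \sum_(k < r | (j < k)%N) l2 (j, k) = \sum_(k < r | (j < k)%N) c2 x (tnth t k).
    by apply: eq_bigr => k _; rewrite /l2 /= eqxx.
  have -> : \sum_(i < r | i != j) \sum_(k < r | (i < k)%N) l2 (i, k) = \sum_(i < r | (i < j)%N) c2 x (tnth t i).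
    rewrite [RHS](_ : _ = \sum_(i < r | i != j) (if (i < j)%N then c2 x (tnth t i) else 0)); last first.
      rewrite -big_mkcondr /=; apply: eq_bigl => i; case: (ltngtP i j) => [h|h|/val_inj ->]; rewrite ?andbF ?eqxx ?andbT //.
      by rewrite -val_eqE /= ltn_eqF.
    apply: eq_bigr => i /negPf ij; rewrite /l2 /=.
    rewrite [LHS](_ : _ = \sum_(k < r | (i < k)%N) (if k == j then c2 x (tnth t i) else 0)); last first.
      by apply: eq_bigr => k _; rewrite ij.
    rewrite -big_mkcondr /=; case: ifP => h.
      rewrite (big_pred1 j) // => k /=; case: (eqVneq k j) => [->|_]; rewrite ?h ?andbF //.
    by rewrite big_pred0 // => k; case: (eqVneq k j) => [->|_]; rewrite ?h ?andbF.
  rewrite addrC [RHS](bigID (fun i : 'I_r => (i < j)%N)) /=; congr (_ + _).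
    by apply: eq_bigl => k; rewrite -val_eqE /=; case: (ltngtP k j).
  by apply: eq_bigl => k; rewrite -val_eqE /=; case: (ltngtP k j).
rewrite E2 in D3.
have D := is_derive_mul D1 (is_derive_mul D2 D3).
rewrite (_ : (fun y => fw (upd t j y)) = (fun y => f_delta (- 2 * nu) (upd t j y) *
  ((\prod_(k < r) w1 b iota (tnth (upd t j y) k)) *
   (\prod_(p : 'I_r * 'I_r | (p.1 < p.2)%N) w2 a (tnth (upd t j y) p.1) (tnth (upd t j y) p.2))))); last first.
  by apply/funext => y; rewrite fwE wE.
by apply: is_derive_eq D _; rewrite !upd_id fwE wE /Ll -/x; ring.
Qed.

Lemma continuous_powR_sh (m : R) : 0 < m -> continuous (fun x : R => powR (sh x) m).
Proof.
move=> m0 x; have [->|x0] := eqVneq x 0.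
  rewrite /continuous_at sh0 powR0 ?gt_eqF //; apply/cvgr0Pnorm_lt => e e0.
  have d0 : 0 < powR e m^-1 by exact: powR_gt0.
  have C : sh x @[x --> (0 : R)] --> 0 by have := @continuous_sh R 0; rewrite /continuous_at sh0.
  have /cvgr0Pnorm_lt/(_ _ d0) := C; apply: filterS => y; rewrite ger0_norm ?sh_ge0 // => H.
  rewrite ger0_norm ?powR_ge0 // -[ltRHS](powRr1 (ltW e0)) -(mulVf (lt0r_neq0 m0)) powRrM.
  by apply: gt0_ltr_powR => //; rewrite nnegrE ?sh_ge0 ?powR_ge0.
have h : 1 * x + 0 != 0 by rewrite mul1r addr0.
have := is_derive_cont (is_derive_powR_sh m h).
have E : (fun y : R => powR (sh (1 * y + 0)) m) = (fun y => powR (sh y) m).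
  by apply/funext => y; rewrite mul1r addr0.
move=> C; exact: (eq_ind _ (fun g : R -> R => {for x, continuous g}) C _ E).
Qed.

Lemma cvg_prod (I : Type) (s : seq I) (P : pred I) (F : I -> R -> R) (x : R) :
  (forall i, {for x, continuous (F i)}) -> {for x, continuous (fun y => \prod_(i <- s | P i) F i y)}.
Proof.
move=> H; elim: s => [|i s IH].
  by rewrite (_ : (fun y => _) = cst 1); [exact: cvg_cst|apply/funext => y; rewrite big_nil].
case Pi: (P i); last first.
  by rewrite (_ : (fun y => _) = (fun y : R => \prod_(i <- s | P i) F i y)) //; apply/funext => y; rewrite big_cons Pi.
rewrite (_ : (fun y => _) = (fun y : R => F i y * \prod_(i <- s | P i) F i y)); first by apply: cvgM; [exact: H|exact: IH].
by apply/funext => y; rewrite big_cons Pi.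
Qed.

Lemma continuous_fw j t : continuous (fun x => fw (upd t j x)).
Proof.
move=> x.
have cu k : {for x, continuous (fun y => tnth (upd t j y) k)}.
  case: (eqVneq k j) => [->|kj].
    rewrite (_ : (fun y => _) = id); first exact: cvg_id.
    by apply/funext => y; rewrite tnth_upd eqxx.
  rewrite (_ : (fun y => _) = cst (tnth t k)); first exact: cvg_cst.
  by apply/funext => y; rewrite tnth_upd (negbTE kj).
have cs m (u : R -> R) : 0 < m -> {for x, continuous u} -> {for x, continuous (fun y => powR (sh (u y)) m)}.
  by move=> m0 cu'; apply: (@continuous_comp _ _ _ u (fun z => powR (sh z) m)) => //; exact: continuous_powR_sh.
apply: cvgM.
  apply: cvg_prod => k; apply: (@continuous_comp _ _ _ (fun y => tnth (upd t j y) k) (fun z => powR (coshR z) (- 2 * nu))) => //.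
  exact: is_derive_cont (is_derive_powR_cosh _ _).
rewrite /mu_density; apply: cvgM.
  apply: cvg_prod => k; apply: cvgM; apply: cs; rewrite ?mulr_gt0 //.
  by apply: cvgM; [exact: cvg_cst|exact: cu].
apply: cvg_prod => k; apply: cvg_prod => l; apply: cvgM; apply: cs => //.
  by apply: cvgB; exact: cu.
by apply: cvgD; exact: cu.
Qed.

End WeightLine.

(** * Decay along lines and crossings of the walls *)

Section LineLimits.
Context {R : realType}.

Lemma cvg0_expdecay (F : R -> R) (K ka : R) : 0 <= K -> 0 < ka ->
  (forall x, `|F x| <= K * expR (- ka * `|x|)) ->
  (F x @[x --> +oo%R] --> (0 : R)) /\ (F x @[x --> -oo%R] --> (0 : R)).
Proof.
move=> K0 k0 H.
have key e x : 0 < e -> K / (ka * e) < `|x| -> `|F x| < e.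
  move=> e0 xM; apply: le_lt_trans (H x) _.
  have x0 : 0 < `|x| by apply: le_lt_trans xM; rewrite divr_ge0 // mulr_ge0 // ltW.
  have kx : 0 < ka * `|x| by rewrite mulr_gt0.
  have e1 := expR_ge1Dx (ka * `|x|).
  rewrite mulNr expRN ltr_pdivrMr ?expR_gt0 //.
  rewrite ltr_pdivrMr ?mulr_gt0 // in xM.
  have : e * (1 + ka * `|x|) <= e * expR (ka * `|x|) by rewrite ler_pM2l.
  lra.
split; apply/cvgr0Pnorm_lt => e e0; near=> x; apply: key => //.
  by apply: lt_le_trans (ler_norm x); near: x; apply: nbhs_pinfty_gt; exact: num_real.
rewrite -normrN; apply: lt_le_trans (ler_norm (- x)); rewrite ltrNr.
by near: x; apply: nbhs_ninfty_lt; exact: num_real.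
Unshelve. all: end_near. Qed.

Lemma l1_ins n j (x : R) (t : TT (R:=R) n) : l1 (ins j (x, t)) = `|x| + l1 t.
Proof.
by have := expl1_ins (-1) j x t; rewrite /expl1 opprK !mul1r -expRD => /(@expR_inj R) ->.
Qed.

Lemma upd_ins n j (x y : R) (t : TT (R:=R) n) : upd (ins j (x, t)) j y = ins j (y, t).
Proof.
by apply: eq_from_tnth => k; rewrite !tnth_mktuple; case: (unliftP j k) => [k' ->|->]; rewrite ?eqxx // eq_sym (negbTE (neq_lift _ _)).
Qed.

Definition bad_coords n (t : TT (R:=R) n) : seq R :=
  0 :: [seq tnth t i | i <- enum 'I_n] ++ [seq - tnth t i | i <- enum 'I_n].

Lemma regular_ins n j (x y : R) (t : TT (R:=R) n) :
  regular (ins j (y, t)) -> x \notin bad_coords t -> regular (ins j (x, t)).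
Proof.
rewrite inE mem_cat !negb_or => -[r1 r2] /and3P[x0 x1 x2].
have X1 i : x != tnth t i.
  by apply: contraNneq x1 => ->; apply/mapP; exists i => //; rewrite mem_enum.
have X2 i : x != - tnth t i.
  by apply: contraNneq x2 => ->; apply/mapP; exists i => //; rewrite mem_enum.
split=> [k|k l].
  by case: (unliftP j k) => [k' ->|->]; rewrite ?tnth_ins // tnth_ins_lift; have := r1 (lift j k'); rewrite tnth_ins_lift.
case: (unliftP j k) => [k' ->|->]; case: (unliftP j l) => [l' ->|->] kl; rewrite ?tnth_ins ?tnth_ins_lift /=.
- by have := r2 _ _ kl; rewrite !tnth_ins_lift.
- by split; rewrite eq_sym //= -1?[_ == - x]eqr_oppLR // eqr_oppLR.
- by split.
- by rewrite eqxx in kl.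
Qed.

End LineLimits.

(** * Total derivatives integrate to zero *)

Section TotalDerivative.
Context {R : realType}.
Variables (a b iota : R).
Hypotheses (a0 : 0 < a) (b0 : 0 < b) (i0 : 0 < iota).

Lemma good_th r (j : 'I_r) : good (fun t : r.-tuple R => th (tnth t j)).
Proof.
move=> t _; have Ae c : An t (fun y => expR (c * tnth y j)) by apply/An_exp/AnZ; exact: An_coord.
apply: (@An_ext _ _ _ (fun y => (expR (1 * tnth y j) - expR (-1 * tnth y j)) * (expR (1 * tnth y j) + expR (-1 * tnth y j))^-1)).
  move=> y; rewrite /th /sinhR /coshR !mul1r !mulN1r; field.
  by rewrite gt_eqF // addr_gt0 ?expR_gt0.
apply: AnM; first exact: AnB.
by apply: AnV; [rewrite gt_eqF // addr_gt0 ?expR_gt0|exact: AnD].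
Qed.

Lemma good_Ll r nu (j : 'I_r) : good (Ll a b iota nu j).
Proof.
apply: goodD; first apply: goodD.
- by apply: goodZ; exact: good_th.
- apply: goodD; apply: goodZ; apply: goodB; try exact: good_cst; apply: goodZ; [exact: good_kap1|exact: good_kap2].
move=> t rt; apply: An_sum => k kj; rewrite /c2; have jk : j != k by rewrite eq_sym.
apply: AnD; apply: AnZ; apply: AnB; try exact: An_cst; apply: AnZ.
  exact: (good_kap_sub jk rt).
exact: (good_kap_add jk rt).
Qed.

Definition totder r nu (j : 'I_r) (g k : @gfun R r) (t : r.-tuple R) : R :=
  (der j g t * k t + g t * der j k t + g t * k t * Ll a b iota nu j t) * fw a b iota nu t.

(** On each line [g k fw] is continuous even across the walls, since [fw] vanishes there while [g k]
    stays locally bounded, and it decays exponentially at both ends. A line without regular points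
    carries no weight at all. *)
Lemma totder0 r nu eps (j : 'I_r) (g k : @gfun R r) : 0 <= eps -> eps < 2 * (nu - @rho1 R r a b iota) ->
  bnd eps g -> bnd 0 k ->
  (leb r).-integrable setT (fun t : TT r => (totder nu j g k t)%:E) ->
  (\int[leb r]_t (totder nu j g k t)%:E = 0)%E.
Proof.
case: r j g k => [[]//|n] j g k e0 ep [Cg Cg0 Hg] [Ck Ck0 Hk] It.
apply: (leb_line0 It (j := j)) => t' Il.
have [[y0 ry0]|nr] := pselect (exists y, regular (ins j (y, t'))); last first.
  apply: integral0_eq => x _; rewrite /totder fw_nonreg ?mulr0 // => rx; apply: nr; by exists x.
pose F (x : R) := g (ins j (x, t')) * k (ins j (x, t')) * fw a b iota nu (ins j (x, t')).
pose C := Cg * Ck; have C0 : 0 <= C by rewrite mulr_ge0.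
have FB x : `|F x| <= C * (expR (eps * (`|x| + l1 t')) * fw a b iota nu (ins j (x, t'))).
  have fw0 := fw_ge0 a b iota nu (ins j (x, t')).
  rewrite /F; case: (pselect (regular (ins j (x, t')))) => [rx|nx]; last by rewrite fw_nonreg // !mulr0 normr0.
  have h1 := Hg _ rx; have h2 := Hk _ rx; rewrite mul0r expR0 mulr1 in h2; rewrite l1_ins in h1.
  have h3 : `|g (ins j (x, t')) * k (ins j (x, t'))| <= C * expR (eps * (`|x| + l1 t')).
    by rewrite normrM /C mulrAC; apply: ler_pM.
  rewrite normrM (ger0_norm fw0) [leRHS]mulrA; exact: ler_wpM2r fw0 _ _ h3.
have DF x : regular (ins j (x, t')) -> is_derive x 1 F (totder nu j g k (ins j (x, t'))).
  move=> rx; set T := ins j (x, t') in rx *.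
  have E (G : (n.+1).-tuple R -> R) : (fun s => G (upd T j s)) = (fun s => G (ins j (s, t'))).
    by apply/funext => s; rewrite upd_ins.
  have TE : tnth T j = x by rewrite tnth_ins.
  have Dg := An_upd j (gfun_good g rx); have Dk := An_upd j (gfun_good k rx).
  have Dw := is_derive_fw a b iota nu j rx.
  rewrite !E TE in Dg Dk Dw.
  apply: is_derive_eq (is_derive_mul (is_derive_mul Dg Dk) Dw) _.
  rewrite /totder -/T; ring.
have cfw : continuous (fun x => fw a b iota nu (ins j (x, t'))).
  have EE : (fun x => fw a b iota nu (upd (ins j (0, t')) j x)) = (fun x => fw a b iota nu (ins j (x, t'))).
    by apply/funext => x; apply: f_equal; exact: upd_ins.
  rewrite -EE; exact: (@continuous_fw R n.+1 a b iota a0 b0 i0 nu j (ins j (0, t'))).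
have cF : continuous F.
  move=> x; have [rx|nx] := pselect (regular (ins j (x, t'))); first exact: is_derive_cont (DF x rx).
  rewrite /continuous_at; have Fx : F x = 0 by rewrite /F fw_nonreg // mulr0.
  pose B y := C * (expR (eps * (`|y| + l1 t')) * fw a b iota nu (ins j (y, t'))).
  have cB : B y @[y --> x] --> (0 : R).
    have Bx : 0 = B x by rewrite /B fw_nonreg // !mulr0.
    rewrite {1}Bx.
    apply: cvgM; first exact: cvg_cst.
    apply: cvgM; last exact: cfw.
    apply: (@continuous_comp _ _ _ (fun y => eps * (`|y| + l1 t')) (@expR R)); last exact: continuous_expR.
    apply: cvgM; first exact: cvg_cst.
    by apply: cvgD; [exact: norm_continuous|exact: cvg_cst].
  rewrite Fx; apply: (@squeeze_cvgr _ _ _ _ (- B) B) => //.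
  - by apply: nearW => y; rewrite -ler_norml.
  - by rewrite -[X in _ --> X]oppr0; apply: cvgN.
have ka0 : 0 < 2 * (nu - @rho1 R n.+1 a b iota) - eps by rewrite subr_gt0.
have nu0 : 0 <= nu by have := @rho1_gt0 R n.+1 a b iota a0 b0 i0; lra.
pose A := powR 2 (2 * nu) ^+ n.+1 : R; have A0 : 0 <= A by rewrite exprn_ge0 // powR_ge0.
have dec x : `|F x| <= C * A * expR (- (2 * (nu - @rho1 R n.+1 a b iota) - eps) * `|x|).
  apply: le_trans (FB x) _; rewrite -mulrA; apply: ler_wpM2l => //.
  have h1 := f_delta_le (ins j (x, t')) nu0; have h2 := w_le a0 b0 i0 (ins j (x, t')).
  have h3 : fw a b iota nu (ins j (x, t')) <=
      A * expl1 (2 * nu) (ins j (x, t')) * expR (2 * @rho1 R n.+1 a b iota * l1 (ins j (x, t'))).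
    by apply: ler_pM; [exact: f_delta_ge0|exact: w_ge0| |].
  apply: le_trans (ler_wpM2l (expR_ge0 _) h3) _.
  rewrite -[A * _ * _]mulrA [leLHS]mulrCA; apply: (ler_wpM2l A0); rewrite /expl1 l1_ins -!expRD ler_expR.
  have l0 : 0 <= l1 t' by apply: sumr_ge0.
  have := mulr_ge0 (ltW ka0) l0; lra.
have [Fy FNy] := cvg0_expdecay (mulr_ge0 C0 A0) ka0 dec.
apply: (@FTC_line _ (bad_coords t') F) => // x xS; have rx := regular_ins ry0 xS.
split; first exact: DF.
apply: cvgM; last exact: cfw.
set T := ins j (x, t') in rx *.
pose Q t := der j g t * k t + g t * der j k t + g t * k t * Ll a b iota nu j t.
have gQ : good Q.
  apply: goodD; first apply: goodD.
  - by apply: goodM; [apply: good_der; exact: gfun_good|exact: gfun_good].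
  - by apply: goodM; [exact: gfun_good|apply: good_der; exact: gfun_good].
  - by apply: goodM; [apply: goodM; exact: gfun_good|exact: good_Ll].
have := An_upd j (gQ T rx); rewrite tnth_ins /=.
have -> : (fun s => Q (upd T j s)) = (fun s => Q (ins j (s, t'))) by apply/funext => s; rewrite upd_ins.
exact: is_derive_cont.
Qed.

End TotalDerivative.

(** * Integrable functions with integral zero *)

Section NullIntegrals.
Context {R : realType} {r : nat}.
Implicit Types f : TT (R:=R) r -> R.

Definition nullint f := (leb r).-integrable setT (EFin \o f) /\ (\int[leb r]_t (f t)%:E = 0)%E.

Lemma nullintD f h : nullint f -> nullint h -> nullint (fun t => f t + h t).
Proof.
move=> [If If0] [Ih Ih0]; split.
  by apply: eq_integrable (integrableD measurableT If Ih) => // t _; rewrite /= EFinD.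
under eq_integral do rewrite EFinD.
by have := integralD_EFin measurableT If Ih => /= ->; rewrite If0 Ih0 adde0.
Qed.

Lemma nullint0 : nullint (fun=> 0).
Proof. by split; [exact: integrable0|exact: integral0]. Qed.

Lemma nullint_sum (I : Type) (s : seq I) (P : pred I) (F : I -> TT r -> R) :
  (forall i, P i -> nullint (F i)) -> nullint (fun t => \sum_(i <- s | P i) F i t).
Proof.
move=> H; elim: s => [|i s IH].
  by rewrite (_ : (fun t => _) = fun=> 0); [exact: nullint0|apply/funext => t; rewrite big_nil].
case Pi: (P i); last first.
  by rewrite (_ : (fun t => _) = (fun t => \sum_(i <- s | P i) F i t)) //; apply/funext => t; rewrite big_cons Pi.
rewrite (_ : (fun t => _) = (fun t => F i t + \sum_(i <- s | P i) F i t)); first by apply: nullintD => //; exact: H.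
by apply/funext => t; rewrite big_cons Pi.
Qed.

Lemma nullint_inv (s : TT r -> TT r) f : leb_inv s -> (leb r).-integrable setT (EFin \o f) ->
  nullint (fun t => f (s t) - f t).
Proof.
move=> iS If; have [Is E] := leb_inv_integrable iS If; split.
  by apply: eq_integrable (integrableB measurableT Is If) => // t _; rewrite /= EFinB.
under eq_integral do rewrite EFinB.
have := @integralB_EFin _ _ _ (leb r) setT (f \o s) f measurableT Is If => /= ->.
by rewrite E subee //; exact: integrable_fin_num If.
Qed.

End NullIntegrals.

(** * The adjoint of a Cherednik operator *)

Section Adjoint.
Context {R : realType} {r : nat}.
Variables (a b iota : R).
Hypotheses (a0 : 0 < a) (b0 : 0 < b) (i0 : 0 < iota).
Variable (nu : R).
Local Notation pt := (r.-tuple R).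
Local Notation DL := (@DL R r a b iota).
Local Notation fw := (@fw R r a b iota nu).
Local Notation rho1 := (@rho1 R r a b iota).
Implicit Types (t : pt).

(* [Dm j k] is [t |-> (D_j (h f) / f) (- t)] for [k t = h (- t)] and [f = f_delta (- 2 * nu)]. *)
Definition Dm (j : 'I_r) (k : pt -> R) t : R :=
  - der j k t
  + \sum_(i | i != j) (a * (1 - kap (tnth t j - tnth t i) - (i < j)%:R) * (k t - k (s_ij j i t))
      + a * (1 - kap (tnth t j + tnth t i)) * (k t - k (sigma_ij j i t)))
  + (2 * iota * (1 - kap (2 * tnth t j)) + 2 * b * (1 - kap (tnth t j))) * (k t - k (sigma_i j t))
  - rho_j a b iota j * k t + 2 * nu * th (tnth t j) * k t.

Lemma act_invol (g : @hyp r) t : invol g -> act g (act g t) = t.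
Proof.
move=> [i1 i2]; apply: eq_from_tnth => k; rewrite !tnth_mktuple /= i1 i2.
by case: (g.2 k); ring.
Qed.

Lemma prod_act (W : R -> R) (g : @hyp r) t : (forall x, W (- x) = W x) ->
  \prod_j W (tnth (act g t) j) = \prod_j W (tnth t j).
Proof.
move=> N; rewrite [RHS](reindex_perm g.1); apply: eq_bigr => k _.
by rewrite tactp_tnth /=; case: (g.2 k); rewrite ?mul1r ?mulN1r ?N.
Qed.

(* The square of the product over pairs [i < j] runs over all off-diagonal pairs, which is visibly invariant. *)
Lemma prod_pairs_act (W : R -> R -> R) (g : @hyp r) t : (forall x y, W x y = W y x) ->
  (forall x y, W (- x) y = W x y) -> (forall x y, 0 <= W x y) ->
  \prod_(p : 'I_r * 'I_r | (p.1 < p.2)%N) W (tnth (act g t) p.1) (tnth (act g t) p.2) =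
  \prod_(p : 'I_r * 'I_r | (p.1 < p.2)%N) W (tnth t p.1) (tnth t p.2).
Proof.
move=> C N W0.
have sq s : (\prod_(p : 'I_r * 'I_r | (p.1 < p.2)%N) W (tnth s p.1) (tnth s p.2)) ^+ 2 =
    \prod_(p : 'I_r * 'I_r | p.1 != p.2) W (tnth s p.1) (tnth s p.2).
  rewrite expr2 [RHS](bigID (fun p : 'I_r * 'I_r => (p.1 < p.2)%N)) /=; congr (_ * _).
    by apply: eq_bigl => -[i j] /=; rewrite andbC neq_ltn; case: ltnP.
  rewrite [LHS](reindex_inj (h := fun p : 'I_r * 'I_r => (p.2, p.1))) /=; last by move=> [i j] [k l] [-> ->].
  apply: eq_big => [[i j] /=|p _]; last exact: C.
  by rewrite neq_ltn -leqNgt; case: ltngtP.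
have P s : 0 <= \prod_(p : 'I_r * 'I_r | (p.1 < p.2)%N) W (tnth s p.1) (tnth s p.2) by exact: prodr_ge0.
apply/eqP; rewrite -(@eqrXn2 _ 2) // !sq; apply/eqP.
rewrite [RHS](reindex_inj (h := fun p : 'I_r * 'I_r => (g.1 p.1, g.1 p.2))) /=; last first.
  by move=> [i j] [k l] [/(@perm_inj _ g.1) -> /(@perm_inj _ g.1) ->].
apply: eq_big => [p|p _]; first by rewrite (inj_eq (@perm_inj _ g.1)).
rewrite !tactp_tnth /=; case: (g.2 p.1); case: (g.2 p.2); rewrite ?mul1r ?mulN1r ?N //.
all: by rewrite C N C.
Qed.

Lemma w_act (g : @hyp r) t : mu_density a b iota (act g t) = mu_density a b iota t.
Proof.
have H1 : \prod_j w1 b iota (tnth (act g t) j) = \prod_j w1 b iota (tnth t j).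
  by apply: prod_act => x; rewrite /w1 mulrN !shN.
have H2 : \prod_(p : 'I_r * 'I_r | (p.1 < p.2)%N) w2 a (tnth (act g t) p.1) (tnth (act g t) p.2) =
    \prod_(p : 'I_r * 'I_r | (p.1 < p.2)%N) w2 a (tnth t p.1) (tnth t p.2).
  apply: prod_pairs_act; first exact: w2C.
    by move=> x y; rewrite /w2 -opprD shN (_ : - x + y = - (x - y)) ?shN; [exact: mulrC|ring].
  by move=> x y; exact: mulr_ge0 (powR_ge0 _ _) (powR_ge0 _ _).
exact: etrans (wE a b iota (act g t)) (etrans (f_equal2 *%R H1 H2) (esym (wE a b iota t))).
Qed.

Lemma f_delta_act d (g : @hyp r) t : f_delta d (act g t) = f_delta d t :> R.
Proof.
apply: (@prod_act (fun x => powR (coshR x) d)) => x; congr powR.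
by rewrite /coshR opprK [X in X / 2]addrC.
Qed.

Lemma fw_act (g : @hyp r) t : fw (act g t) = fw t.
Proof. by rewrite -[LHS]/(f_delta (- 2 * nu) _ * mu_density _ _ _ _) f_delta_act w_act. Qed.

Lemma kap_abs (x : R) : x != 0 -> `|kap x| <= 1 + `|x|^-1.
Proof.
move=> x0.
have key (y : R) : 0 < y -> 1 <= kap y <= 1 + y^-1.
  move=> y0; have e1 := expR_ge1Dx (2 * y); have e0 := expR_gt0 (- 2 * y).
  have lt1 : expR (- 2 * y) < 1 by rewrite expR_lt1; lra.
  have d0 : 0 < 1 - expR (- 2 * y) by lra.
  apply/andP; split; first by rewrite /kap invf_ge1 //; lra.
  rewrite /kap -[leLHS]mul1r ler_pdivrMr //.
  have : expR (- 2 * y) * (1 + 2 * y) <= expR (- 2 * y) * expR (2 * y) by rewrite ler_pM2l.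
  rewrite -expRD (_ : - 2 * y + 2 * y = 0) ?expR0; [|by ring].
  set E := expR _ in e0 lt1 d0 * => H.
  have yi : 0 < y^-1 by rewrite invr_gt0.
  have H2 : y * (E * (1 + 2 * y)) <= y by rewrite ler_piMr // ltW.
  have -> : (1 + y^-1) * (1 - E) = (y + 1) * (1 - E) / y by field; rewrite gt_eqF.
  by rewrite ler_pdivlMr // mul1r; have := mulr_ge0 (ltW y0) (ltW e0); lra.
have [xp|xn|/eqP] := ltgtP 0 x; last by rewrite eq_sym (negbTE x0).
  by have /andP[h1 h2] := key x xp; rewrite gtr0_norm; [rewrite gtr0_norm|lra].
have xN : 0 < - x by rewrite oppr_gt0.
have /andP[h1 h2] := key _ xN; rewrite kapN // in h1 h2.
by rewrite (ltr0_norm xn) ler0_norm; lra.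
Qed.

(** The derivative is moved by a total derivative, the reflections by the invariance of [fw]. A
    reflection turns [kap] of its root into [1 - kap], and together with the [coth] terms of [Ll]
    the coefficients become those of [Dm]. The second factor is named [k2] so that its boundedness
    can be assumed. *)
Lemma adjoint eps (j : 'I_r) (g k k2 : @gfun R r) : 0 <= eps -> eps < 2 * (nu - rho1) ->
  bnd eps g -> bnd eps (DL j g) -> bnd 0 k -> bnd 0 k2 ->
  (forall t, regular t -> k2 t = Dm j k t) ->
  (\int[leb r]_t ((DL j g t * k t) * fw t)%:E = \int[leb r]_t ((g t * k2 t) * fw t)%:E)%E.
Proof.
move=> e0 ep Bg BDg Bk Bk2 k2E.
have bM F G : bnd eps F -> bnd 0 G -> bnd eps (fun t => F t * G t).
  move=> [CF CF0 HF] [CG CG0 HG]; exists (CF * CG); first exact: mulr_ge0.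
  move=> t rt; have := HG t rt; rewrite mul0r expR0 mulr1 => h.
  by rewrite normrM mulrAC; apply: ler_pM => //; exact: HF.
have I1 : (leb r).-integrable setT (EFin \o (fun t : TT r => (DL j g t * k t) * fw t)).
  apply: (bnd_integrable a0 b0 i0 j e0 ep); first exact: bM.
  by apply: measurable_funM; exact: measurable_gfun.
have I2 : (leb r).-integrable setT (EFin \o (fun t : TT r => (g t * k2 t) * fw t)).
  apply: (bnd_integrable a0 b0 i0 j e0 ep); first exact: bM.
  by apply: measurable_funM; exact: measurable_gfun.
(* [c] is a root coefficient with [c (s t) = c' t]; the two leftover terms are exchanged by [s]. *)
have odd (h : @hyp r) (s : pt -> pt) (al c c' : pt -> R) K : invol h -> s = act h ->
    leb_inv (s : TT r -> TT r) -> good c -> is_root j al -> 0 <= K ->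
    (forall t, regular t -> `|c t| <= K * (1 + `|al t|^-1)) ->
    (forall t, regular t -> c (s t) = c' t) ->
    nullint (fun t => (c' t * g t * k (s t) - c t * g (s t) * k t) * fw t).
  move=> ih sE iS gc Hal K0 cb cs.
  have rs t : regular t -> regular (s t) by rewrite sE; exact: regular_act.
  have ss t : s (s t) = t by rewrite sE act_invol.
  pose F := cut (fun t => c t * g (s t) * k t).
  have gF : good (fun t => c t * g (s t) * k t).
    apply: goodM; last exact: gfun_good.
    apply: goodM => // t /rs; rewrite sE => rt.
    by apply: An_tact; [exact/unimod_le/unimod_wt|exact: gfun_good].
  have IF : (leb r).-integrable setT (EFin \o (fun t : TT r => F t * fw t)).
    have [Cg Cg0 Hg] := Bg; have [Ck Ck0 Hk] := Bk.
    apply: (dom_integrable a0 b0 i0 (C := K * Cg * Ck) e0 ep Hal); rewrite ?mulr_ge0 //.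
      exact: measurable_cut.
    move=> t rt; rewrite /F cutE // !normrM.
    have := Hk t rt; rewrite mul0r expR0 mulr1 => hk.
    have := Hg _ (rs t rt); rewrite {2}sE l1_act => hg.
    have -> : K * Cg * Ck * expR (eps * l1 t) * (1 + `|al t|^-1) = K * (1 + `|al t|^-1) * (Cg * expR (eps * l1 t)) * Ck by ring.
    apply: ler_pM hk; rewrite ?mulr_ge0 //.
    by apply: ler_pM (cb t rt) hg.
  have := nullint_inv iS IF; rewrite (_ : (fun t => _) = (fun t => (c' t * g t * k (s t) - c t * g (s t) * k t) * fw t)) //.
  apply/funext => t; rewrite (_ : fw (s t) = fw t); last by rewrite sE fw_act.
  case: (pselect (regular t)) => [rt|nr]; last by rewrite fw_nonreg // !mulr0 subrr.
  by rewrite /F !cutE //; [rewrite ss cs //; ring|exact: rs].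
pose N t := \sum_(i | i != j) (
    (a * (1 - kap (tnth t j - tnth t i) - (i < j)%:R) * g t * k (s_ij j i t) -
     a * (kap (tnth t j - tnth t i) - (i < j)%:R) * g (s_ij j i t) * k t) * fw t +
    (a * (1 - kap (tnth t j + tnth t i)) * g t * k (sigma_ij j i t) -
     a * kap (tnth t j + tnth t i) * g (sigma_ij j i t) * k t) * fw t) +
  ((2 * iota * (1 - kap (2 * tnth t j)) + 2 * b * (1 - kap (tnth t j))) * g t * k (sigma_i j t) -
   (2 * iota * kap (2 * tnth t j) + 2 * b * kap (tnth t j)) * g (sigma_i j t) * k t) * fw t.
have NN : nullint N.
  apply: nullintD; first apply: nullint_sum => i ij; first apply: nullintD.
  - have ji : j != i by rewrite eq_sym.
    apply: (odd (gsw j i) _ (fun t => tnth t j - tnth t i) (fun t => a * (kap (tnth t j - tnth t i) - (i < j)%:R)) _ (2 * a)).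
    + exact: invol_gsw.
    + by rewrite s_ijE -wt_gsw.
    + exact: leb_inv_s_ij.
    + by apply: goodZ; apply: goodB; [exact: good_kap_sub|exact: good_cst].
    + by right; exists i => //; left.
    + by rewrite mulr_ge0 // ltW.
    + move=> t rt; have x0 := reg_sub_neq0 rt ji; rewrite normrM gtr0_norm //.
      have := kap_abs x0; have := ler_normB (kap (tnth t j - tnth t i)) (i < j)%:R.
      have : `|(i < j)%:R : R| <= 1 by case: (i < j)%N; rewrite ?normr1 ?normr0.
      have : 0 <= `|tnth t j - tnth t i|^-1 by rewrite invr_ge0.
      move: (`|_|^-1) => X h1 h2 h3 h4; rewrite (mulrC 2) -mulrA ler_pM2l //; lra.
    + move=> t rt; have x0 := reg_sub_neq0 rt ji.
      by rewrite s_ijE !tactp_tnth /= !eqxx (negbTE ij) !mul1r -kapN // opprB.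
  - have ji : j != i by rewrite eq_sym.
    apply: (odd (gsg j i) _ (fun t => tnth t j + tnth t i) (fun t => a * kap (tnth t j + tnth t i)) _ a).
    + exact: invol_gsg.
    + by rewrite sigma_ijE -wt_gsg.
    + exact: leb_inv_sigma_ij.
    + by apply: goodZ; exact: good_kap_add.
    + by right; exists i => //; right.
    + exact: ltW.
    + move=> t rt; have x0 := reg_add_neq0 rt ji; rewrite normrM gtr0_norm // ler_pM2l //.
      exact: kap_abs.
    + move=> t rt; have x0 := reg_add_neq0 rt ji.
      by rewrite sigma_ijE !tactp_tnth /= !eqxx (negbTE ij) /= !mulN1r -kapN // opprD addrC.
  apply: (odd (gng j) _ (fun t => tnth t j) (fun t => 2 * iota * kap (2 * tnth t j) + 2 * b * kap (tnth t j)) _ (2 * iota + 2 * b)).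
  + exact: invol_gng.
  + by rewrite sigma_iE -wt_gng.
  + exact: leb_inv_sigma_i.
  + by apply: goodD; apply: goodZ; [exact: good_kap2|exact: good_kap1].
  + by left.
  + by rewrite addr_ge0 // mulr_ge0 // ltW.
  + move=> t [rt _]; have x0 := rt j; have x2 : 2 * tnth t j != 0 by rewrite mulf_neq0.
    have h1 := kap_abs x0; have h2 := kap_abs x2.
    have h3 : `|2 * tnth t j|^-1 <= `|tnth t j|^-1.
      by rewrite lef_pV2 ?posrE ?normr_gt0 // normrM gtr0_norm // ler_peMl //; lra.
    apply: le_trans (ler_normD _ _) _; rewrite [leRHS]mulrDl; apply: lerD; rewrite normrM gtr0_norm ?mulr_gt0 // ler_pM2l ?mulr_gt0 //.
    by apply: le_trans h2 _; rewrite lerD2l.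
  + move=> t [rt _]; have x0 := rt j; have x2 : 2 * tnth t j != 0 by rewrite mulf_neq0.
    by rewrite sigma_iE !tactp_tnth /= !eqxx /= !mulN1r mulrN !kapN.
(* Pointwise Leibniz rule: the two integrands to be compared differ by a total derivative and by
   [N], which the reflections make integrate to zero. *)
have E t : totder a b iota nu j g k t = (DL j g t * k t) * fw t - (g t * k2 t) * fw t - N t.
  case: (pselect (regular t)) => [rt|nr]; last first.
    rewrite /totder /N fw_nonreg // !mulr0 big1 ?addr0 ?subr0 // => i _; by rewrite !mulr0 addr0.
  rewrite /totder k2E // (DVE _ _ _ j g rt) /Dch /Dm /opB /Ll /N.
  under [X in _ - (X + _)]eq_bigr do rewrite -mulrDl.
  rewrite -mulr_suml -mulrDl -!mulrBl; congr (_ * _).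
  set SA := \sum_(i | _) opA _ _ _ _ _; set SC := \sum_(i | _) c2 _ _ _.
  set SM := \sum_(i | _) _; set SN := \sum_(i | _) _.
  have key : SA * k t - g t * SM - SN = g t * k t * SC.
    rewrite /SA /SM /SN /SC mulr_suml !mulr_sumr -!sumrB; apply: eq_bigr => i _.
    by rewrite /opA /c2; ring.
  rewrite [X in _ + X]mulrDr -key; ring.
have IT : (leb r).-integrable setT (fun t : TT r => (totder a b iota nu j g k t)%:E).
  apply: eq_integrable (integrableB measurableT (integrableB measurableT I1 I2) NN.1) => // t _.
  by rewrite E /= !EFinB.
have T0 := totder0 a0 b0 i0 e0 ep Bg Bk IT.
have IB : (leb r).-integrable setT (EFin \o (fun t : TT r => (DL j g t * k t) * fw t - (g t * k2 t) * fw t)).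
  by apply: eq_integrable (integrableB measurableT I1 I2) => // t _; rewrite /= EFinB.
have H1 := @integralB_EFin _ _ _ (leb r) setT _ _ measurableT IB NN.1.
have H2 := @integralB_EFin _ _ _ (leb r) setT _ _ measurableT I1 I2.
move: T0; under eq_integral do rewrite E EFinB.
rewrite /= in H1 H2; rewrite H1 NN.2 sube0; under eq_integral do rewrite EFinB.
rewrite H2; have := integrable_fin_num measurableT I1; have := integrable_fin_num measurableT I2.
rewrite /=; move: (\int[_]_(_ in _) _)%E (\int[_]_(_ in _) _)%E => [x| |] [y| |] // _ _ [/eqP].
by rewrite subr_eq0 => /eqP ->.
Qed.

End Adjoint.

(** * Coefficients as rational functions of [tanh] *)

Section Tanh.
Context {R : realType}.
Implicit Types x z : R.

Lemma thE x : th x = (1 - expR (- 2 * x)) / (1 + expR (- 2 * x)).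
Proof.
rewrite /th /sinhR /coshR (_ : - 2 * x = - x + - x); last by ring.
rewrite expRD expRN; have := expR_gt0 x; move: (expR x) => e e0.
have e2 : 0 < e ^+ 2 by rewrite exprn_gt0.
by field; rewrite !gt_eqF // addr_gt0.
Qed.

Lemma thN x : th (- x) = - th x.
Proof. by rewrite /th /sinhR /coshR opprK [X in _ / (X / 2)]addrC -mulNr -mulNr opprB. Qed.

Lemma th_bound x : - 1 < th x < 1.
Proof.
have e0 := expR_gt0 (- 2 * x); rewrite thE.
by rewrite ltr_pdivlMr ?ltr_pdivrMr; [apply/andP; split|..]; lra.
Qed.

Lemma is_derive_th x : is_derive x 1 (@th R) (1 - th x ^+ 2).
Proof.
have H (u : R) : is_derive u 1 (fun u : R => th u) (1 - th u ^+ 2).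
  have D (s : R) (v : R) : is_derive v 1 (fun v => 1 + s * expR (- 2 * v)) (s * (- 2 * expR (- 2 * v))).
    apply: is_derive_eq (is_deriveD (is_derive_cst (1 : R) v 1) (is_deriveZ s (is_derive_explin1 (- 2) v))) _.
    by rewrite add0r.
  have e0 := expR_gt0 (- 2 * u).
  have n0 : 1 + 1 * expR (- 2 * u) != 0 by rewrite gt_eqF // mul1r addr_gt0.
  have -> : (fun u : R => th u) = (fun v => (1 + -1 * expR (- 2 * v)) * (1 + 1 * expR (- 2 * v))^-1).
    by apply/funext => v; rewrite thE mulN1r mul1r.
  have DV := @is_deriveV R (fun v : R => 1 + 1 * expR (- 2 * v)) u _ 1 n0 (D 1 u).
  apply: is_derive_eq (is_derive_mul (D (- 1) u) DV) _.
  rewrite thE /GRing.scale /=; move: n0; rewrite mul1r; move: (expR _) => e n0.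
  by field.
exact: H.
Qed.

(** In the variables [tanh] the coefficients are rational with denominator [th x - th z], so [Dm]
    acts on polynomials in them by divided differences. *)
Lemma kap_subE x z : x != z ->
  th x - th z != 0 /\ kap (x - z) = (1 + th x) * (1 - th z) / 2 / (th x - th z).
Proof.
rewrite -subr_eq0 => xz.
have [-> ] : kap (x - z) = expR (- 2 * z) / (expR (- 2 * z) - expR (- 2 * x)) /\ expR (- 2 * z) - expR (- 2 * x) != 0.
  have := exp_neq1 xz; rewrite /kap (_ : - 2 * (x - z) = - 2 * x - (- 2 * z)); last by ring.
  rewrite expRD expRN; have := expR_gt0 (- 2 * z); move: (expR (- 2 * z)) (expR (- 2 * x)) => u v u0.
  have un : u != 0 by rewrite gt_eqF.
  move=> H; have H' : u - v != 0 by apply: contraNneq H => /subr0_eq <-; rewrite divff // subrr.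
  by split=> //; field; rewrite un H'.
rewrite !thE; have := expR_gt0 (- 2 * z); have := expR_gt0 (- 2 * x).
move: (expR (- 2 * z)) (expR (- 2 * x)) => u v u0 v0 uv.
have U : 1 + u != 0 by rewrite gt_eqF // addr_gt0.
have V : 1 + v != 0 by rewrite gt_eqF // addr_gt0.
have E : (1 - v) / (1 + v) - (1 - u) / (1 + u) = 2 * (u - v) / ((1 + v) * (1 + u)) by field; rewrite U V.
have E0 : 2 * (u - v) / ((1 + v) * (1 + u)) != 0 by rewrite !mulf_neq0 ?invr_eq0 ?mulf_neq0 ?pnatr_eq0.
by rewrite E; split=> //; field; rewrite U V uv.
Qed.

Lemma kap_addE x z : x != - z ->
  th x + th z != 0 /\ kap (x + z) = (1 + th x) * (1 + th z) / 2 / (th x + th z).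
Proof. by move=> /kap_subE; rewrite opprK thN opprK. Qed.

Lemma kap1E x : x != 0 -> th x != 0 /\ kap x = (1 + th x) / 2 / th x.
Proof.
move=> x0; have := @kap_subE x 0 x0; rewrite subr0 {2 4 6}/th /sinhR oppr0 subrr !mul0r !subr0 mulr1.
by [].
Qed.

Lemma kap2E x : x != 0 -> kap (2 * x) = (1 + th x) ^+ 2 / 4 / th x.
Proof.
move=> x0; have [t0 _] := kap1E x0.
have xx : x != - x by rewrite -addr_eq0 -mulr2n mulrn_eq0 /= x0.
have [_ E] := kap_addE xx.
rewrite (_ : 2 * x = x + x); last by ring.
have t2 : th x + th x != 0 by rewrite -mulr2n mulrn_eq0.
by rewrite E; field; rewrite t0 t2.
Qed.

End Tanh.

(** * Products of functions of single coordinates *)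

Section CoordinateProducts.
Context {R : realType} {r : nat}.
Implicit Types (t : r.-tuple R) (F : 'I_r -> R -> R).

Definition cprod F t := \prod_l F l (tnth t l).

Lemma cprod_split F t j : cprod F t = (\prod_(l | l != j) F l (tnth t l)) * F j (tnth t j).
Proof. by rewrite /cprod (bigD1 j) //= mulrC. Qed.

Lemma cprod_sigma_i F t j :
  cprod F (sigma_i j t) = (\prod_(l | l != j) F l (tnth t l)) * F j (- tnth t j).
Proof.
rewrite (cprod_split _ _ j) tnth_mktuple eqxx; congr (_ * _).
by apply: eq_bigr => l lj; rewrite tnth_mktuple (negbTE lj).
Qed.

Lemma der_cprod F t j d : is_derive (tnth t j) 1 (F j) d ->
  der j (cprod F) t = (\prod_(l | l != j) F l (tnth t l)) * d.
Proof.
move=> D; rewrite /der derive1E.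
rewrite (_ : (fun s => _) = (fun s => (\prod_(l | l != j) F l (tnth t l)) *: F j s)).
  by have := is_deriveZ (\prod_(l | l != j) F l (tnth t l)) D => /@derive_val ->.
apply/funext => s; rewrite (cprod_split _ _ j) tnth_upd eqxx; congr (_ * _).
by apply: eq_bigr => l lj; rewrite tnth_upd (negbTE lj).
Qed.

Lemma cprod_split2 F t i j : i != j -> exists P,
  [/\ cprod F t = P * F j (tnth t j) * F i (tnth t i),
      cprod F (s_ij j i t) = P * F j (tnth t i) * F i (tnth t j) &
      cprod F (sigma_ij j i t) = P * F j (- tnth t i) * F i (- tnth t j)].
Proof.
move=> ij; exists (\prod_(l | (l != j) && (l != i)) F l (tnth t l)).
have S s : cprod F s = (\prod_(l | (l != j) && (l != i)) F l (tnth s l)) * F j (tnth s j) * F i (tnth s i).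
  by rewrite /cprod (bigD1 j) //= (bigD1 i) //=; ring.
split; rewrite S ?tnth_mktuple ?eqxx ?(negbTE ij) //; congr (_ * _ * _);
  by apply: eq_bigr => l /andP[lj li]; rewrite tnth_mktuple (negbTE lj) (negbTE li).
Qed.

End CoordinateProducts.

(** * The chain of products between 1 and [\prod_j (1 - tanh t_j ^ 2)] *)

Section ShiftProducts.
Context {R : realType} {r : nat}.
Variables (a b iota nu : R).
Local Notation rho1 := (@rho1 R r a b iota).
Local Notation Dm := (@Dm R r a b iota nu).
Implicit Types (t : r.-tuple R).

(** Two chains with a common end: [thp false 0] is 1, [thp true 0] is the product of the
    [1 - th ^ 2], and for [n = r] both are the product of the [1 - th]. *)
Definition thfac (e : bool) (n : nat) (i : 'I_r) (x : R) : R :=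
  if (i < n)%N then 1 - th x else 1 - e%:R * th x ^+ 2.

Definition thp e n : r.-tuple R -> R := cprod (thfac e n).

Lemma good_thp e n : good (thp e n).
Proof.
move=> t rt; rewrite /thp /cprod.
have K (s : seq 'I_r) : An t (fun t => \prod_(l <- s) thfac e n l (tnth t l)).
  elim: s => [|l s IH].
    by rewrite (_ : (fun t => _) = fun=> 1); [exact: An_cst|apply/funext => u; rewrite big_nil].
  rewrite (_ : (fun t => _) = (fun t => thfac e n l (tnth t l) * \prod_(l <- s) thfac e n l (tnth t l))).
    apply: AnM => //; rewrite /thfac; case: (l < n)%N; apply: AnB; try exact: An_cst; first exact: good_th.
    by apply: AnZ; apply: AnM; exact: good_th.
  by apply/funext => u; rewrite big_cons.
exact: K.
Qed.

Definition gthp e n : @gfun R r := gcut (good_thp e n).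

Lemma thp_bound e n t : `|thp e n t| <= 2 ^+ r.
Proof.
rewrite /thp /cprod normr_prod -[in leRHS](card_ord r) -prodr_const.
apply: ler_prod => i _; rewrite normr_ge0 /thfac.
have /andP[h1 h2] := th_bound (tnth t i).
case: (i < n)%N => /=; rewrite ler_norml; first by apply/andP; split; lra.
have h3 : th (tnth t i) ^+ 2 <= 1 by nra.
have h4 := sqr_ge0 (th (tnth t i)).
by case: e; rewrite ?mul1r ?mul0r; apply/andP; split; lra.
Qed.

Lemma bnd_gthp e n : bnd 0 (gthp e n).
Proof.
exists (2 ^+ r); first exact: exprn_ge0.
by move=> t rt; rewrite mul0r expR0 mulr1 /= cutE //; exact: thp_bound.
Qed.

Lemma thp_step e (j : 'I_r) t : exists P,
  [/\ thp e j t = P * (1 - e%:R * th (tnth t j) ^+ 2), thp e j.+1 t = P * (1 - th (tnth t j)) &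
   P = \prod_(l | l != j) thfac e j l (tnth t l)].
Proof.
exists (\prod_(l | l != j) thfac e j l (tnth t l)); split=> //.
  by rewrite /thp (cprod_split _ _ j) /thfac ltnn.
rewrite /thp (cprod_split _ _ j) /thfac ltnSn; congr (_ * _); apply: eq_bigr => l lj.
by rewrite ltnS leq_eqVlt (inj_eq val_inj) (negbTE lj).
Qed.

Lemma sum_lt (j : 'I_r) : \sum_(i | i != j) (i < j)%:R = j%:R :> R.
Proof.
rewrite -natr_sum; congr _%:R.
rewrite [RHS](_ : (j : nat) = \sum_(i < j) 1)%N; last by rewrite sum1_card card_ord.
rewrite (big_ord_widen_cond r xpredT (fun=> 1%N)) /=; last exact: ltnW.
rewrite [RHS]big_mkcond [LHS]big_mkcond; apply: eq_bigr => i _ /=.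
by case: eqVneq => [->|_]; [rewrite ltnn|case: (i < j)%N].
Qed.

Lemma sum_neq (j : 'I_r) : \sum_(i | i != j) 1 = r.-1%:R :> R.
Proof. by rewrite sumr_const cardC1 card_ord. Qed.

Lemma rho_jE (j : 'I_r) : rho_j a b iota j = rho1 - a * j%:R :> R.
Proof.
have r1 : (0 < r)%N := leq_ltn_trans (leq0n j) (ltn_ord j).
rewrite /rho_j -[rho1]/(iota + b + a * r.-1%:R) -subnDA natrB; last by have := ltn_ord j; lia.
by rewrite -subn1 natrB // natrD; ring.
Qed.

(** Only the indices [i < j] contribute to the sum, [- a * th t_j] each, since coordinates from [j]
    on still carry the factor 1. This is why the chain follows the order of the indices built into
    [D_j]. *)
Lemma Dm_thp0 (j : 'I_r) t : regular t ->
  Dm j (thp false j) t = - (rho1 - 2 * nu) * thp false j t - (2 * nu - a * j%:R) * thp false j.+1 t.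
Proof.
move=> rt; have [P [E0 E1 PE]] := thp_step false j t; rewrite mul0r subr0 mulr1 in E0.
rewrite /Dm.
have -> : der j (thp false j) t = 0.
  have D : is_derive (tnth t j) 1 (thfac false j j) 0.
    rewrite (_ : thfac false j j = cst 1); first exact: is_derive_cst.
    by apply/funext => x; rewrite /thfac ltnn mul0r subr0.
  by rewrite (der_cprod D) mulr0.
have -> : thp false j (sigma_i j t) = thp false j t.
  by rewrite /thp cprod_sigma_i (cprod_split _ _ j) /thfac ltnn !mul0r.
have -> : \sum_(i | i != j) (a * (1 - kap (tnth t j - tnth t i) - (i < j)%:R) *
      (thp false j t - thp false j (s_ij j i t)) +
    a * (1 - kap (tnth t j + tnth t i)) * (thp false j t - thp false j (sigma_ij j i t))) =
    \sum_(i | i != j) (i < j)%:R * (- a * th (tnth t j) * thp false j t).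
  apply: eq_bigr => i ij; have ji : j != i by rewrite eq_sym.
  have [/kap_subE[s0 ->] x1] := rt.2 j i ji.
  have [a0 ->] := kap_addE x1.
  rewrite /thp; have [Q [-> -> ->]] := cprod_split2 (thfac false j) t ij.
  rewrite /thfac ltnn !mul0r !subr0 !mulr1; case: (i < j)%N; last by rewrite !mul0r subrr !mulr0 addr0.
  by rewrite (_ : true%:R = 1 :> R) // thN; field; rewrite s0 a0.
rewrite -mulr_suml sum_lt subrr rho_jE E0 E1; ring.
Qed.

(** The other half of the chain: [D_j] replaces the factor [1 - th] at [j] by [1 - th ^ 2], with the
    opposite diagonal coefficient. *)
Lemma Dm_thp1 (j : 'I_r) t : regular t ->
  Dm j (thp true j.+1) t = (rho1 - 2 * nu) * thp true j.+1 t +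
    (1 + 2 * nu - iota - a * (r - 1 - j)%:R) * thp true j t.
Proof.
move=> rt; have [P [E0 E1 PE]] := thp_step true j t; rewrite mul1r in E0.
rewrite /Dm; have [t0 K1] := kap1E (rt.1 j).
have PE' : \prod_(l | l != j) thfac true j.+1 l (tnth t l) = P.
  rewrite PE; apply: eq_bigr => l lj.
  by rewrite /thfac ltnS leq_eqVlt (inj_eq val_inj) (negbTE lj).
have -> : der j (thp true j.+1) t = P * - (1 - th (tnth t j) ^+ 2).
  rewrite -PE'; apply: der_cprod.
  rewrite (_ : thfac true j.+1 j = (fun x => 1 - th x)); last by apply/funext => x; rewrite /thfac ltnSn.
  rewrite -sub0r; exact: (is_deriveB (is_derive_cst (1 : R) (tnth t j) (1 : R)) (is_derive_th (tnth t j))).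
have -> : thp true j.+1 (sigma_i j t) = P * (1 + th (tnth t j)).
  by rewrite /thp cprod_sigma_i PE' /thfac ltnSn thN opprK.
have -> : \sum_(i | i != j) (a * (1 - kap (tnth t j - tnth t i) - (i < j)%:R) *
      (thp true j.+1 t - thp true j.+1 (s_ij j i t)) +
    a * (1 - kap (tnth t j + tnth t i)) * (thp true j.+1 t - thp true j.+1 (sigma_ij j i t))) =
    \sum_(i | i != j) (1 * (a * (1 - th (tnth t j)) * thp true j.+1 t) +
      (i < j)%:R * (a * th (tnth t j) * thp true j.+1 t)).
  apply: eq_bigr => i ij; have ji : j != i by rewrite eq_sym.
  have [/kap_subE[s0 ->] x1] := rt.2 j i ji.
  have [a0 ->] := kap_addE x1.
  rewrite /thp; have [Q [-> -> ->]] := cprod_split2 (thfac true j.+1) t ij.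
  have L : (i < j.+1)%N = (i < j)%N by rewrite ltnS leq_eqVlt (inj_eq val_inj) (negbTE ij).
  rewrite /thfac ltnSn L; case: (i < j)%N; rewrite !thN.
    by rewrite (_ : true%:R = 1 :> R) //; field; rewrite s0 a0.
  by rewrite (_ : true%:R = 1 :> R) // (_ : false%:R = 0 :> R) //; field; rewrite s0 a0.
rewrite big_split /= -!mulr_suml sum_neq sum_lt (kap2E (rt.1 j)) K1 E0 E1.
have r1 : (0 < r)%N := leq_ltn_trans (leq0n j) (ltn_ord j).
rewrite rho_jE -[rho1]/(iota + b + a * r.-1%:R) -subnDA natrB; last by have := ltn_ord j; lia.
rewrite -subn1 natrB // natrD; move: (th (tnth t j)) t0 => y t0; move: (r%:R) (j%:R) => n m.
by field.
Qed.

End ShiftProducts.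

(** * Affine functions of commuting operators *)

Section AffineOperators.
Context {K : comNzRingType} {V : lmodType K}.
Implicit Types (D : {linear V -> V}) (v : V).

Lemma affine_comm D D' c d c' d' v : D (D' v) = D' (D v) ->
  c *: D (c' *: D' v + d' *: v) + d *: (c' *: D' v + d' *: v) =
  c' *: D' (c *: D v + d *: v) + d' *: (c *: D v + d *: v).
Proof.
move=> H; rewrite (linearD D) (linearD D') (linearZ_LR D) (linearZ_LR D) (linearZ_LR D') (linearZ_LR D') H.
rewrite !scalerDr !scalerA (mulrC c' c) (mulrC d d') (mulrC d c') (mulrC d' c).
by rewrite addrACA.
Qed.

Lemma affine_sqr D c v :
  (-1) *: D (1 *: D v + c *: v) + c *: (1 *: D v + c *: v) = c ^+ 2 *: v - D (D v).
Proof.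
rewrite !scale1r scaleN1r (linearD D) (linearZ_LR D) scalerDr scalerA -expr2 opprD.
by rewrite -addrA addKr addrC.
Qed.

End AffineOperators.

(** * The recursion in [nu] *)

Section ShiftIntegral.
Context {R : realType} {r : nat}.
Variables (a b iota : R).
Hypotheses (a0 : 0 < a) (b0 : 0 < b) (i0 : 0 < iota).
Local Notation pt := (r.-tuple R).
Local Notation gfun := (@gfun R r).
Local Notation DL := (@DL R r a b iota).
Local Notation fw := (@fw R r a b iota).
Local Notation rho1 := (@rho1 R r a b iota).
Implicit Types (t : pt) (g k : gfun).

Definition Iw nu (F : pt -> R) : R := fine (\int[leb r]_t (F t * fw nu t)%:E)%E.

Lemma Iw_ext nu (F G : pt -> R) : (forall t, regular t -> F t = G t) -> Iw nu F = Iw nu G.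
Proof.
move=> E; congr fine; apply: eq_integral => t _; congr EFin.
by case: (pselect (regular t)) => [/E ->|nr] //; rewrite fw_nonreg // !mulr0.
Qed.

Lemma Iw_lin nu eps (j : 'I_r) c (F G : TT r -> R) : 0 <= eps -> eps < 2 * (nu - rho1) ->
  bnd eps F -> bnd eps G -> measurable_fun setT F -> measurable_fun setT G ->
  Iw nu (fun t => c * F t + G t) = c * Iw nu F + Iw nu G.
Proof.
move=> e0 ep BF BG mF mG.
have IF := bnd_integrable a0 b0 i0 j e0 ep BF mF; have IG := bnd_integrable a0 b0 i0 j e0 ep BG mG.
have IcF := integrableZl measurableT c IF.
rewrite /Iw; have -> : (fun t : TT r => ((c * F t + G t) * fw nu t)%:E) =
    (fun t => (c%:E * (F t * fw nu t)%:E + (G t * fw nu t)%:E)%E).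
  by apply/funext => t; rewrite mulrDl EFinD -mulrA EFinM.
rewrite (integralD measurableT IcF IG) (integralZl measurableT IF).
rewrite fineD ?fineM ?integrable_fin_num //; apply: fin_numM => //; exact: integrable_fin_num IF.
Qed.

Lemma Dm_cut nu (j : 'I_r) (F : pt -> R) t : regular t -> Dm a b iota nu j (cut F) t = Dm a b iota nu j F t.
Proof.
move=> rt; rewrite /Dm (@der_near _ _ j (cut F) F); last first.
  by apply: nearp_sub (regular_near rt) => y ry; rewrite cutE.
rewrite !cutE //; [|exact: reg_ng].
congr (_ + _ + _ - _ + _); apply: eq_bigr => i ij.
by rewrite !cutE //; [exact: reg_sg|exact: reg_s].
Qed.

Lemma sech_sqr (x : R) : 1 - th x ^+ 2 = powR (coshR x) (- 2).
Proof.
have c0 := coshR_gt0 x.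
rewrite powRN powR_mulrn ?ltW // /th.
have : coshR x ^+ 2 - sinhR x ^+ 2 = 1.
  rewrite /coshR /sinhR; have : expR x * expR (- x) = 1 by rewrite -expRD subrr expR0.
  by move: (expR _) (expR _) => u v H; rewrite -[RHS]H; field.
move: c0; move: (coshR x) (sinhR x) => u v u0 H; have un : u != 0 by rewrite gt_eqF.
by apply: (mulIf (expf_neq0 2 un)); rewrite mulVf ?expf_neq0 // -[RHS]H; field.
Qed.

Lemma fw_shift nu t : fw (nu + 1) t = thp true 0 t * fw nu t.
Proof.
rewrite !fwE mulrA; congr (_ * _); rewrite /f_delta /thp /cprod -big_split /=.
apply: eq_bigr => i _; rewrite /thfac ltn0 mul1r.
have c0 := coshR_gt0 (tnth t i).
rewrite sech_sqr.
by rewrite -powRD ?(gt_eqF c0) ?implybT //; congr powR; ring.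
Qed.

Lemma temperedZ eps c g : tempered a b iota eps g -> tempered a b iota eps (c *: g).
Proof.
by move=> H; rewrite -[c](subrK 1) scalerDl scale1r; exact: tempered_lin.
Qed.

Definition Dop (c d : R) (j : 'I_r) g : gfun := c *: DL j g + d *: g.

Lemma tempered_Dop eps c d j g : tempered a b iota eps g -> tempered a b iota eps (Dop c d j g).
Proof. by move=> H; apply: tempered_lin; [exact: tempered_DL|exact: temperedZ]. Qed.

Lemma tempered_Dops eps c d s g : tempered a b iota eps g -> tempered a b iota eps (foldr (Dop c d) g s).
Proof. by move=> H; elim: s => //= j s; exact: tempered_Dop. Qed.

Lemma bnd0M eps (F G : pt -> R) : bnd eps F -> bnd 0 G -> bnd eps (fun t => F t * G t).
Proof.
move=> [CF CF0 HF] [CG CG0 HG]; exists (CF * CG); first exact: mulr_ge0.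
move=> t rt; have := HG t rt; rewrite mul0r expR0 mulr1 => h.
by rewrite normrM mulrAC; apply: ler_pM => //; exact: HF.
Qed.

(** The scalar in [Dop] is chosen to cancel the diagonal term [al * k] of the adjoint, so that only
    the next product [k'] remains. *)
Lemma Iw_Dop nu eps (j : 'I_r) (g k k' : gfun) (c al be : R) : 0 <= eps -> eps < 2 * (nu - rho1) ->
  tempered a b iota eps g -> bnd 0 k -> bnd 0 k' ->
  (forall t, regular t -> Dm a b iota nu j k t = al * k t + be * k' t) ->
  Iw nu (fun t => Dop c (- (c * al)) j g t * k t) = c * be * Iw nu (fun t => g t * k' t).
Proof.
move=> e0 ep tg bk bk' H.
pose k2 : gfun := al *: k + be *: k'.
have k2E t : k2 t = al * k t + be * k' t by [].
have bk2 : bnd 0 k2.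
  have := bnd_lin al bk (bnd_lin (be - 1) bk' bk').
  by rewrite (_ : (fun y => _) = k2) //; apply/funext => y; rewrite k2E; ring.
have bg := tempered_bnd tg; have bDg := tempered_bnd (tempered_DL j tg).
have mM (u v : gfun) : measurable_fun setT (fun t : TT r => u t * v t).
  by apply: measurable_funM; exact: measurable_gfun.
have A := @adjoint R r a b iota a0 b0 i0 nu eps j g k k2 e0 ep bg bDg bk bk2 (fun t rt => esym (H t rt)).
have E1 : Iw nu (fun t => DL j g t * k t) = Iw nu (fun t => g t * k2 t) by rewrite /Iw A.
have E2 : Iw nu (fun t => g t * k2 t) = al * Iw nu (fun t => g t * k t) + be * Iw nu (fun t => g t * k' t).
  rewrite (_ : (fun t => g t * k2 t) = (fun t => al * (g t * k t) + (be * (g t * k' t) + 0))); last first.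
    by apply/funext => t; rewrite k2E; ring.
  have b0' : bnd eps (fun _ : pt => 0) by exists 0 => // t _; rewrite normr0 mul0r.
  have I0 : Iw nu (fun=> 0) = 0 by rewrite /Iw (_ : (fun t => _) = cst 0%E) ?integral0 //; apply/funext => t; rewrite mul0r.
  have bgk' := bnd0M bg bk'.
  have bz : bnd eps (fun t => be * (g t * k' t) + 0) by exact: bnd_lin.
  rewrite (Iw_lin j al e0 ep (bnd0M bg bk) bz) ?(Iw_lin j be e0 ep bgk' b0') ?I0 ?addr0 //.
  by apply: measurable_funD => //; apply: measurable_funM => //.
rewrite (_ : (fun t => _) = (fun t => c * (DL j g t * k t) + (- (c * al) * (g t * k t) + 0))); last first.
  apply/funext => t; rewrite -[Dop _ _ _ _ t]/(c * DL j g t + - (c * al) * g t).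
  move: (DL j g t) => x; ring.
have b0' : bnd eps (fun _ : pt => 0) by exists 0 => // t _; rewrite normr0 mul0r.
have I0 : Iw nu (fun=> 0) = 0 by rewrite /Iw (_ : (fun t => _) = cst 0%E) ?integral0 //; apply/funext => t; rewrite mul0r.
have bgk := bnd0M bg bk.
have bz : bnd eps (fun t => - (c * al) * (g t * k t) + 0) by exact: bnd_lin.
rewrite (Iw_lin j c e0 ep (bnd0M bDg bk) bz) ?(Iw_lin j _ e0 ep bgk b0') ?I0 ?addr0 //.
  by rewrite E1 E2; ring.
by apply: measurable_funD => //; apply: measurable_funM => //.
Qed.

Lemma drop_enum m (mr : (m < r)%N) : drop m (enum 'I_r) = Ordinal mr :: drop m.+1 (enum 'I_r).
Proof.
rewrite (drop_nth (Ordinal mr)) ?size_enum_ord //; congr (_ :: _).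
by apply: val_inj; rewrite /= nth_enum_ord.
Qed.

Lemma take_enum m (mr : (m < r)%N) : take m.+1 (enum 'I_r) = rcons (take m (enum 'I_r)) (Ordinal mr).
Proof.
rewrite (take_nth (Ordinal mr)) ?size_enum_ord //; congr rcons.
by apply: val_inj; rewrite /= nth_enum_ord.
Qed.

Lemma Iw_down nu eps g m : 0 <= eps -> eps < 2 * (nu - rho1) -> tempered a b iota eps g -> (m <= r)%N ->
  Iw nu (fun t => foldr (Dop (- 1) (2 * nu - rho1)) g (drop m (enum 'I_r)) t * gthp false m t) =
  (\prod_(m <= i < r) (2 * nu - a * i%:R)) * Iw nu (fun t => g t * gthp false r t).
Proof.
move=> e0 ep tg mr; rewrite -(subKn mr); elim: (r - m)%N (leq_subr m r) => [|d IH] dr.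
  by rewrite subn0 drop_oversize ?size_enum_ord // big_geq // mul1r.
have lt : (r - d.+1 < r)%N by rewrite ltn_subLR //; lia.
have E : (r - d.+1).+1 = (r - d)%N by lia.
rewrite (drop_enum lt) /= E big_ltn // E -mulrA -(IH (ltnW dr)).
set G := foldr _ g _; have tG : tempered a b iota eps G by exact: tempered_Dops.
have := @Iw_Dop nu eps (Ordinal lt) G (gthp false (r - d.+1)) (gthp false (r - d)) (- 1)
  (- (rho1 - 2 * nu)) (- (2 * nu - a * (r - d.+1)%:R)) e0 ep tG (bnd_gthp _ _) (bnd_gthp _ _).
rewrite (_ : - (- 1 * - (rho1 - 2 * nu)) = 2 * nu - rho1); last by ring.
rewrite mulrNN mul1r; apply => t rt.
rewrite /= Dm_cut // !cutE // (Dm_thp0 a b iota nu (Ordinal lt) rt) /= E; ring.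
Qed.

(** Here a step lowers the index of the product, so the operators come in reversed order;
    [foldr_Dop_rev] removes the reversal by commutativity. *)
Lemma Iw_up nu eps g m : 0 <= eps -> eps < 2 * (nu - rho1) -> tempered a b iota eps g -> (m <= r)%N ->
  Iw nu (fun t => foldr (Dop 1 (2 * nu - rho1)) g (rev (take m (enum 'I_r))) t * gthp true m t) =
  (\prod_(0 <= i < m) (1 + 2 * nu - iota - a * (r - 1 - i)%:R)) * Iw nu (fun t => g t * gthp true 0 t).
Proof.
move=> e0 ep tg; elim: m => [|m IH] mr; first by rewrite take0 big_geq // mul1r.
rewrite (take_enum mr) rev_rcons big_nat_recr //= [RHS]mulrAC [RHS]mulrC -(IH (ltnW mr)).
set G := foldr _ g _; have tG : tempered a b iota eps G by exact: tempered_Dops.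
have := @Iw_Dop nu eps (Ordinal mr) G (gthp true m.+1) (gthp true m) 1
  (rho1 - 2 * nu) (1 + 2 * nu - iota - a * (r - 1 - m)%:R) e0 ep tG (bnd_gthp _ _) (bnd_gthp _ _).
rewrite (_ : - (1 * (rho1 - 2 * nu)) = 2 * nu - rho1); last by ring.
rewrite mul1r; apply => t rt.
by rewrite /= Dm_cut // !cutE // (Dm_thp1 a b iota nu (Ordinal mr) rt).
Qed.

Lemma DL_comm i j g : DL i (DL j g) = DL j (DL i g).
Proof. exact: (DV_comm a b iota). Qed.

Lemma Dop_comm c d c' d' i j g : Dop c d i (Dop c' d' j g) = Dop c' d' j (Dop c d i g).
Proof.
exact: affine_comm (DL_comm i j g).
Qed.

Lemma foldr_Dop_comm c d c' d' i g s :
  Dop c d i (foldr (Dop c' d') g s) = foldr (Dop c' d') (Dop c d i g) s.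
Proof. by elim: s => //= j s IH; rewrite Dop_comm IH. Qed.

Lemma foldr_Dop_rev c d g s : foldr (Dop c d) g (rev s) = foldr (Dop c d) g s.
Proof. by elim: s => //= j s IH; rewrite rev_cons foldr_rcons -foldr_Dop_comm IH. Qed.

Definition shiftop (c2 : R) g s : gfun := foldr (fun j v => c2 *: v - DL j (DL j v)) g s.

Lemma shiftopE c g s :
  foldr (Dop (- 1) c) (foldr (Dop 1 c) g s) s = shiftop (c ^+ 2) g s.
Proof.
by elim: s => //= j s IH; rewrite -foldr_Dop_comm IH; exact: affine_sqr.
Qed.

(** In both halves of the chain the diagonal coefficient is [2 * nu - rho1] up to sign. The two
    first-order operators at [j] are therefore [c - D_j] and [c + D_j] with the same [c], and
    multiply to [c ^ 2 - D_j ^ 2]. *)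
Lemma Iw_shift nu eps g : 0 <= eps -> eps < 2 * (nu - rho1) -> tempered a b iota eps g ->
  Iw nu (shiftop ((2 * nu - rho1) ^+ 2) g (enum 'I_r)) =
  (\prod_(i < r) ((2 * nu - a * i%:R) * (1 + 2 * nu - iota - a * (r - 1 - i)%:R))) * Iw (nu + 1) g.
Proof.
move=> e0 ep tg; set c := 2 * nu - rho1.
have tg' : tempered a b iota eps (foldr (Dop 1 c) g (enum 'I_r)) by exact: tempered_Dops.
have H1 := Iw_down e0 ep tg' (leq0n r); have H2 := Iw_up e0 ep tg (leqnn r).
rewrite drop0 (shiftopE c g (enum 'I_r)) in H1.
have sz : (size (enum 'I_r) <= r)%N by rewrite size_enum_ord.
rewrite (take_oversize sz) -/c foldr_Dop_rev in H2.
have -> : Iw nu (shiftop (c ^+ 2) g (enum 'I_r)) = Iw nu (fun t => shiftop (c ^+ 2) g (enum 'I_r) t * gthp false 0 t).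
  apply: Iw_ext => t rt; rewrite /= cutE // /thp /cprod big1 ?mulr1 // => i _.
  by rewrite /thfac ltn0 mul0r subr0.
rewrite H1 (_ : Iw nu _ = Iw nu (fun t => foldr (Dop 1 c) g (enum 'I_r) t * gthp true r t)); last first.
  apply: Iw_ext => t rt; rewrite /= !cutE //; congr (_ * _); apply: eq_bigr => i _.
  by rewrite /thfac ltn_ord.
rewrite H2 mulrA !big_mkord -big_split /=; congr (_ * _).
rewrite /Iw; congr fine; apply: eq_integral => t _; congr EFin.
case: (pselect (regular t)) => [rt|nr]; last by rewrite !fw_nonreg // !mulr0.
by rewrite /= cutE // fw_shift mulrA.
Qed.

Definition shift_factor nu : R :=
  \prod_(i < r) ((2 * nu - a * i%:R) * (1 + 2 * nu - iota - a * (r - 1 - i)%:R)).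

Lemma Iw_scale nu eps (j : 'I_r) c g : 0 <= eps -> eps < 2 * (nu - rho1) -> bnd eps g ->
  Iw nu (c *: g) = c * Iw nu g.
Proof.
move=> e0 ep bg; have := @Iw_lin nu eps j (c - 1) g g e0 ep bg bg (measurable_gfun _) (measurable_gfun _).
rewrite (_ : Iw nu (fun t => _) = Iw nu (c *: g)) => [->|]; first by ring.
by apply: Iw_ext => t _; rewrite -[(c *: g) t]/(c * g t); ring.
Qed.

Lemma Iw_shift_eigen nu eps g z : (0 < r)%N -> 0 <= eps -> eps < 2 * (nu - rho1) -> tempered a b iota eps g ->
  (forall c2, shiftop c2 g (enum 'I_r) = (\prod_(k < r) (c2 - z k)) *: g) ->
  (\prod_(k < r) ((2 * nu - rho1) ^+ 2 - z k)) * Iw nu g = shift_factor nu * Iw (nu + 1) g.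
Proof.
move=> r0 e0 ep tg H; rewrite -(Iw_shift e0 ep tg) H (Iw_scale (Ordinal r0) _ e0 ep) //.
exact: tempered_bnd tg.
Qed.

Lemma shiftop_Eop g z : (forall i, Eop DL g (enum 'I_r) i = esc z (enum 'I_r) i *: g) ->
  forall c2, shiftop c2 g (enum 'I_r) = (\prod_(k < r) (c2 - z k)) *: g.
Proof.
move=> H c2; pose X : {linear gfun -> gfun} := ( *:%R c2).
have Xc j v : X (DL j v) = DL j (X v) by rewrite /X /= (linearZ_LR (DL j)).
rewrite -[LHS]/(Hop DL X g (enum 'I_r)) (Hop_eigen Xc H) /Hsc -[in RHS]big_enum /=.
elim: (enum 'I_r) => [|k s IH]; first by rewrite big_nil scale1r.
by rewrite big_cons /= IH -scalerA scalerBl.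
Qed.

Definition gone : gfun := gcut (good_cst (1 : R)).

(** Constants are killed by the derivative and by all differences, so 1 is a joint eigenfunction and
    the recursion applies to the norm integral too. *)
Lemma DL_gone j : DL j gone = - rho_j a b iota j *: gone.
Proof.
apply: gfun_eq => t rt; rewrite -[(_ *: gone) t]/(- rho_j a b iota j * gone t) (DVE _ _ _ j gone rt) /Dch.
rewrite big1 => [|i ij]; last first.
  by rewrite /opA /= !cutE ?subrr ?mulr0 ?addr0 //; first [exact: reg_s|exact: reg_sg].
rewrite /opB /= !cutE //; last exact: reg_ng.
rewrite subrr mulr0 !addr0 (@der_near _ _ j _ (fun=> 1)) ?der_cst ?sub0r ?mulNr //.
by apply: nearp_sub (regular_near rt) => y ry; rewrite cutE.
Qed.

Lemma tempered_gone eps : 0 <= eps -> tempered a b iota eps gone.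
Proof.
move=> e0 s; have [c ->] : exists c, foldr (fun j G => DL j G) gone s = c *: gone.
  elim: s => [|j s [c IH]]; first by exists 1; rewrite scale1r.
  exists (c * - rho_j a b iota j); apply: etrans (congr1 (DL j) IH) _.
  by rewrite (linearZ_LR (DL j)) DL_gone scalerA.
exists `|c| => // t rt; rewrite -[(c *: gone) t]/(c * gone t) /= cutE // mulr1 ler_peMr //.
by rewrite -expR0 ler_expR mulr_ge0 //; exact: sumr_ge0.
Qed.

Lemma shiftop_gone c2 : shiftop c2 gone (enum 'I_r) = (\prod_(k < r) (c2 - rho_j a b iota k ^+ 2)) *: gone.
Proof.
rewrite -[in RHS]big_enum /=; elim: (enum 'I_r) => [|k s IH]; first by rewrite big_nil scale1r.
rewrite big_cons /= IH (linearZ_LR (DL k)) DL_gone !(linearZ_LR (DL k)) DL_gone !scalerA -scalerBl.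
congr (_ *: _); ring.
Qed.

End ShiftIntegral.

(** * Limits at infinity and slow variation *)

Section LimitsAtInfinity.
Context {R : realType}.
Implicit Types (f g q : R -> R).

Lemma cvg_lin_ratio (p q : R) : (x + p) / (x + q) @[x --> +oo%R] --> (1 : R).
Proof.
apply/cvgrPdist_le => e e0; near=> x.
have x1 : 0 < x + q.
  by rewrite -ltrBlDr sub0r; near: x; apply: nbhs_pinfty_gt; exact: num_real.
have x2 : `|q - p| / e < x + q.
  by rewrite -ltrBlDr; near: x; apply: nbhs_pinfty_gt; exact: num_real.
have -> : 1 - (x + p) / (x + q) = (q - p) / (x + q) by field; rewrite gt_eqF.
by rewrite normrM normfV (gtr0_norm x1) ler_pdivrMr // mulrC -ler_pdivrMr // ltW.
Unshelve. all: end_near. Qed.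

Lemma cvg1_prod (I : Type) (s : seq I) (P : pred I) (F : I -> R -> R) :
  (forall i, P i -> F i x @[x --> +oo%R] --> (1 : R)) ->
  \prod_(i <- s | P i) F i x @[x --> +oo%R] --> (1 : R).
Proof.
move=> H; elim: s => [|i s IH].
  by rewrite (_ : (fun x => _) = cst 1); [exact: cvg_cst|apply/funext => x; rewrite big_nil].
rewrite (_ : (fun x => _) = (fun x => (if P i then F i x else 1) * \prod_(i <- s | P i) F i x)).
  rewrite -[X in _ --> X](mulr1 1); apply: cvgM IH.
  by case: (boolP (P i)) => [/H //|_]; exact: cvg_cst.
by apply/funext => x; rewrite big_cons; case: ifP => // _; rewrite mul1r.
Qed.

Lemma cvg1M f g : f x @[x --> +oo%R] --> (1 : R) -> g x @[x --> +oo%R] --> (1 : R) ->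
  f x * g x @[x --> +oo%R] --> (1 : R).
Proof. by move=> cf cg; rewrite -[X in _ --> X](mulr1 1); exact: cvgM. Qed.

Lemma cvg1V f : f x @[x --> +oo%R] --> (1 : R) -> (f x)^-1 @[x --> +oo%R] --> (1 : R).
Proof. by move=> cf; rewrite -[X in _ --> X]invr1; apply: cvgV => //; exact: oner_neq0. Qed.

Lemma cvg_translate f (l c : R) : f x @[x --> +oo%R] --> l -> f (x + c) @[x --> +oo%R] --> l.
Proof. by move=> H; apply: cvg_comp H; exact: cvg_addrr. Qed.

Lemma cvg_near_eq f g (l A : R) : (forall x, A < x -> f x = g x) ->
  f x @[x --> +oo%R] --> l -> g x @[x --> +oo%R] --> l.
Proof.
move=> E; apply: cvg_trans; apply: near_eq_cvg; near=> x.
by apply: E; near: x; apply: nbhs_pinfty_gt; exact: num_real.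
Unshelve. all: end_near. Qed.

Lemma cvg_squeeze_pinfty f g h (l A : R) : (forall x, A < x -> f x <= g x <= h x) ->
  f x @[x --> +oo%R] --> l -> h x @[x --> +oo%R] --> l -> g x @[x --> +oo%R] --> l.
Proof.
move=> H cf ch; apply: squeeze_cvgr cf ch; near=> x.
by apply: H; near: x; apply: nbhs_pinfty_gt; exact: num_real.
Unshelve. all: end_near. Qed.

Lemma periodic_cvg g (A l : R) : (forall x, A < x -> g (x + 1) = g x) ->
  g x @[x --> +oo%R] --> l -> forall x, A < x -> g x = l.
Proof.
move=> per cg x Ax.
have gn n : g (x + n%:R) = g x.
  elim: n => [|n IH]; first by rewrite addr0.
  by rewrite -natr1 addrA per // ltr_wpDr.
apply/eqP; rewrite -subr_eq0 -normr_eq0; apply/eqP/le_anti; rewrite normr_ge0 andbT.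
apply/ler_addgt0Pr => e e0; rewrite add0r.
have /cvgrPdist_le/(_ _ e0)[M [_ HM]] := cg.
pose n := (Num.truncn `|M - x|).+1.
have := HM (x + n%:R); rewrite gn distrC; apply.
rewrite -ltrBlDl; apply: le_lt_trans (ler_norm _) _; exact: truncnS_gt.
Qed.

(* A positive nonincreasing function whose unit-step ratio tends to 1 varies slowly. *)
Lemma cvg_shift_ratio f q (A s : R) : (forall x, A < x -> 0 < f x) ->
  (forall x y, A < x -> x <= y -> f y <= f x) ->
  (forall x, A < x -> f (x + 1) = q x * f x) -> q x @[x --> +oo%R] --> (1 : R) -> 0 <= s ->
  f (x + s) / f x @[x --> +oo%R] --> (1 : R).
Proof.
move=> f0 fd fq cq s0.
have nat_shift M : f (x + M%:R) / f x @[x --> +oo%R] --> (1 : R).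
  elim: M => [|M IH].
    apply: (@cvg_near_eq (cst 1) _ _ A); last exact: cvg_cst.
    by move=> x Ax; rewrite addr0 divff // gt_eqF // f0.
  apply: (@cvg_near_eq (fun x => q (x + M%:R) * (f (x + M%:R) / f x)) _ _ A).
    by move=> x Ax; rewrite -natr1 addrA fq ?mulrA // ltr_wpDr.
  by apply: cvg1M => //; exact: cvg_translate.
pose M := (Num.truncn s).+1.
have sM : s <= M%:R by rewrite ltW // truncnS_gt.
apply: (@cvg_squeeze_pinfty (fun x => f (x + M%:R) / f x) _ (cst 1) 1 A); last exact: cvg_cst.
  move=> x Ax; have fx := f0 x Ax; rewrite ler_pM2r ?invr_gt0 // ler_pdivrMr // mul1r.
  by rewrite !fd //; [rewrite lerDl|rewrite ltr_wpDr|rewrite lerD2l].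
exact: nat_shift.
Qed.

End LimitsAtInfinity.

(** * Asymptotics of Gamma quotients *)

Section GammaRatios.
Context {R : realType}.
Implicit Types (x y s c p X : R).

Lemma gam_ratio_dec c x y : 0 <= c -> 0 < x -> x <= y -> gam y / gam (y + c) <= gam x / gam (x + c).
Proof.
move=> c0 x0 xy; have gx := gam_gt0 (ltr_wpDr c0 x0); have gy := gam_gt0 (ltr_wpDr c0 (lt_le_trans x0 xy)).
rewrite (ler_pdivrMr _ _ gy) mulrAC (ler_pdivlMr _ _ gx) [leRHS]mulrC; exact: (gam_convex x0 xy c0).
Qed.

Lemma cvg_gam_ratio_step p c s : 0 <= c -> 0 <= s ->
  (gam (x + s + p) / gam (x + s + p + c)) / (gam (x + p) / gam (x + p + c)) @[x --> +oo%R] --> (1 : R).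
Proof.
move=> c0 s0; apply: (@cvg_shift_ratio _ (fun x => gam (x + p) / gam (x + p + c)) (fun x => (x + p) / (x + (p + c))) (- p)); last exact: s0.
- move=> x xp; have x0 : 0 < x + p by rewrite -ltrBlDr sub0r.
  by rewrite divr_gt0 ?gam_gt0 // ltr_wpDr.
- move=> x y xp xy; have x0 : 0 < x + p by rewrite -ltrBlDr sub0r.
  by apply: gam_ratio_dec => //; rewrite lerD2r.
- move=> x xp; have x0 : 0 < x + p by rewrite -ltrBlDr sub0r.
  have x1 : 0 < x + p + c by rewrite ltr_wpDr.
  rewrite (addrAC x 1 p) (addrAC (x + p) 1 c) !gam_rec // invfM addrA; ring.
- exact: cvg_lin_ratio.
Qed.

(** This is [|Gamma (X + i y)| ^ 2]. *)
Definition gam_sqr X y : R := Jg X (osc y 1 0) ^+ 2 + Jg X (osc y 0 1) ^+ 2.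

Lemma gam_sqr_rec X y : 0 < X -> gam_sqr (X + 1) y = (X ^+ 2 + y ^+ 2) * gam_sqr X y.
Proof.
move=> X0; rewrite /gam_sqr !Jg_osc_rec //.
have -> : Jg X (osc y 0 (- 1)) = - Jg X (osc y 0 1).
  by have := @Jg_oscD R X y 0 1 0 0 (- 1) 0 X0; rewrite !mulr0 !addr0 mulr1 mul0r addr0 mulN1r.
by rewrite oppr0; ring.
Qed.

(** Positive once [X - 1 > 4 * y ^ 2], by the lower bound of [Jg_osc_sqr]; the recursion carries
    positivity back in unit steps. *)
Lemma gam_sqr_gt0 X y : 0 < X -> 0 < gam_sqr X y.
Proof.
move=> X0; pose n := (Num.truncn (1 + 4 * y ^+ 2)).+1.
have nb : 1 + 4 * y ^+ 2 < n%:R by exact: truncnS_gt.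
have y2 := sqr_ge0 y.
have H : 0 < gam_sqr (X + n%:R) y.
  have X1 : 1 < X + n%:R by lra.
  have /andP[h _] := Jg_osc_sqr y X1; apply: lt_le_trans h.
  rewrite mulr_gt0 ?exprn_gt0 ?gam_gt0 ?subr_gt0 //; last by lra.
  by rewrite ltr_pdivrMr ?mul1r; lra.
elim: n {nb} H => [|n IH]; first by rewrite addr0.
have Xn : 0 < X + n%:R by rewrite ltr_wpDr.
rewrite -natr1 addrA gam_sqr_rec // pmulr_rgt0 //.
by rewrite ltr_pwDl ?sqr_ge0 // exprn_gt0.
Qed.

(** The quotient splits into [gam_sqr X y / gam X ^ 2], squeezed by [Jg_osc_sqr], and a ratio of
    Gamma quotients shifted by [s]. *)
Lemma gam_sqr_cvg y s : 0 <= s -> gam_sqr X y / (gam (X + s) * gam (X - s)) @[X --> +oo%R] --> (1 : R).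
Proof.
move=> s0; pose A := 1 + s.
apply: (@cvg_near_eq _ (fun X => (gam_sqr X y / gam X ^+ 2) *
   ((gam (X + - s + s) / gam (X + - s + s + s)) / (gam (X + - s) / gam (X + - s + s)))) _ _ A).
  move=> X XA; have X0 : 0 < X by rewrite /A in XA; lra.
  have X1 : 0 < X + s by lra.
  have X2 : 0 < X - s by rewrite /A in XA; lra.
  rewrite !subrK; have := gam_gt0 X0; have := gam_gt0 X1; have := gam_gt0 X2.
  move: (gam _) (gam _) (gam _) => u v w u0 v0 w0.
  by field; rewrite !gt_eqF.
apply: cvg1M; last first.
  have H := cvg_translate (- s) (@cvg_gam_ratio_step 0 s s s0 s0).
  by apply: (cvg_near_eq (A := 0) _ H) => x _; rewrite !addr0.
apply: (@cvg_squeeze_pinfty _ (fun X => 1 - 4 * y ^+ 2 / (X - 1)) _ (cst 1) 1 1); last exact: cvg_cst.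
  move=> X X1; have X0 : 0 < X by lra.
  have g2 : 0 < gam X ^+ 2 by rewrite exprn_gt0 ?gam_gt0.
  by rewrite ler_pdivlMr // ler_pdivrMr // mul1r; exact: Jg_osc_sqr.
rewrite -[X in _ --> X](subr0 1); apply: cvgB; first exact: cvg_cst.
rewrite -(mulr0 (4 * y ^+ 2)); apply: cvgM; first exact: cvg_cst.
have := @cvg_lin_ratio R 0 (- 1); have H := @cvg_lin_ratio R (- 1 + 1) (- 1).
have -> : 0 = 1 - 1 :> R by rewrite subrr.
move=> _; apply: (@cvg_near_eq _ (fun x => (x + (- 1 + 1)) / (x + - 1) - 1) _ _ 1).
  by move=> x x1; field; rewrite subr_eq0 gt_eqF.
by apply: cvgB H _; exact: cvg_cst.
Qed.

End GammaRatios.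

(** * The norm integral up to a constant *)

Section NormIntegral.
Context {R : realType} {r : nat}.
Variables (a b iota : R).
Hypotheses (a0 : 0 < a) (b0 : 0 < b) (i0 : 0 < iota) (r0 : (0 < r)%N).
Local Notation gfun := (@gfun R r).
Local Notation fw := (@fw R r a b iota).
Local Notation rho1 := (@rho1 R r a b iota).
Local Notation Iw := (@Iw R r a b iota).
Local Notation rho j := (@rho_j R r a b iota j).
Implicit Types (t : r.-tuple R) (g : gfun) (nu : R).

Definition Nw nu : R := Iw nu (fun=> 1).

Lemma Nw_gone nu : Iw nu gone = Nw nu.
Proof. by apply: (Iw_ext iota a0 b0) => t rt; rewrite /= cutE. Qed.

Lemma rhoE (j : 'I_r) : rho j = rho1 - a * j%:R /\ rho j = iota + b + a * (r.-1%:R - j%:R).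
Proof. by rewrite rho_jE -[rho1]/(iota + b + a * r.-1%:R); split=> //; ring. Qed.

Lemma rho_bounds (j : 'I_r) : 0 < rho j <= rho1.
Proof.
have [E1 E2] := rhoE j.
have h1 : 0 <= a * j%:R by rewrite mulr_ge0 // ltW.
have h2 : 0 <= a * (r.-1%:R - j%:R).
  by rewrite mulr_ge0 ?subr_ge0 ?ler_nat ?ltW //; have := ltn_ord j; lia.
by apply/andP; split; [rewrite E2 ltr_pwDl // addr_gt0|rewrite E1 lerBlDr lerDl].
Qed.

(** The Gamma factors of [N_nu] that contain [nu] have arguments [nu + pK i] above and
    [nu + pK i + cK] below; the gap [cK] is the same for all [i]. *)
Definition pK (i : nat) : R := - iota - b - a / 2 * r.-1%:R - a / 2 * i%:R.
Definition cK : R := (1 + iota) / 2 + b + a / 2 * r.-1%:R.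

Lemma pK_gt0 nu (i : 'I_r) : rho1 < nu -> 0 < nu + pK i.
Proof.
rewrite -[rho1]/(iota + b + a * r.-1%:R) /pK => h.
have : a / 2 * i%:R <= a / 2 * r.-1%:R.
  apply: ler_wpM2l; first by rewrite divr_ge0 // ltW.
  by rewrite ler_nat; have := ltn_ord i; lia.
move: (a / 2 * i%:R) => u hu; have := b0; have := i0; lra.
Qed.

Lemma cK_ge0 : 0 <= cK.
Proof.
have : 0 <= a / 2 * r.-1%:R by rewrite mulr_ge0 // divr_ge0 // ltW.
rewrite /cK; have := b0; have := i0; lra.
Qed.

Definition qK nu : R := \prod_(i < r) ((nu + pK i) / (nu + (pK i + cK))).
Definition Kw nu : R := \prod_(i < r) (gam (nu + pK i) / gam (nu + pK i + cK)).

Lemma Kw_gt0 nu : rho1 < nu -> 0 < Kw nu.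
Proof.
move=> h; apply: prodr_gt0 => i _; have p0 := pK_gt0 i h.
by rewrite divr_gt0 ?gam_gt0 // ltr_wpDr // cK_ge0.
Qed.

Lemma Kw_rec nu : rho1 < nu -> Kw (nu + 1) = qK nu * Kw nu.
Proof.
move=> h; rewrite /Kw /qK -big_split /=; apply: eq_bigr => i _.
have p0 := pK_gt0 i h; have p1 : 0 < nu + pK i + cK by rewrite ltr_wpDr // cK_ge0.
rewrite (addrAC nu 1) (addrAC (nu + pK i) 1 cK) (gam_rec p0) (gam_rec p1) (addrA nu (pK i) cK) invfM.
by move: (gam _) (gam _) => u v; ring.
Qed.

Lemma Kw_dec nu nu' : rho1 < nu -> nu <= nu' -> Kw nu' <= Kw nu.
Proof.
move=> h h'; apply: ler_prod => i _; have p0 := pK_gt0 i h.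
have p0' := pK_gt0 i (lt_le_trans h h'); have c0 := cK_ge0.
apply/andP; split; first by rewrite divr_ge0 // ltW // gam_gt0 // ltr_wpDr.
by apply: gam_ratio_dec; rewrite ?lerD2r.
Qed.

Lemma cvg_qK : qK x @[x --> +oo%R] --> (1 : R).
Proof. by apply: cvg1_prod => i _; exact: cvg_lin_ratio. Qed.

(** The factors of the recursion at [i] match the Gamma factors with the reversed index [r - 1 - i];
    the factor [2 * nu - a * i] is common to both sides and cancels. *)
Lemma rho_factor nu (i : 'I_r) : rho1 < nu ->
  [/\ (2 * nu - rho1) ^+ 2 - rho i ^+ 2 = 2 * (nu + pK (r - 1 - i)) * (2 * nu - a * i%:R),
      1 + 2 * nu - iota - a * (r - 1 - i)%:R = 2 * (nu + pK (r - 1 - i) + cK),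
      0 < 2 * nu - a * i%:R, 0 < nu + pK (r - 1 - i) & 0 < nu + pK (r - 1 - i) + cK].
Proof.
move=> h; have li : (i < r)%N := ltn_ord i.
have E : (r - 1 - i)%:R = r.-1%:R - i%:R :> R by rewrite subn1 natrB //; lia.
have lt : (r - 1 - i < r)%N by lia.
have p0 := pK_gt0 (Ordinal lt) h; rewrite /= in p0.
have hi : a * i%:R <= a * r.-1%:R by apply: (ler_wpM2l (ltW a0)); rewrite ler_nat; lia.
have [E1 E2] := rhoE i; have rE : rho1 = iota + b + a * r.-1%:R by [].
split=> //.
- by rewrite E1 /pK E rE; field.
- by rewrite /pK /cK E; field.
- have : 0 <= a * i%:R by rewrite mulr_ge0 // ltW.
  by rewrite rE in h; move: (a * i%:R) (a * r.-1%:R) hi h => u v hi h; have B := b0; have I := i0; lra.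
- by rewrite ltr_wpDr // cK_ge0.
Qed.

Lemma shift_factor_gt0 nu : rho1 < nu -> 0 < @shift_factor R r a iota nu.
Proof.
move=> h; apply: prodr_gt0 => i _; have [_ -> h1 h2 h3] := rho_factor i h.
by rewrite !mulr_gt0.
Qed.

Lemma qKE nu : rho1 < nu ->
  \prod_(i < r) ((2 * nu - rho1) ^+ 2 - rho i ^+ 2) = qK nu * @shift_factor R r a iota nu.
Proof.
move=> h; rewrite /qK [in RHS](reindex_inj rev_ord_inj) /= -big_split /=; apply: eq_bigr => i _.
have [-> -> h1 h2 h3] := rho_factor i h.
rewrite (_ : (r - i.+1 = r - 1 - i)%N); last by have := ltn_ord i; lia.
move: h3; rewrite (addrA nu _ cK); move: (nu + pK _) => u h3.
by field; rewrite gt_eqF.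
Qed.

Lemma Nw_rec nu : rho1 < nu -> Nw (nu + 1) = qK nu * Nw nu.
Proof.
move=> h; have e0 : 0 <= 0 :> R by []; have ep : 0 < 2 * (nu - rho1) by rewrite mulr_gt0 // subr_gt0.
have := @Iw_shift_eigen R r a b iota a0 b0 i0 nu 0 gone (fun k => rho k ^+ 2) r0 e0 ep
  (tempered_gone a b iota e0) (shiftop_gone a b iota).
rewrite (qKE h) !Nw_gone mulrAC [RHS]mulrC.
by move=> /mulIf -> //; rewrite gt_eqF // shift_factor_gt0.
Qed.

Lemma coshR_ge1 (x : R) : 1 <= coshR x.
Proof.
have e0 : 0 < expR (x / 2) by exact: expR_gt0.
have E1 : expR x = expR (x / 2) ^+ 2 by rewrite -expRM_natl; congr expR; field.
have E2 : expR (- x) = (expR (x / 2))^-1 ^+ 2 by rewrite -expRN -expRM_natl; congr expR; field.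
rewrite /coshR E1 E2 ler_pdivlMr //; move: (expR _) e0 => e e0.
by rewrite -subr_ge0 (_ : _ - _ = (e - e^-1) ^+ 2) ?sqr_ge0 //; field; rewrite gt_eqF.
Qed.

Lemma fw_dec nu nu' t : nu <= nu' -> fw nu' t <= fw nu t.
Proof.
move=> h; apply: ler_wpM2r; first exact: w_ge0.
apply: ler_prod => i _; rewrite powR_ge0 /=; apply: ler_powR; first exact: coshR_ge1.
lra.
Qed.

Lemma integrable_one nu : rho1 < nu -> (leb r).-integrable setT (fun t : TT r => (1 * fw nu t)%:E).
Proof.
move=> h; have ep : 0 < 2 * (nu - rho1) by rewrite mulr_gt0 // subr_gt0.
apply: (@bnd_integrable R r a b iota a0 b0 i0 nu 0 (Ordinal r0) (fun=> 1)) => //.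
by exists 1 => // t _; rewrite normr1 mul1r mul0r expR0.
Qed.

Lemma Nw_ge0 nu : 0 <= Nw nu.
Proof. by rewrite fine_ge0 // integral_ge0 // => t _; rewrite lee_fin mul1r fw_ge0. Qed.

Lemma Nw_dec nu nu' : rho1 < nu -> nu <= nu' -> Nw nu' <= Nw nu.
Proof.
move=> h h'; have I1 := integrable_one h; have I2 := integrable_one (lt_le_trans h h').
apply: fine_le; [exact: (integrable_fin_num _ I2)|exact: (integrable_fin_num _ I1)|].
apply: ge0_le_integral => //.
- by move=> t _; rewrite lee_fin mul1r fw_ge0.
- by case/integrableP: I2.
- by case/integrableP: I1.
- by move=> t _; rewrite lee_fin !mul1r fw_dec.
Qed.

(* The quotient of [Nw] by the Gamma product is 1-periodic, and both vary slowly. *)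
Lemma Nw_Kw : exists2 c, 0 <= c & forall nu, rho1 < nu -> Nw nu = c * Kw nu.
Proof.
(* Positivity of the norm integral only follows once the constant is known. A zero would spread to
   the right by monotonicity and back to the left by the recursion, and then [c = 0] fits. *)
have [[nu0 [h0 N0]]|Npos] := pselect (exists nu, rho1 < nu /\ Nw nu = 0).
  exists 0; first by [].
  move=> nu h; rewrite mul0r.
  have qpos x : rho1 < x -> qK x != 0.
    move=> hx; apply/prodf_neq0 => i _; have p0 := pK_gt0 i hx.
    by rewrite mulf_neq0 ?invr_eq0 ?gt_eqF // addrA ltr_wpDr // cK_ge0.
  have H n x : rho1 < x -> Nw (x + n%:R) = 0 -> Nw x = 0.
    elim: n x => [|n IH] x hx; first by rewrite addr0.
    have hn : rho1 < x + n%:R by rewrite ltr_wpDr.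
    rewrite -natr1 addrA (Nw_rec hn) => /eqP; rewrite mulf_eq0 (negbTE (qpos _ hn)) => /eqP.
    exact: IH.
  apply: (H (Num.truncn `|nu0 - nu|).+1 nu h); apply/le_anti; rewrite Nw_ge0 andbT -[leRHS]N0.
  apply: (Nw_dec h0); rewrite -lerBlDl; apply: le_trans (ler_norm _) _.
  by rewrite ltW // truncnS_gt.
have {}Npos nu : rho1 < nu -> 0 < Nw nu.
  by move=> h; rewrite lt_def Nw_ge0 andbT; apply/eqP => N0; apply: Npos; exists nu.
have key nu s : rho1 < nu -> 0 <= s -> Nw (nu + s) / Kw (nu + s) = Nw nu / Kw nu.
  move=> h s0.
  pose g x := (Nw (x + s) / Nw x) / (Kw (x + s) / Kw x).
  have per x : rho1 < x -> g (x + 1) = g x.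
    move=> hx; have hs : rho1 < x + s by rewrite ltr_wpDr.
    have h1 := Npos _ hx; have h2 := Kw_gt0 hx; have h3 := Kw_gt0 hs.
    have q0 y : rho1 < y -> qK y != 0.
      by move=> hy; apply/eqP => q0; have := Npos _ (ltr_wpDr ler01 hy); rewrite Nw_rec // q0 mul0r ltxx.
    have E1 := Nw_rec hs; have E2 := Nw_rec hx; have E3 := Kw_rec hs; have E4 := Kw_rec hx.
    have q1 := q0 _ hs; have q2 := q0 _ hx.
    rewrite /g (_ : x + 1 + s = x + s + 1); last by ring.
    rewrite E1 E2 E3 E4; move: (Nw (x + s)) (Nw x) (Kw (x + s)) (Kw x) (qK (x + s)) (qK x) h1 h2 h3 q1 q2 => n n' k k' q q' h1 h2 h3 q1 q2.
    by field; rewrite (gt_eqF h1) (gt_eqF h2) (gt_eqF h3) q1 q2.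
  have cg : g x @[x --> +oo%R] --> (1 : R).
    apply: cvg1M; last apply: cvg1V.
      by apply: (@cvg_shift_ratio _ Nw qK rho1 s Npos Nw_dec Nw_rec cvg_qK s0).
    by apply: (@cvg_shift_ratio _ Kw qK rho1 s Kw_gt0 Kw_dec Kw_rec cvg_qK s0).
  have := periodic_cvg per cg h; rewrite /g.
  have hs : rho1 < nu + s by rewrite ltr_wpDr.
  have h1 := Npos _ h; have h2 := Kw_gt0 h; have h3 := Kw_gt0 hs.
  move: (Nw nu) (Kw nu) (Nw (nu + s)) (Kw (nu + s)) h1 h2 h3 => n k n' k' h1 h2 h3 /eqP.
  rewrite -subr_eq0 => /eqP H; apply/eqP; rewrite -subr_eq0; apply/eqP.
  transitivity ((n' / n / (k' / k) - 1) * (n / k)); last by rewrite H mul0r.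
  by field; rewrite !gt_eqF.
pose nu0 := rho1 + 1; have h0 : rho1 < nu0 by rewrite /nu0 ltrDl.
exists (Nw nu0 / Kw nu0); first by rewrite divr_ge0 ?Nw_ge0 ?ltW ?Kw_gt0.
move=> nu h; have k0 := Kw_gt0 h; apply: (mulIf (_ : (Kw nu)^-1 != 0)); first by rewrite invr_eq0 gt_eqF.
have K0 : Kw nu != 0 by rewrite gt_eqF.
rewrite (mulfK K0); have [le|/ltW le] := leP nu0 nu; rewrite -subr_ge0 in le.
  by move: (key nu0 (nu - nu0) h0 le); rewrite subrKC.
by move: (key nu (nu0 - nu) h le); rewrite subrKC => ->.
Qed.

End NormIntegral.

(** * Identification of the transform *)

Section SphericalLimit.
Context {R : realType} {r : nat}.
Variables (a b iota : R).
Hypotheses (a0 : 0 < a) (b0 : 0 < b) (i0 : 0 < iota) (r0 : (0 < r)%N).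
Local Notation gfun := (@gfun R r).
Local Notation fw := (@fw R r a b iota).
Local Notation rho1 := (@rho1 R r a b iota).
Local Notation Iw := (@Iw R r a b iota).
Local Notation Nw := (@Nw R r a b iota).
Local Notation qK := (@qK R r a b iota).
Local Notation rho j := (@rho_j R r a b iota j).
Implicit Types (t : r.-tuple R) (nu : R).

Lemma coshR_quad (x : R) : 1 + x ^+ 2 / 8 <= coshR x.
Proof.
have key (y : R) : 0 <= y -> 1 + y ^+ 2 / 8 <= coshR y.
  move=> y0; have y2 : 0 <= y / 2 by rewrite divr_ge0.
  have e1 := expR_ge1Dx (y / 2).
  have E1 : expR y = expR (y / 2) ^+ 2 by rewrite -expRM_natl; congr expR; field.
  have E2 : expR (- y) = (expR (y / 2))^-1 ^+ 2 by rewrite -expRN -expRM_natl; congr expR; field.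
  have e0 := expR_gt0 (y / 2).
  have v1 : (expR (y / 2))^-1 <= 1 by rewrite invf_le1 //; lra.
  have -> : coshR y = 1 + (expR (y / 2) - (expR (y / 2))^-1) ^+ 2 / 2.
    by rewrite /coshR E1 E2; field; rewrite gt_eqF.
  rewrite lerD2l (_ : y ^+ 2 / 8 = (y / 2) ^+ 2 / 2); last by field.
  apply: ler_wpM2r; first by rewrite invr_ge0.
  by rewrite ler_sqr ?nnegrE //; lra.
have [x0|x0] := leP 0 x; first exact: key.
by have := key (- x); rewrite sqrrN oppr_ge0 ltW // /coshR opprK [X in X / 2]addrC; apply.
Qed.

Lemma thp_sech t : thp true 0 t = \prod_i powR (coshR (tnth t i)) (- 2).
Proof. by apply: eq_bigr => i _; rewrite /thfac ltn0 mul1r sech_sqr. Qed.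

Lemma sech_le1 (x : R) : 0 <= powR (coshR x) (- 2) <= 1.
Proof.
rewrite powR_ge0 /= -[leRHS](powRr0 (coshR x)); apply: ler_powR; first exact: coshR_ge1.
lra.
Qed.

Lemma thp_le1 t : 0 <= thp true 0 t <= 1.
Proof.
rewrite thp_sech; apply/andP; split; first by apply: prodr_ge0 => i _; exact: powR_ge0.
rewrite -[leRHS](big1_eq (R := R) (op := *%R) (idx := 1) (index_enum 'I_r) xpredT) //.
by apply: ler_prod => i _; exact: sech_le1.
Qed.

Lemma thp_exp_le t : expR (2 * l1 t) * thp true 0 t <= 4 ^+ r.
Proof.
rewrite thp_sech /l1 mulr_sumr expR_sum -big_split /= -[in leRHS](card_ord r) -prodr_const.
apply: ler_prod => i _; rewrite mulr_ge0 ?powR_ge0 ?expR_ge0 //=.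
have H : powR (coshR (tnth t i)) (- 2) <= powR 2 2 * expR (- 2 * `|tnth t i|) by exact: powR_cosh_le.
apply: le_trans (ler_wpM2l (expR_ge0 _) H) _.
by rewrite mulrCA -expRD (_ : _ + _ = 0) ?expR0 ?mulr1 ?powR_mulrn //; [rewrite -natrX|ring].
Qed.

Lemma thp_far t (de : R) (k : 'I_r) : 0 < de -> de <= `|tnth t k| ->
  thp true 0 t <= (1 + de ^+ 2 / 8)^-1.
Proof.
move=> d0 dk; rewrite thp_sech (bigD1 k) //=.
have d2 : 0 <= de ^+ 2 / 8 by rewrite divr_ge0 // sqr_ge0.
apply: (@le_trans _ _ (powR (coshR (tnth t k)) (- 2) * 1)).
  apply: ler_wpM2l; first exact: powR_ge0.
  rewrite -[leRHS](big1_eq (R := R) (op := *%R) (idx := 1) (index_enum 'I_r) (fun i => i != k)) //.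
  by apply: ler_prod => i _; exact: sech_le1.
rewrite mulr1; apply: (@le_trans _ _ (powR (coshR (tnth t k)) (- 1))).
  by apply: ler_powR; [exact: coshR_ge1|lra].
rewrite powR_inv1; last by rewrite ltW // coshR_gt0.
rewrite lef_pV2 ?posrE ?coshR_gt0 //; last by lra.
apply: le_trans (coshR_quad _); rewrite lerD2l; apply: ler_wpM2r; first by rewrite invr_ge0.
by rewrite -[leRHS]real_normK ?num_real // ler_sqr ?nnegrE // ltW.
Qed.

(** The weight at [nu] is [thp true 0] times the weight at [nu - 1]. Away from the origin
    [1 - thp true 0] is bounded below, so the error made there is charged to it, and its integral is
    [Nw (nu - 1) - Nw nu]. *)
Lemma spherical_near (U : gfun) (u0 e : R) : 0 < e -> bnd 2 U ->
  (forall e, 0 < e -> exists2 de, 0 < de & forall t, regular t -> (forall k, `|tnth t k| < de) -> `|U t - u0| <= e) ->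
  exists2 K, 0 <= K & forall nu, rho1 + 1 < nu ->
    `|Iw nu U - u0 * Nw nu| <= e * Nw nu + K * (Nw (nu - 1) - Nw nu).
Proof.
move=> e0 BU /(_ e e0)[de d0 Hde]; have [C C0 HC] := BU.
(* [ka] bounds [1 - thp true 0] below outside the box of radius [de] ([thp_far]), and [M] bounds
   [|U - u0| * thp true 0] everywhere, because [thp true 0] decays like [e^(-2 l1)]. *)
pose ka : R := 1 - (1 + de ^+ 2 / 8)^-1; pose M : R := C * 4 ^+ r + `|u0|.
have M0 : 0 <= M by rewrite addr_ge0 // mulr_ge0 // exprn_ge0.
have d2 : 0 < de ^+ 2 / 8 by rewrite divr_gt0 // exprn_gt0.
have k0 : 0 < ka by rewrite subr_gt0 invf_lt1; lra.
exists (M / ka) => [|nu h]; first by rewrite divr_ge0 // ltW.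
have pw t : regular t -> `|U t - u0| * thp true 0 t <= e * thp true 0 t + M / ka * (1 - thp true 0 t).
  move=> rt; have /andP[T0 T1] := thp_le1 t.
  have Mk : 0 <= M / ka by rewrite divr_ge0 // ltW.
  case: (pselect (forall k, `|tnth t k| < de)) => [near|/existsNP[k /negP]]; last rewrite -leNgt => far.
    have := ler_wpM2r T0 (Hde t rt near); have : 0 <= M / ka * (1 - thp true 0 t) by rewrite mulr_ge0 // subr_ge0.
    move: (M / ka * _) => X; lra.
  have TF : ka <= 1 - thp true 0 t by rewrite lerD2l lerN2 (thp_far d0 far).
  apply: (@le_trans _ _ M).
    apply: le_trans (ler_wpM2r T0 (ler_normB _ _)) _; rewrite mulrDl; apply: lerD.
      apply: le_trans (ler_wpM2r T0 (HC t rt)) _; rewrite -mulrA; apply: ler_wpM2l => //; exact: thp_exp_le.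
    by rewrite ler_piMr.
  apply: ler_wpDl; first by rewrite mulr_ge0 // ltW.
  by rewrite mulrAC ler_pdivlMr // ler_wpM2l.
have nu1 : rho1 < nu - 1 by rewrite ltrBrDr.
have nu0 : rho1 < nu by apply: lt_trans h; rewrite ltrDl.
have fs t : fw nu t = thp true 0 t * fw (nu - 1) t by rewrite -fw_shift subrK.
have I1 := integrable_one a0 b0 i0 r0 nu1; have I2 := integrable_one a0 b0 i0 r0 nu0.
have ep : 2 < 2 * (nu - rho1) by lra.
have IU := bnd_integrable a0 b0 i0 (Ordinal r0) (ler0n R 2) ep BU (measurable_gfun U).
have E : Iw nu U - u0 * Nw nu = fine (\int[leb r]_t ((U t - u0) * fw nu t)%:E)%E.
  have Iu := integrableZl measurableT u0 I2.
  rewrite (_ : (fun t : TT r => _) = (fun t => ((U t * fw nu t)%:E - u0%:E * (1 * fw nu t)%:E)%E)); last first.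
    by apply/funext => t; rewrite mulrBl EFinB mul1r EFinM.
  rewrite (integralB measurableT IU Iu) (integralZl measurableT I2) fineB ?fineM ?(integrable_fin_num _ I2) //.
    exact: integrable_fin_num IU.
  by apply: fin_numM => //; exact: integrable_fin_num I2.
pose K := M / ka.
pose rhs t := e * (1 * fw nu t) + (K * (1 * fw (nu - 1) t) + - K * (1 * fw nu t)).
have Ir : (leb r).-integrable setT (fun t : TT r => (rhs t)%:E).
  have J1 := integrableZl measurableT e I2; have J2 := integrableZl measurableT K I1; have J3 := integrableZl measurableT (- K) I2.
  by apply: eq_integrable (integrableD measurableT J1 (integrableD measurableT J2 J3)) => // t _; rewrite /rhs !EFinD !EFinM.
have Er : fine (\int[leb r]_t (rhs t)%:E)%E = e * Nw nu + K * (Nw (nu - 1) - Nw nu).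
  have J1 := integrableZl measurableT e I2; have J2 := integrableZl measurableT K I1; have J3 := integrableZl measurableT (- K) I2.
  rewrite (_ : (fun t : TT r => _) = (fun t => (e%:E * (1 * fw nu t)%:E + (K%:E * (1 * fw (nu - 1) t)%:E + (- K)%:E * (1 * fw nu t)%:E))%E)); last first.
    by apply/funext => t; rewrite /rhs !EFinD !EFinM.
  rewrite (integralD measurableT J1 (integrableD measurableT J2 J3)) (integralD measurableT J2 J3).
  have EA : (\int[leb r]_t (1 * fw nu t)%:E = (Nw nu)%:E)%E by rewrite fineK // (integrable_fin_num _ I2).
  have EB : (\int[leb r]_t (1 * fw (nu - 1) t)%:E = (Nw (nu - 1))%:E)%E by rewrite fineK // (integrable_fin_num _ I1).
  rewrite (integralZl measurableT I2 e) (integralZl measurableT I1 K) (integralZl measurableT I2 (- K)) EA EB.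
  by rewrite -!EFinM -!EFinD /=; ring.
have Id : (leb r).-integrable setT (fun t : TT r => ((U t - u0) * fw nu t)%:E).
  have Iu := integrableZl measurableT u0 I2.
  by apply: eq_integrable (integrableB measurableT IU Iu) => // t _; rewrite mulrBl EFinB mul1r EFinM.
rewrite E -Er -[X in X <= _]/(fine (`|_|%:E)) -fine_abse //=; last exact: integrable_fin_num Id.
have Fi : (\int[leb r]_t `|((U t - u0) * fw nu t)%:E|)%E \is a fin_num.
  by apply: integrable_fin_num => //; exact: integrable_abse.
rewrite fine_le ?abse_fin_num ?(integrable_fin_num _ Id) ?(integrable_fin_num _ Ir) //.
apply: le_trans (le_abse_integral _ measurableT (measurable_int _ Id)) _.
have mrhs := measurable_int _ Ir.
apply: ge0_le_integral => //.
- by apply: measurableT_comp => //; exact: measurable_int Id.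
- move=> t _; rewrite abse_EFin lee_fin normrM (ger0_norm (fw_ge0 _ _ _ _ _)).
  case: (pselect (regular t)) => [rt|nr]; last by rewrite /rhs !fw_nonreg // !mulr0 !addr0.
  have := ler_wpM2r (fw_ge0 a b iota (nu - 1) t) (pw t rt).
  by rewrite /rhs !fs /K; move: (M / ka) (fw _ _) (`|_|) (thp _ _ _) => X Y Z T; lra.
Qed.

(** The expected transform divided by the norm integral at [lam = i y], with conjugate Gamma factors
    merged into [gam_sqr]. *)
Definition Gw (y : 'I_r -> R) nu : R := \prod_j (gam_sqr (nu - rho1 / 2) (y j / 2) /
  (gam (nu - rho1 / 2 + rho j / 2) * gam (nu - rho1 / 2 - rho j / 2))).

Lemma Gw_arg_gt0 nu (j : 'I_r) : rho1 < nu ->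
  [/\ 0 < nu - rho1 / 2, 0 < nu - rho1 / 2 + rho j / 2 & 0 < nu - rho1 / 2 - rho j / 2].
Proof.
move=> h; have /andP[h1 h2] := rho_bounds a0 b0 i0 r0 j.
by move: (rho j) (rho1) h h1 h2 => u v h h1 h2; split; lra.
Qed.

Lemma Gw_rec y nu : rho1 < nu ->
  Gw y (nu + 1) * (qK nu * @shift_factor R r a iota nu) =
  Gw y nu * \prod_j ((2 * nu - rho1) ^+ 2 - - y j ^+ 2).
Proof.
move=> h; rewrite -(qKE a0 b0 i0 r0 h) -!big_split /=; apply: eq_bigr => j _.
have [h1 h2 h3] := Gw_arg_gt0 j h.
have g2 := gam_gt0 h2; have g3 := gam_gt0 h3.
rewrite (_ : nu + 1 - rho1 / 2 = nu - rho1 / 2 + 1); last by ring.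
rewrite (_ : nu - rho1 / 2 + 1 + rho j / 2 = nu - rho1 / 2 + rho j / 2 + 1); last by ring.
rewrite (_ : nu - rho1 / 2 + 1 - rho j / 2 = nu - rho1 / 2 - rho j / 2 + 1); last by ring.
rewrite (gam_sqr_rec _ h1) (gam_rec h2) (gam_rec h3).
have -> : 2 * nu - rho1 = 2 * (nu - rho1 / 2) by field.
move: (gam (_ + _)) (gam (_ - _)) g2 g3 => u v u0 v0.
move: (gam_sqr (nu - rho1 / 2) (y j / 2)) (rho j) (nu - rho1 / 2) h1 h2 h3 => A B C h1 h2 h3.
have -> : (2 * C) ^+ 2 - B ^+ 2 = 4 * ((C + B / 2) * (C - B / 2)) by field.
move: (C + B / 2) (C - B / 2) h2 h3 => p q p0 q0.
by field; rewrite (gt_eqF u0) (gt_eqF v0) (gt_eqF p0) (gt_eqF q0).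
Qed.

Lemma Gw_gt0 y nu : rho1 < nu -> 0 < Gw y nu.
Proof.
move=> h; apply: prodr_gt0 => j _; have [h1 h2 h3] := Gw_arg_gt0 j h.
by apply: divr_gt0; [exact: gam_sqr_gt0|apply: mulr_gt0; exact: gam_gt0].
Qed.

Lemma cvg_Gw y : Gw y x @[x --> +oo%R] --> (1 : R).
Proof.
apply: cvg1_prod => j _.
have s0 : 0 <= rho j / 2 by have /andP[h1 _] := rho_bounds a0 b0 i0 r0 j; rewrite divr_ge0 // ltW.
exact: cvg_translate (- (rho1 / 2)) (gam_sqr_cvg (y j / 2) s0).
Qed.

Hypothesis Npos : forall nu, rho1 < nu -> 0 < Nw nu.
Variables (U : gfun) (u0 : R) (y : 'I_r -> R).
Hypothesis U_eigen : forall c2, shiftop a b iota c2 U (enum 'I_r) = (\prod_(k < r) (c2 - - y k ^+ 2)) *: U.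
Hypothesis U_tempered : forall eps, 0 < eps -> tempered a b iota eps U.
Hypothesis U_near : forall e, 0 < e -> exists2 de, 0 < de &
  forall t, regular t -> (forall k, `|tnth t k| < de) -> `|U t - u0| <= e.

Lemma mean_dist_le (I u N N' q K e : R) : 0 < N -> N' = q * N ->
  `|I - u * N| <= e / 2 * N + K * (N' - N) -> `|0 - K * (q - 1)| <= e / 2 -> `|u - I / N| <= e.
Proof.
move=> N0 -> H1; rewrite sub0r normrN => H2.
have -> : u - I / N = (u * N - I) / N by rewrite mulrBl mulfK // gt_eqF.
rewrite normrM normfV (gtr0_norm N0) ler_pdivrMr // distrC; apply: le_trans H1 _.
have -> : e / 2 * N + K * (q * N - N) = (e / 2 + K * (q - 1)) * N by ring.
by rewrite ler_pM2r //; have := le_trans (ler_norm _) H2; lra.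
Qed.

(** By [Nw_rec] the ratio [Nw (x - 1) / Nw x] tends to 1, so the second error term of
    [spherical_near] is negligible against [Nw x]. *)
Lemma cvg_mean : Iw x U / Nw x @[x --> +oo%R] --> u0.
Proof.
apply/cvgrPdist_le => e e0.
have e2 : 0 < e / 2 by rewrite divr_gt0.
have [K K0 HK] := spherical_near e2 (tempered_bnd (U_tempered (ltr0n R 2))) U_near.
have cq : (qK (x - 1))^-1 @[x --> +oo%R] --> (1 : R).
  by apply: (cvg1V (f := fun x => qK (x - 1))); exact: cvg_translate (- 1) (cvg_qK a b iota).
have cK : K * ((qK (x - 1))^-1 - 1) @[x --> +oo%R] --> (0 : R).
  rewrite -(mulr0 K); apply: cvgM; first exact: cvg_cst.
  by rewrite -(subrr (1 : R)); apply: cvgB cq _; exact: cvg_cst.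
have /cvgrPdist_le/(_ _ e2) HK0 := cK; near=> x.
have h : rho1 + 1 < x by near: x; apply: nbhs_pinfty_gt; exact: num_real.
have h1 : rho1 < x - 1 by rewrite ltrBrDr.
have h0 : rho1 < x by apply: lt_trans h; rewrite ltrDl.
have N0 := Npos h0; have N1 := Npos h1.
have E : Nw x = qK (x - 1) * Nw (x - 1) by rewrite -(Nw_rec a0 b0 i0 r0 h1) subrK.
have q0 : qK (x - 1) != 0 by apply: contraTneq N0 => q0; rewrite E q0 mul0r ltxx.
have H1 := HK x h.
have H2 : `|0 - K * ((qK (x - 1))^-1 - 1)| <= e / 2 by near: x; exact: HK0.
have E2 : Nw (x - 1) = (qK (x - 1))^-1 * Nw x by rewrite E mulKf.
exact: mean_dist_le N0 E2 H1 H2.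
Unshelve. all: end_near. Qed.

(** Dividing by [Nw] and [Gw] cancels the recursion: the quotient has period 1 and tends to [u0],
    hence equals [u0]. *)
Lemma Iw_spherical nu : rho1 < nu -> Iw nu U = u0 * Nw nu * Gw y nu.
Proof.
move=> h; pose g x := Iw x U / Nw x * (Gw y x)^-1.
have per x : rho1 < x -> g (x + 1) = g x.
  move=> hx; have N0 := Npos hx; have G0 := Gw_gt0 y hx.
  have h1 : rho1 < x + 1 by apply: lt_trans hx _; rewrite ltrDl.
  have N1 := Npos h1; have G1 := Gw_gt0 y h1; have s0 := shift_factor_gt0 a0 b0 i0 r0 hx.
  have eN := Nw_rec a0 b0 i0 r0 hx; have eG := Gw_rec y hx.
  have e0 : 0 < x - rho1 by rewrite subr_gt0.
  have ep : x - rho1 < 2 * (x - rho1) by rewrite mulr_natl mulr2n ltrDl.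
  have eI := Iw_shift_eigen a0 b0 i0 r0 (ltW e0) ep (U_tempered e0) U_eigen.
  rewrite /g; rewrite eN in N1 *.
  move: (Iw (x + 1) U) (Iw x U) (Nw x) (Gw y (x + 1)) (Gw y x) (qK x) (@shift_factor R r a iota x) (\prod_(_ < _) _)
     N0 G0 N1 G1 s0 eG eI => I' I N G' G q s P N0 G0 N1 G1 s0 eG eI.
  have q0 : q != 0 by apply: contraTneq N1 => ->; rewrite mul0r ltxx.
  have -> : I' = P * I / s by rewrite eI mulrAC mulfV ?mul1r // gt_eqF.
  have -> : G' = G * P / (q * s) by rewrite -eG mulfK // mulf_neq0 // gt_eqF.
  have P0 : P != 0.
    apply: contraTneq G1 => P0; move: eG; rewrite P0 mulr0 => /eqP.
    by rewrite !mulf_eq0 (negbTE q0) (gt_eqF s0) !orbF => /eqP ->; rewrite ltxx.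
  by field; rewrite (gt_eqF N0) (gt_eqF G0) (gt_eqF s0) q0 P0.
have cg : g x @[x --> +oo%R] --> u0.
  rewrite -[u0]mulr1; apply: cvgM; first exact: cvg_mean.
  by apply: cvg1V; exact: cvg_Gw.
have := periodic_cvg per cg h; rewrite /g => <-.
have N0 := Npos h; have G0 := Gw_gt0 y h.
move: (Iw nu U) (Nw nu) (Gw y nu) N0 G0 => x n k n0 k0.
by field; rewrite (gt_eqF n0) (gt_eqF k0).
Qed.

End SphericalLimit.

(** * Exponential integrals and right-continuity of Gamma *)

Section ExponentialIntegrals.
Context {R : realType}.
Local Notation mu := (@lebesgue_measure R).

Lemma int_expR_half (k : R) : 0 < k -> (\int[mu]_(x in `[0%R, +oo[) (expR (- k * x))%:E = (k^-1)%:E)%E.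
Proof.
move=> k0; have k0E : (0 <= k%:E)%E by rewrite lee_fin ltW.
have mE : measurable_fun (`[0%R, +oo[%classic : set R) (fun x : R => (expR (- k * x))%:E).
  apply/measurable_EFinP; apply: measurable_funTS; apply: continuous_measurable_fun => x.
  exact: is_derive_cont (is_derive_explin1 (- k) x).
have := integral_exponential_pdf k0.
rewrite (_ : (fun x => _) = (EFin \o (fun x => k * expR (- k * x))) \_ `[0, +oo[); last by rewrite restrict_EFin.
rewrite -integral_mkcond (_ : EFin \o _ = (fun x => (k%:E * (expR (- k * x))%:E)%E)) //.
rewrite ge0_integralZl //; move: (\int[mu]_(_ in _) _)%E => -[z| |] //=.
- by move=> [kz]; congr EFin; apply: (mulfI (lt0r_neq0 k0)); rewrite divff // lt0r_neq0.
- by rewrite gt0_muley // lte_fin.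
- by rewrite gt0_muleNy // lte_fin.
Qed.

Lemma int_expR_abs (k : R) : 0 < k -> (\int[mu]_x (expR (- k * `|x|))%:E = (2 / k)%:E)%E.
Proof.
move=> k0; rewrite ge0_symfun_integralT; last 3 first.
- by move=> x; exact: expR_ge0.
- move=> x; apply: (@continuous_comp _ _ _ (fun x : R => - k * `|x|) (@expR R)); last exact: continuous_expR.
  by apply: cvgM; [exact: cvg_cst|exact: norm_continuous].
- by move=> x /=; rewrite normrN.
have -> : [set x : R | 0 <= x] = `[0, +oo[%classic by apply/seteqP; split=> x /=; rewrite in_itv /= andbT.
rewrite EFinM -(int_expR_half k0); congr (_ * _)%E; apply: eq_integral => x.
by rewrite inE /= in_itv /= andbT => x0; rewrite ger0_norm.
Qed.

Lemma gam_1 : gam 1 = 1 :> R.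
Proof.
rewrite /gam /Jg /Rintegral -[RHS]/(fine 1%E); congr fine.
have := int_expR_half (ltr01 : 0 < 1 :> R); rewrite invr1 -integral_itv_obnd_cbnd.
  by move=> <-; apply: eq_integral => x _; rewrite /gw /cst mul1r subrr mul0r sub0r mulN1r.
apply/measurable_EFinP; apply: measurable_funTS; apply: continuous_measurable_fun => x.
exact: is_derive_cont (is_derive_explin1 (- 1) x).
Qed.

(* Log-convexity squeezes [(f (x + 1 / k) / f x) ^ k] between [f x / f (x - 1)] and [f (x + 1) / f x]. *)
Lemma logconvex_cvg (f : R -> R) (x : R) : (forall x : R, 0 < x -> 0 < f x) ->
  (forall x : R, 0 < x -> f (x + 1) = x * f x) ->
  (forall x y c : R, 0 < y -> y <= x -> 0 <= c -> f x * f (y + c) <= f (x + c) * f y) ->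
  0 < x -> f (x + k.+1%:R^-1) @[k --> \oo] --> f x.
Proof.
move=> f0 fr fc.
have big (z : R) : 1 < z -> f (z + k.+1%:R^-1) @[k --> \oo] --> f z.
  move=> z1; have z0 : 0 < z by lra.
  have gz := f0 z z0.
  have aux (A B C D : R) : 0 < D -> A * B <= C * D -> B / D * (A / D) <= C / D.
    move=> D0 H; rewrite mulf_div ler_pdivrMr ?mulr_gt0 // mulrA divfK ?gt_eqF //.
    by rewrite (mulrC B).
  have step (c : R) i : 0 <= c -> (f (z + c) / f z) ^+ i <= f (z + i%:R * c) / f z.
    move=> c0; elim: i => [|i IH]; first by rewrite mul0r addr0 divff ?gt_eqF.
    have zi : 0 < z + i%:R * c by rewrite ltr_wpDr // mulr_ge0.
    rewrite exprS; apply: (@le_trans _ _ ((f (z + c) / f z) * (f (z + i%:R * c) / f z))).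
      by apply: (ler_wpM2l _ IH); rewrite divr_ge0 // ltW // f0 // ltr_wpDr.
    have C : f (z + i%:R * c) * f (z + c) <= f (z + i%:R * c + c) * f z.
      by apply: fc => //; rewrite lerDl mulr_ge0.
    rewrite (_ : z + i.+1%:R * c = z + i%:R * c + c); last by rewrite -natr1; ring.
    exact: aux.
  have step' (c : R) i : 0 <= c -> z - 1 = f z / f (z - 1) -> i%:R * c = 1 -> z - 1 <= (f (z + c) / f z) ^+ i.
    move=> c0 E ic; rewrite E.
    have H m : (m <= i)%N -> f (z - 1 + m%:R * c) / f (z - 1) <= (f (z + c) / f z) ^+ m.
      elim: m => [|m IH] mi; first by rewrite mul0r addr0 divff // gt_eqF // f0; lra.
      have zm : 0 < z - 1 + m%:R * c by rewrite ltr_wpDr ?mulr_ge0 // subr_gt0.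
      have le : z - 1 + m%:R * c <= z.
        have : m%:R * c <= i%:R * c by apply: ler_wpM2r => //; rewrite ler_nat ltnW.
        by rewrite ic; lra.
      have C : f z * f (z - 1 + m%:R * c + c) <= f (z + c) * f (z - 1 + m%:R * c) by exact: fc.
      rewrite (_ : z - 1 + m.+1%:R * c = z - 1 + m%:R * c + c); last by rewrite -natr1; ring.
      rewrite exprS; apply: le_trans (ler_wpM2l _ (IH (ltnW mi))); last first.
        by rewrite divr_ge0 // ltW // f0 // ltr_wpDr.
      have g1 : 0 < f (z - 1) by rewrite f0 // subr_gt0.
      rewrite mulrA ler_pM2r ?invr_gt0 // mulrAC ler_pdivlMr //.
      by rewrite mulrC.
    by have := H i (leqnn i); rewrite ic subrK.
  pose M : R := `|ln (z - 1)| + `|ln z|.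
  pose ph k : R := f (z + k.+1%:R^-1) / f z.
  have ph0 k : 0 < ph k by rewrite divr_gt0 // f0 // ltr_wpDr.
  have Hb k : z - 1 <= ph k ^+ k.+1 <= z.
    have k0 : k.+1%:R != 0 :> R by [].
    have kc : k.+1%:R * k.+1%:R^-1 = 1 :> R by rewrite divff.
    have E : z - 1 = f z / f (z - 1).
      have z1' : 0 < z - 1 by lra.
      by have := fr _ z1'; rewrite subrK => ->; rewrite mulfK // gt_eqF // f0.
    apply/andP; split; first by apply: step' => //; rewrite invr_ge0.
    have c0 : 0 <= k.+1%:R^-1 :> R by rewrite invr_ge0.
    by apply: le_trans (step _ k.+1 c0) _; rewrite kc fr // mulfK // gt_eqF.
  have lnb k : `|ln (ph k)| <= M * k.+1%:R^-1.
    have /andP[h1 h2] := Hb k; have z1' : 0 < z - 1 by lra.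
    have p0 : 0 < ph k ^+ k.+1 by rewrite exprn_gt0.
    have l1' : ln (z - 1) <= ln (ph k ^+ k.+1) by rewrite ler_ln ?posrE.
    have l2' : ln (ph k ^+ k.+1) <= ln z by rewrite ler_ln ?posrE.
    rewrite lnXn // in l1' l2'; rewrite ler_pdivlMr // -[X in _ * X]ger0_norm // -normrM mulr_natr.
    have h3 := ler_norm (ln z); have h4 := ler_norm (- ln (z - 1)); rewrite normrN in h4.
    have h5 := normr_ge0 (ln z); have h6 := normr_ge0 (ln (z - 1)).
    by rewrite /M ler_norml; apply/andP; split; lra.
  have ln0 : ln (ph k) @[k --> \oo] --> (0 : R).
    apply: (cvg0_le lnb); rewrite -(mulr0 M); apply: cvgM; [exact: cvg_cst|exact: cvg_harmonic].
  have : expR (ln (ph k)) * f z @[k --> \oo] --> expR 0 * f z.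
    by apply: cvgM; [apply: continuous_cvg => //; exact: continuous_expR|exact: cvg_cst].
  rewrite expR0 mul1r; apply: cvg_trans; apply: near_eq_cvg; near=> k.
  by rewrite lnK ?posrE // /ph divfK // gt_eqF.
(* The squeeze needs [x - 1 > 0]; arguments up to 1 are reached from [x + 1] by the recursion. *)
move=> x0; have x1 : 1 < x + 1 by rewrite ltrDr.
have H : f (x + 1 + k.+1%:R^-1) / (x + k.+1%:R^-1) @[k --> \oo] --> f (x + 1) / (x + 0).
  apply: cvgM; first exact: big.
  apply: cvgV; first by rewrite addr0 gt_eqF.
  by apply: cvgD; [exact: cvg_cst|exact: cvg_harmonic].
move: H; rewrite addr0 fr // mulrAC mulfV ?mul1r ?gt_eqF //.
apply: cvg_trans; apply: near_eq_cvg; near=> k.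
have xk : 0 < x + k.+1%:R^-1 by rewrite ltr_wpDr.
by rewrite addrAC fr // mulrAC mulfV ?mul1r // gt_eqF.
Unshelve. all: end_near. Qed.

Lemma gam_cvg (x : R) : 0 < x -> gam (x + k.+1%:R^-1) @[k --> \oo] --> gam x.
Proof. exact: (logconvex_cvg (@gam_gt0 R) (@gam_rec R) (@gam_convex R)). Qed.

(** Bernoulli's inequality for the integer [m], which bounds the real exponent [p] from above. *)
Lemma bernoulli_powR (p x : R) m : 0 < p -> p <= m%:R -> 0 <= x -> x <= 1 -> 1 - m%:R * x <= powR (1 - x) p <= 1.
Proof.
move=> p0 pm x0 x1.
have B k : 1 - k%:R * x <= (1 - x) ^+ k.
  elim: k => [|k IH]; first by rewrite mul0r subr0.
  rewrite exprS -natr1; have y0 : 0 <= 1 - x by rewrite subr_ge0.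
  have := ler_wpM2l y0 IH; have : 0 <= k%:R * x * x by rewrite !mulr_ge0.
  move: (_ ^+ k) => z; lra.
have [->|xn] := eqVneq x 1.
  rewrite subrr powR0 ?gt_eqF // mulr1 ler01 andbT subr_le0.
  rewrite ler1n lt0n; apply/eqP => m0; move: pm; rewrite m0; lra.
have y0 : 0 < 1 - x by rewrite subr_gt0 lt_neqAle xn.
have y1 : 0 < 1 - x <= 1 by rewrite y0 gerBl.
apply/andP; split; last by rewrite -[leRHS](powRr0 (1 - x)); apply: ger_powR => //; exact: ltW.
apply: le_trans (B m) _; rewrite -powR_mulrn ?(ltW y0) //; exact: ger_powR.
Qed.

End ExponentialIntegrals.

(** * Splitting off a dominant coordinate *)

Section RankRecursion.
Context {R : realType} {n : nat}.
Variables (a b iota : R).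
Hypotheses (a0 : 0 < a) (b0 : 0 < b) (i0 : 0 < iota).
Local Notation rho1 := (@rho1 R n.+1 a b iota).
Implicit Types (t : TT (R:=R) n.+1) (s : TT (R:=R) n) (x y nu eta : R).

Lemma coshR_le x y : `|x| <= `|y| -> coshR x <= coshR y.
Proof.
have N (u : R) : coshR u = coshR `|u|.
  by have [u0|u0] := leP 0 u; [rewrite ger0_norm|rewrite ltr0_norm // /coshR opprK addrC].
rewrite (N x) (N y) => h; rewrite /coshR; apply: ler_wpM2r => //.
have e1 : 1 <= expR `|x| by rewrite -expR0 ler_expR.
have e2 : expR `|x| <= expR `|y| by rewrite ler_expR.
rewrite !expRN; move: (expR `|x|) (expR `|y|) e1 e2 => u v u1 uv.
have u0 : 0 < u by lra.
have v0 : 0 < v by lra.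
rewrite -subr_ge0 (_ : _ - _ = (v - u) * (1 - (u * v)^-1)); last by field; rewrite !gt_eqF.
apply: mulr_ge0; rewrite subr_ge0 // invf_le1 ?mulr_gt0 //.
by rewrite -[leLHS]mulr1 ler_pM //; lra.
Qed.

(** The two differences of exponentials multiply to [4 * (cosh x ^ 2 - cosh y ^ 2)], which isolates
    the leading factor when [x] dominates. *)
Lemma w2E x y : `|y| <= `|x| ->
  w2 a x y = powR (2 * coshR x) (2 * a) * powR (1 - (coshR y / coshR x) ^+ 2) a.
Proof.
move=> /coshR_le cyx; have c0 := coshR_gt0 x; have d0 := coshR_gt0 y.
have q1 : (coshR y / coshR x) ^+ 2 <= 1.
  have q0 : 0 <= coshR y / coshR x by rewrite divr_ge0 // ltW.
  by rewrite expr_le1 // ler_pdivrMr // mul1r.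
rewrite powRrM powR_mulrn; last by rewrite mulr_ge0 // ltW.
rewrite /w2 -!powRM ?sh_ge0 ?subr_ge0 ?sqr_ge0 //; congr (powR _ a).
rewrite !shE -normrM.
have -> : (expR (x - y) - expR (- (x - y))) * (expR (x + y) - expR (- (x + y))) = 4 * (coshR x ^+ 2 - coshR y ^+ 2).
  rewrite /coshR opprB !opprD !expRD.
  have hx : expR x * expR (- x) = 1 by rewrite -expRD subrr expR0.
  have hy : expR y * expR (- y) = 1 by rewrite -expRD subrr expR0.
  move: (expR x) (expR (- x)) (expR y) (expR (- y)) hx hy => u u' v v' hu hv.
  transitivity (u ^+ 2 * (v * v') - v' ^+ 2 * (u * u') - v ^+ 2 * (u * u') + u' ^+ 2 * (v * v')); first by ring.
  rewrite hu hv; transitivity (u ^+ 2 + 2 * (u * u') + u' ^+ 2 - (v ^+ 2 + 2 * (v * v') + v' ^+ 2)); last by field.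
  by rewrite hu hv; ring.
rewrite ger0_norm; first by field; rewrite gt_eqF.
by rewrite mulr_ge0 // subr_ge0 ler_sqr ?nnegrE // ltW.
Qed.

Lemma w1E x : w1 b iota x = powR (2 * coshR x) (2 * b + 2 * iota) * powR (1 - (coshR x)^-1 ^+ 2) (b + iota / 2).
Proof.
have c0 := coshR_gt0 x; have c2 : 0 < 2 * coshR x by rewrite mulr_gt0.
have v1 : 0 <= 1 - (coshR x)^-1 ^+ 2.
  have q0 : 0 <= (coshR x)^-1 by rewrite invr_ge0 ltW.
  by rewrite subr_ge0 expr_le1 // invf_le1 //; exact: coshR_ge1.
have s2 : sh x ^+ 2 = (2 * coshR x) ^+ 2 * (1 - (coshR x)^-1 ^+ 2).
  rewrite shE real_normK ?num_real //.
  have hx : expR x * expR (- x) = 1 by rewrite -expRD subrr expR0.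
  transitivity ((2 * coshR x) ^+ 2 - 4); last by field; rewrite gt_eqF.
  rewrite /coshR; move: (expR x) (expR (- x)) hx => u v h.
  by transitivity ((u + v) ^+ 2 - 4 * (u * v)); [ring|rewrite h; field].
have sd : sh (2 * x) = sh x * (2 * coshR x).
  rewrite -[2 * coshR x](gtr0_norm c2) !shE -normrM; congr `|_|.
  rewrite (_ : 2 * x = x + x); last by ring.
  by rewrite opprD !expRD /coshR; field.
have dbl (z p : R) : 0 <= z -> powR z (2 * p) = powR (z ^+ 2) p by move=> z0; rewrite powRrM powR_mulrn.
have A (p : R) : powR (sh x) (2 * p) = powR (2 * coshR x) (2 * p) * powR (1 - (coshR x)^-1 ^+ 2) p.
  by rewrite dbl ?sh_ge0 // s2 powRM ?sqr_ge0 // -dbl // ltW.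
have A2 := A (iota / 2); rewrite (_ : 2 * (iota / 2) = iota) in A2; last by field.
rewrite /w1 sd powRM ?sh_ge0 ?(ltW c2) // A A2.
have E (p q : R) : powR (2 * coshR x) p * powR (2 * coshR x) q = powR (2 * coshR x) (p + q).
  by rewrite -powRD // (gt_eqF c2) implybT.
have F (p q : R) : 0 < p -> 0 < q -> powR (1 - (coshR x)^-1 ^+ 2) p * powR (1 - (coshR x)^-1 ^+ 2) q = powR (1 - (coshR x)^-1 ^+ 2) (p + q).
  by move=> p0 q0; rewrite -powRD // gt_eqF // addr_gt0.
have i2 : 0 < iota / 2 by rewrite divr_gt0.
rewrite -(F _ _ b0 i2) -E (_ : 2 * iota = iota + iota) -?E; last by ring.
by move: (powR _ _) (powR _ _) (powR _ _) (powR _ _) => p q u v; ring.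
Qed.

(** The ratio of the weight in rank [n + 1] at [(x, s)] to the weight in rank [n] at [s]. *)
Definition dfac nu x s : R := powR (coshR x) (- 2 * nu) * w1 b iota x * \prod_(i < n) w2 a x (tnth s i).

Lemma fw_ins0 nu x s : fw a b iota nu (ins ord0 (x, s)) = dfac nu x s * fw a b iota nu s.
Proof.
have E (i : 'I_n) : tnth (ins ord0 (x, s)) (lift ord0 i) = tnth s i by exact: tnth_ins_lift.
have E0 : tnth (ins ord0 (x, s)) ord0 = x by exact: tnth_ins.
have EF (G : R -> R) : \prod_(j < n.+1) G (tnth (ins ord0 (x, s)) j) = G x * \prod_(j < n) G (tnth s j).
  by rewrite big_ord_recl E0; congr (_ * _); apply: eq_bigr => j _; rewrite E.
have EP (G : R -> R -> R) : \prod_(j < n.+1) \prod_(k < n.+1 | (j < k)%N)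
      G (tnth (ins ord0 (x, s)) j) (tnth (ins ord0 (x, s)) k) =
    (\prod_(i < n) G x (tnth s i)) * \prod_(j < n) \prod_(k < n | (j < k)%N) G (tnth s j) (tnth s k).
  rewrite big_ord_recl; congr (_ * _).
    by rewrite big_mkcond big_ord_recl /= mul1r E0; apply: eq_bigr => i _; rewrite E.
  apply: eq_bigr => j _; rewrite big_mkcond big_ord_recl /= mul1r [RHS]big_mkcond.
  by apply: eq_bigr => k _; rewrite !E.
have aux (A B C D E' F : R) : A * B * (C * D * (E' * F)) = A * C * E' * (B * (D * F)) by ring.
rewrite !fwE /f_delta /mu_density (EF (fun z => powR (coshR z) (- 2 * nu))).
rewrite [X in _ * (X * _) = _](EF (fun z => powR `|2 * sinhR z| (2 * b) * powR `|2 * sinhR (2 * z)| iota)).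
rewrite (EP (fun z z' => powR `|2 * sinhR (z - z')| a * powR `|2 * sinhR (z + z')| a)).
rewrite /dfac -[w1 b iota x]/(powR `|2 * sinhR x| (2 * b) * powR `|2 * sinhR (2 * x)| iota).
rewrite -[X in _ = powR _ _ * _ * X * _]/(\prod_(i < n) (powR `|2 * sinhR (x - tnth s i)| a * powR `|2 * sinhR (x + tnth s i)| a)).
exact: aux.
Qed.

Definition domi x s : bool := [forall i, `|tnth s i| < `|x|].

(** What [dfac] retains beside a constant and a power of [cosh x]; it lies in [[0, 1]] and tends to
    1 when [x] grows with [s] fixed. *)
Definition thet x s : R := powR (1 - (coshR x)^-1 ^+ 2) (b + iota / 2) *
  \prod_(i < n) powR (1 - (coshR (tnth s i) / coshR x) ^+ 2) a.

Lemma dfacE eta x s : domi x s -> dfac (rho1 + eta) x s = powR (coshR x) (- 2 * eta) * powR 2 (2 * rho1) * thet x s.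
Proof.
move=> /forallP dom; rewrite /dfac /thet w1E.
under eq_bigr => i _ do rewrite (w2E (ltW (dom i))).
rewrite big_split /= prodr_const card_ord -[X in X * \prod_(_ < _) _]powR_mulrn ?powR_ge0 // -powRrM.
have c0 := coshR_gt0 x; have c2 : 0 < 2 * coshR x by rewrite mulr_gt0.
have E : powR (coshR x) (- 2 * (rho1 + eta)) * powR (2 * coshR x) (2 * b + 2 * iota) * powR (2 * coshR x) (2 * a * n%:R) =
    powR (coshR x) (- 2 * eta) * powR 2 (2 * rho1).
  rewrite -mulrA -powRD ?(gt_eqF c2) ?implybT //.
  rewrite (_ : 2 * b + 2 * iota + 2 * a * n%:R = 2 * rho1); last first.
    by rewrite -[rho1]/(iota + b + a * n%:R); ring.
  rewrite powRM ?(ltW c0) // mulrA mulrAC -powRD ?(gt_eqF c0) ?implybT //.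
  by congr (powR _ _ * _); ring.
rewrite -E; ring.
Qed.

Definition bernm : nat := (Num.truncn (a + b + iota)).+1.
(** [tht <= 1] lets a defect [(cosh y / cosh x) ^ 2] be bounded by the power [2 * tht] of the same
    ratio; [tht < a] keeps [rho1 - tht] above the convergence threshold [rho1 - a] of rank [n]. *)
Definition tht : R := Num.min 1 (a / 2).
Definition bernD : R := bernm%:R * n.+1%:R.

Lemma tht_bounds : 0 < tht /\ tht <= 1 /\ tht < a.
Proof.
rewrite /tht; split; first by rewrite lt_min ltr01 divr_gt0.
by split; [rewrite ge_min lexx|rewrite gt_min; apply/orP; right; have := a0; lra].
Qed.

Lemma bernm_ge : a <= bernm%:R /\ b + iota / 2 <= bernm%:R.
Proof.
have h : a + b + iota < bernm%:R by exact: truncnS_gt.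
by have A := a0; have B := b0; have I := i0; split; lra.
Qed.

(** Weierstrass' inequality [\prod (1 - u_i) >= 1 - \sum u_i]; when the sum exceeds 1 nonnegativity
    of the product is enough. *)
Lemma prod_lower (I : Type) (l : seq I) (F u : I -> R) : (forall i, 0 <= u i /\ 1 - u i <= F i <= 1) ->
  (forall i, 0 <= F i) -> 0 <= \prod_(i <- l) F i <= 1 /\ 1 - \sum_(i <- l) u i <= \prod_(i <- l) F i.
Proof.
move=> H F0; elim: l => [|i l [/andP[h1 h2] h3]]; first by rewrite !big_nil subr0 ler01 lexx.
rewrite !big_cons; have [u0 /andP[f1 f2]] := H i; have f0 := F0 i.
split; first by rewrite mulr_ge0 //= mulr_ile1.
have [le|lt] := leP (\sum_(j <- l) u j) 1.
  have S0 : 0 <= \sum_(j <- l) u j by apply: sumr_ge0 => j _; exact: (H j).1.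
  have := ler_wpM2l f0 h3; have : 0 <= (1 - F i) * \sum_(j <- l) u j by rewrite mulr_ge0 ?subr_ge0.
  by move: (\prod_(_ <- _) _) (\sum_(_ <- _) _) => P S; lra.
have := mulr_ge0 f0 h1; move: (\prod_(_ <- _) _) (\sum_(_ <- _) _) lt => P S; lra.
Qed.

Lemma thet_bounds x s : domi x s ->
  0 <= thet x s <= 1 /\ 1 - bernD * (powR (coshR x) (- 2 * tht) * \prod_(i < n) powR (coshR (tnth s i)) (2 * tht)) <= thet x s.
Proof.
move=> /forallP dom; have c0 := coshR_gt0 x; have c1 := coshR_ge1 x.
have [t0 [t1 ta]] := tht_bounds; have [ma mb] := bernm_ge.
have T2 : 0 <= 2 * tht by rewrite mulr_ge0 // ltW.
have T3 : 2 * tht <= 2 by rewrite ler_piMr.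
have p1 (z : R) : 1 <= powR (coshR z) (2 * tht) by rewrite -[leLHS](powRr0 (coshR z)); apply: ler_powR => //; exact: coshR_ge1.
set T := powR (coshR x) _ * _.
have pr (i : 'I_n) : powR (coshR (tnth s i)) (2 * tht) <= \prod_(i < n) powR (coshR (tnth s i)) (2 * tht).
  rewrite (bigD1 i) //= ler_peMr ?powR_ge0 //.
  by rewrite -[leLHS](big1_eq (R := R) (op := *%R) (idx := 1) (index_enum 'I_n) (fun j => j != i)) ler_prod // => j _; rewrite ler01 p1.
have prg : 1 <= \prod_(i < n) powR (coshR (tnth s i)) (2 * tht).
  by rewrite -[leLHS](big1_eq (R := R) (op := *%R) (idx := 1) (index_enum 'I_n) xpredT) ler_prod // => j _; rewrite ler01 p1.
have ci (q : R) : 0 < q -> powR (q / coshR x) (2 * tht) = powR (coshR x) (- 2 * tht) * powR q (2 * tht).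
  move=> q0; rewrite powRM ?invr_ge0 ?ltW // mulrC -powR_inv1 ?(ltW c0) // -powRrM; congr (powR _ _ * _); ring.
have low (q : R) : 0 < q -> q <= coshR x -> (q / coshR x) ^+ 2 <= powR (coshR x) (- 2 * tht) * powR q (2 * tht).
  move=> q0 qc; have q1 : 0 <= q / coshR x by rewrite divr_ge0 // ltW.
  rewrite -ci // -powR_mulrn //; apply: ger_powR => //.
  by rewrite divr_gt0 //= ler_pdivrMr // mul1r.
(* The [n + 1] factors of [thet] under one index: [None] for the factor of [x] alone, [Some i] for
   the pair with [s_i]. *)
pose Fo (o : option 'I_n) := if o is Some i then powR (1 - (coshR (tnth s i) / coshR x) ^+ 2) a
  else powR (1 - (coshR x)^-1 ^+ 2) (b + iota / 2).
pose uo (o : option 'I_n) := bernm%:R * (if o is Some i then (coshR (tnth s i) / coshR x) ^+ 2 else (coshR x)^-1 ^+ 2).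
have qb (q : R) : 0 < q -> q <= coshR x -> 0 <= (q / coshR x) ^+ 2 <= 1.
  move=> q0 qc; have q1 : 0 <= q / coshR x by rewrite divr_ge0 // ltW.
  by rewrite sqr_ge0 expr_le1 // ler_pdivrMr // mul1r.
have Hcosh i : coshR (tnth s i) <= coshR x by apply: coshR_le; exact: ltW (dom i).
have H o : 0 <= uo o /\ 1 - uo o <= Fo o <= 1.
  case: o => [i|] /=.
    have /andP[h1 h2] := qb _ (coshR_gt0 (tnth s i)) (Hcosh i).
    by split; [rewrite mulr_ge0|exact: bernoulli_powR].
  have /andP[h1 h2] := qb 1 ltr01 c1; rewrite mul1r in h1 h2.
  by split; [rewrite mulr_ge0|apply: bernoulli_powR => //; rewrite addr_gt0 // divr_gt0].
have F0 o : 0 <= Fo o by case: o => [i|]; exact: powR_ge0.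
pose l := None :: [seq Some i | i <- index_enum 'I_n].
have [B1 B2] := prod_lower l H F0.
have E : \prod_(o <- l) Fo o = thet x s by rewrite /l big_cons big_map.
rewrite E in B1 B2; split=> //; apply: le_trans B2; rewrite lerD2l lerN2.
have uT o : uo o <= bernm%:R * T.
  apply: ler_wpM2l => //; case: o => [i|].
    by apply: le_trans (low _ (coshR_gt0 _) (Hcosh i)) _; apply: ler_wpM2l; [exact: powR_ge0|exact: pr].
  have := low 1 ltr01 c1; rewrite mul1r powR1 mulr1 => /le_trans; apply.
  by rewrite ler_peMr // powR_ge0.
apply: (@le_trans _ _ (\sum_(o <- l) bernm%:R * T)); first exact: ler_sum.
rewrite /l big_cons big_map big_const_ord iter_addr_0 /bernD -natr1 -[_ *+ n]mulr_natr.
by rewrite le_eqVlt; apply/orP; left; apply/eqP; ring.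
Qed.

End RankRecursion.

(** * Comparison of the integrals in ranks [n + 1] and [n] *)

Section RankIntegrals.
Context {R : realType} {n : nat}.
Variables (a b iota : R).
Hypotheses (a0 : 0 < a) (b0 : 0 < b) (i0 : 0 < iota).
Local Notation mu := (@lebesgue_measure R).
Local Notation rho1 := (@rho1 R n.+1 a b iota).
Local Notation tht := (@tht R a).
Local Notation bernD := (@bernD R n a b iota).
Implicit Types (t : TT (R:=R) n.+1) (s : TT (R:=R) n) (x nu eta : R) (j : 'I_n.+1).

Definition domj j t : bool := [forall k, (k != j) ==> (`|tnth t k| < `|tnth t j|)].

Lemma domj_ins0 x s : domj ord0 (ins ord0 (x, s)) = domi x s.
Proof.
rewrite /domj /domi tnth_ins; apply/forallP/forallP => H k.
  by have := H (lift ord0 k); rewrite tnth_ins_lift eq_sym neq_lift.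
by case: (unliftP ord0 k) => [k' ->|->]; [apply/implyP => _; rewrite tnth_ins_lift; exact: H|rewrite eqxx].
Qed.

Lemma domj_s_ij j t : domj ord0 (s_ij ord0 j t) = domj j t.
Proof.
rewrite s_ijE -wt_gsw; set p := tperm ord0 j.
have T k : tnth (act (gsw ord0 j) t) k = tnth t (p k).
  by rewrite tactp_tnth /= ffunE mul1r.
have p0 : p ord0 = j by rewrite /p tpermL.
have pp k : p (p k) = k by rewrite /p tpermK.
rewrite /domj -/(act _ _) T p0; apply/forallP/forallP => H k.
  apply/implyP => kj; have := H (p k); rewrite T pp => /implyP; apply.
  by apply: contraNneq kj => pk; rewrite -p0 -pk pp.
apply/implyP => k0; rewrite T; have := H (p k) => /implyP; apply.
by apply: contraNneq k0 => pk; rewrite -(pp k) pk -p0 pp.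
Qed.

Lemma sum_domj t : regular t -> \sum_j (domj j t)%:R = 1 :> R.
Proof.
move=> rt; pose m := [arg max_(i > ord0 | true) `|tnth t i|]%O.
have Hm k : `|tnth t k| <= `|tnth t m| by rewrite /m; case: arg_maxP => // i _; exact.
have dm : domj m t.
  apply/forallP => k; apply/implyP => km; rewrite lt_neqAle Hm andbT.
  have [h1 h2] := rt.2 k m km.
  by rewrite -[tnth t k]/(tnth t k) eqr_norm2 negb_or h1 h2.
rewrite (bigD1 m) //= dm big1 ?addr0 // => k km.
rewrite (_ : domj k t = false) //; apply/negP => /forallP /(_ m); rewrite eq_sym km /= ltNge.
by rewrite Hm.
Qed.

Lemma measurable_domj j : measurable_fun setT (fun t : TT n.+1 => (domj j t)%:R : R).
Proof.
rewrite (_ : (fun t => _) = (fun t : TT n.+1 => \prod_(k < n.+1) (if (k == j) || (`|tnth t k| < `|tnth t j|) then 1 else 0 : R))).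
  apply: measurable_prod => k _; case: (k == j) => /=; first exact: measurable_cst.
  apply: measurable_fun_ifT => //; apply: measurable_fun_ltr; apply: measurableT_comp => //; exact: measurable_tnth.
apply/funext => t; have [d|] := boolP (domj j t).
  rewrite big1 // => k _; case: eqVneq => //= kj.
  by move/forallP: d => /(_ k); rewrite kj /= => ->.
rewrite /domj negb_forall => /existsP[k]; rewrite negb_imply => /andP[kj /negbTE h].
by rewrite (bigD1 k) //= (negbTE kj) h /= mul0r.
Qed.

Definition Jdom nu : \bar R := (\int[leb n.+1]_t ((domj ord0 t)%:R * fw a b iota nu t)%:E)%E.

Lemma measurable_domfw j nu : measurable_fun setT (fun t : TT n.+1 => ((domj j t)%:R * fw a b iota nu t)%:E).
Proof. by apply/measurable_EFinP; apply: measurable_funM; [exact: measurable_domj|exact: measurable_fw]. Qed.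

Lemma domfw_ge0 j nu t : (0 <= ((domj j t)%:R * fw a b iota nu t)%:E)%E.
Proof. by rewrite lee_fin mulr_ge0 // fw_ge0. Qed.

(** Off the walls exactly one coordinate is largest in absolute value, and the weight is invariant
    under permutations, so the [n + 1] regions contribute equally. *)
Lemma int_fw_dom nu : (\int[leb n.+1]_t (fw a b iota nu t)%:E = n.+1%:R%:E * Jdom nu)%E.
Proof.
transitivity (\int[leb n.+1]_t (\sum_(j < n.+1) ((domj j t)%:R * fw a b iota nu t)%:E))%E.
  apply: eq_integral => t _; rewrite sumEFin -mulr_suml.
  by case: (pselect (regular t)) => [/sum_domj ->|nr]; [rewrite mul1r|rewrite fw_nonreg // mulr0].
rewrite ge0_integral_sum //; last 2 first.
- by move=> j; exact: measurable_domfw.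
- by move=> j t _; exact: domfw_ge0.
have E j : (\int[leb n.+1]_t ((domj j t)%:R * fw a b iota nu t)%:E = Jdom nu)%E.
  have [<-|j0] := eqVneq ord0 j; first by [].
  have [ms Is] := @leb_inv_s_ij R n.+1 ord0 j j0.
  rewrite -[RHS](Is _ (measurable_domfw ord0 nu) (domfw_ge0 ord0 nu)).
  apply: eq_integral => t _; have F0 : fw a b iota nu (s_ij ord0 j t) = fw a b iota nu t by rewrite s_ijE -wt_gsw fw_act.
  by rewrite domj_s_ij F0.
rewrite (eq_bigr (fun=> Jdom nu)) //.
rewrite big_const_ord; elim: n.+1 => [|m IH]; first by rewrite mul0e.
by rewrite iterS IH -natr1 addrC EFinD ge0_muleDl ?mul1e // lee_fin.
Qed.

Lemma JdomE nu : Jdom nu = (\int[leb n]_s \int[mu]_x ((domi x s)%:R * (dfac a b iota nu x s * fw a b iota nu s))%:E)%E.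
Proof.
rewrite /Jdom (ge0_leb_ins2 ord0 (measurable_domfw ord0 nu) (domfw_ge0 ord0 nu)).
by apply: eq_integral => s _; apply: eq_integral => x _; rewrite domj_ins0 fw_ins0.
Qed.

Lemma measurable_expR_abs (k : R) : measurable_fun setT (fun x : R => expR (- k * `|x|)).
Proof.
apply: continuous_measurable_fun => x.
apply: (@continuous_comp _ _ _ (fun x : R => - k * `|x|) (@expR R)); last exact: continuous_expR.
by apply: cvgM; [exact: cvg_cst|exact: norm_continuous].
Qed.

Lemma int_sep (K k nu : R) : 0 <= K -> 0 < k ->
  (\int[leb n]_s \int[mu]_x (K * expR (- k * `|x|) * fw a b iota nu s)%:E =
   (K * (2 / k))%:E * \int[leb n]_s (fw a b iota nu s)%:E)%E.
Proof.
move=> K0 k0; have C0 : (0 <= (K * (2 / k))%:E)%E by rewrite lee_fin mulr_ge0 // divr_ge0 // ltW.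
rewrite -ge0_integralZl //; last 2 first.
- by apply/measurable_EFinP; exact: measurable_fw.
- by move=> s _; rewrite lee_fin fw_ge0.
apply: eq_integral => s _.
have f0 := fw_ge0 a b iota nu s.
rewrite (_ : (fun x => _) = (fun x => ((K * fw a b iota nu s)%:E * (expR (- k * `|x|))%:E)%E)); last first.
  by apply/funext => x; rewrite -EFinM mulrAC.
rewrite ge0_integralZl //; last 2 first.
- by apply/measurable_EFinP; exact: measurable_expR_abs.
- by rewrite lee_fin mulr_ge0.
by rewrite int_expR_abs // -!EFinM mulrAC.
Qed.

Lemma measurable_inner nu : measurable_fun setT (fun p : (measurableTypeR R * TT n)%type =>
  ((domi p.1 p.2)%:R * (dfac a b iota nu p.1 p.2 * fw a b iota nu p.2))%:E).
Proof.
rewrite (_ : (fun p => _) = (fun t : TT n.+1 => ((domj ord0 t)%:R * fw a b iota nu t)%:E) \o ins ord0).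
  by apply: measurableT_comp; [exact: measurable_domfw|exact: measurable_ins].
by apply/funext => -[x s]; rewrite /= domj_ins0 fw_ins0.
Qed.

Lemma measurable_sep (K k nu : R) : measurable_fun setT (fun p : (measurableTypeR R * TT n)%type =>
  (K * expR (- k * `|p.1|) * fw a b iota nu p.2)%:E).
Proof.
apply/measurable_EFinP; apply: measurable_funM.
  apply: measurable_funM; first exact: measurable_cst.
  by apply: (measurableT_comp (measurable_expR_abs k)); exact: measurable_fst.
by apply: measurableT_comp (measurable_fw _ _ _ _) _; exact: measurable_snd.
Qed.

Lemma measurable_int1 (g : R -> TT (R:=R) n -> R) :
  measurable_fun setT (fun p : (measurableTypeR R * TT n)%type => (g p.1 p.2)%:E) -> (forall x s, 0 <= g x s) ->
  measurable_fun setT (fun s : TT n => \int[mu]_x (g x s)%:E)%E.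
Proof.
move=> mg g0.
have := @measurable_fun_fubini_tonelli_G _ _ (measurableTypeR R) (TT n) R mu (fun p : (measurableTypeR R * TT n)%type => (g p.1 p.2)%:E).
by apply => // p; rewrite lee_fin.
Qed.

Lemma iter_le (f h : R -> TT (R:=R) n -> R) :
  measurable_fun setT (fun p : (measurableTypeR R * TT n)%type => (f p.1 p.2)%:E) ->
  measurable_fun setT (fun p : (measurableTypeR R * TT n)%type => (h p.1 p.2)%:E) ->
  (forall x s, 0 <= f x s <= h x s) ->
  (\int[leb n]_s \int[mu]_x (f x s)%:E <= \int[leb n]_s \int[mu]_x (h x s)%:E)%E.
Proof.
move=> mf mh H.
have m1 (g : R -> TT n -> R) s : measurable_fun setT (fun p : (measurableTypeR R * TT n)%type => (g p.1 p.2)%:E) ->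
    measurable_fun setT (fun x : measurableTypeR R => (g x s)%:E).
  by move=> mg; have := measurableT_comp mg (@pair2_measurable _ _ (measurableTypeR R) (TT n) s).
have f0 x s : 0 <= f x s by have /andP[] := H x s.
have h0 x s : 0 <= h x s by have /andP[h1 h2] := H x s; exact: le_trans h2.
apply: ge0_le_integral => //.
- by move=> s _; apply: integral_ge0 => x _; rewrite lee_fin.
- exact: measurable_int1.
- exact: measurable_int1.
move=> s _; apply: ge0_le_integral => //.
- by move=> x _; rewrite lee_fin.
- exact: m1.
- exact: m1.
by move=> x _; rewrite lee_fin; have /andP[] := H x s.
Qed.

Lemma dfac_ge0 nu x s : 0 <= dfac a b iota nu x s.
Proof. by rewrite !mulr_ge0 ?powR_ge0 // ?w1_ge0 // prodr_ge0 // => i _; exact: mulr_ge0 (powR_ge0 _ _) (powR_ge0 _ _). Qed.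

(** [thet] and the restriction to the dominant region are dropped; what is left of the [x]-integral
    is at most that of [2^(2 eta) e^(-2 eta |x|)]. *)
Lemma Jdom_upper eta : 0 < eta ->
  (Jdom (rho1 + eta) <= (powR 2 (2 * rho1) * powR 2 (2 * eta) / eta)%:E * \int[leb n]_s (fw a b iota (rho1 + eta) s)%:E)%E.
Proof.
move=> e0; have e2 : 0 < 2 * eta by rewrite mulr_gt0.
have K0 : 0 <= powR 2 (2 * rho1) * powR 2 (2 * eta) :> R by rewrite mulr_ge0 ?powR_ge0.
rewrite (_ : powR 2 (2 * rho1) * powR 2 (2 * eta) / eta = powR 2 (2 * rho1) * powR 2 (2 * eta) * (2 / (2 * eta))); last first.
  by field; rewrite gt_eqF.
rewrite -int_sep // JdomE; apply: (iter_le (measurable_inner _) (measurable_sep _ _ _)) => x s.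
have f0 := fw_ge0 a b iota (rho1 + eta) s; have d0 := dfac_ge0 (rho1 + eta) x s.
apply/andP; split; first by rewrite mulr_ge0 // mulr_ge0.
have [dom|_] := boolP (domi x s); last first.
  by rewrite (_ : false%:R = 0 :> R) // mul0r; exact: mulr_ge0 (mulr_ge0 K0 (expR_ge0 _)) f0.
rewrite (_ : true%:R = 1 :> R) // mul1r; apply: ler_wpM2r => //; rewrite (dfacE a b0 i0 eta dom).
have [/andP[t0 t1] _] := thet_bounds a0 b0 i0 dom.
apply: le_trans (ler_piMr _ t1) _; first by rewrite mulr_ge0 ?powR_ge0.
rewrite mulrC -mulrA; apply: ler_wpM2l; first exact: powR_ge0.
rewrite mulNr; exact: powR_cosh_le (ltW e2).
Qed.

(** The loss has two sources, the defect of [thet] and the region where [x] does not dominate. Both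
    are controlled by [T], which decays in [x] at the fixed rate [2 * tht]; the loss stays bounded
    while the main term grows like [1 / eta]. *)
Lemma Jdom_lower eta : 0 < eta ->
  ((powR 2 (2 * rho1) / eta)%:E * \int[leb n]_s (fw a b iota (rho1 + eta) s)%:E <=
   Jdom (rho1 + eta) + (powR 2 (2 * rho1) * bernD * powR 2 (2 * tht) / tht)%:E * \int[leb n]_s (fw a b iota (rho1 - tht) s)%:E)%E.
Proof.
move=> e0; have e2 : 0 < 2 * eta by rewrite mulr_gt0.
have [t0 [t1 ta]] := tht_bounds a0.
have t2 : 0 < 2 * tht by rewrite mulr_gt0.
have D1 : 1 <= bernD.
  by rewrite -[bernD]/((bernm a b iota)%:R * n.+1%:R) -[leLHS]mulr1 ler_pM // ler1n.
have D0 : 0 <= bernD by apply: le_trans D1.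
pose K : R := powR 2 (2 * rho1) * bernD * powR 2 (2 * tht).
have P0 : 0 <= powR 2 (2 * rho1) :> R := powR_ge0 _ _.
have K0 : 0 <= K by rewrite !mulr_ge0 ?powR_ge0.
rewrite (_ : powR 2 (2 * rho1) / eta = powR 2 (2 * rho1) * (2 / (2 * eta))); last by field; rewrite gt_eqF.
rewrite (_ : powR 2 (2 * rho1) * bernD * powR 2 (2 * tht) / tht = K * (2 / (2 * tht))); last by rewrite /K; field; rewrite gt_eqF.
rewrite -!int_sep // JdomE.
pose f x s := (domi x s)%:R * (dfac a b iota (rho1 + eta) x s * fw a b iota (rho1 + eta) s).
pose h x s := K * expR (- (2 * tht) * `|x|) * fw a b iota (rho1 - tht) s.
have f0 x s : 0 <= f x s by rewrite /f mulr_ge0 // mulr_ge0 ?dfac_ge0 ?fw_ge0.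
have h0 x s : 0 <= h x s by rewrite /h mulr_ge0 ?fw_ge0 // mulr_ge0 ?expR_ge0.
have mf := measurable_inner (rho1 + eta); have mh := measurable_sep K (2 * tht) (rho1 - tht).
have -> : (\int[leb n]_s \int[mu]_x (f x s)%:E + \int[leb n]_s \int[mu]_x (h x s)%:E =
    \int[leb n]_s \int[mu]_x (f x s + h x s)%:E)%E.
  rewrite -ge0_integralD //; last 4 first.
  - by move=> s _; apply: integral_ge0 => x _; rewrite lee_fin.
  - exact: measurable_int1 mf f0.
  - by move=> s _; apply: integral_ge0 => x _; rewrite lee_fin.
  - exact: measurable_int1 mh h0.
  apply: eq_integral => s _; rewrite -ge0_integralD //.
  - by move=> x _; rewrite lee_fin.
  - by have := measurableT_comp mf (@pair2_measurable _ _ (measurableTypeR R) (TT n) s).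
  - by move=> x _; rewrite lee_fin.
  - by have := measurableT_comp mh (@pair2_measurable _ _ (measurableTypeR R) (TT n) s).
apply: (@iter_le (fun x s => powR 2 (2 * rho1) * expR (- (2 * eta) * `|x|) * fw a b iota (rho1 + eta) s) (fun x s => f x s + h x s)).
- exact: measurable_sep.
- rewrite (_ : (fun p => _) = (fun p : (measurableTypeR R * TT n)%type => (f p.1 p.2)%:E + (h p.1 p.2)%:E)%E) //.
  exact: emeasurable_funD.
move=> x s; have fw0 := fw_ge0 a b iota (rho1 + eta) s.
apply/andP; split; first exact: mulr_ge0 (mulr_ge0 P0 (expR_ge0 _)) fw0.
have c0 := coshR_gt0 x; have c1 : 1 <= coshR x by exact: coshR_ge1.
have cexp : coshR x <= expR `|x|.
  have N : coshR x = coshR `|x| by have [u0|u0] := leP 0 x; [rewrite ger0_norm|rewrite ltr0_norm // /coshR opprK addrC].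
  rewrite N /coshR ler_pdivrMr // mulr_natr mulr2n lerD2l ler_expR.
  by have := normr_ge0 x; lra.
have e1 : expR (- (2 * eta) * `|x|) <= powR (coshR x) (- 2 * eta).
  rewrite !mulNr expRN powRN lef_pV2 ?posrE ?expR_gt0 ?powR_gt0 //.
  rewrite [2 * eta * _]mulrC expRM; apply: ge0_ler_powR => //; rewrite ?nnegrE ?expR_ge0 //; exact: ltW.
pose P := \prod_(i < n) powR (coshR (tnth s i)) (2 * tht).
pose T := powR (coshR x) (- 2 * tht) * P.
have hT : powR 2 (2 * rho1) * bernD * T * fw a b iota (rho1 + eta) s <= h x s.
  have E : P * fw a b iota (rho1 + eta) s = fw a b iota (rho1 + eta - tht) s.
    rewrite !fwE mulrA; congr (_ * _); rewrite /f_delta /P -big_split /=; apply: eq_bigr => i _.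
    by rewrite -powRD ?(gt_eqF (coshR_gt0 _)) ?implybT //; congr powR; ring.
  have F : fw a b iota (rho1 + eta - tht) s <= fw a b iota (rho1 - tht) s.
    by apply: fw_dec => //; lra.
  have -> : powR 2 (2 * rho1) * bernD * T * fw a b iota (rho1 + eta) s =
      powR 2 (2 * rho1) * bernD * powR (coshR x) (- 2 * tht) * fw a b iota (rho1 + eta - tht) s.
    by rewrite -E /T; ring.
  rewrite /h /K; apply: ler_pM => //; rewrite ?fw_ge0 ?mulr_ge0 ?powR_ge0 //.
  rewrite -[leRHS]mulrA; apply: ler_wpM2l; first by rewrite mulr_ge0.
  by rewrite mulNr; exact: powR_cosh_le (ltW t2).
have P2 : powR (coshR x) (- 2 * eta) <= 1.
  by rewrite -[leRHS](powRr0 (coshR x)); apply: ler_powR => //; lra.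
apply: (@le_trans _ _ (powR 2 (2 * rho1) * powR (coshR x) (- 2 * eta) * fw a b iota (rho1 + eta) s)).
  by apply: ler_wpM2r => //; apply: ler_wpM2l.
apply: le_trans (lerD (lexx _) hT).
rewrite /f; have [dom|ndom] := boolP (domi x s).
  have [_ th1] := thet_bounds a0 b0 i0 dom; rewrite -/P -/T in th1.
  rewrite (_ : true%:R = 1 :> R) // mul1r (dfacE a b0 i0 eta dom) -mulrDl; apply: ler_wpM2r => //.
  have pc := powR_ge0 (coshR x) (- 2 * eta).
  have T0 : 0 <= bernD * T.
    by apply: mulr_ge0 D0 (mulr_ge0 (powR_ge0 _ _) _); apply: prodr_ge0 => i _; exact: powR_ge0.
  have := ler_wpM2l pc th1; have := ler_wpM2r T0 P2; rewrite mul1r => q1 q2.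
  have q3 : powR (coshR x) (- 2 * eta) <= powR (coshR x) (- 2 * eta) * thet a b iota x s + bernD * T by lra.
  by apply: le_trans (ler_wpM2l P0 q3) _; rewrite le_eqVlt; apply/orP; left; apply/eqP; ring.
(* Some [|s_i| >= |x|] forces [T >= 1], and with [bernD >= 1] the loss term alone covers the left
   side. *)
rewrite (_ : false%:R = 0 :> R) // mul0r add0r; apply: ler_wpM2r => //; rewrite -mulrA; apply: ler_wpM2l => //.
apply: le_trans P2 _; rewrite -[leLHS]mulr1; apply: ler_pM => //.
have [i ci] : exists i : 'I_n, ~~ (`|tnth s i| < `|x|) by apply/existsP; rewrite -negb_forall.
move: ci; rewrite -leNgt => /coshR_le cx.
have p1 (z : R) : 1 <= powR (coshR z) (2 * tht).
  by rewrite -[leLHS](powRr0 (coshR z)); apply: ler_powR; [exact: coshR_ge1|exact: ltW].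
rewrite /T /P (bigD1 i) //= mulrA -[leLHS]mulr1; apply: ler_pM => //.
  rewrite mulNr powRN mulrC (ler_pdivlMr _ _ (powR_gt0 _ (coshR_gt0 x))) mul1r.
  by apply: (ge0_ler_powR (ltW t2) _ _ cx); rewrite nnegrE; exact: ltW (coshR_gt0 _).
by rewrite -[leLHS](big1_eq (R := R) (op := *%R) (idx := 1) (index_enum 'I_n) (fun k : 'I_n => k != i)) ler_prod // => k _; rewrite ler01 p1.
Qed.

End RankIntegrals.

(** * The constant by induction on the rank *)

Section SelbergConstant.
Context {R : realType}.
Variables (a b iota : R).
Hypotheses (a0 : 0 < a) (b0 : 0 < b) (i0 : 0 < iota).
Implicit Types (n : nat) (nu : R).
Local Notation rho n := (@rho1 R n a b iota).
Local Notation N n := (@Nw R n a b iota).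
Local Notation K n := (@Kw R n a b iota).

(** The factor of [N_nu] that does not depend on [nu]. *)
Definition Sel n : R := powR 2 (n%:R * (2 * iota + 2 * b + a * n.-1%:R)) * n`!%:R *
  \prod_(j < n) gam ((iota + 1 + 2 * b + a * n.-1%:R) / 2 - a / 2 * j%:R) *
  \prod_(i < n) \prod_(j < n | (i < j)%N) (gam (a / 2 * (j - i + 1)%:R) / gam (a / 2 * (j - i)%:R)).

(** In rank 0 the integral is the value at a point and converges for every [nu], whereas [rho 0]
    would still be [iota + b]. *)
Definition fin_rank n nu := (n == 0)%N || (rho n < nu).

Lemma fw0E nu (t : 0.-tuple R) : fw a b iota nu t = 1.
Proof.
rewrite fwE.
have E : f_delta (- 2 * nu) t = 1 by exact: big_ord0.
rewrite E mul1r; apply: etrans (mul1r 1); congr (_ * _); exact: big_ord0.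
Qed.

Lemma int_fw n nu : fin_rank n nu -> (\int[leb n]_t (fw a b iota nu t)%:E = (N n nu)%:E)%E.
Proof.
move=> h; rewrite /Nw /Iw (_ : (fun t : TT n => (1 * _)%:E) = (fun t => (fw a b iota nu t)%:E)); last first.
  by apply/funext => t; rewrite mul1r.
rewrite fineK //; case: n h => [_|n]; last first.
  move=> h; have H := integrable_one a0 b0 i0 (ltn0Sn n) h.
  by under eq_fun do rewrite -[fw _ _ _ _ _]mul1r; exact: integrable_fin_num H.
by rewrite ge0_leb0 //; apply/measurable_EFinP; exact: measurable_fw.
Qed.

Lemma N0E nu : N 0 nu = 1.
Proof.
have := int_fw (n := 0) (nu := nu) isT; rewrite ge0_leb0 ?fw0E; first by move=> [].
by apply/measurable_EFinP; exact: measurable_fw.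
Qed.

(** As [eta] tends to 0 both ends approach the same multiple of the rank [n] integral at [rho n.+1],
    where that integral is finite. *)
Lemma rank_bounds n eta : 0 < eta ->
  n.+1%:R * powR 2 (2 * rho n.+1) * (N n (rho n.+1 + eta) -
      eta * (bernD (n := n) a b iota * powR 2 (2 * tht a) / tht a * N n (rho n.+1 - tht a)))
    <= eta * N n.+1 (rho n.+1 + eta) <=
  n.+1%:R * powR 2 (2 * rho n.+1) * (powR 2 (2 * eta) * N n (rho n.+1 + eta)).
Proof.
move=> e0; have [t0 [t1 ta]] := tht_bounds a0.
have r1 : n = 0%N \/ rho n = rho n.+1 - a.
  case: (n) => [|m]; [by left|right].
  by rewrite -[rho m.+1]/(iota + b + a * m%:R) -[rho m.+2]/(iota + b + a * m.+1%:R) -natr1; ring.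
have f1 : fin_rank n (rho n.+1 + eta).
  by rewrite /fin_rank; case: r1 => [->//|->]; apply/orP; right; have A := a0; lra.
have f2 : fin_rank n (rho n.+1 - tht a).
  by rewrite /fin_rank; case: r1 => [->//|->]; apply/orP; right; lra.
have f3 : fin_rank n.+1 (rho n.+1 + eta) by rewrite /fin_rank /= ltrDl.
have := Jdom_upper (n := n) a0 b0 i0 e0; have := Jdom_lower (n := n) a0 b0 i0 e0.
have := int_fw_dom (n := n) iota a0 b0 (rho n.+1 + eta).
rewrite (int_fw f1) (int_fw f2) (int_fw f3).
case: (Jdom _ _ _ _) => [J| |]; last 2 first.
- by rewrite gt0_muley // lte_fin.
- by rewrite gt0_muleNy // lte_fin.
rewrite -!EFinM -EFinD !lee_fin => -[->] h1 h2.
have n0 : 0 <= n.+1%:R :> R by [].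
move: (bernD _ _ _) (N n (_ + eta)) (N n (_ - _)) (powR 2 (2 * rho n.+1)) (powR 2 (2 * eta)) (powR 2 (2 * tht a)) h1 h2
  => D A B p q u h1 h2.
have q1 := ler_wpM2l (ltW e0) h1; have q2 := ler_wpM2l (ltW e0) h2.
have -> : eta * (n.+1%:R * J) = n.+1%:R * (eta * J) by ring.
rewrite -!mulrA; apply/andP; split; apply: ler_wpM2l => //.
  move: q1; have -> : eta * (p / eta * A) = p * A by field; rewrite gt_eqF.
  by move=> q1; rewrite mulrBr lerBlDr; apply: le_trans q1 _; rewrite le_eqVlt; apply/orP; left; apply/eqP; ring.
apply: le_trans q2 _; rewrite le_eqVlt; apply/orP; left; apply/eqP.
by field; rewrite gt_eqF.
Qed.

Lemma gam_half_gt0 m : (0 < m)%N -> 0 < gam (a / 2 * m%:R).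
Proof. by move=> m0; rewrite gam_gt0 // mulr_gt0 ?ltr0n // divr_gt0. Qed.

Lemma Sel_gt0 n : 0 < Sel n.
Proof.
rewrite /Sel !mulr_gt0 ?powR_gt0 ?ltr0n ?fact_gt0 //.
  apply: prodr_gt0 => j _; apply: gam_gt0.
  have : a / 2 * j%:R <= a / 2 * n.-1%:R.
    apply: ler_wpM2l; first by rewrite divr_ge0 // ltW.
    by rewrite ler_nat; have := ltn_ord j; lia.
  have B := b0; have I := i0; rewrite (_ : (_ + a * n.-1%:R) / 2 = (iota + 1 + 2 * b) / 2 + a / 2 * n.-1%:R); last by field.
  by move: (a / 2 * _) (a / 2 * _) => u v; lra.
apply: prodr_gt0 => i _; apply: prodr_gt0 => j ij.
by rewrite divr_gt0 // gam_half_gt0 // ?addn1 // subn_gt0.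
Qed.

(** Equality of the two expressions for the limit in [N_Sel]. The [G i] stand for the Gamma
    denominators occurring in both, so any positive values will do. *)
Lemma Sel_rec n (G : nat -> R) : (forall m, 0 < G m) ->
  Sel n.+1 * (\prod_(i < n) (gam (a / 2 * (n - i)%:R) / G i) / gam ((iota + 1 + 2 * b + a * n%:R) / 2)) =
  n.+1%:R * powR 2 (2 * rho n.+1) * (Sel n * \prod_(i < n) (gam (a / 2 * (n - i + 1)%:R) / G i)).
Proof.
move=> G0.
have gK : 0 < gam ((iota + 1 + 2 * b + a * n%:R) / 2).
  by rewrite gam_gt0 // divr_gt0 // ltr_wpDr ?mulr_ge0 ?(ltW a0) //; have B := b0; have I := i0; lra.
rewrite /Sel factS natrM.
have -> : powR 2 (n.+1%:R * (2 * iota + 2 * b + a * n.+1.-1%:R)) =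
    powR 2 (n%:R * (2 * iota + 2 * b + a * n.-1%:R)) * powR 2 (2 * rho n.+1) :> R.
  rewrite -powRD ?pnatr_eq0 ?implybT //; congr powR.
  rewrite -[rho n.+1]/(iota + b + a * n%:R) -natr1 /=.
  by case: (n) => [|m] /=; [ring|rewrite -natr1; ring].
have -> : \prod_(j < n.+1) gam ((iota + 1 + 2 * b + a * n.+1.-1%:R) / 2 - a / 2 * j%:R) =
    gam ((iota + 1 + 2 * b + a * n%:R) / 2) * \prod_(j < n) gam ((iota + 1 + 2 * b + a * n.-1%:R) / 2 - a / 2 * j%:R).
  rewrite big_ord_recl /= mulr0 subr0; congr (_ * _); apply: eq_bigr => j _; congr gam.
  rewrite /bump /= add1n; case: (n) j => [[]//|m] j /=; rewrite -!natr1; by field.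
have -> : \prod_(i < n.+1) \prod_(j < n.+1 | (i < j)%N) (gam (a / 2 * (j - i + 1)%:R) / gam (a / 2 * (j - i)%:R)) =
   (\prod_(i < n) \prod_(j < n | (i < j)%N) (gam (a / 2 * (j - i + 1)%:R) / gam (a / 2 * (j - i)%:R))) *
   \prod_(i < n) (gam (a / 2 * (n - i + 1)%:R) / gam (a / 2 * (n - i)%:R)).
  rewrite big_ord_recr /= [X in _ * X]big1 ?mulr1 => [|j]; last by rewrite ltnNge -ltnS ltn_ord.
  rewrite -big_split /=; apply: eq_bigr => i _.
  rewrite big_mkcond big_ord_recr /= ltn_ord; congr (_ * _).
  by rewrite [RHS]big_mkcond.
have -> : \prod_(i < n) (gam (a / 2 * (n - i + 1)%:R) / G i) =
    \prod_(i < n) (gam (a / 2 * (n - i + 1)%:R) / gam (a / 2 * (n - i)%:R)) * \prod_(i < n) (gam (a / 2 * (n - i)%:R) / G i).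
  rewrite -big_split /=; apply: eq_bigr => i _.
  have g0 : 0 < gam (a / 2 * (n - i)%:R) by rewrite gam_half_gt0 // subn_gt0.
  by move: (gam _) (gam _) (G i) (G0 i) g0 => u v w w0 v0; field; rewrite !gt_eqF.
move: (gam ((iota + 1 + 2 * b + a * n%:R) / 2)) gK => g g0.
move: (\prod_(_ < n) _) (\prod_(_ < n) _) (\prod_(_ < n) _) (\prod_(_ < n) _) (powR _ _) (powR _ _) => A B C D p q.
by field; rewrite gt_eqF.
Qed.

Lemma N_Sel n nu : fin_rank n nu -> N n nu = Sel n * K n nu.
Proof.
elim: n nu => [|n IH] nu h; first by rewrite N0E /Sel /Kw !big_ord0 mul0r powRr0 !mulr1.
have [c c0 Hc] := Nw_Kw a0 b0 i0 (ltn0Sn n); rewrite Hc //; congr (_ * _).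
set r1 := rho n.+1; have rE : r1 = iota + b + a * n%:R by [].
pose cn := (iota + 1 + 2 * b + a * n%:R) / 2.
have cn0 : 0 < cn by rewrite divr_gt0 // ltr_wpDr ?mulr_ge0 ?(ltW a0) //; have B := b0; have I := i0; lra.
have an (i : 'I_n) : 0 < a / 2 * (n - i)%:R by rewrite mulr_gt0 ?divr_gt0 ?ltr0n ?subn_gt0.
pose G (m : nat) := gam (a / 2 * (n - m)%:R + cn).
have G0 m : 0 < G m by rewrite gam_gt0 // ltr_wpDl // mulr_ge0 // divr_ge0 // ltW.
pose et k : R := k.+1%:R^-1; have et0 k : 0 < et k by rewrite invr_gt0.
have ge : et k @[k --> \oo] --> (0 : R) by exact: cvg_harmonic.
have cp m (F : 'I_m -> nat -> R) (f : 'I_m -> R) : (forall i, F i k @[k --> \oo] --> f i) ->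
    \prod_(i < m) F i k @[k --> \oo] --> \prod_(i < m) f i.
  move=> H; elim: (index_enum _) => [|i l IHl].
    by under eq_fun do rewrite big_nil; rewrite big_nil; exact: cvg_cst.
  by under eq_fun do rewrite big_cons; rewrite big_cons; apply: cvgM.
have g1 : gam (1 + et k) @[k --> \oo] --> (1 : R).
  have := @gam_cvg R 1 ltr01; rewrite gam_1; exact.
have gc : (gam (cn + et k))^-1 @[k --> \oo] --> (gam cn)^-1.
  by apply: cvgV; [rewrite gt_eqF // gam_gt0|exact: gam_cvg].
(* Only the factor [i = n] is singular at the threshold: its numerator is [gam (et k)], and
   [et k * gam (et k) = gam (1 + et k)] tends to 1. *)
have cK1 : et k * K n.+1 (r1 + et k) @[k --> \oo] --> \prod_(i < n) (gam (a / 2 * (n - i)%:R) / G i) / gam cn.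
  rewrite (_ : (fun k => _) = (fun k => (\prod_(i < n) (gam (a / 2 * (n - i)%:R + et k) / gam (a / 2 * (n - i)%:R + cn + et k))) *
      (gam (1 + et k) / gam (cn + et k)))).
    apply: cvgM.
      apply: cp => i; apply: cvgM; first exact: gam_cvg.
      apply: cvgV; first by rewrite gt_eqF // G0.
      by apply: gam_cvg; rewrite addr_gt0.
    by have := cvgM g1 gc; rewrite mul1r; exact.
  apply/funext => k; pose F i := gam (r1 + et k + @pK R n.+1 a b iota i) / gam (r1 + et k + @pK R n.+1 a b iota i + @cK R n.+1 a b iota).
  rewrite -[K n.+1 _]/(\prod_(i < n.+1) F i) big_ord_recr mulrCA /F.
  apply: (congr2 *%R).
    apply: eq_bigr => i _.
    have E : r1 + et k + @pK R n.+1 a b iota i = a / 2 * (n - i)%:R + et k by rewrite /pK rE natrB ?(ltnW (ltn_ord i)) //=; field.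
    have E' : a / 2 * (n - i)%:R + et k + @cK R n.+1 a b iota = a / 2 * (n - i)%:R + cn + et k by rewrite /cK /cn /=; field.
    by rewrite -E' -E.
  have E : r1 + et k + @pK R n.+1 a b iota n = et k by rewrite /pK rE /=; field.
  have E' : et k + @cK R n.+1 a b iota = cn + et k by rewrite /cK /cn /=; field.
  by rewrite -[nat_of_ord ord_max]/n E E' mulrA [1 + _]addrC gam_rec.
(* In rank [n] the numerator arguments at [r1] are larger by [a / 2], because [pK] contains [n.-1]
   in place of [n]; the denominators agree with those of rank [n + 1]. *)
have cK0 : K n (r1 + et k) @[k --> \oo] --> \prod_(i < n) (gam (a / 2 * (n - i + 1)%:R) / G i).
  rewrite (_ : (fun k => _) = (fun k => \prod_(i < n) (gam (a / 2 * (n - i + 1)%:R + et k) / gam (a / 2 * (n - i)%:R + cn + et k)))).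
    apply: cp => i; apply: cvgM; first by apply: gam_cvg; rewrite mulr_gt0 ?divr_gt0 ?ltr0n ?addn1.
    apply: cvgV; first by rewrite gt_eqF // G0.
    by apply: gam_cvg; rewrite addr_gt0.
  apply/funext => k; apply: eq_bigr => i _.
  have n1 : n.-1%:R = n%:R - 1 :> R by rewrite -subn1 natrB //; exact: leq_ltn_trans (ltn_ord i).
  have E : r1 + et k + @pK R n a b iota i = a / 2 * (n - i + 1)%:R + et k.
    by rewrite /pK rE n1 natrD natrB ?(ltnW (ltn_ord i)) //; field.
  have E' : a / 2 * (n - i + 1)%:R + et k + @cK R n a b iota = a / 2 * (n - i)%:R + cn + et k.
    by rewrite /cK /cn n1 natrD natrB ?(ltnW (ltn_ord i)) //; field.
  by rewrite -E' -E.
have f1 k : fin_rank n (r1 + et k).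
  rewrite /fin_rank rE; case: (n) => [//|m] /=.
  rewrite -[rho m.+1]/(iota + b + a * m%:R) -natr1.
  by have A := a0; have := et0 k; lra.
pose p : R := n.+1%:R * powR 2 (2 * r1).
pose M := bernD (n := n) a b iota * powR 2 (2 * tht a) / tht a * N n (r1 - tht a).
have cN : N n (r1 + et k) @[k --> \oo] --> Sel n * \prod_(i < n) (gam (a / 2 * (n - i + 1)%:R) / G i).
  by under eq_fun do rewrite IH //; apply: cvgM; [exact: cvg_cst|exact: cK0].
have cX : et k * N n.+1 (r1 + et k) @[k --> \oo] --> c * (\prod_(i < n) (gam (a / 2 * (n - i)%:R) / G i) / gam cn).
  rewrite (_ : (fun k => _) = (fun k => c * (et k * K n.+1 (r1 + et k)))); first by apply: cvgM; [exact: cvg_cst|exact: cK1].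
  by apply/funext => k; rewrite Hc ?ltrDl // mulrCA.
have cX' : et k * N n.+1 (r1 + et k) @[k --> \oo] --> p * (Sel n * \prod_(i < n) (gam (a / 2 * (n - i + 1)%:R) / G i)).
  apply: (@squeeze_cvgr _ _ _ _ (fun k => p * (N n (r1 + et k) - et k * M)) (fun k => p * (powR 2 (2 * et k) * N n (r1 + et k)))).
  - by apply: nearW => k; exact: rank_bounds.
  - apply: cvgM; first exact: cvg_cst.
    rewrite -[X in _ --> X]subr0; apply: cvgB => //; rewrite -(mul0r M).
    by apply: cvgM => //; exact: cvg_cst.
  - apply: cvgM; first exact: cvg_cst.
    rewrite -[X in _ --> X]mul1r; apply: cvgM => //.
    have -> : (fun k => powR 2 (2 * et k)) = (fun k => expR (2 * et k * ln 2)) by apply/funext => k; rewrite /powR pnatr_eq0.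
    have ce : 2 * et k * ln 2 @[k --> \oo] --> 2 * 0 * ln 2 by apply: cvgM; [apply: cvgM => //; exact: cvg_cst|exact: cvg_cst].
    have := @continuous_cvg _ _ _ _ _ _ expR _ (@continuous_expR R _) ce.
    by rewrite mulr0 mul0r expR0; exact.
have := cvg_unique _ cX cX' => /(_ (@norm_hausdorff _ _)); rewrite -(Sel_rec n G0).
have Z0 : \prod_(i < n) (gam (a / 2 * (n - i)%:R) / G i) / gam cn != 0.
  apply: mulf_neq0; last by rewrite invr_eq0 gt_eqF // gam_gt0.
  by apply/prodf_neq0 => i _; rewrite gt_eqF // divr_gt0 // gam_gt0.
by move=> X; exact: (mulIf Z0 (X _)).
Qed.

End SelbergConstant.

(** * From the integrals of the statement to [Iw] *)

Section Assembly.
Context {R : realType} {r : nat}.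
Variables (a b iota : R).
Hypotheses (a0 : 0 < a) (b0 : 0 < b) (i0 : 0 < iota) (r0 : (0 < r)%N).
Local Notation pt := (r.-tuple R).
Local Notation rho1 := (@rho1 R r a b iota).
Local Notation Nw := (@Nw R r a b iota).
Local Notation mu := (mu_density a b iota).

Lemma mu_nonreg (t : pt) : ~ regular t -> mu t = 0.
Proof.
move=> nr; have := fw_nonreg iota a0 b0 0 nr; rewrite fwE => /eqP.
rewrite mulf_eq0 => /orP[/eqP E|/eqP //].
by move/eqP: E => /prodf_eq0[j _]; rewrite gt_eqF // powR_gt0 // coshR_gt0.
Qed.

Lemma mu_ge0 (t : pt) : 0 <= mu t.
Proof.
apply: mulr_ge0; first by apply: prodr_ge0 => j _; rewrite mulr_ge0 ?powR_ge0.
by apply: prodr_ge0 => j _; apply: prodr_ge0 => k _; rewrite mulr_ge0 ?powR_ge0.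
Qed.

Lemma Rint_muE nu (g F : pt -> R) : measurable_fun setT (F : TT r -> R) ->
  (leb r).-integrable setT (fun t : TT r => (F t * fw a b iota nu t)%:E) ->
  (forall t, regular t -> g t = f_delta (- 2 * nu) t * F t) ->
  Rint_mu a b iota g = Iw a b iota nu F.
Proof.
move=> mF IF gE; pose h (t : TT r) := (F t * fw a b iota nu t)%:E.
have mh : measurable_fun setT h by apply/measurable_EFinP/measurable_funM => //; exact: measurable_fw.
have E (t : pt) c : Num.max (c * g t) 0 * mu t = Num.max (c * (F t * fw a b iota nu t)) 0.
  case: (pselect (regular t)) => [rt|nr]; last by rewrite mu_nonreg // fw_nonreg // !mulr0 maxxx.
  rewrite fwE gE // (maxr_pMl _ _ (mu_ge0 t)) mul0r; congr Num.max.
  by move: (f_delta _ _) (mu t) (F t) => x y z; ring.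
rewrite /Rint_mu (_ : (fun t : pt => (Num.max (g t) 0 * mu t)%:E) = h^\+%E); last first.
  by apply/funext => t; rewrite -[g t]mul1r E mul1r funeposE /h EFin_max.
rewrite (_ : (fun t : pt => (Num.max (- g t) 0 * mu t)%:E) = h^\-%E); last first.
  by apply/funext => t; rewrite -[- g t]mulN1r E mulN1r funenegE /h -EFinN EFin_max.
rewrite !iintE ?/Iw //; try exact: measurable_funepos; try exact: measurable_funeneg.
rewrite -[RHS]/(fine (\int[leb r]_t h t)%E) (integralE (leb r) setT h).
by apply/esym/fineB; [exact: integrable_pos_fin_num IF|exact: integrable_neg_fin_num IF].
Qed.

Lemma Rint_f_delta nu : rho1 < nu -> Rint_mu a b iota (@f_delta R r (- 2 * nu)) = Nw nu.
Proof.
move=> h; apply: (@Rint_muE nu _ (fun=> 1)); [exact: measurable_cst|exact: integrable_one|move=> t _].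
by rewrite mulr1.
Qed.

Lemma L1_f_delta nu : rho1 < nu -> L1_mu a b iota (@f_delta R r (- 2 * nu)).
Proof.
move=> h; split; first exact: measurable_f_delta.
have H := integrable_one a0 b0 i0 r0 h.
rewrite (_ : (fun t : pt => _) = (fun t => (1 * fw a b iota nu t)%:E)); last first.
  by apply/funext => t; rewrite mul1r fwE ger0_norm // f_delta_ge0.
rewrite iintE.
- by have := integrable_fin_num measurableT H; rewrite fin_numElt => /andP[].
- exact: measurable_int H.
- by move=> t; rewrite mul1r lee_fin fw_ge0.
Qed.

Lemma Nw_gt0 nu : rho1 < nu -> 0 < Nw nu.
Proof.
move=> h; rewrite (N_Sel a0 b0 i0); last by rewrite /fin_rank h orbT.
by apply: mulr_gt0; [exact: Sel_gt0|exact: Kw_gt0].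
Qed.

Lemma N_nuE nu : rho1 < nu -> N_nu r a b iota nu = Nw nu.
Proof.
move=> h; rewrite (N_Sel a0 b0 i0); last by rewrite /fin_rank h orbT.
rewrite /N_nu /Sel /Gamma_a.
have -> : (\prod_(j < r) GammaR (nu - iota - b - a / 2 * r.-1%:R - a / 2 * j%:R)) /
    \prod_(j < r) GammaR (nu + (1 - iota) / 2 - a / 2 * j%:R) = @Kw R r a b iota nu.
  rewrite /Kw prodf_div; congr (_ / _); apply: eq_bigr => j _; rewrite GammaRE.
    by congr gam; rewrite /pK; ring.
  by congr gam; rewrite /pK /cK; field.
have -> : \prod_(i < r) \prod_(j < r | (i < j)%N) (GammaR (a / 2 * (j - i + 1)%:R) / GammaR (a / 2 * (j - i)%:R)) =
    \prod_(i < r) \prod_(j < r | (i < j)%N) (gam (a / 2 * (j - i + 1)%:R) / gam (a / 2 * (j - i)%:R)).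
  by apply: eq_bigr => i _; apply: eq_bigr => j _; rewrite !GammaRE.
have -> : \prod_(j < r) GammaR ((iota + 1 + 2 * b + a * r.-1%:R) / 2 - a / 2 * j%:R) =
    \prod_(j < r) gam ((iota + 1 + 2 * b + a * r.-1%:R) / 2 - a / 2 * j%:R).
  by apply: eq_bigr => j _; rewrite GammaRE.
by rewrite mulrAC.
Qed.

Lemma Rint_part nu (lam : r.-tuple R[i]) phi part : is_part (r := r) part -> rho1 < nu -> (forall j, cre (tnth lam j) = 0) ->
  is_HO_spherical a b iota lam phi ->
  Rint_mu a b iota (fun t => part (toC (f_delta (- 2 * nu) t) * phi t)) =
  part 1 * Nw nu * Gw a b iota (fun k => cim (tnth lam k)) nu.
Proof.
move=> P h l0 HO; have [_ an phi0 _] := HO.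
have [U [UE Ueig Utemp]] := tempered_spherical (ltW a0) (ltW b0) (ltW i0) P l0 HO.
rewrite (@Rint_muE nu _ U); last 3 first.
- exact: measurable_gfun.
- have [e e0 eh] : exists2 e, 0 < e & e < 2 * (nu - rho1) by exists (nu - rho1); lra.
  exact: (bnd_integrable a0 b0 i0 (Ordinal r0) (ltW e0) eh (tempered_bnd (Utemp e e0)) (measurable_gfun U)).
- by move=> t rt; rewrite -UE // (partMl P).
apply: (Iw_spherical a0 b0 i0 r0 Nw_gt0 (shiftop_Eop Ueig) Utemp) => // e e0.
have A := An_of_analytic (partD P) (part0 P) (part_le P) (partM P) (an [tuple 0 | _ < r]).
have [d [d0 H]] := An_cont e0 A; exists d => // t rt td; rewrite -UE // -phi0.
have -> : t = shift [tuple 0 | _ < r] (tnth t) by apply: eq_from_tnth => k; rewrite tnth_shift tnth_mktuple add0r.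
by apply: H => k; exact: ltW.
Qed.

End Assembly.

(** * The product of complex Gamma functions *)

Section GammaProducts.
Context {R : realType}.

Lemma Jg_oscN (X y : R) : 0 < X ->
  Jg X (osc (- y) 1 0) = Jg X (osc y 1 0) /\ Jg X (osc (- y) 0 1) = - Jg X (osc y 0 1).
Proof.
move=> X0; split.
  by congr Jg; apply/funext => t; rewrite /osc mulNr cosN !mul0r.
have -> : osc (- y) 0 1 = osc y (-1 * 0 + 0 * 0) (-1 * 1 + 0 * 0).
  by apply/funext => t; rewrite /osc (mulNr y) cosN sinN; ring.
by rewrite Jg_oscD // mul0r addr0 mulN1r.
Qed.

Lemma GammaC_toC (X : R) : 0 < X -> GammaC (toC X) = toC (gam X).
Proof.
move=> X0; rewrite -GammaRE; apply/eqP; rewrite eq_complex /= eqxx /=.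
rewrite -[X in X == _]/(cim (GammaC (toC X))) GammaC_cim /=; have [_] := Jg_oscN 0 X0.
by rewrite oppr0 => /eqP; rewrite -addr_eq0 -mulr2n mulrn_eq0.
Qed.

Lemma GammaC_conj (X y : R) : 0 < X -> GammaC (Complex X y) * GammaC (Complex X (- y)) = toC (gam_sqr X y).
Proof.
move=> X0; have E z : GammaC (Complex X z) = Complex (Jg X (osc z 1 0)) (Jg X (osc z 0 1)).
  by rewrite -[X]/(cre (Complex X z)) -{2 4}[z]/(cim (Complex X z)) -GammaC_cre -GammaC_cim; case: (GammaC _).
have [E1 E2] := Jg_oscN y X0; rewrite !E E1 E2 /gam_sqr /toC.
by move: (Jg _ _) (Jg _ _) => u v; congr Complex; ring.
Qed.

Lemma prod_sign (F : R -> R[i]) : \prod_(eps <- [:: 1; -1]) F eps = F 1 * F (-1).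
Proof. by rewrite !big_cons big_nil mulr1. Qed.

Lemma toC_div (x y : R) : toC (x / y) = toC x / toC y.
Proof. by rewrite toCM toCV. Qed.

(** For imaginary [lam] the two signs give conjugate arguments, so the numerators merge into
    [gam_sqr]. The denominators run through the [rho_j] in increasing order, whence the reversal of
    the index. *)
Lemma prod_GammaC r (a b iota nu : R) (lam : r.-tuple R[i]) : 0 < a -> 0 < b -> 0 < iota ->
  (0 < r)%N -> @rho1 R r a b iota < nu -> (forall j, cre (tnth lam j) = 0) ->
  \prod_(j < r) \prod_(eps <- [:: 1; -1])
    (GammaC (toC (nu - (iota + b + a * r.-1%:R) / 2) + toC (eps / 2) * tnth lam j)
     / GammaC (toC (nu - (iota + b + a * r.-1%:R) / 2 + eps / 2 * (iota + b + a * j%:R)))) =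
  toC (Gw a b iota (fun k => cim (tnth lam k)) nu).
Proof.
move=> a0 b0 i0 r0 h l0; rewrite -[_ + _ + _]/(@rho1 R r a b iota).
have rE (j : 'I_r) : rho_j a b iota (rev_ord j) = iota + b + a * j%:R.
  by rewrite /rho_j /= (_ : (r - 1 - (r - j.+1))%N = j) //; have := ltn_ord j; lia.
pose X := nu - @rho1 R r a b iota / 2; rewrite -/X.
have X0 (j : 'I_r) : 0 <= rho_j a b iota j <= @rho1 R r a b iota.
  by have /andP[h1 h2] := rho_bounds a0 b0 i0 r0 j; rewrite (ltW h1).
pose d (j : 'I_r) := gam (X + rho_j a b iota j / 2) * gam (X - rho_j a b iota j / 2).
rewrite (eq_bigr (fun j => toC (gam_sqr X (cim (tnth lam j) / 2) / d (rev_ord j)))) => [|j _]; last first.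
  rewrite prod_sign [RHS]toC_div /d rE [in RHS]toCM.
  have /andP := X0 (rev_ord j); rewrite rE; move: (iota + b + a * j%:R) => s [h1 h2].
  have XE : X = nu - @rho1 R r a b iota / 2 by [].
  have Xp : 0 < X by lra.
  have P1 : 0 < X + s / 2 by lra.
  have P2 : 0 < X - s / 2 by lra.
  have lE c : toC X + toC c * tnth lam j = Complex X (c * cim (tnth lam j)).
    by move: (l0 j); case: (tnth lam j) => u v /= ->; rewrite /toC; congr Complex; ring.
  rewrite !lE -(GammaC_toC P1) -(GammaC_toC P2) -(GammaC_conj _ Xp) mulrACA -invfM.
  congr (GammaC _ * GammaC _ / (GammaC (toC _) * GammaC (toC _))); try by field.
    by congr Complex; field.
  by congr Complex; field.
rewrite -(big_morph (@toC R) (@toCM R) (erefl _)); congr toC.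
have Ed : \prod_j d (rev_ord j) = \prod_j d j by rewrite [RHS](reindex_inj rev_ord_inj).
rewrite prodf_div Ed -prodf_div.
by apply: eq_bigr.
Qed.

End GammaProducts.

Theorem theorem3p2 (R : realType) (r : nat) (a b iota nu : R) :
  (1 <= r)%N -> 0 < a -> 0 < b -> 0 < iota ->
  iota + b + a * r.-1%:R < nu ->
  [/\ L1_mu a b iota (@f_delta R r (- 2 * nu)),
      Rint_mu a b iota (@f_delta R r (- 2 * nu)) = N_nu r a b iota nu &
      forall lam : r.-tuple R[i], (forall j, cre (tnth lam j) = 0) ->
      forall phi : r.-tuple R -> R[i], is_HO_spherical a b iota lam phi ->
        sph_transform a b iota phi (@f_delta R r (- 2 * nu))
        = toC (N_nu r a b iota nu)
          * \prod_(j < r) \prod_(eps <- [:: 1; -1])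
              (GammaC (toC (nu - (iota + b + a * r.-1%:R) / 2)
                       + toC (eps / 2) * tnth lam j)
               / GammaC (toC (nu - (iota + b + a * r.-1%:R) / 2
                              + eps / 2 * (iota + b + a * j%:R))))].
Proof.
move=> r0 a0 b0 i0 h; have N := N_nuE a0 b0 i0 h.
split; [exact: L1_f_delta|by rewrite N Rint_f_delta|move=> lam l0 phi HO].
rewrite (prod_GammaC a0 b0 i0 r0 h l0) N /sph_transform /Cint_mu.
rewrite (Rint_part a0 b0 i0 r0 is_part_cre h l0 HO) (Rint_part a0 b0 i0 r0 is_part_cim h l0 HO).
by rewrite mul1r !mul0r -toCM.
Qed.
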